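(* Let $M_m$ be a von Mangoldt plane, and let $R_p\in[0,\infty]$ be the radius of the (closed, centered at $o$) metric ball formed by the set of poles of $M_m$. Then: (a) if $0<R_p<\infty$, then the set of poles is a proper subset of the connected component of $\mathfrak C_m$ containing $o$; (b) $R_p=0$ if and only if $\mathfrak C_m=\{o\}$.
   Context: For a smooth function $m\colon[0,\infty)\to[0,\infty)$ with $m(0)=0$, $m'(0)=1$, $m>0$ on $(0,\infty)$ and smooth odd extension, $M_m$ is $\mathbb R^2$ with metric $dr^2+m(r)^2d\theta^2$ (polar coordinates about the origin $o$), curvature $G_m=-m''/m$; it is a von Mangoldt plane if $G_m$ is non-increasing in $r$. A ray is a unit speed geodesic on $[0,\infty)$ minimizing between any two of its points; a pole is a point $q$ such that every geodesic starting at $q$ is a ray. It is known that the set of poles of $M_m$ is a closed metric ball centered at $o$, of some radius $R_p\in[0,\infty]$. $\mathfrak C_m$ is the set of points $q$ such that every unit tangent vector at $q$ makes angle $\le\pi/2$ with some ray starting at $q$. *)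

(* Defs.v *)
From HB Require Import structures.
From mathcomp Require Import all_boot all_order all_algebra.
From mathcomp Require Import all_classical all_reals all_analysis.
Set Implicit Arguments. Unset Strict Implicit. Unset Printing Implicit Defensive.
Import Order.TTheory GRing.Theory Num.Theory.
Import numFieldTopology.Exports numFieldNormedType.Exports.
Import numFieldNormedType.Exports.
Local Open Scope classical_set_scope.
Local Open Scope ring_scope.

Section VonMangoldt.
Variable R : realType.

Local Notation pt := (R * R)%type.
Definition origin : pt := (0, 0).
Definition dotp (p v : pt) : R := p.1 * v.1 + p.2 * v.2.
Definition crossp (p v : pt) : R := p.1 * v.2 - p.2 * v.1.
Definition rad (p : pt) : R := Num.sqrt (dotp p p).

(* m : R -> R is the smooth odd extension of the profile function. *)
Definition smooth (f : R -> R) := forall (n : nat) (x : R), derivable (derive1n n f) x 1.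

Definition profile (m : R -> R) :=
  [/\ smooth m, (forall x, m (- x) = - m x), m 0 = 0,
      derive1 m 0 = 1 & (forall r, 0 < r -> 0 < m r)].

Definition Gm (m : R -> R) (r : R) : R := - derive1n 2 m r / m r.

Definition von_Mangoldt (m : R -> R) :=
  profile m /\ (forall r1 r2, 0 < r1 -> r1 <= r2 -> Gm m r2 <= Gm m r1).

(* The metric dr^2 + m(r)^2 dtheta^2 written in Cartesian coordinates:
   dr(v) = <p,v>/r and dtheta(v) = (p x v)/r^2 at p <> o; Euclidean at o. *)
Definition gmet (m : R -> R) (p v w : pt) : R :=
  if p == origin then dotp v w
  else dotp p v * dotp p w / (rad p ^+ 2)
       + m (rad p) ^+ 2 * (crossp p v * crossp p w) / (rad p ^+ 4).

Definition C1curve (c : R -> pt) :=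
  (forall t, derivable c t 1) /\ continuous (derive1 c).

Definition clength (m : R -> R) (c : R -> pt) : R :=
  Rintegral lebesgue_measure `[0, 1]
    (fun t => Num.sqrt (gmet m (c t) (derive1 c t) (derive1 c t))).

Definition dist (m : R -> R) (p q : pt) : R :=
  inf [set clength m c | c in [set c | C1curve c /\ c 0 = p /\ c 1 = q]].

Definition geodesic (m : R -> R) (g : R -> pt) :=
  forall t, 0 <= t -> exists2 e : R, 0 < e &
    forall s1 s2, 0 <= s1 -> 0 <= s2 -> `|s1 - t| < e -> `|s2 - t| < e ->
      dist m (g s1) (g s2) = `|s1 - s2|.

Definition ray (m : R -> R) (g : R -> pt) :=
  geodesic m g /\
  forall s t, 0 <= s -> 0 <= t -> dist m (g s) (g t) = `|s - t|.

Definition pole (m : R -> R) (q : pt) :=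
  forall g, geodesic m g -> g 0 = q -> ray m g.

Definition poles (m : R -> R) : set pt := [set q | pole m q].

Definition Rp (m : R -> R) : \bar R :=
  ereal_sup [set (dist m origin q)%:E | q in poles m].

Definition init_vel (g : R -> pt) (w : pt) :=
  (fun h => h^-1 *: (g h - g 0)) @ 0^'+ --> w.

Definition angle (m : R -> R) (q v w : pt) : R :=
  acos (gmet m q v w / (Num.sqrt (gmet m q v v) * Num.sqrt (gmet m q w w))).

Definition Cm (m : R -> R) : set pt :=
  [set q | forall v : pt, gmet m q v v = 1 ->
     exists g w, [/\ ray m g, g 0 = q, init_vel g w & angle m q v w <= pi / 2]].

End VonMangoldt.

(* Main.v *)
Require Import Defs.
From mathcomp Require Import all_boot all_order all_algebra.
From mathcomp Require Import all_classical all_reals all_analysis.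
From mathcomp Require Import ring lra.
Require Import Defs.
Set Implicit Arguments. Unset Strict Implicit. Unset Printing Implicit Defensive.
Import Order.TTheory GRing.Theory Num.Theory.
Import numFieldTopology.Exports numFieldNormedType.Exports.
Local Open Scope classical_set_scope.
Local Open Scope ring_scope.

(* Fix a primitive [h] of [-1/m^2] and put [k = m'/m - h]. The von Mangoldt condition makes [k]
   nondecreasing; let [k0] be its infimum. Along a geodesic, [u = h(r)] as a function of the polar
   angle solves [u'' + u = -k(r)], so that Sturm comparison controls the turning of geodesics.

   If [h] is unbounded below, spiralling outwards costs nothing and every ray from [q <> o] is
   radial, so that [q] is not in [Cm]. If [h] is bounded below, geodesics from a point close to [o]
   turn by less than [pi] and do not cross before, hence they are rays and the point is a pole.
   Conversely, if a point at distance [a > 0] is a pole then the meridian through [o] minimizes;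
   comparing it with the geodesics passing close to [o] gives [h a + h b + 2 k0 >= 0] for all
   [b > 0]. This closed condition forces the geodesics tangent to the parallels of radius up to some
   [a' > a] to be rays, hence the ball of radius [a'] is contained in [Cm].

   Geodesics are only given as local minimizers of the distance. The explicit Clairaut arcs are shown
   to be minimizing by calibrations, and a local minimizer which starts along such an arc cannot
   leave it: a corner, even a tangential one, could be cut. *)

(** * Real analysis *)

(** The arcs are explicit, so neither the geodesic equation nor an abstract existence theorem for
    minimizers enters. Each Clairaut constant [c = m rho] gives a calibration [c * theta + J(r)]
    with [J' = sqrt (1 - (c / m)^2)], hence a lower bound on the length of curves sweeping a given
    angle. The derivative of [J] in [c] is minus the angle swept by the arc with this constant; so,
    when the bound is optimised over [rho], stationarity says that the arc with vertex radius [rho]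
    sweeps the prescribed angle, and its length is the bound. Minimizers are found in this way, and
    an arc turning by less than [pi] then minimizes because it is the only candidate. The constant
    [k0] enters since geodesics from radius [a] to radius [b] passing [o] with small Clairaut
    constant [c] turn by at least [pi - c * (h a + h b + 2 * k0)] up to [o(c)]. It is finite because
    the oddness of [m] gives [m''(0) = 0]. The recurrent obstacle is the vertex of an arc, where
    [dr/dt] vanishes and the radius is no coordinate: arcs are parametrised by [s] with
    [r = rho + s^2], and unique continuation needs a separate argument there. *)

Section Derivatives.
Variable R : realType.
Implicit Types (f g df dg F : R -> R) (a b x y c : R).

Lemma der_eq f x c d : is_derive x 1 f c -> c = d -> is_derive x 1 f d.
Proof. by move=> h <-. Qed.

Lemma der_cst c x : is_derive x 1 (fun=> c) 0.
Proof. exact: is_derive_cst. Qed.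

Lemma der_id x : is_derive x 1 (fun t => t) 1.
Proof. exact: is_derive_id. Qed.

Lemma der_add f g x a b : is_derive x 1 f a -> is_derive x 1 g b ->
  is_derive x 1 (fun t => f t + g t) (a + b).
Proof. by move=> ? ?; exact: is_deriveD. Qed.

Lemma der_opp f x a : is_derive x 1 f a -> is_derive x 1 (fun t => - f t) (- a).
Proof. by move=> ?; exact: is_deriveN. Qed.

Lemma der_mul f g x a b : is_derive x 1 f a -> is_derive x 1 g b ->
  is_derive x 1 (fun t => f t * g t) (a * g x + f x * b).
Proof.
move=> hf hg; apply: der_eq (is_deriveM hf hg) _.
by rewrite /GRing.scale /= addrC; congr (_ + _); rewrite mulrC.
Qed.

Lemma der_exp f x a n : is_derive x 1 f a ->
  is_derive x 1 (fun t => f t ^+ n.+1) (n.+1%:R * f x ^+ n * a).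
Proof.
move=> hf; have -> : (fun t => f t ^+ n.+1) = (f ^+ n.+1 : R -> R).
  by apply/funext => t; rewrite -!/(_ t) exprfctE.
by apply: der_eq (is_deriveX _ hf) _; rewrite /GRing.scale /= mulr_natl.
Qed.

Lemma der_comp f g x a b : is_derive (g x) 1 f a -> is_derive x 1 g b ->
  is_derive x 1 (fun t => f (g t)) (a * b).
Proof. by move=> hf hg; exact: is_derive1_comp. Qed.

Lemma der_inv f x a : f x != 0 -> is_derive x 1 f a ->
  is_derive x 1 (fun t => (f t)^-1) (- a / f x ^+ 2).
Proof.
by move=> h0 hf; apply: der_eq (is_deriveV h0 hf) _;
  rewrite /GRing.scale /= mulNr mulrC mulNr.
Qed.

Lemma der_sqrt f x a : 0 < f x -> is_derive x 1 f a ->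
  is_derive x 1 (fun t => Num.sqrt (f t)) (a / (2 * Num.sqrt (f x))).
Proof.
by move=> h0 hf; apply: der_eq (der_comp (is_derive1_sqrt h0) hf) _; rewrite mulrC.
Qed.

Lemma der_sin f x a : is_derive x 1 f a ->
  is_derive x 1 (fun t => sin (f t)) (cos (f x) * a).
Proof. by move=> hf; apply: der_comp hf; exact: is_derive_sin. Qed.

Lemma der_cos f x a : is_derive x 1 f a ->
  is_derive x 1 (fun t => cos (f t)) (- sin (f x) * a).
Proof. by move=> hf; apply: der_comp hf; exact: is_derive_cos. Qed.

End Derivatives.

(** Differentiation is driven by the syntax of the function, and hypotheses are first compared with
    [constr_eq], without unfolding. The tactic [der] leaves the side conditions of inverses and
    roots, then the equality between the computed derivative and the stated one. *)
Ltac der_hyp F x := match goal with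
  | H : is_derive ?y _ ?f _ |- _ => constr_eq f F; constr_eq x y; exact H
  | H : forall y, is_derive y _ ?f _ |- _ =>
      constr_eq f F; notypeclasses refine (H x)
  end.
Ltac der_step := first [
  lazymatch goal with |- is_derive ?x _ ?f _ => der_hyp f x end |
  lazymatch goal with
  | |- is_derive _ _ (fun t => t) _ => notypeclasses refine (der_id _)
  | |- is_derive _ _ (fun _ => ?c) _ => notypeclasses refine (der_cst c _)
  | |- is_derive _ _ (fun t => GRing.add (@?f t) (@?g t)) _ =>
      notypeclasses refine (@der_add _ f g _ _ _ _ _)
  | |- is_derive _ _ (fun t => GRing.opp (@?f t)) _ =>
      notypeclasses refine (@der_opp _ f _ _ _)
  | |- is_derive _ _ (fun t => GRing.mul (@?f t) (@?g t)) _ =>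
      notypeclasses refine (@der_mul _ f g _ _ _ _ _)
  | |- is_derive _ _ (fun t => GRing.exp (@?f t) (S _)) _ =>
      notypeclasses refine (@der_exp _ f _ _ _ _)
  | |- is_derive _ _ (fun t => GRing.inv (@?f t)) _ =>
      notypeclasses refine (@der_inv _ f _ _ _ _)
  | |- is_derive _ _ (fun t => sin (@?f t)) _ =>
      notypeclasses refine (@der_sin _ f _ _ _)
  | |- is_derive _ _ (fun t => cos (@?f t)) _ =>
      notypeclasses refine (@der_cos _ f _ _ _)
  | |- is_derive _ _ (fun t => Num.sqrt (@?f t)) _ =>
      notypeclasses refine (@der_sqrt _ f _ _ _ _)
  | |- is_derive ?x _ ?g _ => first [
      lazymatch g with
      | fun t => ?F t => der_hyp F x
      | fun t => ?F (@?h t) =>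
          notypeclasses refine (@der_comp _ F h _ _ _ _ _); [der_hyp F (h x)|cbv beta]
      end
    | match goal with H : is_derive ?x _ ?f _ |- is_derive ?x _ ?f _ => exact H end
    | match goal with H : forall y, is_derive y _ ?f _ |- is_derive _ _ ?f _ =>
        notypeclasses refine (H _) end
    | match goal with H : forall y, is_derive y _ ?f _ |-
        is_derive _ _ (fun t => ?f t) _ => notypeclasses refine (H _) end
    | match goal with H : forall y, is_derive y _ ?F _ |-
        is_derive _ _ (fun t => ?F (@?g t)) _ =>
        notypeclasses refine (@der_comp _ F g _ _ _ (H _) _) end
    | eassumption ]
  end ].
Ltac der := notypeclasses refine (der_eq _ _); [repeat der_step|cbv beta].

Section MeanValue.
Variable R : realType.
Implicit Types (f g df dg F : R -> R) (a b x y c : R).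

Lemma der_cont f x a : is_derive x 1 f a -> continuous_at x f.
Proof. by move=> [h _]; apply/differentiable_continuous/derivable1_diffP. Qed.

Lemma der_near f g x a : (\forall t \near x, f t = g t) ->
  is_derive x 1 f a -> is_derive x 1 g a.
Proof.
by move=> h hf; exact: near_eq_is_derive hf. Qed.

Lemma mvt f df a b : a < b ->
  (forall x, a <= x <= b -> continuous_at x f) ->
  (forall x, a < x < b -> is_derive x 1 f (df x)) ->
  exists2 c : R, a < c < b & f b - f a = df c * (b - a).
Proof.
move=> ab cf hd.
have hd' x : x \in `]a, b[%R -> is_derive x 1 f (df x) by rewrite in_itv; exact: hd.
have cf' : {within `[a, b], continuous f}.
  apply: continuous_in_subspaceT => y; rewrite inE /= in_itv /=; exact: cf.
by have [c + ->] := MVT ab hd' cf'; rewrite in_itv /= => cab; exists c.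
Qed.

Lemma ndecr_der f df a b : a <= b ->
  (forall x, a <= x <= b -> continuous_at x f) ->
  (forall x, a < x < b -> is_derive x 1 f (df x)) ->
  (forall x, a < x < b -> 0 <= df x) -> f a <= f b.
Proof.
rewrite le_eqVlt => /predU1P[->//|ab] cf hd h0.
rewrite -subr_ge0; have [c cab ->] := mvt ab cf hd.
by rewrite mulr_ge0 ?h0// subr_ge0 ltW.
Qed.

Lemma incr_der f df a b : a < b ->
  (forall x, a <= x <= b -> continuous_at x f) ->
  (forall x, a < x < b -> is_derive x 1 f (df x)) ->
  (forall x, a < x < b -> 0 < df x) -> f a < f b.
Proof.
move=> ab cf hd h0.
rewrite -subr_gt0; have [c cab ->] := mvt ab cf hd.
by rewrite mulr_gt0 ?h0// subr_gt0.
Qed.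

Lemma cst_der f a b : a <= b ->
  (forall x, a <= x <= b -> continuous_at x f) ->
  (forall x, a < x < b -> is_derive x 1 f 0) -> f a = f b.
Proof.
rewrite le_eqVlt => /predU1P[->//|ab] cf hd.
have [c cab /eqP] := mvt ab cf hd.
by rewrite mul0r subr_eq0 => /eqP ->.
Qed.

Lemma ivt f a b v : a <= b -> (forall x, a <= x <= b -> continuous_at x f) ->
  f a <= v <= f b -> exists2 c : R, a <= c <= b & f c = v.
Proof.
move=> ab cf hv; have [||c] := @IVT _ f a b v ab.
- apply: continuous_in_subspaceT => y; rewrite inE /= in_itv /=; exact: cf.
- by case/andP: hv => h1 h2; rewrite ge_min le_max h1 h2 orbT.
by rewrite in_itv /= => cab <-; exists c.
Qed.

Lemma evt_min f a b : a <= b -> (forall x, a <= x <= b -> continuous_at x f) ->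
  exists2 c : R, a <= c <= b & forall t, a <= t <= b -> f c <= f t.
Proof.
move=> ab cf; have [|c] := @EVT_min _ f a b ab.
  apply: continuous_in_subspaceT => y; rewrite inE /= in_itv /=; exact: cf.
by rewrite in_itv /= => cab h; exists c => // t tab; apply: h; rewrite in_itv.
Qed.

Let int_der f (a x : R) : continuous f -> a < x ->
  is_derive x 1 (fun y => (\int[lebesgue_measure]_(t in `[a, y]) f t)%R) (f x).
Proof.
move=> cf ax; have xx : x < x + 1 by rewrite ltrDl.
have [|] := @continuous_FTC1_closed _ f a x (x + 1) xx _ ax (cf x).
  apply: continuous_compact_integrable; first exact: segment_compact.
  exact: continuous_subspaceT.
move=> h1 h2; apply: (DeriveDef h1); rewrite -derive1E; exact: h2.
Qed.

(** The integral from a base point is a primitive only to the right of that point. Two integrals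
    based at -1 are therefore glued at 0: that of [f] for [x >= 0] and that of the reflected
    function for [x < 0]. *)
Lemma primitive_ex f : continuous f ->
  {F : R -> R | F 0 = 0 /\ forall x, is_derive x 1 F (f x)}.
Proof.
move=> cf; have cfN : continuous (fun t => f (- t)).
  by move=> x; apply: continuous_comp; [exact: oppr_continuous|exact: cf].
pose A (y : R) := (\int[lebesgue_measure]_(t in `[-1, y]) f t)%R.
pose B (y : R) := (\int[lebesgue_measure]_(t in `[-1, y]) f (- t))%R.
have dA x : -1 < x -> is_derive x 1 A (f x) by exact: int_der.
have dB x : -1 < x -> is_derive x 1 B (f (- x)) by exact: (int_der cfN).
have dB' x : x < 1 -> is_derive x 1 (fun t : R => - (B (- t) - B 0)) (f x).
  move=> x1; have hx : -1 < - x by rewrite ltrN2.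
  have dBx := dB _ hx.
  have dBN : is_derive x 1 (fun t : R => B (- t)) (f (- - x) * -1).
    exact: der_comp dBx (der_opp (der_id _)).
  by der; rewrite opprK; ring.
have dA' x : -1 < x -> is_derive x 1 (fun t : R => A t - A 0) (f x).
  by move=> hx; have h := dA x hx; der; rewrite addr0.
(* Both branches have derivative [f] on []-1, 1[] and vanish at 0, so they agree around the gluing
   point and the glued function is differentiable there. *)
pose E (t : R) := (A t - A 0) - (- (B (- t) - B 0)).
have dE x : -1 < x < 1 -> is_derive x 1 E 0.
  by move=> /andP[/dA' ? /dB' ?]; rewrite /E; der; rewrite subrr.
have E0 x : -1 < x < 1 -> E x = 0.
  move=> hx; have <- : E 0 = 0 by rewrite /E oppr0 !subrr oppr0 subrr.
  have [x0|x0] := leP x 0.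
    apply: cst_der => // y /andP[h1 h2].
      by apply: (@der_cont _ _ 0); apply: dE; lra.
    by apply: dE; lra.
  apply/esym; apply: cst_der (ltW x0) _ _ => // y /andP[h1 h2].
    by apply: (@der_cont _ _ 0); apply: dE; lra.
  by apply: dE; lra.
exists (fun x => if 0 <= x then A x - A 0 else - (B (- x) - B 0)); split.
  by rewrite lexx subrr.
move=> x; have [x0|x0] := leP 0 x.
  apply: der_near (dA' x _); last by lra.
  have hx : -1 < x by lra.
  near=> t; case: leP => // t0.
  apply/eqP; rewrite -subr_eq0; apply/eqP; apply: E0.
  by apply/andP; split; [near: t; exact: lt_nbhsr|lra].
apply: der_near (dB' x _); last by lra.
near=> t; case: leP => // t0.
suff : t < 0 by lra.
by near: t; exact: lt_nbhsl.
Unshelve. all: by end_near. Qed.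

Lemma ftc2 f F a b : a < b -> continuous f -> (forall x, is_derive x 1 F (f x)) ->
  Rintegral lebesgue_measure `[a, b] f = F b - F a.
Proof.
move=> ab cf dF; rewrite /Rintegral (continuous_FTC2 (F := F)) //.
- exact: continuous_subspaceT.
- split => [x _||]; first by have [] := dF x.
  + by apply: cvg_at_right_filter; apply: der_cont (dF a).
  + by apply: cvg_at_left_filter; apply: der_cont (dF b).
- by move=> x _; rewrite derive1E; have [_ ->] := dF x.
Qed.

End MeanValue.

Section Continuity.
Variable R : realType.
Implicit Types (f g : R -> R) (x y e d : R).

Lemma cont_cst (c x : R) : continuous_at x (fun=> c : R).
Proof. exact: cvg_cst. Qed.

Lemma cont_id x : continuous_at x (fun t : R => t).
Proof. exact: cvg_id. Qed.

Lemma cont_add f g x : continuous_at x f -> continuous_at x g ->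
  continuous_at x (fun t => f t + g t).
Proof. by move=> hf hg; exact: (continuousD hf hg). Qed.

Lemma cont_opp f x : continuous_at x f -> continuous_at x (fun t => - f t).
Proof. by move=> hf; exact: (continuousN hf). Qed.

Lemma cont_mul f g x : continuous_at x f -> continuous_at x g ->
  continuous_at x (fun t => f t * g t).
Proof. by move=> hf hg; exact: (continuousM hf hg). Qed.

Lemma cont_comp f g x : continuous_at (g x) f -> continuous_at x g ->
  continuous_at x (fun t => f (g t)).
Proof. by move=> hf hg; exact: (continuous_comp hg hf). Qed.

Lemma cont_exp f x n : continuous_at x f -> continuous_at x (fun t => f t ^+ n).
Proof.
move=> hf; elim: n => [|n ih]; first exact: (@cont_cst 1).
have -> : (fun t => f t ^+ n.+1) = (fun t => f t * f t ^+ n).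
  by apply/funext => t; rewrite exprS.
exact: cont_mul.
Qed.

Lemma cont_inv f x : f x != 0 -> continuous_at x f ->
  continuous_at x (fun t => (f t)^-1).
Proof. by move=> h0 hf; exact: (continuousV h0 hf). Qed.

Lemma cont_sqrt f x : continuous_at x f -> continuous_at x (fun t => Num.sqrt (f t)).
Proof. by move=> hf; apply: cont_comp hf; exact: sqrt_continuous. Qed.

Lemma cont_norm f x : continuous_at x f -> continuous_at x (fun t => `|f t|).
Proof. by move=> hf; apply: (cont_comp (f := Num.norm)) hf; exact: norm_continuous. Qed.

Lemma cont_sin f x : continuous_at x f -> continuous_at x (fun t => sin (f t)).
Proof. by move=> hf; apply: cont_comp hf; exact: continuous_sin. Qed.

Lemma cont_cos f x : continuous_at x f -> continuous_at x (fun t => cos (f t)).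
Proof. by move=> hf; apply: cont_comp hf; exact: continuous_cos. Qed.

Lemma cont_max f g x : continuous_at x f -> continuous_at x g ->
  continuous_at x (fun t => Num.max (f t) (g t)).
Proof. by move=> hf hg; exact: (continuous_max hf hg). Qed.

Lemma cont_near f g x : (\forall t \near x, f t = g t) ->
  continuous_at x f -> continuous_at x g.
Proof.
move=> h hf; rewrite /continuous_at -(nbhs_singleton h).
by apply: cvg_trans hf; apply: near_eq_cvg; apply: filterS h => y ->.
Qed.

Lemma cont_eq f g x : f =1 g -> continuous_at x f -> continuous_at x g.
Proof. by move=> /funext ->. Qed.

Lemma cont_dist f x e : continuous_at x f -> 0 < e ->
  exists2 d : R, 0 < d & forall y, `|y - x| < d -> `|f y - f x| < e.
Proof.
move=> /cvgrPdist_lt hf e0; have /nbhs_ballP[d /= d0 hd] := hf e e0.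
exists d => // y yx; rewrite distrC; apply: hd.
by rewrite /ball /= distrC.
Qed.

Lemma dist_cont f x : (forall e, 0 < e ->
    exists2 d : R, 0 < d & forall y, `|y - x| < d -> `|f y - f x| < e) ->
  continuous_at x f.
Proof.
move=> h; apply/cvgrPdist_lt => e /h[d d0 hd]; apply/nbhs_ballP; exists d => //= y.
by rewrite /ball /= => yx; rewrite distrC; apply: hd; rewrite distrC.
Qed.

End Continuity.

Ltac cont_hyp F x := match goal with
  | H : continuous ?f |- _ => constr_eq f F; exact (H x)
  | H : forall y, is_derive y _ ?f _ |- _ => constr_eq f F; exact (der_cont (H x))
  | H : continuous_at ?y ?f |- _ => constr_eq f F; constr_eq x y; exact H
  | H : is_derive ?y _ ?f _ |- _ => constr_eq f F; constr_eq x y; exact (der_cont H)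
  end.
Ltac cont_step := lazymatch goal with
  | |- continuous_at _ (fun t => t) => exact: cont_id
  | |- continuous_at _ (fun _ => ?c) => exact: cont_cst
  | |- continuous_at _ (fun t => GRing.add (@?f t) (@?g t)) =>
      refine (@cont_add _ f g _ _ _)
  | |- continuous_at _ (fun t => GRing.opp (@?f t)) => refine (@cont_opp _ f _ _)
  | |- continuous_at _ (fun t => GRing.mul (@?f t) (@?g t)) =>
      refine (@cont_mul _ f g _ _ _)
  | |- continuous_at _ (fun t => GRing.exp (@?f t) _) => refine (@cont_exp _ f _ _ _)
  | |- continuous_at _ (fun t => GRing.inv (@?f t)) => refine (@cont_inv _ f _ _ _)
  | |- continuous_at _ (fun t => sin (@?f t)) => refine (@cont_sin _ f _ _)
  | |- continuous_at _ (fun t => cos (@?f t)) => refine (@cont_cos _ f _ _)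
  | |- continuous_at _ (fun t => Num.sqrt (@?f t)) => refine (@cont_sqrt _ f _ _)
  | |- continuous_at _ (fun t => Num.norm (@?f t)) => refine (@cont_norm _ f _ _)
  | |- continuous_at _ (fun t => Order.max (@?f t) (@?g t)) =>
      refine (@cont_max _ f g _ _ _)
  | |- continuous_at ?x ?g => first [ cont_hyp g x
    | lazymatch g with
      | fun t => ?F t => cont_hyp F x
      | fun t => ?F (@?h t) => refine (@cont_comp _ F h _ _ _); [cont_hyp F (h x)|cbv beta]
      end
    | match goal with H : continuous ?f |- continuous_at _ ?f => exact (H _) end
    | match goal with H : forall y, is_derive y _ ?f _ |- continuous_at _ ?f =>
        exact (der_cont (H _)) end
    | match goal with H : continuous ?F |- continuous_at _ (fun t => ?F (@?g t)) =>
        refine (@cont_comp _ F g _ (H _) _) end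
    | match goal with H : forall y, is_derive y _ ?F _ |-
        continuous_at _ (fun t => ?F (@?g t)) =>
        refine (@cont_comp _ F g _ (der_cont (H _)) _) end
    | eassumption ]
  | |- continuous _ => intro
  | |- prop_for ?x _ => red
  end.
Ltac cont := repeat cont_step.

(** * Plane curves and polar coordinates *)

Section PlaneCurves.
Variable R : realType.
Notation pt := (R * R)%type.
Implicit Types (c : R -> pt) (x y dx dy : R -> R) (p q v : pt) (t : R).

Lemma der_pair x y dx dy (t : R) : is_derive t 1 x (dx t) -> is_derive t 1 y (dy t) ->
  is_derive t 1 (fun s => (x s, y s) : pt) (dx t, dy t).
Proof.
move=> [hx ex] [hy ey].
have hc : (fun h => h^-1 *: ((x (h *: 1 + t), y (h *: 1 + t)) - (x t, y t) : pt)) @ 0^'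
    --> ((dx t, dy t) : pt).
  rewrite -ex -ey; exact: (cvg_pair hx hy).
by apply: DeriveDef; [apply/cvg_ex; eexists; exact: hc|exact: cvg_lim hc].
Qed.

Lemma derivable_fst c (t : R) : derivable c t 1 ->
  is_derive t 1 (fun s => (c s).1) (derive1 c t).1.
Proof.
move=> hc; have h := hc; rewrite /derivable in h.
have hd : (fun h => h^-1 *: ((c (h *: 1 + t)).1 - (c t).1)) @ 0^' --> (derive1 c t).1.
  by rewrite derive1E; exact: (cvg_comp _ _ h cvg_fst).
by apply: DeriveDef; [apply/cvg_ex; eexists; exact: hd|exact: cvg_lim hd].
Qed.

Lemma derivable_snd c (t : R) : derivable c t 1 ->
  is_derive t 1 (fun s => (c s).2) (derive1 c t).2.
Proof.
move=> hc; have h := hc; rewrite /derivable in h.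
have hd : (fun h => h^-1 *: ((c (h *: 1 + t)).2 - (c t).2)) @ 0^' --> (derive1 c t).2.
  by rewrite derive1E; exact: (cvg_comp _ _ h cvg_snd).
by apply: DeriveDef; [apply/cvg_ex; eexists; exact: hd|exact: cvg_lim hd].
Qed.

Lemma C1curve_pair x y dx dy :
  (forall t, is_derive t 1 x (dx t)) -> (forall t, is_derive t 1 y (dy t)) ->
  continuous dx -> continuous dy ->
  C1curve (fun s => (x s, y s) : pt) /\
  (forall t, derive1 (fun s : R => (x s, y s) : pt) t = (dx t, dy t)).
Proof.
move=> hx hy cx cy; have h t := der_pair (hx t) (hy t).
have e t : derive1 (fun s : R => (x s, y s) : pt) t = (dx t, dy t).
  by rewrite derive1E; have [_ ->] := h t.
split=> //; split; first by move=> t; have [] := h t.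
have -> : derive1 (fun s : R => (x s, y s) : pt) = (fun t => (dx t, dy t)) by apply/funext.
by move=> t; exact: (cvg_pair (cx t) (cy t)).
Qed.

Lemma C1curve_coord c : C1curve c ->
  [/\ forall t, is_derive t 1 (fun s => (c s).1) (derive1 c t).1,
      forall t, is_derive t 1 (fun s => (c s).2) (derive1 c t).2,
      continuous (fun t => (derive1 c t).1) & continuous (fun t => (derive1 c t).2)].
Proof.
move=> [hd hc]; split=> t.
- exact: derivable_fst. - exact: derivable_snd.
- exact: (cvg_comp _ _ (hc t) cvg_fst).
- exact: (cvg_comp _ _ (hc t) cvg_snd).
Qed.

Definition pol (r th : R) : pt := (r * cos th, r * sin th).

Lemma rad_ge0 p : 0 <= rad p. Proof. exact: sqrtr_ge0. Qed.

Lemma sqr_rad p : rad p ^+ 2 = p.1 ^+ 2 + p.2 ^+ 2.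
Proof.
by rewrite sqr_sqrtr /dotp ?addr_ge0 -?expr2 ?sqr_ge0.
Qed.

Lemma rad_eq0 p : (rad p == 0) = (p == origin R).
Proof.
apply/idP/idP => [/eqP h|/eqP ->]; last first.
  by rewrite /rad /dotp /= mulr0 addr0 sqrtr0.
have /eqP := sqr_rad p; rewrite h expr0n /= eq_sym paddr_eq0 ?sqr_ge0//.
by rewrite !sqrf_eq0 => /andP[/eqP h1 /eqP h2]; case: p h h1 h2 => /= a b _ -> ->.
Qed.

Lemma rad_gt0 p : (0 < rad p) = (p != origin R).
Proof. by rewrite lt_def rad_ge0 rad_eq0 andbT. Qed.

Lemma rad_pol r th : rad (pol r th) = `|r|.
Proof.
apply/eqP; rewrite -(eqrXn2 (n := 2)) ?rad_ge0 ?normr_ge0// sqr_rad /= !exprMn.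
by rewrite -mulrDr cos2Dsin2 mulr1 real_normK ?num_real.
Qed.

Lemma rad_pol_ge0 r th : 0 <= r -> rad (pol r th) = r.
Proof. by move=> r0; rewrite rad_pol ger0_norm. Qed.

Lemma pol_neq0 r th : 0 < r -> pol r th != origin R.
Proof. by move=> r0; rewrite -rad_gt0 rad_pol_ge0 // ltW. Qed.

Lemma pol0 th : pol 0 th = origin R.
Proof. by rewrite /pol !mul0r. Qed.

Lemma circle_ex (u v : R) : u ^+ 2 + v ^+ 2 = 1 -> exists th, u = cos th /\ v = sin th.
Proof.
move=> h; have hu : -1 <= u <= 1.
  by apply/andP; split; nra.
have hs := sin_acos hu; have hv : 1 - u ^+ 2 = v ^+ 2 by lra.
rewrite hv sqrtr_sqr in hs.
have [v0|v0] := leP 0 v.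
  by exists (acos u); rewrite acosK ?in_itv//= hs ger0_norm.
exists (- acos u); rewrite cosN acosK ?in_itv//= sinN hs ltr0_norm// opprK.
by [].
Qed.

Lemma pol_ex p : exists th, p = pol (rad p) th.
Proof.
have [/eqP|p0] := eqVneq p (origin R).
  by rewrite -rad_eq0 => /eqP h; exists 0; rewrite h pol0; apply/eqP; rewrite -rad_eq0 h.
have r0 : 0 < rad p by rewrite rad_gt0.
have r0' : rad p != 0 by rewrite gt_eqF.
have [th [h1 h2]] : exists th, p.1 / rad p = cos th /\ p.2 / rad p = sin th.
  by apply: circle_ex; rewrite !expr_div_n -mulrDl -sqr_rad divff// expf_neq0.
exists th; rewrite /pol -h1 -h2 !mulrA ![rad p * _]mulrC -!mulrA !divff// !mulr1.
by case: p {p0 r0 r0' h1 h2}.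
Qed.

End PlaneCurves.

(** * The metric and its distance *)

Section Metric.
Variables (R : realType) (m : R -> R).
Hypothesis vM : von_Mangoldt m.
Notation pt := (R * R)%type.
Implicit Types (c : R -> pt) (p q v : pt) (r s t : R) (n : nat).

Let pm : profile m := proj1 vM.

Lemma dm_n n r : is_derive r 1 (derive1n n m) (derive1n n.+1 m r).
Proof.
have [sm _ _ _ _] := pm; have h := sm n r.
by apply: (DeriveDef h); rewrite derive1nS derive1E.
Qed.

Lemma m_at0 : m 0 = 0. Proof. by have [] := pm. Qed.

Lemma m_gt0 r : 0 < r -> 0 < m r. Proof. by have [_ _ _ _ h] := pm; exact: h. Qed.

Lemma m_odd r : m (- r) = - m r. Proof. by have [_ h _ _ _] := pm. Qed.

Lemma m_ge0 r : 0 <= r -> 0 <= m r.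
Proof. by rewrite le_eqVlt => /predU1P[<-|/m_gt0/ltW//]; rewrite m_at0. Qed.

Definition m1 : R -> R := locked (derive1n 1 m).
Definition m2 : R -> R := locked (derive1n 2 m).
Definition m3 : R -> R := locked (derive1n 3 m).

Let m1E : m1 = derive1n 1 m := esym (lock (derive1n 1 m)).
Let m2E : m2 = derive1n 2 m := esym (lock (derive1n 2 m)).
Let m3E : m3 = derive1n 3 m := esym (lock (derive1n 3 m)).

Lemma Gm_E r : Gm m r = - m2 r / m r.
Proof. by rewrite /Gm /m2; congr (- _ / _); rewrite -[in RHS]lock. Qed.

Lemma dm r : is_derive r 1 m (m1 r).
Proof. by rewrite m1E; exact: dm_n 0%N r. Qed.

Lemma dm1 r : is_derive r 1 m1 (m2 r).
Proof. by rewrite m1E m2E; exact: dm_n 1%N r. Qed.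

Lemma dm2 r : is_derive r 1 m2 (m3 r).
Proof. by rewrite m2E m3E; exact: dm_n 2%N r. Qed.

Lemma dm3 r : is_derive r 1 m3 (derive1n 4 m r).
Proof. by rewrite m3E; exact: dm_n 3%N r. Qed.

Lemma m_cont : continuous m. Proof. by move=> r; apply: der_cont (dm r). Qed.

Lemma dm1_cont : continuous (m1).
Proof. by move=> r; apply: der_cont (dm1 r). Qed.

Lemma dm1_at0 : m1 0 = 1.
Proof. by have [_ _ _ h _] := pm; rewrite /m1 -lock derive1n1. Qed.

(** [m] is odd, hence [m'] is even and [m''(0) = 0]; a bound [C] on [m'''] near 0 is then integrated
    three times. The condition on [C * d ^+ 2] keeps [m r / r] and [m1 r] above [1 / 2]. *)
Lemma m_near0 : exists C d : R, [/\ 0 < C, 0 < d, C * d ^+ 2 <= 1 / 2 &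
  forall r, 0 <= r <= d ->
    [/\ `|m2 r| <= C * r, `|m1 r - 1| <= C * r ^+ 2 &
        `|m r - r| <= C * r ^+ 3]].
Proof.
have m2_0 : m2 0 = 0.
  have d1e r : m1 (- r) = m1 r.
    have h1 := dm r; have h2 : is_derive r 1 (fun t => - m (- t)) (m1 (- r)).
      have h3 := dm (- r); notypeclasses refine (der_eq (der_opp (der_comp h3 (der_opp (der_id r)))) _).
      by ring.
    have e : (fun t => - m (- t)) = m by apply/funext => t; rewrite m_odd opprK.
    by rewrite e in h2; case: h1 h2 => [_ <-] [_ <-].
  have h1 := dm1 0; have h2 : is_derive (0 : R) (1 : R) (fun t => m1 (- t)) (- m2 0).
    have h3 : is_derive (- 0 : R) (1 : R) (m1) (m2 0) by rewrite oppr0.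
    by notypeclasses refine (der_eq (der_comp h3 (der_opp (der_id 0))) _); ring.
  have e : (fun t => m1 (- t)) = m1 by apply/funext.
  rewrite e in h2; have : m2 0 = - m2 0.
    by case: h1 h2 => [_ <-] [_ <-].
  by move=> h; lra.
pose C : R := `|m3 0| + 1.
have C0 : 0 < C by rewrite ltr_wpDl.
have [d0 d0gt hd0] : exists2 d : R, 0 < d & forall r, 0 <= r <= d -> `|m3 r| <= C.
  have [d d0 hd] := cont_dist (der_cont (dm3 0)) ltr01.
  exists (d / 2); first by rewrite divr_gt0.
  move=> r hr; have : `|m3 r - m3 0| < 1.
    by apply: hd; rewrite subr0 ger0_norm; lra.
  rewrite /C => h; have := ler_normD (m3 r - m3 0) (m3 0).
  by rewrite subrK; lra.
pose d : R := Num.min d0 (Num.min 1 (1 / (2 * C))).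
have dgt : 0 < d by rewrite !lt_min d0gt ltr01 divr_gt0 ?mulr_gt0.
have dd0 : d <= d0 by rewrite ge_min lexx.
have d1 : d <= 1 by rewrite !ge_min lexx !orbT.
have dC : C * d <= 1 / 2.
  have : d <= 1 / (2 * C) by rewrite !ge_min lexx !orbT.
  by rewrite ler_pdivlMr ?mulr_gt0//; lra.
exists C, d; split=> //; first by rewrite expr2; nra.
have bnd (f df : R -> R) n r : 0 <= r <= d -> f 0 = 0 ->
    (forall x : R, is_derive x 1 f (df x)) ->
    (forall x : R, 0 <= x <= r -> `|df x| <= C * x ^+ n) -> `|f r| <= C * r ^+ n.+1.
  move=> /andP[r0 rd] f0 hf hdf.
  have [r00|rgt] := eqVneq r 0; first by rewrite r00 f0 normr0 exprS mul0r mulr0.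
  have {}rgt : 0 < r by rewrite lt_def rgt.
  have [z /andP[z0 zr]] := mvt rgt (fun x _ => der_cont (hf x)) (fun x _ => hf x).
  rewrite f0 !subr0 => ->; rewrite normrM (ger0_norm r0) exprSr mulrA ler_wpM2r//.
  apply: le_trans (hdf z _) _; first by lra.
  by apply: ler_wpM2l; [exact: ltW|apply: lerXn2r; rewrite ?nnegrE; lra].
move=> r rd.
have b2 (x : R) : 0 <= x <= d -> `|m2 x| <= C * x ^+ 1.
  move=> xd; apply: (bnd _ _ 0%N x xd m2_0 dm2) => y yx.
  by rewrite expr0 mulr1; apply: hd0; lra.
have b1 (x : R) : 0 <= x <= d -> `|m1 x - 1| <= C * x ^+ 2.
  move=> xd; apply: (bnd (fun x : R => m1 x - 1) m2 1%N) => //.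
  - by rewrite dm1_at0 subrr.
  - by move=> z; have h := dm1 z; der; rewrite addr0.
  - by move=> y yx; apply: b2; lra.
split; first by rewrite -[r in C * r]expr1; exact: b2.
- exact: b1.
- apply: (bnd (fun x : R => m x - x) (fun x : R => m1 x - 1) 2%N) => //.
  + by rewrite m_at0 subrr.
  + by move=> z; have h := dm z; der.
  + by move=> y yx; apply: b1; lra.
Qed.

(** Relative excess of the angular part of the metric over the Euclidean one. It tends to 0 at the
    origin, so that in Cartesian coordinates the metric is a continuous perturbation of the
    Euclidean one. *)
Definition gerr r := if r == 0 then 0 else (m r / r) ^+ 2 - 1.

Lemma gerr_cont : continuous gerr.
Proof.
move=> r; have [->|r0] := eqVneq r 0; last first.
  apply: (@cont_near _ (fun r => (m r / r) ^+ 2 - 1)).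
    have : \forall t \near r, t != 0.
      exists `|r|; first by rewrite /= normr_gt0.
      by move=> t /= h; apply: contraTneq h => ->; rewrite subr0 ltxx.
    by apply: filterS => t t0; rewrite /gerr (negbTE t0).
  by have hm := m_cont; cont; exact: r0.
have [C [d [C0 d0 Cd h]]] := m_near0.
(* With [w = m u / u], the excess is [(w - 1) * (w + 1)], where [|w - 1| <= C * u ^+ 2] and
   [|w + 1| <= 3]. *)
have hb t : `|t| <= d -> `|gerr t| <= 3 * C * t ^+ 2.
  move=> td; have [->|t0] := eqVneq t 0.
    by rewrite /gerr eqxx normr0 expr0n /= mulr0.
  rewrite /gerr (negbTE t0).
  have -> : m t / t = m `|t| / `|t|.
    have [tp|tn] := leP 0 t; first by rewrite ?ger0_norm.
    by rewrite ltr0_norm// m_odd invrN mulrNN.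
  have tp : 0 < `|t| by rewrite normr_gt0.
  have [|_ _ h3] := h `|t|; first by rewrite normr_ge0.
  have -> : t ^+ 2 = `|t| ^+ 2 by rewrite real_normK ?num_real.
  set u := `|t| in tp td h3 *; set w := m u / u.
  have hw : `|w - 1| <= C * u ^+ 2.
    have -> : w - 1 = (m u - u) / u by rewrite /w mulrBl divff// gt_eqF.
    rewrite normrM normfV (gtr0_norm tp) ler_pdivrMr// -mulrA -exprSr; exact: h3.
  have -> : w ^+ 2 - 1 = (w - 1) * (w + 1) by ring.
  rewrite normrM mulrC -mulrA ler_pM//.
  have -> : w + 1 = (w - 1) + 2 by ring.
  apply: le_trans (ler_normD _ _) _; rewrite (gtr0_norm (ltr0n _ 2)).
  suff : C * u ^+ 2 <= 1 by lra.
  have : C * u ^+ 2 <= C * d ^+ 2 by rewrite ler_pM2l// lerXn2r// nnegrE ltW.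
  lra.
have e0 : gerr 0 = 0 by rewrite /gerr eqxx.
apply: dist_cont => e egt; rewrite e0.
have ch : continuous_at 0 (fun t : R => 3 * C * t ^+ 2) by cont.
have [d' d'0 hd] := cont_dist ch egt.
exists (Num.min d d'); first by rewrite lt_min d0 d'0.
move=> t; rewrite !subr0 lt_min => /andP[td td'].
apply: le_lt_trans (hb t (ltW td)) _; have := hd t; rewrite subr0 => /(_ td').
rewrite expr0n /= mulr0 subr0; apply: le_lt_trans; exact: ler_norm.
Qed.

Lemma gmet_err p v : gmet m p v v = dotp v v + gerr (rad p) * (crossp p v / rad p) ^+ 2.
Proof.
rewrite /gmet; case: eqP => [->|/eqP p0].
  by rewrite /crossp /= !mul0r subrr mul0r expr0n /= mulr0 addr0.
rewrite /gerr rad_eq0 (negbTE p0).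
have r0 : rad p != 0 by rewrite rad_eq0.
have hr := sqr_rad p; rewrite /dotp /crossp.
have e : dotp v v = (dotp p v ^+ 2 + crossp p v ^+ 2) / rad p ^+ 2.
  apply/eqP; rewrite eq_sym mulrC -(inj_eq (mulfI (expf_neq0 2 r0))) mulrA divff ?expf_neq0//.
  by rewrite mul1r hr /dotp /crossp; apply/eqP; ring.
by rewrite -/(dotp v v) e /dotp /crossp; field.
Qed.

Lemma gmet_polar p v : p != origin R ->
  gmet m p v v = (dotp p v / rad p) ^+ 2 + m (rad p) ^+ 2 * (crossp p v / rad p ^+ 2) ^+ 2.
Proof.
move=> p0; rewrite /gmet (negbTE p0).
have r0 : rad p != 0 by rewrite rad_eq0.
by field.
Qed.

Lemma cross_le p v : (crossp p v / rad p) ^+ 2 <= dotp v v.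
Proof.
have [->|p0] := eqVneq p (origin R).
  by rewrite /crossp /= !mul0r subrr mul0r expr0n /= /dotp addr_ge0// -expr2 sqr_ge0.
have r0 : 0 < rad p by rewrite rad_gt0.
rewrite expr_div_n ler_pdivrMr ?exprn_gt0// sqr_rad /crossp /dotp.
by have := sqr_ge0 (p.1 * v.1 + p.2 * v.2); lra.
Qed.

Lemma gmet_ge0 p v : 0 <= gmet m p v v.
Proof.
have [->|p0] := eqVneq p (origin R).
  by rewrite /gmet eqxx /dotp addr_ge0// -expr2 sqr_ge0.
by rewrite gmet_polar//; apply: addr_ge0; [|apply: mulr_ge0]; exact: sqr_ge0.
Qed.

Definition speed c t := Num.sqrt (gmet m (c t) (derive1 c t) (derive1 c t)).

Lemma speed_ge0 c t : 0 <= speed c t. Proof. exact: sqrtr_ge0. Qed.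

Lemma speed_cont c : C1curve c -> continuous (speed c).
Proof.
move=> cc t; have [d1 d2 c1 c2] := C1curve_coord cc.
rewrite /speed; apply: cont_sqrt.
have -> : (fun t => gmet m (c t) (derive1 c t) (derive1 c t)) =
    (fun t => dotp (derive1 c t) (derive1 c t) +
       gerr (rad (c t)) * (crossp (c t) (derive1 c t) / rad (c t)) ^+ 2).
  by apply/funext => s; exact: gmet_err.
have cd : continuous (fun t => dotp (derive1 c t) (derive1 c t)).
  by move=> s; rewrite /dotp; cont.
have cx : continuous (fun t => crossp (c t) (derive1 c t)).
  by move=> s; rewrite /crossp; cont.
have cr : continuous (fun t => rad (c t)) by move=> s; rewrite /rad /dotp; cont.
have cg := gerr_cont.
apply: cont_add; first exact: cd.
(* Where the curve meets the origin, [crossp / rad] need not have a limit; it stays bounded by the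
   Euclidean speed while the factor [gerr] tends to 0. *)
have [r0|r0] := eqVneq (rad (c t)) 0; last by cont.
have eg : continuous (fun t => gerr (rad (c t))).
  by move=> s; apply: (cont_comp (cg _) (cr s)).
have h0 : gerr (rad (c t)) = 0 by rewrite /gerr r0 eqxx.
have ch : continuous_at t (fun t => `|gerr (rad (c t))| * dotp (derive1 c t) (derive1 c t)).
  by cont.
apply: dist_cont => e egt; have [d d0 hd] := cont_dist ch egt.
exists d => // s /hd; rewrite h0 normr0 !mul0r !subr0.
rewrite normrM normr_id => hs; rewrite normrM; apply: le_lt_trans hs; rewrite ler_wpM2l//.
rewrite (ger0_norm (sqr_ge0 _)); exact: le_trans (cross_le _ _) (ler_norm _).
Qed.

End Metric.

#[global] Opaque m1 m2 m3.

(* [lra] compares atoms up to conversion; unfolding the following ones is hopeless. *)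
Ltac hide_atoms :=
  repeat match goal with
  | H : context [dist _ _ _] |- _ => revert H
  | H : context [clength _ _] |- _ => revert H
  | H : context [speed _ _ _] |- _ => revert H
  | H : context [cos _] |- _ => revert H
  | H : context [sin _] |- _ => revert H
  end;
  repeat match goal with
  | |- context [dist ?m ?p ?q] => generalize (dist m p q)
  | |- context [clength ?m ?c] => generalize (clength m c)
  | |- context [speed ?m ?c ?t] => generalize (speed m c t)
  | |- context [cos ?t] => generalize (cos t)
  | |- context [sin ?t] => generalize (sin t)
  end; intros.
Ltac hlra := hide_atoms; lra.
Ltac hnra := hide_atoms; nra.

Section Distance.
Variables (R : realType) (m : R -> R).
Hypothesis vM : von_Mangoldt m.
Notation pt := (R * R)%type.
Implicit Types (c : R -> pt) (p q v : pt) (r s t a b : R) (n : nat).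

(** From here on lengths are increments of a primitive of the speed, so that inequalities between
    lengths reduce to inequalities between derivatives. *)
Lemma clength_primitive c : C1curve c -> exists S : R -> R,
  (forall t, is_derive t 1 S (speed m c t)) /\ clength m c = S 1 - S 0.
Proof.
move=> cc; have cs := speed_cont vM cc; have [S [_ dS]] := primitive_ex cs.
by exists S; split=> //; exact: (ftc2 ltr01 cs dS).
Qed.

Lemma clength_le c (F f : R -> R) : C1curve c ->
  (forall t, 0 <= t <= 1 -> continuous_at t F) ->
  (forall t, 0 < t < 1 -> is_derive t 1 F (f t)) ->
  (forall t, 0 < t < 1 -> speed m c t <= f t) -> clength m c <= F 1 - F 0.
Proof.
move=> cc cF dF hs; have [S [dS ->]] := clength_primitive cc.
rewrite -subr_ge0; have -> : F 1 - F 0 - (S 1 - S 0) = (F 1 - S 1) - (F 0 - S 0) by ring.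
rewrite subr_ge0.
apply: (@ndecr_der _ (fun t => F t - S t) (fun t => f t - speed m c t) 0 1) => // t ht.
- by have h := cF t ht; cont.
- by have h := dF t ht; der.
- by rewrite subr_ge0 hs.
Qed.

Lemma clength_ge c (F f : R -> R) : C1curve c ->
  (forall t, 0 <= t <= 1 -> continuous_at t F) ->
  (forall t, 0 < t < 1 -> is_derive t 1 F (f t)) ->
  (forall t, 0 < t < 1 -> f t <= speed m c t) -> F 1 - F 0 <= clength m c.
Proof.
move=> cc cF dF hs; have [S [dS ->]] := clength_primitive cc.
rewrite -subr_ge0; have -> : (S 1 - S 0) - (F 1 - F 0) = (S 1 - F 1) - (S 0 - F 0) by ring.
rewrite subr_ge0.
apply: (@ndecr_der _ (fun t => S t - F t) (fun t => speed m c t - f t) 0 1) => // t ht.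
- by have h := cF t ht; cont.
- by have h := dF t ht; der.
- by rewrite subr_ge0 hs.
Qed.

Lemma clength_ge0 c : C1curve c -> 0 <= clength m c.
Proof.
move=> cc; have := @clength_ge c (fun=> 0) (fun=> 0) cc.
rewrite subrr; apply=> t _; [exact: cont_cst|exact: speed_ge0].
Qed.

Let lengths p q := [set clength m c | c in [set c | C1curve c /\ c 0 = p /\ c 1 = q]].

Lemma segment_C1 p q : exists c, C1curve c /\ c 0 = p /\ c 1 = q.
Proof.
pose x t := p.1 + t * (q.1 - p.1); pose y t := p.2 + t * (q.2 - p.2).
have dx t : is_derive t 1 x (q.1 - p.1) by rewrite /x; der; ring.
have dy t : is_derive t 1 y (q.2 - p.2) by rewrite /y; der; ring.
have [cc _] := C1curve_pair dx dy (@cst_continuous _ _ _) (@cst_continuous _ _ _).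
exists (fun t => (x t, y t)); split=> //; rewrite /x /y !mul0r !mul1r !addr0.
have e u w : u + (w - u) = w :> R by ring.
by rewrite !e -!surjective_pairing.
Qed.

Let lengths_lb p q : has_lbound (lengths p q).
Proof. by exists 0 => _ [c [cc _] <-]; exact: clength_ge0. Qed.

Let lengths_inf p q : has_inf (lengths p q).
Proof.
by split=> //; have [c hc] := segment_C1 p q; exists (clength m c), c.
Qed.

Lemma dist_le_clength c : C1curve c -> dist m (c 0) (c 1) <= clength m c.
Proof. by move=> cc; apply: ge_inf; [exact: lengths_lb|exists c]. Qed.

Lemma dist_ge p q (l : R) :
  (forall c, C1curve c -> c 0 = p -> c 1 = q -> l <= clength m c) -> l <= dist m p q.
Proof.
move=> h; apply: lb_le_inf; first by have [] := lengths_inf p q.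
by move=> _ [c [cc [c0 c1]] <-]; exact: h.
Qed.

Lemma dist_ge0 p q : 0 <= dist m p q.
Proof. by apply: dist_ge => c cc _ _; exact: clength_ge0. Qed.

Lemma dist_approx p q (e : R) : 0 < e -> exists c,
  [/\ C1curve c, c 0 = p, c 1 = q & clength m c < dist m p q + e].
Proof.
move=> e0; have [_ [c [cc [c0 c1]] <-] h] := inf_adherent e0 (lengths_inf p q).
by exists c.
Qed.

Lemma C1curve_comp c (f df : R -> R) : C1curve c ->
  (forall t, is_derive t 1 f (df t)) -> continuous df ->
  C1curve (fun t => c (f t)) /\ (forall t, derive1 (fun t => c (f t)) t =
    (df t * (derive1 c (f t)).1, df t * (derive1 c (f t)).2)).
Proof.
move=> cc hf cf; have [d1 d2 c1 c2] := C1curve_coord cc.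
have -> : (fun t => c (f t)) = (fun t => ((c (f t)).1, (c (f t)).2)).
  by apply/funext => t; case: (c (f t)).
apply: C1curve_pair => t.
- apply: der_eq (der_comp (f := fun s => (c s).1) (d1 _) (hf t)) _; exact: mulrC.
- apply: der_eq (der_comp (f := fun s => (c s).2) (d2 _) (hf t)) _; exact: mulrC.
- apply: cont_mul; first exact: cf.
  exact: (cont_comp (f := fun s => (derive1 c s).1) (c1 _) (der_cont (hf t))).
- apply: cont_mul; first exact: cf.
  exact: (cont_comp (f := fun s => (derive1 c s).2) (c2 _) (der_cont (hf t))).
Qed.

Lemma gmet_scale p (v : pt) (k : R) :
  Num.sqrt (gmet m p (k * v.1, k * v.2) (k * v.1, k * v.2)) = `|k| * Num.sqrt (gmet m p v v).
Proof.
have -> : gmet m p (k * v.1, k * v.2) (k * v.1, k * v.2) = k ^+ 2 * gmet m p v v.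
  by rewrite /gmet; case: eqP => _; rewrite /dotp /crossp /=; ring.
by rewrite sqrtrM ?sqr_ge0// sqrtr_sqr.
Qed.

Lemma dist_le_primitive c a b (F f : R -> R) : C1curve c -> a <= b ->
  (forall t, a <= t <= b -> continuous_at t F) ->
  (forall t, a < t < b -> is_derive t 1 F (f t)) ->
  (forall t, a < t < b -> speed m c t <= f t) -> dist m (c a) (c b) <= F b - F a.
Proof.
move=> cc ab cF dF hs; pose k := b - a; pose g t := a + t * k.
have dg t : is_derive t 1 g k by rewrite /g; der; ring.
have [cg eg] := C1curve_comp cc dg (@cst_continuous _ _ _).
have g0 : g 0 = a by rewrite /g mul0r addr0.
have g1 : g 1 = b by rewrite /g /k; ring.
rewrite -g0 -g1; apply: le_trans (dist_le_clength cg) _.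
have k0 : 0 <= k by rewrite subr_ge0.
have gi t : 0 <= t <= 1 -> a <= g t <= b by move=> ht; rewrite /g /k; nra.
have [kz|kz] := eqVneq k 0.
  have ge t : g t = a by rewrite /g kz mulr0 addr0.
  rewrite !ge subrr; apply: le_trans (@clength_le _ (fun=> 0) (fun=> 0) cg _ _ _) _.
  - by move=> t _; exact: cont_cst.
  - by move=> t _; rewrite /speed eg gmet_scale kz normr0 mul0r.
  - by rewrite subrr.
have kp : 0 < k by rewrite lt_def kz.
have gi' t : 0 < t < 1 -> a < g t < b.
  move=> ht; have -> : b = a + k by rewrite /k; ring.
  by rewrite /g; apply/andP; split; nra.
apply: (@clength_le _ (fun t => F (g t)) (fun t => f (g t) * k) cg) => t ht.
- by apply: cont_comp (der_cont (dg t)); apply: cF; exact: gi.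
- by apply: der_comp (dg t); apply: dF; exact: gi'.
- by rewrite /speed eg gmet_scale mulrC ger0_norm// ler_wpM2r//; exact: hs (gi' t ht).
Qed.

Lemma distxx p : dist m p p = 0.
Proof.
apply/eqP; rewrite eq_le dist_ge0 andbT; have [c [cc [c0 c1]]] := segment_C1 p p.
have := @dist_le_primitive c 0 0 (fun=> 0) (fun=> 0) cc; rewrite c0 subrr; apply=> //.
- by move=> t _; exact: cont_cst.
- by move=> t /andP[h1 h2]; have := lt_trans h1 h2; rewrite ltxx.
Qed.

Let dist_sym_le p q : dist m p q <= dist m q p.
Proof.
apply: dist_ge => c cc c0 c1.
pose g t := 1 - t; have dg t : is_derive t 1 g (-1) by rewrite /g; der; ring.
have [cg eg] := C1curve_comp cc dg (@cst_continuous _ _ _).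
have g0 : g 0 = 1 by rewrite /g subr0.
have g1 : g 1 = 0 by rewrite /g subrr.
have := dist_le_clength cg; rewrite g0 g1 c0 c1 => /le_trans; apply.
have [S [dS ->]] := clength_primitive cc.
have -> : S 1 - S 0 = - S (g 1) - - S (g 0) by rewrite g0 g1; ring.
apply: (@clength_le _ (fun t => - S (g t)) (fun t => speed m c (g t)) cg) => t _.
- by apply: cont_opp; exact: (cont_comp (der_cont (dS _)) (der_cont (dg t))).
- by apply: der_eq (der_opp (der_comp (dS _) (dg t))) _; ring.
- by rewrite /speed eg gmet_scale normrN1 mul1r.
Qed.

Lemma dist_sym p q : dist m p q = dist m q p.
Proof. by apply/eqP; rewrite eq_le !dist_sym_le. Qed.

(** A time change at rest outside [[0, 1 / 2]]: its translate by [1 / 2] moves only after it has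
    stopped. It is the normalised primitive of a continuous bump. *)
Lemma smooth_step : exists f df : R -> R,
  [/\ forall t, is_derive t 1 f (df t), continuous df, forall t, 0 <= df t,
      forall t, t <= 0 -> f t = 0 /\ df t = 0 &
      forall t, 1 / 2 <= t -> f t = 1 /\ df t = 0].
Proof.
pose bump (t : R) := Num.max 0 (t * (1 / 2 - t)).
have cb : continuous bump by move=> t; rewrite /bump; cont.
have [B [B0 dB]] := primitive_ex cb.
have bump_ge0 t : 0 <= bump t by rewrite le_max lexx.
have K0 : 0 < B (1 / 2).
  have h01 : 0 < 1 / 2 :> R by lra.
  have := incr_der h01 (fun t _ => der_cont (dB t)) (fun t _ => dB t); rewrite B0; apply.
  by move=> t ht; rewrite lt_max; apply/orP; right; nra.
set K := B (1 / 2) in K0.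
have Kn : K != 0 by rewrite gt_eqF.
have bl t : t <= 0 -> bump t = 0 by move=> t0; apply/max_idPl; nra.
have br t : 1 / 2 <= t -> bump t = 0 by move=> t0; apply/max_idPl; nra.
have Bl t : t <= 0 -> B t = 0.
  move=> t0; rewrite -B0; apply: (cst_der t0 (fun t _ => der_cont (dB t))) => s.
  by move=> /andP[_ /ltW/bl h]; rewrite -h.
have Br t : 1 / 2 <= t -> B t = K.
  move=> t0; apply/esym; apply: (cst_der t0 (fun t _ => der_cont (dB t))) => s.
  by move=> /andP[/ltW/br h _]; rewrite -h.
exists (fun t => B t / K), (fun t => bump t / K); split=> [t|t|t|t t0|t t0].
- by der; ring.
- by cont.
- by rewrite divr_ge0// ltW.
- by rewrite Bl// bl// !mul0r.
- by rewrite Br// br// divff// mul0r.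
Qed.

(* The two curves are run one after the other, each stopping smoothly, and
   then added: whenever one of them moves, the other one rests. *)
Lemma dist_triangle p q v : dist m p v <= dist m p q + dist m q v.
Proof.
apply/ler_addgt0Pr => e e0.
have e2 : 0 < e / 2 by rewrite divr_gt0.
have [c1 [cc1 c10 c11 l1]] := dist_approx p q e2.
have [c2 [cc2 c20 c21 l2]] := dist_approx q v e2.
suff : dist m p v <= clength m c1 + clength m c2 by move=> h; hlra.
have [f1 [b1 [df1 cb1 b1_ge0 f1l f1r]]] := smooth_step.
pose f2 (t : R) := f1 (t - 1 / 2); pose b2 (t : R) := b1 (t - 1 / 2).
have df2 t : is_derive t 1 f2 (b2 t).
  have h : is_derive t 1 (fun t : R => t - 1 / 2) 1 by der; ring.
  have := der_comp (g := fun t : R => t - 1 / 2) (df1 (t - 1 / 2)) h; rewrite mulr1; exact.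
have cb2 : continuous b2.
  move=> t; apply: (cont_comp (f := b1) (g := fun t : R => t - 1 / 2)); first exact: cb1.
  by cont.
have [g1 e1] := C1curve_comp cc1 df1 cb1.
have [g2 e2'] := C1curve_comp cc2 df2 cb2.
have [d11 d12 k11 k12] := C1curve_coord g1.
have [d21 d22 k21 k22] := C1curve_coord g2.
pose x t := (c1 (f1 t)).1 + (c2 (f2 t)).1 - q.1.
pose y t := (c1 (f1 t)).2 + (c2 (f2 t)).2 - q.2.
have dx t : is_derive t 1 x (b1 t * (derive1 c1 (f1 t)).1 + b2 t * (derive1 c2 (f2 t)).1).
  have := d11 t; have := d21 t; rewrite e1 e2' /= => h2 h1.
  by apply: der_eq (der_add (der_add h1 h2) (der_cst (- q.1) t)) _; rewrite addr0.
have dy t : is_derive t 1 y (b1 t * (derive1 c1 (f1 t)).2 + b2 t * (derive1 c2 (f2 t)).2).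
  have := d12 t; have := d22 t; rewrite e1 e2' /= => h2 h1.
  by apply: der_eq (der_add (der_add h1 h2) (der_cst (- q.2) t)) _; rewrite addr0.
have cdx : continuous (fun t => b1 t * (derive1 c1 (f1 t)).1 + b2 t * (derive1 c2 (f2 t)).1).
  move=> t; apply: cont_add.
    by apply: cont_eq (k11 t) => s; rewrite e1.
  by apply: cont_eq (k21 t) => s; rewrite e2'.
have cdy : continuous (fun t => b1 t * (derive1 c1 (f1 t)).2 + b2 t * (derive1 c2 (f2 t)).2).
  move=> t; apply: cont_add.
    by apply: cont_eq (k12 t) => s; rewrite e1.
  by apply: cont_eq (k22 t) => s; rewrite e2'.
have [cxy exy] := C1curve_pair dx dy cdx cdy.
have f2l t : t <= 1 / 2 -> f2 t = 0 /\ b2 t = 0 by move=> h; apply: f1l; hlra.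
have f10 : f1 0 = 0 by have [] := f1l 0 (lexx _).
have f11 : f1 1 = 1 by have [|//] := f1r 1; hlra.
have f20 : f2 0 = 0 by have [|//] := f2l 0; hlra.
have f21 : f2 1 = 1 by have [|//] := f1r (1 - 1 / 2); hlra.
have b2_ge0 t : 0 <= b2 t by exact: b1_ge0.
have E0 : (x 0, y 0) = p.
  by rewrite /x /y f10 f20 c10 c20 !addrK -surjective_pairing.
have E1 : (x 1, y 1) = v.
  rewrite /x /y f21 f11 c11 c21; have e' u w : u + w - u = w :> R by ring.
  by rewrite !e' -surjective_pairing.
have := dist_le_clength cxy; rewrite E0 E1 => /le_trans; apply.
have [S1 [dS1 ->]] := clength_primitive cc1.
have [S2 [dS2 ->]] := clength_primitive cc2.
have -> : S1 1 - S1 0 + (S2 1 - S2 0) = (S1 (f1 1) + S2 (f2 1)) - (S1 (f1 0) + S2 (f2 0)).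
  by rewrite f11 f10 f21 f20; ring.
apply: (@clength_le _ (fun t => S1 (f1 t) + S2 (f2 t))
  (fun t => speed m c1 (f1 t) * b1 t + speed m c2 (f2 t) * b2 t) cxy) => t _.
- apply: cont_add; first exact: cont_comp (der_cont (dS1 _)) (der_cont (df1 t)).
  exact: cont_comp (der_cont (dS2 _)) (der_cont (df2 t)).
- rewrite /speed exy; have [th|/ltW th] := leP t (1 / 2).
    have [e1t e2t] := f2l t th.
    rewrite /x /y e1t e2t !mul0r !addr0 mulr0 addr0 gmet_scale ger0_norm// mulrC c20.
    by rewrite !addrK -surjective_pairing.
  have [e1t e2t] := f1r t th; have e' u w : u + w - u = w :> R by ring.
  rewrite /x /y e1t e2t !mul0r !add0r mulr0 add0r gmet_scale ger0_norm// mulrC c11.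
  by rewrite !e' -surjective_pairing.
Qed.

End Distance.

Section Angles.
Variable R : realType.
Implicit Types (a b t th x : R).

(** Used with [x] the variation of a lifted polar angle: a curve sweeps at least the angle of
    [[0, pi]] between its end directions, because cosine is strictly decreasing there. *)
Lemma angle_le th x : 0 <= th <= pi -> cos x = cos th -> th <= `|x|.
Proof.
move=> hth hc; rewrite leNgt; apply/negP => hx.
have hx' : `|x| \in `[0, pi] by rewrite in_itv /= normr_ge0 /=; lra.
have hth' : th \in `[0, pi] by rewrite in_itv.
by move: (ltr_cos hth' hx') (ltr_cos hx' hth'); rewrite cos_norm hc !ltxx hx.
Qed.

Lemma cos_pi_ex x : exists2 th : R, 0 <= th <= pi & cos x = cos th.
Proof.
have h : -1 <= cos x <= 1 by rewrite cos_geN1 cos_le1.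
by exists (acos (cos x)); rewrite ?acos_ge0 ?acos_lepi// acosK// in_itv.
Qed.

Lemma pol_angle a b t x : 0 < a -> 0 < b -> pol a t = pol b x -> [/\ a = b, cos t = cos x & sin t = sin x].
Proof.
move=> a0 b0 e; have ab : a = b by rewrite -(rad_pol_ge0 t (ltW a0)) e rad_pol_ge0// ltW.
move: e; rewrite /pol ab => -[/mulfI h1 /mulfI h2].
by split=> //; [apply: h1|apply: h2]; rewrite gt_eqF.
Qed.

Lemma angle_rep t x : exists d : R, [/\ `|d| <= pi, cos (t + d) = cos x & sin (t + d) = sin x].
Proof.
have [th /andP[th0 thpi] hc] := cos_pi_ex (x - t).
have hs : sin (x - t) = sin th \/ sin (x - t) = - sin th.
  have : sin (x - t) ^+ 2 = sin th ^+ 2 by rewrite !sin2cos2 hc.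
  by move/eqP; rewrite eqf_sqr => /orP[] /eqP; [left|right].
have e : x = t + (x - t) by ring.
have ec : cos x = cos t * cos th - sin t * sin (x - t) by rewrite {1}e cosD hc.
have es : sin x = sin t * cos th + cos t * sin (x - t) by rewrite {1}e sinD hc.
by case: hs => hs; [exists th|exists (- th)]; split; rewrite ?normrN ?ger0_norm//
  ?cosD ?sinD ?cosN ?sinN ?ec ?es hs; ring.
Qed.

End Angles.

Section PolarCurves.
Variables (R : realType) (m : R -> R).
Hypothesis vM : von_Mangoldt m.
Notation pt := (R * R)%type.
Implicit Types (c : R -> pt) (p q v : pt) (s t a b x : R) (n : nat).

Lemma gmet_pol (r th dr dth : R) : 0 < r ->
  gmet m (pol r th) (dr * cos th - r * sin th * dth, dr * sin th + r * cos th * dth)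
    (dr * cos th - r * sin th * dth, dr * sin th + r * cos th * dth) =
  dr ^+ 2 + m r ^+ 2 * dth ^+ 2.
Proof.
move=> r0; have rn : r != 0 by rewrite gt_eqF.
rewrite gmet_polar ?pol_neq0// rad_pol_ge0 ?ltW//.
have h := cos2Dsin2 th.
have -> : dotp (pol r th) (dr * cos th - r * sin th * dth, dr * sin th + r * cos th * dth) = r * dr.
  by rewrite /dotp /=; transitivity (r * dr * (cos th ^+ 2 + sin th ^+ 2)); [ring|rewrite h mulr1].
have -> : crossp (pol r th) (dr * cos th - r * sin th * dth, dr * sin th + r * cos th * dth) = r ^+ 2 * dth.
  by rewrite /crossp /=; transitivity (r ^+ 2 * dth * (cos th ^+ 2 + sin th ^+ 2)); [ring|rewrite h mulr1].
by field.
Qed.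

(** Source of most upper bounds on distances: the curve is given by its radius and angle, and [F] is
    an explicit primitive of a mere majorant of its speed, so no length integral has to be
    computed. *)
Lemma dist_polar_le (r th dr dth F f : R -> R) a b : a <= b ->
  (forall t, is_derive t 1 r (dr t)) -> (forall t, is_derive t 1 th (dth t)) ->
  continuous dr -> continuous dth -> (forall t, a < t < b -> 0 < r t) ->
  (forall t, a <= t <= b -> continuous_at t F) ->
  (forall t, a < t < b -> is_derive t 1 F (f t)) ->
  (forall t, a < t < b -> 0 <= f t) ->
  (forall t, a < t < b -> dr t ^+ 2 + m (r t) ^+ 2 * dth t ^+ 2 <= f t ^+ 2) ->
  dist m (pol (r a) (th a)) (pol (r b) (th b)) <= F b - F a.
Proof.
move=> ab hr hth cdr cdth r0 cF dF f0 hs.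
have dx t : is_derive t 1 (fun t => r t * cos (th t)) (dr t * cos (th t) - r t * sin (th t) * dth t).
  by der; ring.
have dy t : is_derive t 1 (fun t => r t * sin (th t)) (dr t * sin (th t) + r t * cos (th t) * dth t).
  by der; ring.
have cdx : continuous (fun t => dr t * cos (th t) - r t * sin (th t) * dth t) by cont.
have cdy : continuous (fun t => dr t * sin (th t) + r t * cos (th t) * dth t) by cont.
have [cc ec] := C1curve_pair dx dy cdx cdy.
apply: (dist_le_primitive vM cc ab cF dF) => t ht.
rewrite /speed ec gmet_pol ?r0// -[leRHS]ger0_norm ?f0// -sqrtr_sqr.
by rewrite ler_sqrt ?sqr_ge0// hs.
Qed.

Lemma dot_le_speed p v : dotp p v ^+ 2 <= rad p ^+ 2 * gmet m p v v.
Proof.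
have [->|p0] := eqVneq p (origin R).
  by rewrite /dotp /= !mul0r addr0 expr0n /= mulr_ge0 ?sqr_ge0 ?gmet_ge0.
have r0 : rad p != 0 by rewrite rad_eq0.
rewrite gmet_polar// mulrDr; have -> : rad p ^+ 2 * (dotp p v / rad p) ^+ 2 = dotp p v ^+ 2 by field.
by rewrite lerDl; apply: mulr_ge0; [|apply: mulr_ge0]; exact: sqr_ge0.
Qed.

(** The radius is not differentiable at the origin; it is replaced by [sqrt (r^2 + e^2)], whose
    derivative along the curve is still bounded by the speed, and [e] tends to 0. *)
Lemma rad_lip c a b (S : R -> R) : C1curve c -> a <= b ->
  (forall t, is_derive t 1 S (speed m c t)) -> `|rad (c b) - rad (c a)| <= S b - S a.
Proof.
move=> cc ab dS; have [d1 d2 k1 k2] := C1curve_coord cc.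
apply/ler_addgt0Pr => e e0.
pose q t := (c t).1 ^+ 2 + (c t).2 ^+ 2 + e ^+ 2.
have q0 t : 0 < q t by rewrite ltr_wpDl ?exprn_gt0// addr_ge0 ?sqr_ge0.
have dq t : is_derive t 1 (fun t => Num.sqrt (q t)) (dotp (c t) (derive1 c t) / Num.sqrt (q t)).
  have q0t := q0 t; have h : is_derive t 1 q (2 * dotp (c t) (derive1 c t)).
    by rewrite /q /dotp; der; ring.
  have sq0 : Num.sqrt (q t) != 0 by rewrite gt_eqF// sqrtr_gt0.
  by apply: der_eq (der_sqrt q0t h) _; field.
have hq t : `|dotp (c t) (derive1 c t) / Num.sqrt (q t)| <= speed m c t.
  have sq0 : 0 < Num.sqrt (q t) by rewrite sqrtr_gt0.
  rewrite normrM normfV (gtr0_norm sq0) ler_pdivrMr//.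
  rewrite -(ler_pXn2r (n := 2)) ?nnegrE ?mulr_ge0 ?speed_ge0 ?sqrtr_ge0 ?normr_ge0//.
  rewrite real_normK ?num_real// exprMn /speed !sqr_sqrtr ?gmet_ge0 ?(ltW (q0 t))//.
  apply: le_trans (dot_le_speed _ _) _; rewrite mulrC ler_wpM2l ?gmet_ge0// sqr_rad /q.
  by rewrite lerDl sqr_ge0.
have hsq t : rad (c t) <= Num.sqrt (q t) <= rad (c t) + e.
  have := rad_ge0 (c t); have := sqr_rad (c t); rewrite /q; set u := rad (c t) => <- u0.
  rewrite -{1}[u]ger0_norm// -sqrtr_sqr ler_sqrt ?addr_ge0 ?sqr_ge0// lerDl sqr_ge0 /=.
  have ue : 0 <= u + e by rewrite addr_ge0// ltW.
  rewrite -[leRHS](ger0_norm ue) -sqrtr_sqr ler_sqrt ?sqr_ge0// sqrrD.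
  by rewrite addrAC lerDl mulrn_wge0// mulr_ge0// ltW.
have h1 : Num.sqrt (q b) - S b <= Num.sqrt (q a) - S a.
  have hd t : is_derive t 1 (fun t => - (Num.sqrt (q t) - S t))
      (- (dotp (c t) (derive1 c t) / Num.sqrt (q t) - speed m c t)).
    by apply: der_opp; apply: der_add (dq t) (der_opp (dS t)).
  rewrite -lerN2; apply: (ndecr_der ab (fun t _ => der_cont (hd t)) (fun t _ => hd t)) => t _.
  by rewrite oppr_ge0 subr_le0; apply: le_trans (ler_norm _) (hq t).
have h2 : - Num.sqrt (q b) - S b <= - Num.sqrt (q a) - S a.
  have hd t : is_derive t 1 (fun t => - (- Num.sqrt (q t) - S t))
      (- (- (dotp (c t) (derive1 c t) / Num.sqrt (q t)) - speed m c t)).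
    by apply: der_opp; apply: der_add (der_opp (dq t)) (der_opp (dS t)).
  rewrite -lerN2; apply: (ndecr_der ab (fun t _ => der_cont (hd t)) (fun t _ => hd t)) => t _.
  have := le_trans (ler_norm _) (hq t); have := hq t; rewrite ler_norml => /andP[].
  by move: (_ / _) (speed m c t) => u w h3 h4 h5; lra.
have := hsq a; have := hsq b; move: (rad _) (rad _) (Num.sqrt _) (Num.sqrt _) h1 h2 => u w y z h1 h2 h3 h4.
by rewrite ler_norml; apply/andP; split; lra.
Qed.

Lemma rad_dist p q : `|rad q - rad p| <= dist m p q.
Proof.
apply: (dist_ge vM) => c cc <- <-; have [S [dS ->]] := clength_primitive vM cc.
exact: rad_lip cc ler01 dS.
Qed.

Lemma rad_curve c t : C1curve c -> 0 <= t <= 1 ->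
  `|rad (c t) - rad (c 0)| + `|rad (c 1) - rad (c t)| <= clength m c.
Proof.
move=> cc /andP[t0 t1]; have [S [dS ->]] := clength_primitive vM cc.
have := rad_lip cc t0 dS; have := rad_lip cc t1 dS.
by move: (rad _) (rad _) (rad _) => u w y; lra.
Qed.

Lemma dist_radial a b th : 0 <= a -> 0 <= b -> dist m (pol a th) (pol b th) = `|b - a|.
Proof.
wlog ab : a b / a <= b => [hw a0 b0|a0 b0].
  have [/hw h|/ltW/hw h] := leP a b; first exact: h.
  by rewrite (dist_sym vM) distrC; exact: h.
apply/eqP; rewrite eq_le; apply/andP; split; last first.
  by have := rad_dist (pol a th) (pol b th); rewrite !rad_pol_ge0.
rewrite ger0_norm ?subr_ge0//.
apply: (@dist_polar_le (fun t => t) (fun=> th) (fun=> 1) (fun=> 0) (fun t => t) (fun=> 1) a b) => //.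
- by move=> t; exact: cst_continuous.
- by move=> t; exact: cst_continuous.
- by move=> t /andP[h _]; exact: le_lt_trans h.
- by move=> t _; exact: cont_id.
- by move=> t _; rewrite expr0n /= mulr0 addr0.
Qed.

Lemma dist_origin p : dist m (origin R) p = rad p.
Proof.
have [th e] := pol_ex p; rewrite {1}e -(pol0 th) dist_radial ?rad_ge0//.
by rewrite subr0 ger0_norm ?rad_ge0.
Qed.

Lemma dist_through p q : dist m p q <= rad p + rad q.
Proof.
apply: le_trans (dist_triangle vM p (origin R) q) _.
by rewrite (dist_sym vM p) !dist_origin.
Qed.

(** The angle is the primitive of [(x dy - y dx) / r^2] with the right initial value; in the frame
    turning with it, [c / r] has zero derivative and keeps its initial value [(1, 0)]. *)
Lemma polar_lift c : C1curve c -> (forall t, 0 <= t <= 1 -> c t != origin R) ->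
  exists th dr dth : R -> R, forall t, 0 <= t <= 1 ->
    [/\ c t = pol (rad (c t)) (th t), is_derive t 1 (fun t => rad (c t)) (dr t),
        is_derive t 1 th (dth t) &
        speed m c t ^+ 2 = dr t ^+ 2 + m (rad (c t)) ^+ 2 * dth t ^+ 2].
Proof.
move=> cc cn; have [d1 d2 k1 k2] := C1curve_coord cc.
pose r t := rad (c t); pose x t := (c t).1; pose y t := (c t).2.
pose dx t := (derive1 c t).1; pose dy t := (derive1 c t).2.
have rE t : r t ^+ 2 = x t ^+ 2 + y t ^+ 2 by exact: sqr_rad.
have cr : continuous r.
  by move=> t; rewrite /r /rad /dotp; cont.
have [t0 t01 hmin] := evt_min (ler01 : 0 <= 1 :> R) (fun t _ => cr t).
pose e := r t0; have e0 : 0 < e by rewrite rad_gt0 cn.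
(* Cutting the denominator at its minimum over [[0, 1]] makes [w] continuous on the whole line
   without changing it on [[0, 1]]. *)
pose w t := (x t * dy t - y t * dx t) / Num.max (r t ^+ 2) (e ^+ 2).
have cw : continuous w.
  move=> t; rewrite /w /dx /dy /x /y; cont.
  by rewrite gt_eqF// lt_max orbC exprn_gt0.
have [W [_ dW]] := primitive_ex cw.
have r0 t : 0 <= t <= 1 -> 0 < r t by move=> ht; rewrite rad_gt0 cn.
have wE t : 0 <= t <= 1 -> w t = (x t * dy t - y t * dx t) / r t ^+ 2.
  move=> ht; rewrite /w; congr (_ / _); apply/max_idPl.
  by apply: lerXn2r (hmin t ht); rewrite nnegrE; exact: rad_ge0.
have dr t : 0 <= t <= 1 -> is_derive t 1 r ((x t * dx t + y t * dy t) / r t).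
  move=> ht; have rt := r0 t ht; have rn : r t != 0 by rewrite gt_eqF.
  have h : is_derive t 1 (fun t => (c t).1 * (c t).1 + (c t).2 * (c t).2)
      (2 * (x t * dx t + y t * dy t)).
    by have h1 := d1 t; have h2 := d2 t; der; rewrite /x /y /dx /dy; ring.
  have pos : 0 < (c t).1 * (c t).1 + (c t).2 * (c t).2.
    by rewrite -!expr2 -sqr_rad exprn_gt0.
  have h' : is_derive t 1 r _ := der_sqrt (f := fun t : R => (c t).1 * (c t).1 + (c t).2 * (c t).2) pos h.
  apply: der_eq h' _.
  by rewrite -/(dotp (c t) (c t)) -/(rad (c t)) -/(r t); field.
have [th0 eth0] := pol_ex (c 0).
have h00 : 0 <= (0 : R) <= 1 by rewrite lexx ler01.
pose th t := th0 + (W t - W 0).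
have dth t : is_derive t 1 th (w t) by have h := dW t; rewrite /th; der; ring.
exists th, (fun t => (x t * dx t + y t * dy t) / r t), w => t ht.
split; [|exact: dr|exact: dth|]; last first.
  by rewrite /speed sqr_sqrtr ?gmet_ge0// gmet_polar ?cn// -/(r t) wE.
pose X t := (x t * cos (th t) + y t * sin (th t)) / r t.
pose Y t := (y t * cos (th t) - x t * sin (th t)) / r t.
have dXY s : 0 <= s <= 1 -> is_derive s 1 X 0 /\ is_derive s 1 Y 0.
  move=> hs; have h1 := d1 s; have h2 := d2 s; have h3 := dr s hs; have h4 := dth s.
  have rn : r s != 0 by rewrite gt_eqF// r0.
  have e1 : dx s = (derive1 c s).1 by []. have e2 : dy s = (derive1 c s).2 by [].
  rewrite -e1 in h1; rewrite -e2 in h2.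
  have {}h1 : is_derive s 1 x (dx s) := h1. have {}h2 : is_derive s 1 y (dy s) := h2.
  rewrite (wE s hs) in h4.
  have hR := rE s.
  (* Linear in [(C, S)]: used at [(cos, sin)] for [X] and at [(- sin, cos)] for [Y]. *)
  have key : forall C S : R,
    ((dx s * C + x s * (- S * ((x s * dy s - y s * dx s) / r s ^+ 2)) +
      (dy s * S + y s * (C * ((x s * dy s - y s * dx s) / r s ^+ 2)))) / r s +
     (x s * C + y s * S) * (- ((x s * dx s + y s * dy s) / r s) / r s ^+ 2)) = 0.
    move=> C S.
    transitivity (((dx s * C + dy s * S) * (r s ^+ 2 - (x s ^+ 2 + y s ^+ 2))) / r s ^+ 3); last first.
      by rewrite hR subrr mulr0 mul0r.
    by field.
  split; first by rewrite /X; der; [exact: rn|exact: key].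
  rewrite /Y; der; first exact: rn.
  rewrite -[RHS](key (- sin (th s)) (cos (th s))); ring.
have /andP[t0' t1'] := ht.
have XE : X t = X 0.
  apply/esym; apply: (cst_der t0') => s hs; first by apply: der_cont (dXY s _).1; lra.
  by apply: (dXY s _).1; lra.
have YE : Y t = Y 0.
  apply/esym; apply: (cst_der t0') => s hs; first by apply: der_cont (dXY s _).2; lra.
  by apply: (dXY s _).2; lra.
have th00 : th 0 = th0 by rewrite /th subrr addr0.
have r00 := r0 0 h00; have rn0 : r 0 != 0 by rewrite gt_eqF.
have cs0 := cos2Dsin2 th0.
have x0 : x 0 = r 0 * cos th0 by rewrite /x eth0.
have y0 : y 0 = r 0 * sin th0 by rewrite /y eth0.
have X0 : X 0 = 1.
  rewrite /X th00 x0 y0; transitivity ((r 0 * (cos th0 ^+ 2 + sin th0 ^+ 2)) / r 0); first by congr (_ / _); ring.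
  by rewrite cs0 mulr1 divff.
have Y0 : Y 0 = 0 by rewrite /Y th00 x0 y0; apply/eqP; rewrite mulf_eq0; apply/orP; left; apply/eqP; ring.
have rn : r t != 0 by rewrite gt_eqF// r0.
rewrite X0 /X in XE; rewrite Y0 /Y in YE.
have {}XE : x t * cos (th t) + y t * sin (th t) = r t.
  by rewrite -[LHS](divfK rn) XE mul1r.
have {}YE : y t * cos (th t) - x t * sin (th t) = 0.
  by rewrite -[LHS](divfK rn) YE mul0r.
have cs := cos2Dsin2 (th t).
rewrite /pol -/(r t) -XE [c t]surjective_pairing -/(x t) -/(y t); congr (_, _).
  transitivity (x t * (cos (th t) ^+ 2 + sin (th t) ^+ 2) + sin (th t) * (y t * cos (th t) - x t * sin (th t))).
    by rewrite cs YE; ring.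
  by ring.
transitivity (y t * (cos (th t) ^+ 2 + sin (th t) ^+ 2) - cos (th t) * (y t * cos (th t) - x t * sin (th t))).
  by rewrite cs YE; ring.
by ring.
Qed.

End PolarCurves.

(** * Turning of geodesics *)

Section Calibration.
Variables (R : realType) (m : R -> R).
Hypothesis vM : von_Mangoldt m.
Notation pt := (R * R)%type.
Implicit Types (c : R -> pt) (p q v : pt) (s t a b x : R) (n : nat).

Definition is_lift c (th dr dth : R -> R) := forall t, 0 <= t <= 1 ->
    [/\ c t = pol (rad (c t)) (th t), is_derive t 1 (fun t => rad (c t)) (dr t),
        is_derive t 1 th (dth t) &
        speed m c t ^+ 2 = dr t ^+ 2 + m (rad (c t)) ^+ 2 * dth t ^+ 2].

Lemma cauchy_schwarz (p b q d s : R) : 0 <= s -> p ^+ 2 + b ^+ 2 <= 1 ->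
  s ^+ 2 = d ^+ 2 + q ^+ 2 -> p * q + b * d <= s.
Proof.
move=> s0 h e; rewrite leNgt; apply/negP => lt.
have h1 : s ^+ 2 < (p * q + b * d) ^+ 2 by rewrite ltrXn2r// ?nnegrE//; lra.
have h2 : (p * q + b * d) ^+ 2 + (p * d - b * q) ^+ 2 = (p ^+ 2 + b ^+ 2) * s ^+ 2.
  by rewrite e; ring.
have h3 : (p ^+ 2 + b ^+ 2) * s ^+ 2 <= s ^+ 2 by rewrite -[leRHS]mul1r ler_wpM2r ?sqr_ge0.
have := sqr_ge0 (p * d - b * q); lra.
Qed.

(** The gradient of [A * theta + B(r)] has squared norm [(A / m)^2 + B'^2 <= 1], so the increment of
    this function along a curve is at most the length. *)
Lemma calib_seg c (th dr dth S B B1 : R -> R) (A a b : R) :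
  is_lift c th dr dth -> 0 <= a -> a <= b -> b <= 1 ->
  (forall t, a <= t <= b -> 0 < rad (c t)) ->
  (forall t, is_derive t 1 S (speed m c t)) ->
  (forall t, a <= t <= b -> is_derive (rad (c t)) 1 B (B1 (rad (c t))) /\
     (A / m (rad (c t))) ^+ 2 + B1 (rad (c t)) ^+ 2 <= 1) ->
  A * (th b - th a) + (B (rad (c b)) - B (rad (c a))) <= S b - S a.
Proof.
move=> hl a0 ab b1 r0 dS hB.
pose D t := S t - (A * th t + B (rad (c t))).
pose d t := speed m c t - (A * dth t + B1 (rad (c t)) * dr t).
have dD t : a <= t <= b -> is_derive t 1 D (d t).
  move=> ht; have t01 : 0 <= t <= 1 by lra.
  have [_ h1 h2 _] := hl t t01; have [h3 _] := hB t ht; have h4 := dS t.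
  have h5 := der_comp (g := fun t : R => rad (c t)) h3 h1.
  by rewrite /D /d; der; ring.
have : D a <= D b.
  apply: (ndecr_der (f := D) (df := d) ab) => t ht; [exact: der_cont (dD t ht)|apply: dD; lra|].
  have ht' : a <= t <= b by lra.
  have t01 : 0 <= t <= 1 by lra.
  have [_ _ _ hs] := hl t t01; have [_ hq] := hB t ht'.
  have m0 := m_gt0 vM (r0 t ht').
  have hs' : speed m c t ^+ 2 = dr t ^+ 2 + (m (rad (c t)) * dth t) ^+ 2 by rewrite hs; ring.
  have := cauchy_schwarz (speed_ge0 m c t) hq hs'.
  have -> : A / m (rad (c t)) * (m (rad (c t)) * dth t) = A * dth t.
    by field; rewrite gt_eqF.
  by rewrite /d subr_ge0.
by rewrite /D; move: (B _) (B _) (S _) (S _) (th _) (th _) => *; lra.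
Qed.

(** The calibration [kap * theta + J(r)] is applied before and after [t0], with a sign of the radial
    term chosen separately on each side. With [t0] a point of least radius this is sharp for arcs
    that come in and go out again. *)
Lemma polar_lb c (kap rho t0 a b al be vt : R) (J psi : R -> R) :
  C1curve c -> (forall t, 0 <= t <= 1 -> 0 < rad (c t)) ->
  c 0 = pol a al -> c 1 = pol b be -> 0 < a -> 0 < b -> 0 <= kap ->
  (forall t, 0 <= t <= 1 -> rho <= rad (c t)) ->
  (forall x, is_derive x 1 J (psi x)) ->
  (forall x, 0 < x -> rho <= x -> (kap / m x) ^+ 2 + psi x ^+ 2 <= 1) ->
  0 <= t0 <= 1 -> 0 <= vt <= pi -> cos (be - al) = cos vt ->
  kap * vt + `|J a - J (rad (c t0))| + `|J b - J (rad (c t0))| <= clength m c.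
Proof.
move=> cc cn c0 c1 a0 b0 kap0 hrho dJ hJ t01 hvt hcos.
have cn' t : 0 <= t <= 1 -> c t != origin R by move=> /cn; rewrite rad_gt0.
have [th [dr [dth hl]]] := polar_lift m cc cn'.
have {}hl : is_lift c th dr dth := hl.
have [S [dS ->]] := clength_primitive vM cc.
have h00 : 0 <= (0 : R) <= 1 by rewrite lexx ler01.
have h11 : 0 <= (1 : R) <= 1 by rewrite lexx ler01.
have ra : rad (c 0) = a by rewrite c0 rad_pol_ge0// ltW.
have rb : rad (c 1) = b by rewrite c1 rad_pol_ge0// ltW.
have hth : vt <= `|th 1 - th 0|.
  apply: angle_le => //; rewrite -hcos.
  have [e0 _ _ _] := hl _ h00; have [e1 _ _ _] := hl _ h11.
  rewrite c0 rad_pol_ge0 ?ltW// in e0; rewrite c1 rad_pol_ge0 ?ltW// in e1.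
  have [_ ec0 es0] := pol_angle a0 a0 e0; have [_ ec1 es1] := pol_angle b0 b0 e1.
  by rewrite !cosB ec0 es0 ec1 es1.
have [ep hep epth] : exists2 ep : R, ep ^+ 2 = 1 & ep * (th 1 - th 0) = `|th 1 - th 0|.
  have [h|h] := leP 0 (th 1 - th 0); first by exists 1; rewrite ?expr1n// mul1r ger0_norm.
  by exists (-1); rewrite ?sqrrN ?expr1n// mulN1r ltr0_norm.
have seg a' b' : 0 <= a' -> a' <= b' -> b' <= 1 ->
    ep * kap * (th b' - th a') + `|J (rad (c b')) - J (rad (c a'))| <= S b' - S a'.
  move=> a'0 ab' b'1.
  have [sg hsg sgE] : exists2 sg : R, sg ^+ 2 = 1 &
     sg * (J (rad (c b')) - J (rad (c a'))) = `|J (rad (c b')) - J (rad (c a'))|.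
    have [h|h] := leP 0 (J (rad (c b')) - J (rad (c a'))).
      by exists 1; rewrite ?expr1n// mul1r ger0_norm.
    by exists (-1); rewrite ?sqrrN ?expr1n// mulN1r ltr0_norm.
  rewrite -sgE [sg * (_ - _)]mulrBr.
  apply: (@calib_seg c th dr dth S (fun x => sg * J x) (fun x => sg * psi x) (ep * kap) a' b' hl a'0 ab' b'1) => //.
  - by move=> t ht; apply: cn; lra.
  - move=> t ht; have t01' : 0 <= t <= 1 by lra.
    split; first by have h := dJ (rad (c t)); der; ring.
    have -> : (ep * kap / m (rad (c t))) ^+ 2 + (sg * psi (rad (c t))) ^+ 2 = ep ^+ 2 * (kap / m (rad (c t))) ^+ 2 + sg ^+ 2 * psi (rad (c t)) ^+ 2 by ring.
      by rewrite hep hsg !mul1r hJ ?cn ?hrho.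
have /andP[t00 t01'] := t01.
have s1 := seg 0 t0 (lexx _) t00 t01'; have s2 := seg t0 1 t00 t01' (lexx _).
have s0 : kap * vt <= ep * kap * (th 1 - th 0).
  by rewrite mulrAC epth mulrC ler_wpM2r.
rewrite ra in s1; rewrite rb in s2; rewrite (distrC (J a)).
move: s0 s1 s2; move: (`|J _ - J a|) (`|J b - _|) (S _) (S _) (S _) (th _) (th _) (th _).
move=> x1 x2 x3 x4 x5 x6 x7 x8 s0 s1 s2.
have : ep * kap * (x6 - x7) = ep * kap * (x6 - x8) + ep * kap * (x8 - x7) by ring.
lra.
Qed.

End Calibration.

(** * The functions [h] and [k] *)

Section HK.
Variables (R : realType) (m : R -> R).
Hypothesis vM : von_Mangoldt m.
Implicit Types (s t a b x r : R).

(** [primitive_ex] works on the whole line, so the half-line is reached by the substitution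
    [x = exp y]. *)
Lemma h_ex : exists h : R -> R, forall x, 0 < x -> is_derive x 1 h (- (m x ^- 2)).
Proof.
have pos x : 0 < m (expR x) by rewrite (m_gt0 vM) ?expR_gt0.
have cf : continuous (fun y : R => - (expR y * m (expR y) ^- 2)).
  move=> y; have h1 := der_cont (is_derive_expR y).
  have h2 : continuous_at y (fun y : R => m (expR y)).
    by apply: cont_comp h1; exact: m_cont vM _.
  by cont; rewrite gt_eqF// exprn_gt0.
have [H [_ dH]] := primitive_ex cf.
exists (fun x => H (ln x)) => x x0.
apply: der_eq (der_comp (dH (ln x)) (is_derive1_ln x0)) _.
by rewrite lnK ?posrE// ; field; rewrite !gt_eqF// (m_gt0 vM).
Qed.

Local Notation m1 := (m1 m).
Local Notation m2 := (m2 m).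
Local Notation m3 := (m3 m).

(** The numerator of [k']. Since [P' = - m^2 * Gm'] and [P 0 = 0], monotone curvature makes it
    nonnegative, hence [k] nondecreasing. *)
Let P x := 1 - m1 x ^+ 2 + m x * m2 x.

Let dP x : is_derive x 1 P (m x * m3 x - m1 x * m2 x).
Proof. by have h0 := dm vM x; have h1 := dm1 vM x; have h2 := dm2 vM x; rewrite /P; der; ring. Qed.

(** A negative value would persist nearby by continuity, and [Gm] would increase strictly there. *)
Let dP_ge0 x : 0 < x -> 0 <= m x * m3 x - m1 x * m2 x.
Proof.
move=> x0; rewrite leNgt; apply/negP => hneg.
have cd : continuous (fun x => m x * m3 x - m1 x * m2 x).
  have k0 : continuous m := m_cont vM.
  have k1 : continuous m1 := fun x => der_cont (dm1 vM x).
  have k2 : continuous m2 := fun x => der_cont (dm2 vM x).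
  have k3 : continuous m3 := fun x => der_cont (dm3 vM x).
  by cont.
have hpos : 0 < - (m x * m3 x - m1 x * m2 x) by rewrite oppr_gt0.
have [d d0 hd] := cont_dist (cd x) hpos.
pose g t := - m2 t / m t.
have dg t : 0 < t -> is_derive t 1 g (- (m t * m3 t - m1 t * m2 t) / m t ^+ 2).
  move=> t0; have mt : m t != 0 by rewrite gt_eqF// (m_gt0 vM).
  by have h0 := dm vM t; have h2 := dm2 vM t; rewrite /g; der => //; field.
have xd : x < x + d / 2 by lra.
have : g x < g (x + d / 2).
  apply: (incr_der (f := g) (df := fun t => - (m t * m3 t - m1 t * m2 t) / m t ^+ 2) xd) => t ht.
  - by apply: der_cont (dg t _); lra.
  - by apply: dg; lra.
  - have t0 : 0 < t by lra.
    rewrite divr_gt0 ?exprn_gt0 ?(m_gt0 vM)//.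
    have : `|t - x| < d by rewrite ger0_norm; lra.
    by move/hd; rewrite ltr_norml => /andP[h1 h2]; lra.
have gE t : g t = Gm m t by rewrite Gm_E.
have [_ hG] := vM.
by rewrite !gE ltNge (hG x (x + d / 2) x0 (ltW xd)).
Qed.

Lemma P_ge0 x : 0 < x -> 0 <= P x.
Proof.
move=> x0; have <- : P 0 = 0 by rewrite /P (m_at0 vM) (dm1_at0 vM); ring.
apply: (ndecr_der (ltW x0) (fun t _ => der_cont (dP t)) (fun t _ => dP t)) => t ht.
by apply: dP_ge0; lra.
Qed.

(* [h] is only determined up to a constant; on the flat plane it is [1 / r] and [k = 0],
   on the hyperbolic plane it is [coth r] and again [k = 0]. *)
Variable h : R -> R.
Hypothesis dh : forall x, 0 < x -> is_derive x 1 h (- (m x ^- 2)).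

Definition kk x := m1 x / m x - h x.

Lemma dkk x : 0 < x -> is_derive x 1 kk ((1 - m1 x ^+ 2 + m x * m2 x) / m x ^+ 2).
Proof.
move=> x0; have mx : m x != 0 by rewrite gt_eqF// (m_gt0 vM).
have h0 := dm vM x; have h1 := dm1 vM x; have h2 := dh x0.
by rewrite /kk; der => //; field.
Qed.

Lemma kk_ndecr a b : 0 < a -> a <= b -> kk a <= kk b.
Proof.
move=> a0 ab; apply: (ndecr_der (f := kk) (df := fun x => (1 - m1 x ^+ 2 + m x * m2 x) / m x ^+ 2) ab) => t ht.
- by apply: der_cont (dkk _); lra.
- by apply: dkk; lra.
- have t0 : 0 < t by lra.
  by rewrite divr_ge0 ?sqr_ge0 ?P_ge0.
Qed.

Lemma h_decr a b : 0 < a -> a < b -> h b < h a.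
Proof.
move=> a0 ab; rewrite -ltrN2.
have dhN x : 0 < x -> is_derive x 1 (fun x => - h x) (m x ^- 2).
  by move=> x0; have h0 := dh x0; der; rewrite opprK.
apply: (incr_der (f := fun x => - h x) (df := fun x => m x ^- 2) ab) => t ht.
- by apply: der_cont (dhN _ _); lra.
- by apply: dhN; lra.
- by rewrite invr_gt0 exprn_gt0// (m_gt0 vM)//; lra.
Qed.

Lemma h_le a b : 0 < a -> a <= b -> h b <= h a.
Proof. by move=> a0; rewrite le_eqVlt => /predU1P[->//|/h_decr hh]; exact/ltW/hh. Qed.

Lemma h_inj_lt a b : 0 < a -> 0 < b -> h a < h b -> b < a.
Proof. by move=> a0 b0; apply: contraTT; rewrite -!leNgt => /(h_le a0). Qed.

(** Near 0, [P <= K / 4 * r ^+ 2] and [m r >= r / 2] bound [k'] by [K = 16 * C]; with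
    [K * d <= 1 <= 1 / d] this controls [k] down to 0 and makes its infimum finite. *)
Lemma m_small : exists2 d : R, 0 < d & forall r, 0 < r -> r <= d ->
  [/\ r / 2 <= m r <= 2 * r, 1 / 2 <= m1 r & kk d - kk r <= 1 / d].
Proof.
have [C [d0 [C0 d00 Cd hd]]] := m_near0 vM.
pose K := 16 * C.
have K0 : 0 < K by rewrite mulr_gt0.
pose d : R := Num.min d0 (Num.min 1 (1 / K)).
have dgt : 0 < d by rewrite !lt_min d00 ltr01 divr_gt0.
have dd0 : d <= d0 by rewrite ge_min lexx.
have d1 : d <= 1 by rewrite !ge_min lexx !orbT.
have dK : K * d <= 1.
  have : d <= 1 / K by rewrite !ge_min lexx !orbT.
  by rewrite ler_pdivlMr// mulrC.
have Cdd : C * d ^+ 2 <= 1 / 2.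
  by apply: le_trans Cd; rewrite ler_pM2l// lerXn2r ?nnegrE//; exact: ltW.
have bd r : 0 < r -> r <= d -> [/\ r / 2 <= m r, m r <= 2 * r, 1 / 2 <= m1 r & 1 - m1 r ^+ 2 + m r * m2 r <= K / 4 * r ^+ 2].
  move=> r0 rd; have hr : 0 <= r <= d0 by lra.
  have [b2 b1 b0] := hd r hr.
  have Cr : C * r ^+ 2 <= 1 / 2.
    by apply: le_trans Cdd; rewrite ler_pM2l// lerXn2r ?nnegrE//; exact: ltW.
  have Cr0 : 0 <= C * r ^+ 2 by rewrite mulr_ge0 ?ltW// exprn_gt0.
  have e3 : C * r ^+ 3 = C * r ^+ 2 * r by ring.
  move: b2 b1 b0; rewrite e3 !ler_norml => /andP[b2 b2'] /andP[b1 b1'] /andP[b0 b0'].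
  have h1 : r / 2 <= m r by nra.
  have h2 : m r <= 2 * r by nra.
  split=> //; first lra.
  have h3 : 1 - m1 r ^+ 2 <= 2 * (C * r ^+ 2) by nra.
  have mr0 : 0 <= m r by lra.
  have h4 : m r * m2 r <= 2 * (C * r ^+ 2).
    apply: (@le_trans _ _ (m r * (C * r))); first by rewrite ler_wpM2l.
    have -> : 2 * (C * r ^+ 2) = 2 * r * (C * r) by ring.
    by rewrite ler_wpM2r// mulr_ge0// ltW.
  have -> : K / 4 * r ^+ 2 = 4 * (C * r ^+ 2) by rewrite /K; field.
  lra.
exists d => // r r0 rd; have [h1 h2 h3 _] := bd r r0 rd.
split; [by rewrite h1|by []|].
have : K * r - kk r <= K * d - kk d.
  apply: (ndecr_der (f := fun x => K * x - kk x) (df := fun x => K - (1 - m1 x ^+ 2 + m x * m2 x) / m x ^+ 2) rd) => t ht.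
  - have t0 : 0 < t by lra. have hk := dkk t0; have := der_cont hk => ?; cont.
  - have t0 : 0 < t by lra.
    by have hk := dkk t0; der; ring.
  - have t0 : 0 < t by lra. have td : t <= d by lra.
    have [g1 g2 g3 g4] := bd t t0 td; have mt : 0 < m t by rewrite (m_gt0 vM).
    rewrite subr_ge0 ler_pdivrMr ?exprn_gt0//; apply: le_trans g4 _.
    have : (t / 2) ^+ 2 <= m t ^+ 2 by rewrite lerXn2r// nnegrE; lra.
    have -> : K / 4 * t ^+ 2 = K * (t / 2) ^+ 2 by field.
    by move=> ?; rewrite ler_pM2l.
have : 1 <= 1 / d by rewrite ler_pdivlMr// mul1r.
nra.
Qed.

(** [k0] is the infimum of [k]; by monotonicity it is also its limit at 0, which is the second
    property. *)
Lemma k0_ex : exists k0, (forall x, 0 < x -> k0 <= kk x) /\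
  (forall e, 0 < e -> exists2 d : R, 0 < d & forall x, 0 < x -> x <= d -> kk x < k0 + e).
Proof.
have [d d0 hd] := m_small.
pose A := [set kk x | x in [set x | 0 < x]].
have hA : has_inf A.
  split; first by exists (kk 1); exists 1 => //=; exact: ltr01.
  exists (kk d - 1 / d) => _ [x /= x0 <-].
  have [xd|/ltW xd] := leP x d; first by have [_ _] := hd x x0 xd; lra.
  have := kk_ndecr d0 xd; have : 0 < 1 / d by rewrite divr_gt0.
  lra.
exists (inf A); split=> [x x0|e e0]; first by apply: ge_inf; [by case: hA|exists x].
have [_ [y /= y0 <-] hy] := inf_adherent e0 hA.
by exists y => // x x0 xy; apply: le_lt_trans (kk_ndecr x0 xy) hy.
Qed.

(** Since [m r <= 2 * r] near 0, [h] falls at least as fast as [1 / (4 * r)], which blows up at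
    0. *)
Lemma h_unbounded M : exists2 d : R, 0 < d & forall x, 0 < x -> x <= d -> M < h x.
Proof.
have [d d0 hd] := m_small.
pose y := Num.min d (1 / (4 * (`|M - h d| + 1 / d + 1))).
have pos : 0 < `|M - h d| + 1 / d + 1.
  by rewrite ltr_wpDl// addr_ge0// divr_ge0// ltW.
have y0 : 0 < y by rewrite lt_min d0 divr_gt0// mulr_gt0.
have yd : y <= d by rewrite ge_min lexx.
exists y => // x x0 xy; have xd : x <= d by exact: le_trans yd.
apply: lt_le_trans (h_le x0 xy).
have hy : h d - 1 / (4 * d) <= h y - 1 / (4 * y).
  rewrite -lerN2.
  apply: (ndecr_der (f := fun x => - (h x - 1 / (4 * x))) (df := fun x => m x ^- 2 - 1 / (4 * x ^+ 2)) yd) => t ht.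
  - have t0 : 0 < t by lra. have := der_cont (dh t0) => ?; cont; by rewrite gt_eqF// mulr_gt0.
  - have t0 : 0 < t by lra. have hk := dh t0; have tn : t != 0 by rewrite gt_eqF.
    der; last by field; rewrite tn gt_eqF// (m_gt0 vM).
    by rewrite gt_eqF// mulr_gt0.
  - have t0 : 0 < t by lra. have td : t <= d by lra.
    have [/andP[_ g] _ _] := hd t t0 td; have mt := m_gt0 vM t0.
    rewrite subr_ge0 mul1r lef_pV2 ?posrE ?exprn_gt0// ?mulr_gt0 ?exprn_gt0//.
    have -> : 4 * t ^+ 2 = (2 * t) ^+ 2 by ring.
    by rewrite lerXn2r// nnegrE; lra.
have : `|M - h d| + 1 / d + 1 <= 1 / (4 * y).
  rewrite ler_pdivlMr ?mulr_gt0//.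
  have : y <= 1 / (4 * (`|M - h d| + 1 / d + 1)) by rewrite ge_min lexx orbT.
  rewrite ler_pdivlMr ?mulr_gt0//; lra.
have := ler_norm (M - h d).
have e4 : 1 / (4 * d) = (1 / d) / 4 by field; rewrite gt_eqF.
rewrite e4 in hy.
have : 0 < 1 / d by rewrite divr_gt0.
lra.
Qed.

End HK.

Section RealTools.
Variable R : realType.
Implicit Types (f g df dg D : R -> R) (a b s t x y T : R).

(** A total choice of primitive, with junk value 0 on discontinuous integrands, so that it can be
    used inside definitions before continuity is known. *)
Definition prim f : R -> R :=
  match pselect (continuous f) with
  | left cf => sval (primitive_ex cf)
  | right _ => fun=> 0
  end.

Lemma prim0 f : prim f 0 = 0.
Proof. by rewrite /prim; case: pselect => // cf; case: (primitive_ex cf) => F []. Qed.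

Lemma dprim f x : continuous f -> is_derive x 1 (prim f) (f x).
Proof. by rewrite /prim; case: pselect => // cf _; case: (primitive_ex cf) => F []. Qed.

Lemma first_neg f a b : a <= b -> (forall x, a <= x <= b -> continuous_at x f) ->
  0 < f a -> f b <= 0 ->
  exists T, [/\ a < T <= b, f T <= 0 & forall y, a <= y -> y < T -> 0 < f y].
Proof.
move=> ab cf fa fb; pose A := [set t | a <= t <= b /\ f t <= 0].
have hA : has_inf A by split; [exists b; rewrite /A /= lexx ab|exists a => t [/andP[]]].
have aT : a <= inf A by apply: lb_le_inf; [case: hA|move=> t [/andP[]]].
have Tb : inf A <= b by apply: ge_inf; [case: hA|rewrite /A /= lexx ab].
have cT : continuous_at (inf A) f by apply: cf; rewrite aT.
have fT : f (inf A) <= 0.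
  rewrite leNgt; apply/negP => fT; have [d d0 hd] := cont_dist cT fT.
  have [t [/andP[t1 t2] t3] t4] := inf_adherent d0 hA.
  have t5 : inf A <= t by apply: ge_inf; [case: hA|rewrite /A /= t1 t2].
  have : `|t - inf A| < d by rewrite ger0_norm ?subr_ge0//; lra.
  by move/hd; rewrite ltr_norml => /andP[]; lra.
exists (inf A); split=> //.
  by rewrite Tb andbT lt_neqAle aT andbT; apply/eqP => e; move: fT; rewrite -e; lra.
move=> y ay yT; rewrite ltNge; apply/negP => fy.
have : inf A <= y by apply: ge_inf; [case: hA|rewrite /A /= ay fy; split=> //; lra].
by rewrite leNgt yT.
Qed.

Lemma der_pos_near f a l : is_derive a 1 f l -> 0 < l ->
  exists2 d : R, 0 < d & forall x, a < x -> x < a + d -> f a < f x.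
Proof.
move=> [hf ef] l0; move: hf; rewrite /derivable => /cvg_ex[/= l' hl].
have e : l' = l by rewrite -ef; apply/esym/cvg_lim.
rewrite e in hl; move/cvgrPdist_lt: hl => /(_ l l0).
rewrite /= nearE /= => -[d /= d0 hd]; exists d => // x ax xd.
have h0 : x - a != 0 by rewrite gt_eqF// subr_gt0.
have := hd (x - a); rewrite /ball /= sub0r normrN ger0_norm; last by lra.
have -> : (x - a)%:A + a = x by rewrite -[_%:A]/((x - a) * 1) mulr1 subrK.
move=> h; have := h _ h0; rewrite -[_ *: _]/((x - a)^-1 * (f x - f a)).
move=> {}h; have : `|l - (x - a)^-1 * (f x - f a)| < l by apply: h; lra.
rewrite ltr_norml => /andP[_ h1].
have h2 : 0 < (x - a)^-1 * (f x - f a) by lra.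
by move: h2; rewrite pmulr_rgt0 ?invr_gt0; lra.
Qed.

(** Meant for [s * wE rho s] at the vertex, where [wE] is only shown to be continuous. *)
Lemma der_mul_id f : continuous_at (0 : R) f -> is_derive (0 : R) (1 : R) (fun s : R => s * f s) (f 0).
Proof.
move=> cf.
have hc : (fun z => z^-1 *: ((z *: (1 : R) + 0) * f (z *: (1 : R) + 0) - 0 * f 0)) @ (0 : R)^' --> f 0.
  apply/cvgrPdist_lt => e e0; have [d d0 hd] := cont_dist cf e0.
  rewrite nearE /=; exists d => //= z; rewrite /ball /= sub0r normrN => zd z0.
  rewrite -[_%:A]/(z * 1) mulr1 addr0 mul0r subr0 -[_ *: _]/(z^-1 * _) mulKf// distrC.
  by apply: hd; rewrite subr0.
by apply: DeriveDef; [apply/cvg_ex; eexists; exact: hc|exact: cvg_lim hc].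
Qed.

Lemma inverse_ex f df : (forall x, is_derive x 1 f (df x)) -> (forall x, 0 < df x) ->
  exists S : R -> R, (forall x, S (f x) = x) /\ forall x, is_derive (f x) 1 S (df x)^-1.
Proof.
move=> dF pos.
have inj x y : f x = f y -> x = y.
  move=> e; apply/eqP; case: ltgtP => // xy; exfalso.
    by have := incr_der xy (fun t _ => der_cont (dF t)) (fun t _ => dF t) (fun t _ => pos t); rewrite e ltxx.
  by have := incr_der xy (fun t _ => der_cont (dF t)) (fun t _ => dF t) (fun t _ => pos t); rewrite e ltxx.
pose S y := xget 0 [set x | f x = y].
have SK x : S (f x) = x by apply: inj; exact: (xgetI (P := [set z | f z = f x]) 0 (erefl (f x))).
exists S; split=> // x; apply: (@is_derive_inverse _ f S (df x) x).
- by near=> z.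
- by near=> z; exact: der_cont (dF z).
- by rewrite gt_eqF.
Unshelve. all: by end_near. Qed.

(** The Wronskian of [D] with the solution [sin (T - x)] of [y'' + y = 0] has derivative
    [(D'' + D) * sin (T - x)], nonnegative because [T <= pi]. *)
Lemma sturm D (D1 D2 : R -> R) T : 0 <= T <= pi ->
  (forall x, 0 <= x <= T -> is_derive x 1 D (D1 x)) ->
  (forall x, 0 <= x <= T -> is_derive x 1 D1 (D2 x)) ->
  (forall x, 0 < x < T -> 0 <= D2 x + D x) ->
  D 0 * cos T + D1 0 * sin T <= D T.
Proof.
move=> /andP[T0 Tpi] h0 h1 h2.
pose K x := D1 x * sin (T - x) + D x * cos (T - x).
have dK x : 0 <= x <= T -> is_derive x 1 K ((D2 x + D x) * sin (T - x)).
  by move=> hx; have g0 := h0 x hx; have g1 := h1 x hx; rewrite /K; der; ring.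
have : K 0 <= K T.
  apply: (ndecr_der (f := K) (df := fun x => (D2 x + D x) * sin (T - x)) T0) => x hx.
  - exact: der_cont (dK x hx).
  - by apply: dK; lra.
  - by rewrite mulr_ge0 ?h2// sin_ge0_pi//; lra.
by rewrite /K subrr sin0 cos0 subr0 mulr0 mulr1 add0r addrC.
Qed.

Lemma sturm_le D (D1 D2 : R -> R) T : 0 <= T <= pi ->
  (forall x, 0 <= x <= T -> is_derive x 1 D (D1 x)) ->
  (forall x, 0 <= x <= T -> is_derive x 1 D1 (D2 x)) ->
  (forall x, 0 < x < T -> D2 x + D x <= 0) ->
  D T <= D 0 * cos T + D1 0 * sin T.
Proof.
move=> hT h0 h1 h2; rewrite -lerN2 opprD -!mulNr.
apply: (@sturm (fun x => - D x) (fun x => - D1 x) (fun x => - D2 x)) => // x hx.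
- exact: der_opp (h0 x hx).
- exact: der_opp (h1 x hx).
- by have := h2 x hx; lra.
Qed.

(** Same argument with the solution [cos x], nonnegative on [[0, pi / 2]]; the result bounds the
    initial slope by the data at the end [T]. *)
Lemma sturm_cot D (D1 D2 : R -> R) T : 0 <= T <= pi / 2 ->
  (forall x, 0 <= x <= T -> is_derive x 1 D (D1 x)) ->
  (forall x, 0 <= x <= T -> is_derive x 1 D1 (D2 x)) ->
  (forall x, 0 < x < T -> 0 <= D2 x + D x) ->
  D1 0 <= D T * sin T + D1 T * cos T.
Proof.
move=> /andP[T0 Tpi] h0 h1 h2.
pose K x := D x * sin x + D1 x * cos x.
have dK x : 0 <= x <= T -> is_derive x 1 K ((D2 x + D x) * cos x).
  by move=> hx; have g0 := h0 x hx; have g1 := h1 x hx; rewrite /K; der; ring.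
have : K 0 <= K T.
  apply: (ndecr_der (f := K) (df := fun x => (D2 x + D x) * cos x) T0) => x hx.
  - exact: der_cont (dK x hx).
  - by apply: dK; lra.
  - by rewrite mulr_ge0 ?h2// cos_ge0_pihalf//; lra.
by rewrite /K sin0 cos0 mulr0 mulr1 add0r.
Qed.

End RealTools.

(** * Clairaut arcs parametrised from their vertex *)

Section ECurves.
Variables (R : realType) (m : R -> R).
Hypothesis vM : von_Mangoldt m.
Implicit Types (s t a b x r rho : R).
Local Notation m1 := (m1 m).
Local Notation m2 := (m2 m).

(* [Reg rho] says that the geodesic tangent to the parallel of radius [rho] escapes to
   infinity on both sides. With Clairaut constant [m rho] and [r = rho + s ^+ 2], it is
   smoothly parametrised by the signed variable [s]: its polar angle is [GG rho s], its arc
   length [TT rho s], both counted from the vertex [s = 0]. There [s * wE rho s] is the signed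
   square root of [m r ^+ 2 - m rho ^+ 2], and [psi rho r] is [|dr / dt|]. *)
Definition Reg rho := [/\ 0 < rho, (forall x, 0 < x -> x <= rho -> 0 < m1 x) &
  (forall x, rho < x -> m rho < m x)].

Lemma Reg_incr rho a b : Reg rho -> 0 <= a -> a < b -> b <= rho -> m a < m b.
Proof.
move=> [r0 h _] a0 ab br.
apply: (incr_der ab (fun t _ => der_cont (dm vM t)) (fun t _ => dm vM t)) => t ht.
by apply: h; lra.
Qed.

Lemma Reg_lt rho x : Reg rho -> 0 < x -> x <= rho -> Reg x.
Proof.
move=> hr x0 xr; have [r0 h1 h2] := hr; split=> //.
  by move=> y y0 yx; apply: h1 => //; lra.
move=> y xy; have [yr|ry] := leP y rho; first by apply: (Reg_incr hr) => //; exact: ltW.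
apply: le_lt_trans (h2 _ ry); move: xr; rewrite le_eqVlt => /predU1P[->//|xr].
by apply/ltW/(Reg_incr hr) => //; exact: ltW.
Qed.

Lemma Reg_inj r1 r2 : Reg r1 -> Reg r2 -> m r1 = m r2 -> r1 = r2.
Proof.
move=> [_ _ h1] [_ _ h2] e; case: (ltgtP r1 r2) => // [/h1|/h2]; by rewrite e ltxx.
Qed.

(** The maximum freezes the radius below [rho], so that [psi rho] is continuous on the line and
    vanishes there. [JJ rho] is the radial part of the calibration [m rho * theta + JJ rho r], whose
    gradient is a unit vector beyond [rho]. *)
Definition psi rho x := Num.sqrt (1 - (m rho / m (Num.max x rho)) ^+ 2).
Definition JJ rho := prim (psi rho).

Lemma psi_cont rho : 0 <= rho -> continuous (psi rho).
Proof.
rewrite le_eqVlt => /predU1P[<-|r0] x.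
  have -> : psi 0 = fun=> Num.sqrt 1; last exact: cont_cst.
  by apply/funext => y; rewrite /psi (m_at0 vM) mul0r expr0n subr0.
have mc : continuous m := m_cont vM.
rewrite /psi; cont.
by rewrite gt_eqF// (m_gt0 vM)// lt_max r0 orbT.
Qed.

Lemma dJJ rho x : 0 <= rho -> is_derive x 1 (JJ rho) (psi rho x).
Proof. by move=> r0; apply: dprim; exact: psi_cont. Qed.

Lemma psi0 x : psi 0 x = 1.
Proof. by rewrite /psi (m_at0 vM) mul0r expr0n subr0 sqrtr1. Qed.

Lemma psi_ge0 rho x : 0 <= psi rho x. Proof. exact: sqrtr_ge0. Qed.

Lemma psi_le1 rho x : psi rho x <= 1.
Proof. by rewrite -[leRHS]sqrtr1 ler_sqrt// gerBl sqr_ge0. Qed.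

Lemma psi_below rho x : 0 < rho -> x <= rho -> psi rho x = 0.
Proof.
move=> r0 xr; rewrite /psi; have -> : Num.max x rho = rho by apply/max_idPr.
by rewrite divff ?expr1n ?subrr ?sqrtr0// gt_eqF// (m_gt0 vM).
Qed.

Lemma JJ0 x : JJ 0 x = x.
Proof.
have h (y : R) : is_derive y (1 : R) (fun x : R => JJ 0 x - x) 0.
  by have g := dJJ y (lexx 0); rewrite psi0 in g; der; rewrite subrr.
suff : JJ 0 x - x = JJ 0 0 - 0 by rewrite /JJ prim0; lra.
have [x0|/ltW x0] := leP 0 x.
  by apply/esym/(cst_der x0 (fun t _ => der_cont (h t))) => t _; exact: h.
by apply/(cst_der x0 (fun t _ => der_cont (h t))) => t _; exact: h.
Qed.

Lemma JJ_below rho x : 0 < rho -> 0 <= x -> x <= rho -> JJ rho x = 0.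
Proof.
move=> r0 x0 xr; rewrite -(prim0 (psi rho)) -/(JJ rho).
apply/esym/(cst_der x0) => t ht; first exact: der_cont (dJJ t (ltW r0)).
have g := dJJ t (ltW r0); rewrite psi_below// in g; lra.
Qed.

Lemma JJ_ndecr rho a b : 0 <= rho -> a <= b -> JJ rho a <= JJ rho b.
Proof.
move=> r0 ab; apply: (ndecr_der ab (fun t _ => der_cont (dJJ t r0)) (fun t _ => dJJ t r0)).
by move=> t _; exact: psi_ge0.
Qed.

Lemma psi_sqr rho x : 0 <= rho -> (rho = 0 \/ Reg rho) -> 0 < x -> rho <= x ->
  (m rho / m x) ^+ 2 + psi rho x ^+ 2 = 1.
Proof.
move=> r0 hr x0 rx; have mx := m_gt0 vM x0.
have h : m rho / m x <= 1.
  rewrite ler_pdivrMr// mul1r; case: hr => [->|[_ _ h]]; first by rewrite (m_at0 vM) ltW.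
  by move: rx; rewrite le_eqVlt => /predU1P[->//|/h/ltW].
have h' : 0 <= m rho / m x by rewrite divr_ge0// ?(m_ge0 vM)// ltW.
rewrite /psi; have -> : Num.max x rho = x by apply/max_idPl.
by rewrite sqr_sqrtr ?subr_ge0 ?expr_le1//; ring.
Qed.

Definition wE rho s := if s == 0 then Num.sqrt (2 * m rho * m1 rho)
  else Num.sqrt ((m (rho + s ^+ 2) ^+ 2 - m rho ^+ 2) / s ^+ 2).
Definition GG rho := prim (fun s => 2 * m rho / (m (rho + s ^+ 2) * wE rho s)).
Definition TT rho := prim (fun s => 2 * m (rho + s ^+ 2) / wE rho s).

Section OneCurve.
Variable rho : R.
Hypothesis hr : Reg rho.
Local Notation c := (m rho).
Local Notation w := (wE rho).
Local Notation G := (GG rho).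
Local Notation T := (TT rho).
Local Notation rr s := (rho + s ^+ 2).

Lemma Reg_gt0 : 0 < rho. Proof. by case: hr. Qed.

Lemma c_gt0 : 0 < c. Proof. exact (m_gt0 vM Reg_gt0). Qed.

Lemma rr_gt0 s : 0 < rr s. Proof. by rewrite ltr_wpDr ?sqr_ge0 ?Reg_gt0. Qed.

Lemma mrr_gt0 s : 0 < m (rr s). Proof. exact (m_gt0 vM (rr_gt0 s)). Qed.

Lemma c_lt s : s != 0 -> c < m (rr s).
Proof. by move=> s0; have [_ _ h] := hr; apply: h; rewrite ltrDl exprn_even_gt0. Qed.

Lemma wE_gt0 s : 0 < w s.
Proof.
rewrite /wE; case: eqVneq => [_|s0]; rewrite sqrtr_gt0.
  by have [r0 h _] := hr; rewrite !mulr_gt0 ?c_gt0 ?h.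
rewrite divr_gt0 ?exprn_even_gt0// subr_gt0 ltrXn2r ?nnegrE ?ltW ?c_gt0 ?mrr_gt0//.
exact: c_lt.
Qed.

Lemma wE_neq0 s : w s != 0. Proof. by rewrite gt_eqF ?wE_gt0. Qed.

Lemma wE_sqr s : (s * w s) ^+ 2 = m (rr s) ^+ 2 - c ^+ 2.
Proof.
rewrite exprMn /wE; case: eqVneq => [->|s0]; first by rewrite expr0n /= mul0r addr0 subrr.
have h := c_lt s0; rewrite sqr_sqrtr; first by field.
rewrite divr_ge0 ?sqr_ge0// subr_ge0 lerXn2r ?nnegrE ?ltW ?c_gt0 ?mrr_gt0//.
Qed.

Lemma wE_cont : continuous w.
Proof.
have mc : continuous m := m_cont vM.
have m1c : continuous m1 := dm1_cont vM.
move=> s; have [->|s0] := eqVneq s 0; last first.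
  pose f t := Num.sqrt ((m (rho + t ^+ 2) ^+ 2 - c ^+ 2) / t ^+ 2).
  apply: (@cont_near _ f).
    near=> t; rewrite /wE /f ifF//; apply/negbTE.
    near: t; apply/nbhs_ballP; exists `|s|; first by rewrite /= normr_gt0.
    by move=> t /=; rewrite /ball /=; apply: contraTneq => ->; rewrite subr0 ltxx.
  by rewrite /f; cont; rewrite expf_eq0.
have hM : continuous (fun x => 2 * m x * m1 x) by cont.
(* [w s ^+ 2] is the difference quotient of [m ^+ 2] between [rho] and [rho + s ^+ 2]; it tends to
   the derivative [2 * m rho * m1 rho], which is the value chosen at [s = 0]. *)
have hf : continuous_at (0 : R) (fun s => w s ^+ 2).
  apply: dist_cont => e e0; have [d d0 hd] := cont_dist (hM rho) e0.
  exists (Num.min d 1); first by rewrite lt_min d0 ltr01.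
  move=> y; rewrite subr0 lt_min => /andP[yd y1].
  have e1 : w 0 ^+ 2 = 2 * c * m1 rho.
    rewrite /wE eqxx sqr_sqrtr//; have [r0 h _] := hr.
    by rewrite !mulr_ge0 ?(ltW c_gt0)// ltW// h.
  have [->|y0] := eqVneq y 0; first by rewrite subrr normr0.
  have y2 : 0 < y ^+ 2 by rewrite exprn_even_gt0.
  have e2 : w y ^+ 2 * y ^+ 2 = m (rr y) ^+ 2 - c ^+ 2 by rewrite -wE_sqr exprMn mulrC.
  have ry : rho < rr y by rewrite ltrDl.
  have dM x : is_derive x 1 (fun x => m x ^+ 2) (2 * m x * m1 x).
    by have h := dm vM x; der; ring.
  have [z /andP[z1 z2]] := mvt ry (fun t _ => der_cont (dM t)) (fun t _ => dM t).
  rewrite -e2; have -> : rr y - rho = y ^+ 2 by ring.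
  move/mulIf => e3; rewrite e3 ?gt_eqF// e1; apply: hd.
  rewrite ger0_norm; last by lra.
  apply: (@lt_le_trans _ _ (y ^+ 2)); first lra.
  by rewrite -real_normK ?num_real//; have := normr_ge0 y; nra.
have -> : w = fun s => Num.sqrt (w s ^+ 2).
  by apply/funext => t; rewrite sqrtr_sqr ger0_norm// ltW// wE_gt0.
exact: cont_sqrt hf.
Unshelve. all: by end_near. Qed.

Lemma dG s : is_derive s 1 G (2 * c / (m (rr s) * w s)).
Proof.
apply: dprim => x; have mc : continuous m := m_cont vM; have wc := wE_cont.
by cont; rewrite mulf_neq0 ?wE_neq0// gt_eqF ?mrr_gt0.
Qed.

Lemma dT s : is_derive s 1 T (2 * m (rr s) / w s).
Proof.
apply: dprim => x; have mc : continuous m := m_cont vM; have wc := wE_cont.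
by cont; rewrite wE_neq0.
Qed.

Lemma dG_gt0 s : 0 < 2 * c / (m (rr s) * w s).
Proof. by rewrite divr_gt0// mulr_gt0 ?c_gt0 ?mrr_gt0 ?wE_gt0. Qed.

Lemma dT_gt0 s : 0 < 2 * m (rr s) / w s.
Proof. by rewrite divr_gt0 ?mulr_gt0 ?mrr_gt0 ?wE_gt0. Qed.

Lemma G_lt s t : s < t -> G s < G t.
Proof.
by move=> st; apply: (incr_der st (fun x _ => der_cont (dG x)) (fun x _ => dG x)) => x _; exact: dG_gt0.
Qed.

Lemma T_lt s t : s < t -> T s < T t.
Proof.
by move=> st; apply: (incr_der st (fun x _ => der_cont (dT x)) (fun x _ => dT x)) => x _; exact: dT_gt0.
Qed.

Lemma G_le s t : s <= t -> G s <= G t.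
Proof. by rewrite le_eqVlt => /predU1P[->//|/G_lt/ltW]. Qed.

Lemma T_le s t : s <= t -> T s <= T t.
Proof. by rewrite le_eqVlt => /predU1P[->//|/T_lt/ltW]. Qed.

Lemma wEN s : w (- s) = w s. Proof. by rewrite /wE oppr_eq0 sqrrN. Qed.

Lemma odd_prim (f F : R -> R) s : (forall x, is_derive x 1 F (f x)) -> F 0 = 0 ->
  (forall x, f (- x) = f x) -> F (- s) = - F s.
Proof.
move=> dF F0 fN; pose D x := F (- x) + F x.
have hD x : is_derive x 1 D 0.
  have h := dF x; have h' := der_comp (dF (- x)) (der_opp (der_id x)).
  by rewrite /D; der; rewrite fN; ring.
suff : D s = D 0 by rewrite /D oppr0 F0; lra.
have [x0|/ltW x0] := leP 0 s.
  by apply/esym/(cst_der x0 (fun t _ => der_cont (hD t))) => t _; exact: hD.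
by apply/(cst_der x0 (fun t _ => der_cont (hD t))) => t _; exact: hD.
Qed.

Lemma GN s : G (- s) = - G s.
Proof. by apply: odd_prim dG _ _; [exact: prim0|move=> x; rewrite sqrrN wEN]. Qed.

Lemma TN s : T (- s) = - T s.
Proof. by apply: odd_prim dT _ _; [exact: prim0|move=> x; rewrite sqrrN wEN]. Qed.

Lemma G0 : G 0 = 0. Proof. exact: prim0. Qed.
Lemma T0 : T 0 = 0. Proof. exact: prim0. Qed.

Lemma psi_rr s : 0 <= s -> psi rho (rr s) = s * w s / m (rr s).
Proof.
move=> s0; have h := psi_sqr (ltW Reg_gt0) (or_intror hr) (rr_gt0 s) _.
have {}h : psi rho (rr s) ^+ 2 = (s * w s / m (rr s)) ^+ 2.
  rewrite expr_div_n wE_sqr mulrBl divff; last by rewrite expf_neq0// gt_eqF ?mrr_gt0.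
  by rewrite -h ?lerDl ?sqr_ge0// expr_div_n; ring.
apply/eqP; rewrite -(eqrXn2 (n := 2)) ?psi_ge0 ?h//.
by rewrite divr_ge0 ?mulr_ge0 ?(ltW (wE_gt0 s)) ?(ltW (mrr_gt0 s)).
Qed.

(** The calibration is sharp along its own arc: [dt = m rho * dtheta + psi * dr], and all terms
    vanish at the vertex. This identifies lengths of arcs with the bounds given by calibrations. *)
Lemma T_GJ s : 0 <= s -> T s = c * G s + JJ rho (rr s).
Proof.
move=> s0; pose D x := T x - c * G x - JJ rho (rr x).
have r0 := ltW Reg_gt0.
suff : D s = 0.
  by rewrite /D => e; rewrite -[LHS](subrK (c * G s)) -[X in X + _](subrK (JJ rho (rr s))) e add0r addrC.
have <- : D 0 = 0.
  by rewrite /D T0 G0 mulr0 expr0n /= addr0 (JJ_below Reg_gt0) ?lexx ?subrr ?subr0.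
have hD x : 0 <= x -> is_derive x 1 D 0.
  move=> x0; have h1 := dT x; have h2 := dG x.
  have h3 := der_comp (g := fun t => rr t) (dJJ (rr x) r0) (der_add (der_cst rho x) (der_exp 1 (der_id x))).
  rewrite /D; der; rewrite psi_rr//.
  have e := wE_sqr x; have wn := wE_neq0 x; have mn : m (rr x) != 0 by rewrite gt_eqF ?mrr_gt0.
  transitivity (2 * (m (rr x) ^+ 2 - c ^+ 2 - (x * w x) ^+ 2) / (m (rr x) * w x)).
    by field; rewrite wn mn.
  by rewrite e subrr mulr0 mul0r.
apply/esym/(cst_der s0) => t ht; [apply: der_cont (hD t _)|apply: hD]; lra.
Qed.

(** Away from 0 the root of [m r ^+ 2 - m rho ^+ 2] is differentiated with a locally constant sign
    [sg]; at the vertex, where the root is singular, [der_mul_id] takes over. *)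
Lemma dY s : is_derive s 1 (fun s => s * w s) (2 * m (rr s) * m1 (rr s) / w s).
Proof.
have [s0|s0] := eqVneq s 0.
  rewrite s0; refine (der_eq (der_mul_id (f := w) (@wE_cont 0)) _).
  have e : w 0 ^+ 2 = 2 * c * m1 rho.
    rewrite /wE eqxx sqr_sqrtr//; have [r0 h _] := hr.
    by rewrite !mulr_ge0 ?(ltW c_gt0)// ltW// h.
  have := wE_neq0 0 => wn; rewrite expr0n /= addr0 -e; by field.
pose sg : R := if 0 < s then 1 else -1.
have hsg : sg ^+ 2 = 1 by rewrite /sg; case: ifP; rewrite ?sqrrN expr1n.
have sgs : 0 < sg * s.
  rewrite /sg; case: ifPn => h; first by rewrite mul1r.
  by rewrite mulN1r oppr_gt0 lt_neqAle s0 leNgt.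
have pos : 0 < m (rr s) ^+ 2 - c ^+ 2.
  by rewrite subr_gt0 ltrXn2r ?nnegrE ?ltW ?c_gt0 ?mrr_gt0// c_lt.
have h1 : is_derive s 1 (fun s => m (rr s) ^+ 2 - c ^+ 2) (2 * m (rr s) * m1 (rr s) * (2 * s)).
  have h := der_comp (g := fun t => rr t) (dm vM (rr s)) (der_add (der_cst rho s) (der_exp 1 (der_id s))).
  by der; rewrite expr1; ring.
have h2 := der_mul (der_cst sg s) (der_sqrt (f := fun t : R => m (rr t) ^+ 2 - c ^+ 2) pos h1).
have eY : sg * Num.sqrt (m (rr s) ^+ 2 - c ^+ 2) = s * w s.
  rewrite -wE_sqr sqrtr_sqr normrM (gtr0_norm (wE_gt0 s)) mulrA; congr (_ * _).
  have := gtr0_norm sgs; rewrite normrM.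
  have -> : `|sg| = 1 by rewrite /sg; case: ifP; rewrite ?normrN normr1.
  by rewrite mul1r => ->; rewrite mulrA -expr2 hsg mul1r.
apply: der_near; last first.
  apply: der_eq h2 _; rewrite mul0r add0r.
  have e2 : Num.sqrt (m (rr s) ^+ 2 - c ^+ 2) = sg * (s * w s).
    by rewrite -eY mulrA -expr2 hsg mul1r.
  rewrite e2; have wn := wE_neq0 s; have sn : sg != 0 by rewrite -sqrf_eq0 hsg oner_eq0.
  transitivity (sg ^+ 2 * (2 * m (rr s) * m1 (rr s) / w s) / sg ^+ 2); last by rewrite hsg mul1r divr1.
  by field; rewrite wn sn s0.
have sc : \forall t \near s, 0 < sg * t.
  have : continuous_at s (fun t => sg * t) by cont.
  by move/cvgr_gt; apply.
near=> t; have st : 0 < sg * t by near: t.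
rewrite /= -wE_sqr sqrtr_sqr normrM (gtr0_norm (wE_gt0 t)) mulrA; congr (_ * _).
have := gtr0_norm st; rewrite normrM.
have -> : `|sg| = 1 by rewrite /sg; case: ifP; rewrite ?normrN normr1.
by rewrite mul1r => ->; rewrite mulrA -expr2 hsg mul1r.
Unshelve. all: by end_near. Qed.

End OneCurve.
End ECurves.

(** * Sturm comparison of arcs *)

Section Turning.
Variables (R : realType) (m : R -> R).
Hypothesis vM : von_Mangoldt m.
Variable h : R -> R.
Hypothesis dh : forall x : R, 0 < x -> is_derive x 1 h (- (m x ^- 2)).
Implicit Types (s t a b x r rho : R).
Local Notation m1 := (m1 m).
Local Notation m2 := (m2 m).
Local Notation k := (kk m h).

(* In the variables [theta] and [u = h r] the geodesic equation reads
   [u'' + u = - k(r)], so that Sturm comparison applies with [k] monotone. *)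
Lemma arc_u rho sa s1 : Reg m rho -> sa <= s1 -> exists sx U V : R -> R,
  [/\ sx 0 = sa, sx (GG m rho s1 - GG m rho sa) = s1 &
  forall x, 0 <= x <= GG m rho s1 - GG m rho sa ->
    [/\ sa <= sx x <= s1, U x = h (rho + sx x ^+ 2),
        V x = - (sx x * wE m rho (sx x)) / (m rho * m (rho + sx x ^+ 2)),
        is_derive x 1 U (V x) & is_derive x 1 V (- (U x + k (rho + sx x ^+ 2)))]].
Proof.
move=> hr s01; have dG0 := dG vM hr; have [S [SK dS]] := inverse_ex dG0 (dG_gt0 vM hr).
pose G := GG m rho; pose w := wE m rho.
pose sx x := S (G sa + x).
have ex x : 0 <= x <= G s1 - G sa -> exists2 s, sa <= s <= s1 & G s = G sa + x.
  move=> hx; apply: ivt => //; first by move=> t _; exact: der_cont (dG0 t).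
  by rewrite -/G; lra.
exists sx, (fun x => h (rho + sx x ^+ 2)), (fun x => - (sx x * w (sx x)) / (m rho * m (rho + sx x ^+ 2))).
have e0 : sx 0 = sa by rewrite /sx addr0 SK.
have e1 : sx (G s1 - G sa) = s1 by rewrite /sx addrC subrK SK.
split=> // x hx; have [s hs es] := ex x hx.
have sxE : sx x = s by rewrite /sx -es SK.
have r0 := rr_gt0 hr s; have mr := m_gt0 vM r0; have w0 := wE_gt0 vM hr s.
have c0 := c_gt0 vM hr.
have dsx : is_derive x 1 sx (m (rho + s ^+ 2) * w s / (2 * m rho)).
  have h1 := dS s; rewrite -/G es in h1.
  have h2 := der_comp (g := fun t => G sa + t) h1 (der_add (der_cst (G sa) x) (der_id x)).
  apply: der_eq h2 _; rewrite add0r mulr1 invf_div; by [].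
have drs : is_derive x 1 (fun x => rho + sx x ^+ 2) (2 * s * (m (rho + s ^+ 2) * w s / (2 * m rho))).
  by der; rewrite sxE expr1; ring.
have rn : rho + sx x ^+ 2 = rho + s ^+ 2 by rewrite sxE.
split=> //; first by rewrite sxE.
  have hh := dh r0; rewrite -rn in hh.
  have h2 := der_comp (g := fun x => rho + sx x ^+ 2) hh drs.
  apply: der_eq h2 _; rewrite rn sxE; field.
  by rewrite !gt_eqF.
have hm := dm vM (rho + s ^+ 2); rewrite -rn in hm.
have h2 := der_comp (g := fun x => rho + sx x ^+ 2) hm drs.
have hY := dY vM hr s; rewrite -{1}sxE in hY.
have h3 := der_comp (g := sx) hY dsx.
have nz : m rho * m (rho + sx x ^+ 2) != 0 by rewrite rn mulf_neq0// gt_eqF.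
have h4 := der_mul (f := fun=> m rho) (g := fun t : R => m (rho + sx t ^+ 2)) (der_cst (m rho) x) h2.
have h5 := der_mul (f := fun t : R => - (sx t * w (sx t))) (g := fun t : R => (m rho * m (rho + sx t ^+ 2))^-1) (der_opp h3) (der_inv (f := fun t : R => m rho * m (rho + sx t ^+ 2)) nz h4).
apply: der_eq h5 _; rewrite rn sxE /kk.
have eY : (s * w s) ^+ 2 = m (rho + s ^+ 2) ^+ 2 - m rho ^+ 2 := wE_sqr vM hr s.
have -> : h (rho + s ^+ 2) + (m1 (rho + s ^+ 2) / m (rho + s ^+ 2) - h (rho + s ^+ 2)) =
  m1 (rho + s ^+ 2) / m (rho + s ^+ 2) by ring.
have mn : m (rho + s ^+ 2) != 0 by rewrite gt_eqF.
have cn : m rho != 0 by rewrite gt_eqF.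
have wn : w s != 0 by rewrite gt_eqF.
transitivity (- (m1 (rho + s ^+ 2) * (m (rho + s ^+ 2) ^+ 2 - (s * w s) ^+ 2)) /
  (m rho ^+ 2 * m (rho + s ^+ 2))).
  by rewrite -/w; field; rewrite wn mn cn.
by rewrite eY; field; rewrite mn cn.
Qed.

(** For [D = U2 - U1] one has [D'' + D = k(r1) - k(r2)], and [D > 0] means [r2 < r1], where the
    right-hand side is nonnegative. So positivity of [D] feeds the Sturm comparison
    [D >= D'(0) * sin], which in turn keeps [D] positive before [pi]; at [pi] itself only the weak
    inequality survives. *)
Lemma noncross_lt rho1 rho2 sa1 s1 sa2 s2 : Reg m rho1 -> Reg m rho2 ->
  sa1 <= s1 -> sa2 <= s2 -> rho1 + sa1 ^+ 2 = rho2 + sa2 ^+ 2 ->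
  GG m rho1 s1 - GG m rho1 sa1 = GG m rho2 s2 - GG m rho2 sa2 ->
  0 < GG m rho1 s1 - GG m rho1 sa1 <= pi ->
  sa2 * wE m rho2 sa2 / m rho2 < sa1 * wE m rho1 sa1 / m rho1 ->
  h (rho1 + s1 ^+ 2) < h (rho2 + s2 ^+ 2) ?<= if (GG m rho1 s1 - GG m rho1 sa1 == pi).
Proof.
move=> hr1 hr2 s11 s22 ea eT /andP[T0 Tpi] hsl.
have [sx1 [U1 [V1 [a1 b1 H1]]]] := arc_u hr1 s11.
have [sx2 [U2 [V2 [a2 b2 H2]]]] := arc_u hr2 s22.
rewrite -eT in b2 H2; move: b1 b2 H1 H2 T0 Tpi.
set T := GG m rho1 s1 - _ => b1 b2 H1 H2 T0 Tpi.
pose D x := U2 x - U1 x; pose D1 x := V2 x - V1 x.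
pose D2 x := k (rho1 + sx1 x ^+ 2) - k (rho2 + sx2 x ^+ 2) - D x.
have dD x : 0 <= x <= T -> is_derive x 1 D (D1 x).
  by move=> hx; have [_ _ _ g1 _] := H1 x hx; have [_ _ _ g2 _] := H2 x hx; rewrite /D /D1; der.
have dD1 x : 0 <= x <= T -> is_derive x 1 D1 (D2 x).
  move=> hx; have [_ _ _ _ g1] := H1 x hx; have [_ _ _ _ g2] := H2 x hx.
  by rewrite /D1 /D2 /D; der; ring.
have h00 : 0 <= (0 : R) <= T by rewrite lexx ltW.
have D00 : D 0 = 0.
  by have [_ e1 _ _ _] := H1 _ h00; have [_ e2 _ _ _] := H2 _ h00; rewrite /D e1 e2 a1 a2 ea subrr.
have D10 : 0 < D1 0.
  have [_ _ e1 _ _] := H1 _ h00; have [_ _ e2 _ _] := H2 _ h00.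
  rewrite /D1 e1 e2 a1 a2 -ea.
  have mr := m_gt0 vM (rr_gt0 hr1 sa1); have c1 := c_gt0 vM hr1; have c2 := c_gt0 vM hr2.
  have -> : - (sa2 * wE m rho2 sa2) / (m rho2 * m (rho1 + sa1 ^+ 2)) -
     - (sa1 * wE m rho1 sa1) / (m rho1 * m (rho1 + sa1 ^+ 2)) =
     (sa1 * wE m rho1 sa1 / m rho1 - sa2 * wE m rho2 sa2 / m rho2) / m (rho1 + sa1 ^+ 2).
    by field; rewrite !gt_eqF.
  by rewrite divr_gt0// subr_gt0.
have hTT : 0 <= T <= T by rewrite lexx ltW.
have <- : U1 T = h (rho1 + s1 ^+ 2) by have [_ -> _ _ _] := H1 _ hTT; rewrite b1.
have <- : U2 T = h (rho2 + s2 ^+ 2) by have [_ -> _ _ _] := H2 _ hTT; rewrite b2.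
have hD2 y x : 0 < y -> y < x -> x <= T -> (forall z, 0 < z -> z < x -> 0 < D z) -> 0 <= D2 y + D y.
  move=> y0 yx xT hD; rewrite /D2 subrK subr_ge0; apply: (kk_ndecr vM dh); first exact: (rr_gt0 hr2).
  have hy' : 0 <= y <= T by lra.
  have := hD y y0 yx; rewrite /D subr_gt0.
  have [_ -> _ _ _] := H1 y hy'; have [_ -> _ _ _] := H2 y hy'.
  by move/(h_inj_lt vM dh (rr_gt0 hr1 _) (rr_gt0 hr2 _))/ltW.
have st x : 0 < x -> x <= T -> (forall z, 0 < z -> z < x -> 0 < D z) -> D1 0 * sin x <= D x.
  move=> x0 xT hD; have -> : D1 0 * sin x = D 0 * cos x + D1 0 * sin x by rewrite D00 mul0r add0r.
  apply: (@sturm R D D1 D2) => [|y hy|y hy|y hy]; first lra.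
  - by apply: dD; lra.
  - by apply: dD1; lra.
  - by apply: (hD2 y x) => //; lra.
(* At a first failure of positivity the Sturm bound on the interval before it would be violated. The
   search starts at [e > 0], since [D] vanishes at 0; the slope covers the points below [e]. *)
have main x : 0 < x -> x <= T -> x < pi -> 0 < D x.
  move=> x0 xT xpi; rewrite ltNge; apply/negP => DT.
  have [d d0 hd] := der_pos_near (dD _ h00) D10.
  pose e : R := Num.min (d / 2) (x / 2).
  have e0 : 0 < e by rewrite lt_min !divr_gt0.
  have ed : e <= d / 2 by rewrite ge_min lexx.
  have eTT : e <= x / 2 by rewrite ge_min lexx orbT.
  have De : 0 < D e by rewrite -D00; apply: hd; lra.
  have [||z [/andP[ez zx] Dz hz]] := @first_neg R D e x _ _ De DT; first lra.
    by move=> y hy; apply: der_cont (dD y _); lra.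
  have z0 : 0 < z by lra.
  have zT : z <= T by lra.
  have : D1 0 * sin z <= D z.
    apply: st => // y y0 yz; have [ey|ye] := leP e y; first by apply: hz; lra.
    by rewrite -D00; apply: hd; lra.
  rewrite leNgt => /negP; apply; apply: le_lt_trans Dz _.
  by rewrite mulr_gt0// sin_gt0_pi//; lra.
case: eqVneq => [e|ne] /=.
  rewrite -subr_ge0 -/(D T); apply: le_trans (st T T0 (lexx T) _); first by rewrite e sinpi mulr0.
  by move=> z z0 zT; apply: main => //; lra.
rewrite -subr_gt0 -/(D T); apply: main => //; rewrite lt_neqAle ne; exact: Tpi.
Qed.

(** [noncross_lt] used both ways excludes different initial slopes. The slope [s * w / m rho] has
    square [(m r / m rho)^2 - 1], so equal slopes at the same radius force the same Clairaut
    constant, hence the same vertex radius. *)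
Lemma noncross rho1 rho2 sa1 s1 sa2 s2 : Reg m rho1 -> Reg m rho2 ->
  sa1 <= s1 -> sa2 <= s2 -> rho1 + sa1 ^+ 2 = rho2 + sa2 ^+ 2 ->
  GG m rho1 s1 - GG m rho1 sa1 = GG m rho2 s2 - GG m rho2 sa2 ->
  0 < GG m rho1 s1 - GG m rho1 sa1 < pi ->
  rho1 + s1 ^+ 2 = rho2 + s2 ^+ 2 -> [/\ rho1 = rho2, sa1 = sa2 & s1 = s2].
Proof.
move=> hr1 hr2 s11 s22 ea eT hT eb.
have ltle (x : R) : 0 < x < pi -> 0 < x <= pi by move=> /andP[-> /ltW].
have esl : sa1 * wE m rho1 sa1 / m rho1 = sa2 * wE m rho2 sa2 / m rho2.
  apply/eqP; case: ltgtP => // hlt.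
  - have hT' : 0 < GG m rho2 s2 - GG m rho2 sa2 < pi by rewrite -eT.
    by have := noncross_lt hr2 hr1 s22 s11 (esym ea) (esym eT) (ltle _ hT') hlt; rewrite eb (lt_eqF (proj2 (andP hT'))) /= ltxx.
  - by have := noncross_lt hr1 hr2 s11 s22 ea eT (ltle _ hT) hlt; rewrite eb (lt_eqF (proj2 (andP hT))) /= ltxx.
have c1 := c_gt0 vM hr1; have c2 := c_gt0 vM hr2.
have e2 : (sa1 * wE m rho1 sa1 / m rho1) ^+ 2 = (sa2 * wE m rho2 sa2 / m rho2) ^+ 2 by rewrite esl.
rewrite !expr_div_n !(wE_sqr vM)// -ea !mulrBl !divff ?expf_neq0 ?gt_eqF// in e2.
have mr := m_gt0 vM (rr_gt0 hr1 sa1).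
have mn : m (rho1 + sa1 ^+ 2) ^+ 2 != 0 by rewrite expf_neq0// gt_eqF.
move/addIr/(mulfI mn)/invr_inj : e2 => e2.
have em : m rho1 = m rho2 by apply/eqP; rewrite -(eqrXn2 (n := 2)) ?ltW// e2.
have er := Reg_inj hr1 hr2 em.
subst rho2; move/addrI: ea => ea.
have cn : (m rho1)^-1 != 0 by rewrite invr_neq0// gt_eqF.
move/(mulIf cn): esl => esl.
have es : sa1 = sa2.
  have : wE m rho1 sa1 = wE m rho1 sa2.
    by move/eqP: ea; rewrite eqf_sqr => /orP[] /eqP ->; rewrite ?wEN.
  by move=> ew; move: esl; rewrite ew => /mulIf; apply; exact: (wE_neq0 vM hr1).
split=> //; subst sa2; move/addIr: eT => eG.
apply/eqP; case: ltgtP => // /(G_lt vM hr1); by rewrite eG ltxx.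
Qed.

Variable k0 : R.
Hypothesis k0_le : forall x, 0 < x -> k0 <= k x.

(** [(u + k0)'' + (u + k0) = k0 - k <= 0], so [u + k0] stays below the trigonometric solution with
    the same initial data. *)
Lemma turn_le rho sa s : Reg m rho -> sa <= s -> GG m rho s - GG m rho sa <= pi ->
  h (rho + s ^+ 2) + k0 <= (h (rho + sa ^+ 2) + k0) * cos (GG m rho s - GG m rho sa) -
    sa * wE m rho sa / (m rho * m (rho + sa ^+ 2)) * sin (GG m rho s - GG m rho sa).
Proof.
move=> hr sas; have [sx [U [V [a1 b1 H]]]] := arc_u hr sas.
have T0 : 0 <= GG m rho s - GG m rho sa by rewrite subr_ge0 (G_le vM hr).
move: b1 H T0; set T := GG m rho s - _ => b1 H T0 Tpi.
have hTT : 0 <= T <= T by rewrite lexx T0.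
have h00 : 0 <= (0 : R) <= T by rewrite lexx T0.
have <- : U T = h (rho + s ^+ 2) by have [_ -> _ _ _] := H _ hTT; rewrite b1.
have <- : U 0 = h (rho + sa ^+ 2) by have [_ -> _ _ _] := H _ h00; rewrite a1.
have -> : sa * wE m rho sa / (m rho * m (rho + sa ^+ 2)) = - V 0.
  by have [_ _ -> _ _] := H _ h00; rewrite a1 mulNr opprK.
rewrite mulNr opprK.
apply: (@sturm_le R (fun x => U x + k0) V (fun x => - (U x + k (rho + sx x ^+ 2)))) => [|x hx|x hx|x hx].
- by rewrite T0.
- by have [_ _ _ g _] := H x hx; der; rewrite addr0.
- by have [] := H x hx.
- by have := k0_le (rr_gt0 hr (sx x)); lra.
Qed.

(** At the angle [pi], [turn_le] reads [h r + k0 <= - (h a + k0)] for the radii [a] and [r] of the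
    two ends, against the hypothesis. *)
Lemma turn_lt rho sa s : Reg m rho -> sa <= s ->
  (forall t, sa <= t <= s -> 0 < h (rho + sa ^+ 2) + h (rho + t ^+ 2) + 2 * k0) ->
  GG m rho s - GG m rho sa < pi.
Proof.
move=> hr sas hp; rewrite ltNge; apply/negP => hpi.
have [||t ht et] := @ivt R (GG m rho) sa s (GG m rho sa + pi) sas.
- by move=> x _; exact: der_cont (dG vM hr x).
- by rewrite lerDl pi_ge0 /=; lra.
have e : GG m rho t - GG m rho sa = pi by rewrite et; ring.
have /andP[sat _] := ht.
have := turn_le hr sat; rewrite e lexx cospi sinpi mulr0 subr0 => /(_ isT).
by have := hp t ht; lra.
Qed.

End Turning.

Section Arcs.
Variables (R : realType) (m : R -> R).
Hypothesis vM : von_Mangoldt m.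
Implicit Types (s t a b x r rho : R).

(* Spreading a rotation by [d] uniformly along an arc of Clairaut constant [c]
   changes its length by [c d + O(d^2)]. *)
Lemma arc_spread rho sa s sg al : Reg m rho -> sa < s -> sg ^+ 2 = 1 ->
  exists2 C : R, 0 <= C & forall d : R,
  dist m (pol (rho + sa ^+ 2) al) (pol (rho + s ^+ 2) (al + sg * (GG m rho s - GG m rho sa) + d)) <=
  TT m rho s - TT m rho sa + sg * m rho * d + C * d ^+ 2.
Proof.
move=> hr sas hsg; pose L := TT m rho s - TT m rho sa.
have L0 : 0 < L by rewrite subr_gt0 (T_lt vM hr).
have mc : continuous m := m_cont vM.
have cm : continuous (fun x => - m (rho + x ^+ 2)) by cont.
have [x0 hx0 hmin] := evt_min (ltW sas) (fun x _ => cm x).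
pose M := m (rho + x0 ^+ 2).
have hM x : sa <= x <= s -> m (rho + x ^+ 2) <= M by move=> /hmin; rewrite lerN2.
have c0 := c_gt0 vM hr.
have cM : m rho <= M.
  rewrite /M; have [->|x00] := eqVneq x0 0; first by rewrite expr0n addr0.
  by rewrite ltW// (c_lt hr).
exists (M ^+ 2 / (2 * L)) => [|d]; first by rewrite divr_ge0 ?sqr_ge0// mulr_ge0// ltW.
pose G := GG m rho; pose T := TT m rho.
(* Relative lengthening. Adding the angular velocity [d / L] per unit length multiplies the squared
   speed by at most [1 + 2 * sg * m rho * d / L + (M * d / L)^2], which is [(1 + e)^2 - e^2]. *)
pose e := sg * m rho * d / L + M ^+ 2 * d ^+ 2 / (2 * L ^+ 2).
have := @dist_polar_le R m vM (fun x => rho + x ^+ 2)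
  (fun x => al + sg * (G x - G sa) + d * ((T x - T sa) / L)) (fun x => 2 * x)
  (fun x => sg * (2 * m rho / (m (rho + x ^+ 2) * wE m rho x)) +
     d * ((2 * m (rho + x ^+ 2) / wE m rho x) / L))
  (fun x => T x * (1 + e)) (fun x => (2 * m (rho + x ^+ 2) / wE m rho x) * (1 + e)) sa s (ltW sas).
have -> : T s * (1 + e) - T sa * (1 + e) = L + sg * m rho * d + M ^+ 2 / (2 * L) * d ^+ 2.
  by rewrite -mulrBl -/L /e; field; rewrite gt_eqF.
rewrite subrr mulr0 addr0 subrr mul0r mulr0 addr0 -/L divff ?gt_eqF// mulr1.
have dG0 := dG vM hr; have dT0 := dT vM hr; have wc : continuous (wE m rho) := @wE_cont _ _ vM _ hr.
have e0 : 0 <= 1 + e.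
  have -> : 1 + e = ((1 + sg * m rho * d / L) ^+ 2 + 1 + (M ^+ 2 - sg ^+ 2 * m rho ^+ 2) * (d / L) ^+ 2) / 2.
    by rewrite /e; field; rewrite gt_eqF.
  rewrite hsg mul1r divr_ge0// addr_ge0 ?addr_ge0 ?sqr_ge0// mulr_ge0 ?sqr_ge0// subr_ge0.
  by rewrite lerXn2r ?nnegrE ?(ltW c0)// (le_trans (ltW c0)).
apply=> //.
- by move=> t; der; ring.
- by move=> t; rewrite /G /T; der; ring.
- by move=> t; cont.
- by move=> t; cont; rewrite ?mulf_neq0 ?(wE_neq0 vM hr)// gt_eqF// (mrr_gt0 vM).
- by move=> t _; exact: (rr_gt0 hr).
- by move=> t _; rewrite /T; cont.
- by move=> t _; rewrite /T; der; ring.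
- by move=> t _; rewrite mulr_ge0// ltW// (dT_gt0 vM hr).
move=> t ht.
have w0 := wE_gt0 vM hr t; have mr := mrr_gt0 vM hr t; have eY := wE_sqr vM hr t.
have -> : (2 * t) ^+ 2 = 4 * (m (rho + t ^+ 2) ^+ 2 - m rho ^+ 2) / wE m rho t ^+ 2.
  by rewrite -eY; field; rewrite gt_eqF.
have -> : 4 * (m (rho + t ^+ 2) ^+ 2 - m rho ^+ 2) / wE m rho t ^+ 2 +
   m (rho + t ^+ 2) ^+ 2 * (sg * (2 * m rho / (m (rho + t ^+ 2) * wE m rho t)) +
     d * (2 * m (rho + t ^+ 2) / wE m rho t / L)) ^+ 2 =
   (2 * m (rho + t ^+ 2) / wE m rho t) ^+ 2 *
     (1 + 2 * (sg * m rho * d / L) + m (rho + t ^+ 2) ^+ 2 * (d / L) ^+ 2 +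
      (sg ^+ 2 - 1) * m rho ^+ 2 / m (rho + t ^+ 2) ^+ 2).
  by field; rewrite !gt_eqF.
rewrite hsg subrr !mul0r addr0 [leRHS]exprMn ler_wpM2l ?sqr_ge0//.
have -> : (1 + e) ^+ 2 = 1 + 2 * (sg * m rho * d / L) + M ^+ 2 * (d / L) ^+ 2 + e ^+ 2.
  by rewrite /e; field; rewrite gt_eqF.
apply: ler_wpDr; first exact: sqr_ge0.
rewrite lerD2l ler_wpM2r ?sqr_ge0// lerXn2r ?nnegrE ?(ltW mr)//.
  by rewrite (le_trans (ltW c0)).
by apply: hM; lra.
Qed.

Lemma arc_dist rho sa s sg al : Reg m rho -> sa <= s -> sg ^+ 2 = 1 ->
  dist m (pol (rho + sa ^+ 2) al) (pol (rho + s ^+ 2) (al + sg * (GG m rho s - GG m rho sa))) <=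
  TT m rho s - TT m rho sa.
Proof.
move=> hr; rewrite le_eqVlt => /predU1P[-> hsg|sas hsg].
  by rewrite !subrr mulr0 addr0 (distxx vM).
have [C C0 /(_ 0)] := arc_spread al hr sas hsg.
by rewrite addr0 expr0n /= !mulr0 !addr0.
Qed.

Variable h : R -> R.
Hypothesis dh : forall x : R, 0 < x -> is_derive x 1 h (- (m x ^- 2)).

(** The angle is spread with [dtheta / dr] proportional to [1 / m^2], the choice that minimises the
    second-order cost, half the integral of [m^2 * theta'^2]. That cost is the last term; it becomes
    negligible when [h r2] tends to minus infinity. *)
Lemma spiral_le r1 r2 th d : 0 < r1 -> r1 < r2 ->
  dist m (pol r1 th) (pol r2 (th + d)) <= r2 - r1 + d ^+ 2 / (2 * (h r1 - h r2)).
Proof.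
move=> r10 r12; pose q x := m (Num.max x r1) ^- 2.
have mx x : 0 < m (Num.max x r1) by apply: (m_gt0 vM); rewrite lt_max r10 orbT.
have mc : continuous m := m_cont vM.
have cq : continuous q by rewrite /q; cont; rewrite gt_eqF// exprn_gt0.
have [H [_ dH]] := primitive_ex cq.
have qE x : r1 <= x -> q x = m x ^- 2 by move=> hx; rewrite /q; congr (m _ ^- 2); apply/max_idPl.
have e1 : H r2 + h r2 = H r1 + h r1.
  apply/esym/(cst_der (f := fun x => H x + h x) (ltW r12)) => x hx.
    have x0 : 0 < x by lra.
    by have g := dh x0; have g' := der_cont g; have g2 := der_cont (dH x); cont.
  have x0 : 0 < x by lra.
  have g := dh x0; have g2 := dH x; der; rewrite qE ?subrr//; lra.
pose D := h r1 - h r2; have D0 : 0 < D by rewrite subr_gt0 (h_decr vM dh).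
have HD : H r2 - H r1 = D by rewrite /D; lra.
have := @dist_polar_le R m vM (fun x => x) (fun x => th + d * ((H x - H r1) / D)) (fun=> 1)
  (fun x => d * (q x / D)) (fun x => x + d ^+ 2 / (2 * D ^+ 2) * H x)
  (fun x => 1 + d ^+ 2 / (2 * D ^+ 2) * q x) r1 r2 (ltW r12).
have -> : r2 + d ^+ 2 / (2 * D ^+ 2) * H r2 - (r1 + d ^+ 2 / (2 * D ^+ 2) * H r1) =
   r2 - r1 + d ^+ 2 / (2 * D ^+ 2) * (H r2 - H r1) by ring.
rewrite subrr mul0r mulr0 addr0 HD divff ?gt_eqF// mulr1.
have -> : d ^+ 2 / (2 * D ^+ 2) * D = d ^+ 2 / (2 * D) by field; rewrite gt_eqF.
have c0 : 0 <= d ^+ 2 / (2 * D ^+ 2) by rewrite divr_ge0 ?sqr_ge0// mulr_ge0// sqr_ge0.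
have q0 x : 0 < q x by rewrite /q invr_gt0 exprn_gt0.
apply=> //.
- by move=> t; der; ring.
- by move=> t; exact: cont_cst.
- by move=> t; cont.
- by move=> t ht; lra.
- by move=> t _; cont.
- by move=> t _; rewrite addr_ge0// mulr_ge0// ltW.
move=> t ht; rewrite expr1n qE; last by lra.
have mt : 0 < m t by apply: (m_gt0 vM); lra.
have -> : m t ^+ 2 * (d * (m t ^- 2 / D)) ^+ 2 = d ^+ 2 / D ^+ 2 * m t ^- 2 by field; rewrite !gt_eqF.
have -> : (1 + d ^+ 2 / (2 * D ^+ 2) * m t ^- 2) ^+ 2 = 1 + d ^+ 2 / D ^+ 2 * m t ^- 2 + (d ^+ 2 / (2 * D ^+ 2) * m t ^- 2) ^+ 2.
  by field; rewrite !gt_eqF.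
by rewrite lerDl sqr_ge0.
Qed.

End Arcs.

(** * The swept angle and its dependence on the Clairaut constant *)

Section Tau.
Variables (R : realType) (m : R -> R).
Hypothesis vM : von_Mangoldt m.
Implicit Types (s t a b x y r rho e : R).
Local Notation psi := (psi m).
Local Notation J := (JJ m).

(* The angle swept between the vertex and the radius [r]. *)
Definition Tau rho r := GG m rho (Num.sqrt (r - rho)).

(* The value [rho = 0] stands for the lines through the origin. *)
Definition Reg0 rho := rho = 0 \/ Reg m rho.

Lemma Reg0_ge0 rho : Reg0 rho -> 0 <= rho.
Proof. by case=> [->//|/Reg_gt0/ltW]. Qed.

Lemma Reg0_le rho x : Reg m rho -> 0 <= x -> x <= rho -> Reg0 x.
Proof.
move=> hr; rewrite le_eqVlt => /predU1P[<- _|x0 xr]; first by left.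
by right; exact: Reg_lt vM _ _ hr x0 xr.
Qed.

Lemma Tau0 r : Tau 0 r = 0.
Proof.
have e : (fun s => 2 * m 0 / (m (0 + s ^+ 2) * wE m 0 s)) = fun=> 0.
  by apply/funext => s; rewrite (m_at0 vM) mulr0 mul0r.
have dF (x : R) : is_derive x (1 : R) (prim (fun=> 0 : R)) 0.
  by apply: (@dprim R (fun=> 0)); exact: cst_continuous.
rewrite /Tau /GG e; have := cst_der (sqrtr_ge0 (r - 0)) (fun t _ => der_cont (dF t)) (fun t _ => dF t).
by rewrite prim0 => <-.
Qed.

Lemma Reg0_m_ge0 rho : Reg0 rho -> 0 <= m rho.
Proof. by move/Reg0_ge0/(m_ge0 vM). Qed.

Lemma Reg0_lt rho x : Reg0 rho -> rho < x -> m rho < m x.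
Proof.
case=> [->|[_ _ h]]; last exact: h.
by rewrite (m_at0 vM) => /(m_gt0 vM).
Qed.

Lemma psi_eq rho x : Reg0 rho -> 0 < x -> rho <= x ->
  (m rho / m x) ^+ 2 + psi rho x ^+ 2 = 1.
Proof. by move=> hr; apply: (psi_sqr vM) => //; exact: Reg0_ge0. Qed.

Lemma psi_gt0 rho x : Reg0 rho -> rho < x -> 0 < psi rho x.
Proof.
move=> hr rx; have r0 := Reg0_ge0 hr; have x0 : 0 < x := le_lt_trans r0 rx.
have e := psi_eq hr x0 (ltW rx).
rewrite lt_def psi_ge0 andbT; apply: contra_eq_neq e => ->.
rewrite expr0n /= addr0 lt_eqF// expr_lt1 ?divr_ge0 ?(Reg0_m_ge0 hr) ?(ltW (m_gt0 vM x0))//.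
by rewrite ltr_pdivrMr ?(m_gt0 vM)// mul1r Reg0_lt.
Qed.

Lemma Tau_rho rho : Tau rho rho = 0.
Proof. by rewrite /Tau subrr sqrtr0 /GG prim0. Qed.

Lemma Tau_cont rho : Reg0 rho -> continuous (Tau rho).
Proof.
case=> [->|hr] x.
  have -> : Tau 0 = fun=> 0 by apply/funext => y; exact: Tau0.
  exact: cst_continuous.
have dG0 := dG vM hr.
apply: (@cont_comp R (GG m rho) (fun r => Num.sqrt (r - rho))); first exact: der_cont (dG0 _).
by cont.
Qed.

Lemma Tau_der rho x : Reg0 rho -> rho < x ->
  is_derive x 1 (Tau rho) (m rho / (m x ^+ 2 * psi rho x)).
Proof.
case=> [->|hr] rx.
  have -> : Tau 0 = fun=> 0 by apply/funext => y; exact: Tau0.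
  by rewrite (m_at0 vM) mul0r; exact: der_cst.
have xr : 0 < x - rho by rewrite subr_gt0.
have h1 : is_derive x 1 (fun r => r - rho) 1 by der; rewrite addr0.
have h2 := der_sqrt (f := fun r => r - rho) xr h1.
have h3 := der_comp (f := GG m rho) (g := fun r => Num.sqrt (r - rho)) (dG vM hr _) h2.
apply: der_eq h3 _.
set s := Num.sqrt (x - rho); have s0 : 0 < s by rewrite sqrtr_gt0.
have rs : rho + s ^+ 2 = x by rewrite sqr_sqrtr ?ltW//; ring.
have := psi_rr vM hr (ltW s0); rewrite rs => ->.
have mx : 0 < m x by rewrite -rs; exact: mrr_gt0.
by field; rewrite !gt_eqF ?(wE_gt0 vM hr).
Qed.

Lemma Tau_ndecr rho x y : Reg0 rho -> rho <= x -> x <= y -> Tau rho x <= Tau rho y.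
Proof.
move=> hr rx xy; apply: (ndecr_der (f := Tau rho) (df := fun t => m rho / (m t ^+ 2 * psi rho t)) xy) => t ht.
- exact: (Tau_cont hr).
- by apply: Tau_der => //; lra.
- by rewrite divr_ge0 ?Reg0_m_ge0// mulr_ge0 ?sqr_ge0 ?psi_ge0.
Qed.

Lemma Tau_ge0 rho x : Reg0 rho -> rho <= x -> 0 <= Tau rho x.
Proof. by move=> hr hx; rewrite -(Tau_rho rho) Tau_ndecr. Qed.

Section Two.
Variables r1 r2 : R.
Hypotheses (h1 : Reg0 r1) (h2 : Reg m r2) (r12 : r1 < r2).

Lemma c12 : m r1 < m r2. Proof. exact: Reg0_lt. Qed.

(** [(m r1 / m x, psi r1 x)] and [(m r2 / m x, psi r2 x)] are unit vectors, and both bounds say that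
    their scalar product is at most 1. Integrated, they become [tau_lo] and [tau_hi],
    finite-difference versions of the rule that [JJ] has derivative [- Tau] in the Clairaut
    constant. *)
Lemma psi_two x : r2 < x ->
  (m r2 - m r1) * (m r1 / (m x ^+ 2 * psi r1 x)) <= psi r1 x - psi r2 x <=
  (m r2 - m r1) * (m r2 / (m x ^+ 2 * psi r2 x)).
Proof.
have r12' := r12.
move=> x2; have x1 : r1 < x by lra.
have x0 : 0 < x by apply: le_lt_trans x1; exact: Reg0_ge0.
have mx := m_gt0 vM x0; have p1 := psi_gt0 h1 x1.
have p2 := psi_gt0 (or_intror h2) x2.
have e1 := psi_eq h1 x0 (ltW x1); have e2 := psi_eq (or_intror h2) x0 (ltW x2).
have e2' : 1 ^+ 2 = psi r2 x ^+ 2 + (m r2 / m x) ^+ 2 by rewrite expr1n addrC.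
have e1' : (m r1 / m x) ^+ 2 + psi r1 x ^+ 2 <= 1 by rewrite e1.
have cs := cauchy_schwarz ler01 e1' e2'.
apply/andP; split.
  have -> : (m r2 - m r1) * (m r1 / (m x ^+ 2 * psi r1 x)) =
     ((m r1 / m x) * (m r2 / m x) - (m r1 / m x) ^+ 2) / psi r1 x by field; rewrite !gt_eqF.
  rewrite ler_pdivrMr//; move: e1 cs; move: (m r1 / m x) (m r2 / m x) => q1 q2; nra.
have -> : (m r2 - m r1) * (m r2 / (m x ^+ 2 * psi r2 x)) =
     ((m r2 / m x) ^+ 2 - (m r1 / m x) * (m r2 / m x)) / psi r2 x by field; rewrite !gt_eqF.
rewrite ler_pdivlMr//; move: e2 cs; move: (m r1 / m x) (m r2 / m x) => q1 q2; nra.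
Qed.

Let dJ r x : Reg0 r -> is_derive x 1 (J r) (psi r x).
Proof. by move/Reg0_ge0 => r0; exact: dJJ. Qed.

Lemma tau_lo x y : r2 <= x -> x <= y ->
  (m r2 - m r1) * (Tau r1 y - Tau r1 x) <= (J r1 y - J r1 x) - (J r2 y - J r2 x).
Proof.
have r12' := r12.
move=> rx xy; pose D t := J r1 t - J r2 t - (m r2 - m r1) * Tau r1 t.
have : D x <= D y.
  apply: (ndecr_der (f := D) (df := fun t => psi r1 t - psi r2 t - (m r2 - m r1) * (m r1 / (m t ^+ 2 * psi r1 t))) xy) => t ht.
  - have g1 := der_cont (dJ t h1); have g2 := der_cont (dJ t (or_intror h2)).
    by have g3 := @Tau_cont r1 h1; rewrite /D; cont.
  - have g1 := dJ t h1; have g2 := dJ t (or_intror h2).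
    have t1 : r1 < t by lra.
    by have g3 := Tau_der h1 t1; rewrite /D; der; ring.
  - have t2 : r2 < t by lra.
    by have /andP[g _] := psi_two t2; rewrite subr_ge0.
by rewrite /D; hlra.
Qed.

Lemma tau_hi x y : r2 <= x -> x <= y ->
  (J r1 y - J r1 x) - (J r2 y - J r2 x) <= (m r2 - m r1) * (Tau r2 y - Tau r2 x).
Proof.
have r12' := r12.
move=> rx xy; pose D t := (m r2 - m r1) * Tau r2 t - (J r1 t - J r2 t).
have : D x <= D y.
  apply: (ndecr_der (f := D) (df := fun t => (m r2 - m r1) * (m r2 / (m t ^+ 2 * psi r2 t)) - (psi r1 t - psi r2 t)) xy) => t ht.
  - have g1 := der_cont (dJ t h1); have g2 := der_cont (dJ t (or_intror h2)).
    by have g3 := @Tau_cont r2 (or_intror h2); rewrite /D; cont.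
  - have g1 := dJ t h1; have g2 := dJ t (or_intror h2).
    have t1 : r2 < t by lra.
    by have g3 := Tau_der (or_intror h2) t1; rewrite /D; der; ring.
  - have t2 : r2 < t by lra.
    by have /andP[_ g] := psi_two t2; rewrite subr_ge0.
by rewrite /D; hlra.
Qed.

Lemma J_at_rho r : Reg0 r -> J r r = 0.
Proof. by case=> [->|hr]; [rewrite /JJ prim0|apply: (JJ_below vM) => //; have := Reg_gt0 hr; lra]. Qed.

Lemma J_between : 0 <= J r1 r2 <= (r2 - r1) * psi r1 r2.
Proof.
have r12' := r12.
have [z /andP[z1 z2]] := mvt r12 (fun t _ => der_cont (dJ t h1)) (fun t _ => dJ t h1).
rewrite (J_at_rho h1) subr0 => ->; have r0 := Reg0_ge0 h1.
have d0 : 0 <= r2 - r1 by lra.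
rewrite mulr_ge0 ?psi_ge0//= mulrC ler_wpM2l//.
have z0 : 0 < z by lra. have r20 : 0 < r2 by lra.
have e1 := psi_eq h1 z0 (ltW z1); have e2 := psi_eq h1 r20 (ltW r12).
rewrite -(ler_pXn2r (n := 2)) ?nnegrE ?psi_ge0//.
suff : (m r1 / m r2) ^+ 2 <= (m r1 / m z) ^+ 2 by lra.
have mz := m_gt0 vM z0; have mr := m_gt0 vM r20.
rewrite lerXn2r ?nnegrE ?divr_ge0 ?(Reg0_m_ge0 h1) ?(ltW mz) ?(ltW mr)//.
rewrite ler_wpM2l ?(Reg0_m_ge0 h1)// lef_pV2// ltW// (Reg_incr vM h2)// ltW//.
Qed.

Lemma J_antitone y : r2 <= y -> J r2 y <= J r1 y.
Proof.
have r12' := r12.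
move=> ry; have := tau_lo (lexx r2) ry; have /andP[+ _] := J_between.
rewrite (J_at_rho (or_intror h2)) => g1.
have : 0 <= (m r2 - m r1) * (Tau r1 y - Tau r1 r2).
  by rewrite mulr_ge0 ?subr_ge0 ?(ltW c12)// Tau_ndecr// ltW.
hlra.
Qed.

(** Below [x0] only [psi <= 1] is used; beyond, two values of [psi] differ by at most the root of
    the difference of their squares. The bound is crude but holds down to [r1 = 0], and it gives
    continuity of [JJ] in [rho]. *)
Lemma J_bound x0 y : Reg m x0 -> r2 <= x0 -> x0 <= y ->
  J r1 y - J r2 y <= (x0 - r1) + y * (Num.sqrt (m r2 ^+ 2 - m r1 ^+ 2) / m x0).
Proof.
have r12' := r12.
move=> hx0 rx0 x0y; have r0 := Reg0_ge0 h1.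
have x00 : 0 < x0 by lra.
have mx0 := m_gt0 vM x00.
set K := Num.sqrt _ / _; have K0 : 0 <= K by rewrite divr_ge0 ?sqrtr_ge0// ltW.
have a1 : J r1 x0 - J r2 x0 <= x0 - r1.
  have b1 : J r1 x0 - x0 <= J r1 r1 - r1.
    have r1x : r1 <= x0 by lra.
    rewrite -lerN2; apply: (ndecr_der (f := fun x => - (J r1 x - x)) (df := fun x => - (psi r1 x - 1)) r1x) => t ht.
    - by have g := der_cont (dJ t h1); cont.
    - by have g := dJ t h1; der.
    - by have := psi_le1 m r1 t; lra.
  have b2 : 0 <= J r2 x0.
    by rewrite -(J_at_rho (or_intror h2)); apply: (JJ_ndecr vM) => //; lra.
  by move: b1; rewrite (J_at_rho h1); hlra.
have a2 : (J r1 y - J r2 y) - (J r1 x0 - J r2 x0) <= (y - x0) * K.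
  have : J r2 x0 - J r1 x0 + K * x0 <= J r2 y - J r1 y + K * y.
    apply: (ndecr_der (f := fun x => J r2 x - J r1 x + K * x) (df := fun x => psi r2 x - psi r1 x + K) x0y) => t ht.
    - have g1 := der_cont (dJ t h1); have g2 := der_cont (dJ t (or_intror h2)); by cont.
    - by have g1 := dJ t h1; have g2 := dJ t (or_intror h2); der; ring.
    have t0 : 0 < t by lra.
    have t1 : r1 <= t by lra.
    have t2 : r2 <= t by lra.
    have mt := m_gt0 vM t0.
    have e1 := psi_eq h1 t0 t1; have e2 := psi_eq (or_intror h2) t0 t2.
    have mm : m x0 <= m t by have [_ _ g] := hx0; apply/ltW/g; lra.
    have pp : psi r1 t <= psi r2 t + K.
      rewrite -(ler_pXn2r (n := 2)) ?nnegrE ?psi_ge0 ?addr_ge0 ?psi_ge0//.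
      have : psi r1 t ^+ 2 <= psi r2 t ^+ 2 + K ^+ 2.
        have -> : psi r1 t ^+ 2 = psi r2 t ^+ 2 + ((m r2 / m t) ^+ 2 - (m r1 / m t) ^+ 2) by lra.
        rewrite lerD2l /K [leRHS]expr_div_n sqr_sqrtr; last first.
          by rewrite subr_ge0 lerXn2r ?nnegrE ?(Reg0_m_ge0 h1) ?(Reg0_m_ge0 (or_intror h2))// ltW// c12.
        rewrite !expr_div_n -mulrBl ler_wpM2l//.
          by rewrite subr_ge0 lerXn2r ?nnegrE ?(Reg0_m_ge0 h1) ?(Reg0_m_ge0 (or_intror h2))// ltW// c12.
        by rewrite lef_pV2 ?posrE ?exprn_gt0// lerXn2r// nnegrE ltW.
      by have := psi_ge0 m r2 t; nra.
    lra.
  by hnra.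
have : 0 <= x0 * K by rewrite mulr_ge0// ltW.
by move: a1 a2; rewrite mulrBl; move: (J _ y) (J _ y) (J _ x0) (J _ x0) => *; lra.
Qed.

End Two.

(** The integrand of [Tau] is singular at the vertex but Lipschitz in the Clairaut constant on
    [[x0, y]], where [m] and [psi r3] have positive minima [mu] and [P]. In [K0], [1 / P] accounts
    for the numerator and [1 / P ^+ 3] for the variation of [psi]. *)
Lemma Tau_lip r3 x0 y : Reg m r3 -> r3 < x0 -> x0 <= y -> exists2 K : R, 0 <= K &
  forall r1 r2, Reg0 r1 -> r1 < r2 -> r2 <= r3 ->
    (Tau r2 y - Tau r2 x0) - (Tau r1 y - Tau r1 x0) <= (m r2 - m r1) * K.
Proof.
move=> h3 r3x x0y; have r30 := Reg_gt0 h3.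
have mc : continuous m := m_cont vM.
have pc : continuous (psi r3) := psi_cont vM (ltW r30).
have [x1 hx1 hm1] := evt_min x0y (fun x _ => mc x).
have [x2 hx2 hm2] := evt_min x0y (fun x _ => pc x).
have mu0 : 0 < m x1 by apply: (m_gt0 vM); lra.
have P0 : 0 < psi r3 x2 by apply: psi_gt0; [right|lra].
move: hm1 hm2 mu0 P0; move: (m x1) (psi r3 x2) => mu P hm1 hm2 mu0 P0.
pose K0 := (1 / P + 1 / P ^+ 3) / mu ^+ 2.
have K00 : 0 <= K0 by rewrite divr_ge0 ?sqr_ge0// addr_ge0// divr_ge0// ?exprn_ge0// ltW.
exists (K0 * (y - x0)) => [|r1 r2 h1 r12 r23]; first by rewrite mulr_ge0// subr_ge0.
have r20 : 0 < r2 by apply: le_lt_trans r12; exact: Reg0_ge0.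
have h2 := Reg_lt vM h3 r20 r23.
have cc := c12 h1 r12.
pose D t := (m r2 - m r1) * K0 * t - (Tau r2 t - Tau r1 t).
have : D x0 <= D y.
  apply: (ndecr_der (f := D) (df := fun t => (m r2 - m r1) * K0 - (m r2 / (m t ^+ 2 * psi r2 t) - m r1 / (m t ^+ 2 * psi r1 t))) x0y) => t ht.
  - have g1 := @Tau_cont r1 h1; have g2 := @Tau_cont r2 (or_intror h2).
    by rewrite /D; cont.
  - have t1 : r1 < t by lra. have t2 : r2 < t by lra.
    by have g1 := Tau_der h1 t1; have g2 := Tau_der (or_intror h2) t2; rewrite /D; der; ring.
  have t1 : r1 < t by lra. have t2 : r2 < t by lra. have t0 : 0 < t by lra.
  have t3 : r3 < t by lra.
  have /andP[_ g] := psi_two h1 h2 r12 t2.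
  have mt := m_gt0 vM t0; have p1 := psi_gt0 h1 t1; have p2 := psi_gt0 (or_intror h2) t2.
  have mum : mu <= m t by apply: hm1; lra.
  have Pp3 : P <= psi r3 t by apply: hm2; lra.
  have p23 : psi r3 t <= psi r2 t.
    rewrite -(ler_pXn2r (n := 2)) ?nnegrE ?psi_ge0//.
    have e1 := psi_eq (or_intror h2) t0 (ltW t2); have e2 := psi_eq (or_intror h3) t0 (ltW t3).
    suff : (m r2 / m t) ^+ 2 <= (m r3 / m t) ^+ 2 by lra.
    rewrite lerXn2r ?nnegrE ?divr_ge0 ?(ltW mt) ?(ltW (m_gt0 vM _))// ler_wpM2r ?invr_ge0 ?(ltW mt)//.
    by move: r23; rewrite le_eqVlt => /predU1P[->//|r23]; apply/ltW/(Reg_incr vM h3); lra.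
  have p21 : psi r2 t <= psi r1 t.
    have /andP[g' _] := psi_two h1 h2 r12 t2; rewrite -subr_ge0; apply: le_trans g'.
    by rewrite mulr_ge0 ?subr_ge0 ?(ltW cc)// divr_ge0 ?(Reg0_m_ge0 h1)// mulr_ge0 ?sqr_ge0 ?psi_ge0.
  have Pp2 : P <= psi r2 t by lra.
  have Pp1 : P <= psi r1 t by lra.
  have c1 := Reg0_m_ge0 h1.
  have c1m : m r1 <= m t by apply/ltW/(Reg0_lt h1).
  have c2m : m r2 <= m t by apply/ltW/(Reg0_lt (or_intror h2)).
  rewrite subr_ge0.
  have -> : m r2 / (m t ^+ 2 * psi r2 t) - m r1 / (m t ^+ 2 * psi r1 t) =
    ((m r2 - m r1) / psi r2 t + m r1 / (psi r1 t * psi r2 t) * (psi r1 t - psi r2 t)) / m t ^+ 2.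
    by field; rewrite !gt_eqF.
  rewrite /K0 mulrA; apply: ler_pM.
  - rewrite addr_ge0 ?divr_ge0 ?mulr_ge0 ?invr_ge0 ?mulr_ge0 ?subr_ge0 ?psi_ge0 ?(ltW cc)//.
  - by rewrite invr_ge0 sqr_ge0.
  - rewrite [leRHS]mulrDr; apply: lerD.
      by rewrite mul1r ler_wpM2l ?subr_ge0 ?(ltW cc)// lef_pV2.
    apply: (@le_trans _ _ (m r1 / (psi r1 t * psi r2 t) * ((m r2 - m r1) * (m r2 / (m t ^+ 2 * psi r2 t))))).
      by rewrite ler_wpM2l// divr_ge0// mulr_ge0 ?psi_ge0.
    have -> : m r1 / (psi r1 t * psi r2 t) * ((m r2 - m r1) * (m r2 / (m t ^+ 2 * psi r2 t))) =
      (m r2 - m r1) * ((m r1 / m t) * (m r2 / m t) / (psi r1 t * (psi r2 t * psi r2 t))).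
      by field; rewrite !gt_eqF.
    rewrite ler_wpM2l ?subr_ge0 ?(ltW cc)//; apply: ler_pM.
    + by rewrite !mulr_ge0 ?invr_ge0 ?(ltW mt)// (Reg0_m_ge0 (or_intror h2)).
    + by rewrite invr_ge0 !mulr_ge0 ?psi_ge0.
    + rewrite -[leRHS]mulr1; apply: ler_pM; rewrite ?divr_ge0 ?(ltW mt) ?(Reg0_m_ge0 (or_intror h2))//.
        by rewrite ler_pdivrMr// mul1r.
      by rewrite ler_pdivrMr// mul1r.
    + rewrite lef_pV2 ?posrE ?exprn_gt0 ?mulr_gt0// !exprS expr0 mulr1.
      by apply: ler_pM; rewrite ?mulr_ge0 ?(ltW P0)//; apply: ler_pM; rewrite ?(ltW P0).
  - by rewrite lef_pV2 ?posrE ?exprn_gt0// lerXn2r// nnegrE ltW.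
rewrite /D => g; rewrite mulrA mulrBr; move: g.
by move: ((m r2 - m r1) * K0 * y) ((m r2 - m r1) * K0 * x0) => *; hlra.
Qed.

(** Freezing the vertex radius to [[0, lo]] gives functions with two-sided continuity at both ends
    of this interval, as [evt_min] expects. *)
Definition clamp lo rho : R := Num.max 0 (Num.min rho lo).

Lemma clamp_in lo rho : 0 <= lo -> 0 <= clamp lo rho <= lo.
Proof.
by move=> l0; rewrite /clamp le_max lexx /= ge_max l0 ge_min lexx orbT.
Qed.

Lemma clampE lo rho : 0 <= rho -> rho <= lo -> clamp lo rho = rho.
Proof. by move=> r0 rl; rewrite /clamp min_l// max_r. Qed.

Lemma clamp_lip lo x y : `|clamp lo x - clamp lo y| <= `|x - y|.
Proof.
have n1 := ler_norm (x - y); have n2 := ler_norm (y - x); rewrite distrC in n2.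
move: n1 n2; move: (`|x - y|) => N n1 n2.
have [a1 a2] : clamp lo x - clamp lo y <= N /\ clamp lo y - clamp lo x <= N.
  rewrite /clamp; case: (leP x lo) => h1; case: (leP y lo) => h2;
    case: (leP 0 x) => h3; case: (leP 0 y) => h4; case: (leP 0 lo) => h5; split; lra.
by rewrite ler_norml; apply/andP; split; lra.
Qed.

Lemma JJ_cont_rho lo y : Reg m lo -> lo <= y -> continuous (fun rho => J (clamp lo rho) y).
Proof.
move=> hl ly z; have l0 := Reg_gt0 hl; have y0 : 0 < y by lra.
have mc : continuous m := m_cont vM.
suff key e : 0 < e -> exists2 d : R, 0 < d & forall c, 0 <= c -> c <= lo ->
    `|c - clamp lo z| < d -> `|J c y - J (clamp lo z) y| < e.
  apply: dist_cont => e /key[d d0 hd]; exists d => // x xd.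
  have /andP[c1 c2] := clamp_in x (ltW l0); apply: hd => //.
  exact: le_lt_trans (clamp_lip _ _ _) xd.
move=> e0; have /andP[z1 z2] := clamp_in z (ltW l0); move: z1 z2; move: (clamp lo z) => c0 z1 z2.
have [c00|c0n] := eqVneq c0 0.
  pose x0 := Num.min lo (e / 3).
  have x00 : 0 < x0 by rewrite lt_min l0 divr_gt0.
  have x0l : x0 <= lo by rewrite ge_min lexx.
  have x0e : x0 <= e / 3 by rewrite ge_min lexx orbT.
  have mx0 := m_gt0 vM x00.
  have e1 : 0 < e / 3 * m x0 / y by rewrite divr_gt0// mulr_gt0// divr_gt0.
  have [d d0 hd] := cont_dist (mc 0) e1.
  exists (Num.min d x0); first by rewrite lt_min d0.
  move=> c c1 c2; rewrite c00 subr0 lt_min => /andP[cd cx].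
  have [->|cn] := eqVneq c 0; first by rewrite subrr normr0.
  have cpos : 0 < c by rewrite lt_def cn.
  rewrite ger0_norm// in cx.
  have hx0 := Reg_lt vM hl x00 x0l.
  have hc := Reg_lt vM hl cpos c2.
  have cx0 : c <= x0 by exact: ltW.
  have x0y : x0 <= y by lra.
  have b := J_bound (or_introl (erefl 0)) hc cpos hx0 cx0 x0y.
  have b' := J_antitone (or_introl (erefl 0)) hc cpos (le_trans cx0 x0y).
  rewrite distrC ger0_norm ?subr_ge0//; apply: le_lt_trans b _.
  rewrite (m_at0 vM) expr0n /= !subr0 sqrtr_sqr ger0_norm ?(ltW (m_gt0 vM cpos))//.
  have := hd c; rewrite subr0 => /(_ cd); rewrite (m_at0 vM) subr0 ger0_norm ?(ltW (m_gt0 vM cpos))//.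
  rewrite ltr_pdivlMr// -ltr_pdivrMr// => b2.
  have -> : y * (m c / m x0) = m c * y / m x0 by ring.
  lra.
have c0p : 0 < c0 by rewrite lt_def c0n.
have h2 : 0 < c0 / 2 by rewrite divr_gt0.
have mh := m_gt0 vM h2.
pose f c := `|c - c0| + y * (Num.sqrt `|m c ^+ 2 - m c0 ^+ 2| / m (c0 / 2)).
have cf : continuous_at c0 f by rewrite /f; cont; rewrite gt_eqF.
have f0 : f c0 = 0 by rewrite /f !subrr normr0 sqrtr0 mul0r mulr0 addr0.
have [d d0 hd] := cont_dist cf e0.
exists (Num.min d (c0 / 2)); first by rewrite lt_min d0.
move=> c c1 c2; rewrite lt_min => /andP[/hd + cx]; rewrite f0 subr0.
move=> /(le_lt_trans (ler_norm _)); apply: le_lt_trans.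
move: cx; rewrite ltr_norml => /andP[cx _].
have ch : c0 / 2 < c by lra.
have cp : 0 < c by lra.
have bnd a b : 0 < a -> a < b -> b <= lo -> c0 / 2 < b ->
   `|J a y - J b y| <= (b - a) + y * (Num.sqrt (m b ^+ 2 - m a ^+ 2) / m (c0 / 2)).
  move=> a0 ab bl cb.
  have ha : Reg0 a by right; apply: (Reg_lt vM hl) => //; lra.
  have hb : Reg m b by apply: (Reg_lt vM hl) => //; lra.
  have b' := J_antitone ha hb ab (le_trans bl ly).
  rewrite ger0_norm ?subr_ge0//; apply: le_trans (J_bound ha hb ab hb (lexx b) (le_trans bl ly)) _.
  rewrite lerD2l ler_wpM2l ?(ltW y0)// ler_wpM2l ?sqrtr_ge0// lef_pV2 ?posrE//.
    by apply/ltW/(Reg_incr vM hl); lra.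
  by apply: (m_gt0 vM); lra.
rewrite /f; case: (ltgtP c c0) => [cc|cc|->].
- have b := bnd c c0 cp cc z2; apply: le_trans (b _) _; first lra.
  have mm : m c ^+ 2 <= m c0 ^+ 2.
    by rewrite lerXn2r ?nnegrE ?(ltW (m_gt0 vM _))//; apply/ltW/(Reg_incr vM hl).
  rewrite [`|c - c0|]distrC [`|_ ^+ 2 - _|]distrC ger0_norm ?subr_ge0 ?(ltW cc)//.
  by rewrite [`|_ ^+ 2 - _|]ger0_norm ?subr_ge0.
- have b := bnd c0 c c0p cc c2; rewrite distrC; apply: le_trans (b _) _; first lra.
  have mm : m c0 ^+ 2 <= m c ^+ 2.
    by rewrite lerXn2r ?nnegrE ?(ltW (m_gt0 vM _))//; apply/ltW/(Reg_incr vM hl).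
  rewrite ger0_norm ?subr_ge0 ?(ltW cc)//.
  by rewrite [`|_ ^+ 2 - _|]ger0_norm ?subr_ge0.
- by rewrite !subrr normr0 sqrtr0 mul0r mulr0 addr0.
Qed.

End Tau.

(** * Existence of minimizing arcs *)

Section Limits.
Variable R : realType.
Implicit Types (f : R -> R) (a b e l x y : R).

Lemma near_left f x l e : continuous_at x f -> l < x -> 0 < e ->
  exists2 y, l < y < x & `|f y - f x| < e.
Proof.
move=> cf lx e0; have [d d0 hd] := cont_dist cf e0.
pose z := Num.max ((l + x) / 2) (x - d / 2).
have z1 : (l + x) / 2 <= z by rewrite le_max lexx.
have z2 : x - d / 2 <= z by rewrite le_max lexx orbT.
have zx : z < x by rewrite gt_max; apply/andP; split; lra.
exists z; first lra.
by apply: hd; rewrite distrC ger0_norm; lra.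
Qed.

Lemma near_right f x l e : continuous_at x f -> x < l -> 0 < e ->
  exists2 y, x < y < l & `|f y - f x| < e.
Proof.
move=> cf lx e0; have [d d0 hd] := cont_dist cf e0.
pose z := Num.min ((l + x) / 2) (x + d / 2).
have z1 : z <= (l + x) / 2 by rewrite ge_min lexx.
have z2 : z <= x + d / 2 by rewrite ge_min lexx orbT.
have zx : x < z by rewrite lt_min; apply/andP; split; lra.
exists z; first lra.
by apply: hd; rewrite ger0_norm; lra.
Qed.

(** The hypothesis bounds the upper right Dini derivative by 0. After subtracting a slope [e1], a
    rise would leave a last nonpositive point, just after which the hypothesis forbids it. The last
    point is found as a first one after reflection, whence the signs. *)
Lemma dini_le f a b : a <= b -> (forall x, a <= x <= b -> continuous_at x f) ->
  (forall x e, a <= x -> x < b -> 0 < e -> exists2 d : R, 0 < d &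
     forall y, x < y -> y < x + d -> y <= b -> f y <= f x + e * (y - x)) ->
  f b <= f a.
Proof.
move=> ab cf hd; apply/ler_addgt0Pr => e e0; rewrite leNgt; apply/negP => hb.
pose e1 := e / (b - a + 1).
have ba : 0 < b - a + 1 by lra.
have e10 : 0 < e1 by rewrite divr_gt0.
pose g t := f t - f a - e1 * (t - a).
have gb : 0 < g b.
  rewrite /g; have : e1 * (b - a) <= e by rewrite /e1 mulrAC ler_pdivrMr// ler_wpM2l ?(ltW e0)//; lra.
  lra.
have ba' : - b <= - a by rewrite lerN2.
have cg x : - b <= x <= - a -> continuous_at x (fun u => g (- u)).
  move=> hx; have hx' : a <= - x <= b by lra.
  have c1 := cf _ hx'; apply: (@cont_comp R g (fun u => - u)); last by cont.
  by rewrite /g; cont.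
have g1 : 0 < g (- - b) by rewrite opprK.
have g2 : g (- - a) <= 0 by rewrite opprK /g !subrr mulr0 subr0.
have [T [/andP[T1 T2] T3 T4]] := @first_neg R (fun u => g (- u)) (- b) (- a) ba' cg g1 g2.
have [||d d0 dd] := hd (- T) e1 _ _ e10; [lra|lra|].
pose y := Num.min b (- T + d / 2).
have y1 : y <= b by rewrite ge_min lexx.
have y2 : y <= - T + d / 2 by rewrite ge_min lexx orbT.
have y3 : - T < y by rewrite lt_min; apply/andP; split; lra.
have := dd y y3; have := T4 (- y); rewrite opprK /g; move: T3; rewrite /g => T3 T5 T6.
have {}T5 : 0 < f y - f a - e1 * (y - a) by apply: T5; lra.
have {}T6 : f y <= f (- T) + e1 * (y - - T) by apply: T6; lra.
nra.
Qed.

End Limits.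

Section Exists.
Variables (R : realType) (m : R -> R).
Hypothesis vM : von_Mangoldt m.
Implicit Types (s t x y r rho e : R).
Local Notation J := (JJ m).
Local Notation Tau := (Tau m).
Local Notation Reg0 := (Reg0 m).
Local Notation Reg := (Reg m).

Lemma arc_sqrt rho r : Reg rho -> rho <= r ->
  [/\ rho + Num.sqrt (r - rho) ^+ 2 = r, rho + (- Num.sqrt (r - rho)) ^+ 2 = r,
      TT m rho (Num.sqrt (r - rho)) = m rho * Tau rho r + J rho r,
      GG m rho (- Num.sqrt (r - rho)) = - Tau rho r &
      TT m rho (- Num.sqrt (r - rho)) = - (m rho * Tau rho r + J rho r)].
Proof.
move=> hr rr; have e : rho + Num.sqrt (r - rho) ^+ 2 = r.
  by rewrite sqr_sqrtr ?subr_ge0//; ring.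
have eT : TT m rho (Num.sqrt (r - rho)) = m rho * Tau rho r + J rho r.
  by rewrite (T_GJ vM hr (sqrtr_ge0 _)) e.
by split; rewrite ?sqrrN ?(GN vM hr) ?(TN vM hr) ?eT.
Qed.

Section Ends.
Variables a b vt lo hi : R.
Hypotheses (hlo : Reg lo) (a_ge : lo <= a) (b_ge : lo <= b)
  (hl : (lo = a /\ hi = b) \/ (lo = b /\ hi = a)) (lohi : lo <= hi) (hvt : 0 <= vt <= pi).

Let lo_gt0 : 0 < lo. Proof. exact: Reg_gt0 hlo. Qed.

(* For a curve from radius [a] to radius [b] sweeping the angle [vt], calibration with Clairaut
   constant [m rho] bounds the length below by [Phi rho] if the smallest radius is [rho], and by
   [Psi rho] if it is at least [rho]. *)
Definition Phi rho := m rho * vt + J rho a + J rho b.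
Definition Psi rho := m rho * vt + (J rho hi - J rho lo).

Lemma Phi0 : Phi 0 = a + b.
Proof. by rewrite /Phi (m_at0 vM) mul0r add0r !(JJ0 vM). Qed.

Lemma Phi_diff r1 r2 : Reg0 r1 -> Reg r2 -> r1 < r2 -> r2 <= lo ->
  (m r2 - m r1) * (Tau r1 a + Tau r1 b - vt - 2 * Tau r1 r2) <= Phi r1 - Phi r2 <=
  (m r2 - m r1) * (Tau r2 a + Tau r2 b - vt) + 2 * ((r2 - r1) * psi m r1 r2).
Proof.
move=> h1 h2 r12 r2lo; have ra := le_trans r2lo a_ge; have rb := le_trans r2lo b_ge.
have l1 := tau_lo vM h1 h2 r12 (lexx r2) ra; have l2 := tau_lo vM h1 h2 r12 (lexx r2) rb.
have u1 := tau_hi vM h1 h2 r12 (lexx r2) ra; have u2 := tau_hi vM h1 h2 r12 (lexx r2) rb.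
have /andP[j0 j1] := J_between vM h1 h2 r12.
have e2 := J_at_rho vM (or_intror h2); have t2 := Tau_rho m r2.
rewrite e2 in l1 l2 u1 u2; rewrite t2 in u1 u2.
move: l1 l2 u1 u2 j0 j1; rewrite /Phi.
move: (J _ _) (J _ _) (J _ _) (J _ _) (J _ _) (Tau _ _) (Tau _ _) (Tau _ _) (Tau _ _) (Tau _ _) (_ * psi _ _ _) (m r1) (m r2).
by move=> *; apply/andP; split; nra.
Qed.

(** First-order condition at a minimum, seen from the left. The error [(r2 - r1) * psi m r1 r2] is
    negligible against [m r2 - m r1]: [psi m r1 r2] tends to 0, and [m1] has a positive minimum near
    [r2]. *)
Lemma Phi_left r2 : Reg r2 -> r2 <= lo -> (forall r1, 0 <= r1 -> r1 < r2 -> Phi r2 <= Phi r1) ->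
  vt <= Tau r2 a + Tau r2 b.
Proof.
move=> h2 r2lo hmin; rewrite leNgt; apply/negP => hlt.
pose e := vt - (Tau r2 a + Tau r2 b); have e0 : 0 < e by rewrite subr_gt0.
have r20 := Reg_gt0 h2; have m20 := c_gt0 vM h2.
have m1c : continuous (m1 m) := dm1_cont vM.
have r22 : r2 / 2 <= r2 by lra.
have [x1 hx1 hm1] := evt_min r22 (fun x _ => m1c x).
have mu0 : 0 < m1 m x1 by have [_ g _] := h2; apply: g; lra.
have mc : continuous m := m_cont vM.
have cf : continuous_at r2 (fun x => Num.sqrt (1 - (m x / m r2) ^+ 2)) by cont.
have e1 : 0 < m1 m x1 * e / 2 by rewrite divr_gt0// mulr_gt0.
have r2h : r2 / 2 < r2 by lra.
have [r1 /andP[r1l r12]] := near_left cf r2h e1.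
rewrite divff ?gt_eqF// expr1n subrr sqrtr0 subr0 => /(le_lt_trans (ler_norm _)) hps.
have r10 : 0 <= r1 by lra.
have h1 := Reg0_le vM h2 r10 (ltW r12).
have /andP[_ u] := Phi_diff h1 h2 r12 r2lo.
have := hmin r1 r10 r12.
have ps : psi m r1 r2 < m1 m x1 * e / 2.
  by rewrite /psi; have -> : Num.max r2 r1 = r2 by apply/max_idPl/ltW.
have cc : m1 m x1 * (r2 - r1) <= m r2 - m r1.
  have [z /andP[z1 z2] ->] := mvt r12 (fun t _ => der_cont (dm vM t)) (fun t _ => dm vM t).
  rewrite ler_wpM2r ?subr_ge0 ?(ltW r12)//; apply: hm1; lra.
have d0 : 0 < r2 - r1 by rewrite subr_gt0.
move=> hP; have : (m r2 - m r1) * e <= 2 * ((r2 - r1) * psi m r1 r2).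
  by move: u; rewrite /e; hnra.
apply/negP; rewrite -ltNge.
apply: (@lt_le_trans _ _ ((m1 m x1 * (r2 - r1)) * e)); last by rewrite ler_wpM2r ?(ltW e0).
have -> : m1 m x1 * (r2 - r1) * e = 2 * ((r2 - r1) * (m1 m x1 * e / 2)) by field.
by rewrite ltr_pM2l// ltr_pM2l.
Qed.

Lemma Phi_right r1 r3 : Reg0 r1 -> r1 < r3 -> r3 <= lo ->
  (forall r2, r1 < r2 -> r2 <= r3 -> Phi r1 <= Phi r2) -> Tau r1 a + Tau r1 b <= vt.
Proof.
move=> h1 r13 r3lo hmin; have r10 := Reg0_ge0 h1.
apply/ler_addgt0Pr => e e0; have e2 : 0 < e / 2 by rewrite divr_gt0.
have [r2 /andP[r12 r23]] := near_right (Tau_cont vM h1 (x := r1)) r13 e2.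
rewrite Tau_rho subr0 => /(le_lt_trans (ler_norm _)) ht.
have r20 : 0 < r2 by lra.
have r2lo : r2 <= lo by lra.
have h2 := Reg_lt vM hlo r20 r2lo.
have /andP[l _] := Phi_diff h1 h2 r12 r2lo.
have := hmin r2 r12 (ltW r23); have cc : 0 < m r2 - m r1 by rewrite subr_gt0 (c12 vM h1 r12).
move=> hP; have : (m r2 - m r1) * (Tau r1 a + Tau r1 b - vt - 2 * Tau r1 r2) <= 0.
  by apply: le_trans l _; rewrite subr_le0.
rewrite pmulr_rle0//; hlra.
Qed.

Lemma Psi_diff r1 r2 : Reg0 r1 -> Reg r2 -> r1 < r2 -> r2 <= lo ->
  (m r2 - m r1) * (Tau r1 hi - Tau r1 lo - vt) <= Psi r1 - Psi r2 <=
  (m r2 - m r1) * (Tau r2 hi - Tau r2 lo - vt).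
Proof.
move=> h1 h2 r12 r2lo.
have := tau_lo vM h1 h2 r12 r2lo lohi; have := tau_hi vM h1 h2 r12 r2lo lohi.
rewrite /Psi.
move: (J _ _) (J _ _) (J _ _) (J _ _) (Tau _ _) (Tau _ _) (Tau _ _) (Tau _ _) (m r1) (m r2).
by move=> *; apply/andP; split; nra.
Qed.

Lemma Psi_right r1 : Reg0 r1 -> r1 < lo ->
  (forall r2, r1 < r2 -> r2 <= lo -> Psi r2 <= Psi r1) -> vt <= Tau r1 hi - Tau r1 lo.
Proof.
move=> h1 r1lo hmax; have r10 := Reg0_ge0 h1.
pose r3 := (r1 + lo) / 2; have r30 : 0 < r3 by rewrite /r3; have := lo_gt0; lra.
have r3lo : r3 < lo by rewrite /r3; lra. have r13 : r1 < r3 by rewrite /r3; lra.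
have h3 := Reg_lt vM hlo r30 (ltW r3lo).
have [K K0 hK] := Tau_lip vM h3 r3lo lohi.
have mc : continuous m := m_cont vM.
apply/ler_addgt0Pr => e e0; have e1 : 0 < e / (K + 1) by rewrite divr_gt0//; lra.
have [r2 /andP[r12 r23] hm] := near_right (mc r1) r13 e1.
have r20 : 0 < r2 by lra. have r2lo : r2 <= lo by lra.
have h2 := Reg_lt vM hlo r20 r2lo.
have cc : 0 < m r2 - m r1 by rewrite subr_gt0 (c12 vM h1 r12).
have /andP[_ u] := Psi_diff h1 h2 r12 r2lo.
have := hmax r2 r12 r2lo; have := hK r1 r2 h1 r12 (ltW r23).
rewrite gtr0_norm// ltr_pdivlMr in hm; last by lra.
move=> g1 g2; have : 0 <= (m r2 - m r1) * (Tau r2 hi - Tau r2 lo - vt).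
  by apply: le_trans u; rewrite subr_ge0.
rewrite pmulr_rge0// => g3; have : (m r2 - m r1) * K <= (m r2 - m r1) * (K + 1).
  by rewrite ler_pM2l//; lra.
by move: g1 g3 hm; hlra.
Qed.

(** For [r2 = lo] the Lipschitz bound on [Tau] fails at the vertex itself, so the angle is only
    measured from a radius [x0 > r2]; [x0] tends to [lo] later. *)
Lemma Psi_left r2 x0 : Reg r2 -> r2 <= lo -> lo <= x0 -> r2 < x0 -> x0 <= hi ->
  (forall r1, 0 <= r1 -> r1 < r2 -> Psi r1 <= Psi r2) -> Tau r2 hi - Tau r2 x0 <= vt.
Proof.
move=> h2 r2lo lox r2x xhi hmax; have r20 := Reg_gt0 h2.
have [K K0 hK] := Tau_lip vM h2 r2x xhi.
have mc : continuous m := m_cont vM.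
apply/ler_addgt0Pr => e e0; have e1 : 0 < e / (K + 1) by rewrite divr_gt0//; lra.
have [r1 /andP[r10 r12] hm] := near_left (mc r2) r20 e1.
have h1 := Reg0_le vM h2 (ltW r10) (ltW r12).
have cc : 0 < m r2 - m r1 by rewrite subr_gt0 (c12 vM h1 r12).
have /andP[l _] := Psi_diff h1 h2 r12 r2lo.
have := hmax r1 (ltW r10) r12; have := hK r1 r2 h1 r12 (lexx r2).
rewrite distrC gtr0_norm// ltr_pdivlMr in hm; last by lra.
move=> g1 g2; have : (m r2 - m r1) * (Tau r1 hi - Tau r1 lo - vt) <= 0.
  by apply: le_trans l _; rewrite subr_le0.
rewrite pmulr_rle0// => g3; have : (m r2 - m r1) * K <= (m r2 - m r1) * (K + 1).
  by rewrite ler_pM2l//; lra.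
have r1lo : r1 <= lo by lra.
by have := Tau_ndecr vM h1 r1lo lox; move: g1 g3 hm; hlra.
Qed.

(** The least radius of the curve decides. If it is at least [r0], the calibration of [r0] applies
    throughout; if it is smaller and positive, its own calibration applies, split where the minimum
    is attained; if it is 0, the bound is [Phi 0 = a + b]. *)
Lemma curve_lb r0 sg al c : Reg0 r0 -> r0 <= lo -> sg ^+ 2 = 1 -> C1curve c ->
  c 0 = pol a al -> c 1 = pol b (al + sg * vt) ->
  Psi r0 <= clength m c \/ (exists r, [/\ 0 <= r, r <= r0 & Phi r <= clength m c]).
Proof.
move=> h0 r0lo hsg cc c0 c1; have l0 := lo_gt0.
have a0 : 0 < a := lt_le_trans l0 a_ge; have b0 : 0 < b := lt_le_trans l0 b_ge.
have [d1 d2 k1 k2] := C1curve_coord cc.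
have cr : continuous (fun t => rad (c t)) by move=> t; rewrite /rad /dotp; cont.
have [t0 t01 hmin] := evt_min (ler01 : 0 <= (1 : R)) (fun t _ => cr t).
have ra : rad (c 0) = a by rewrite c0 rad_pol_ge0// ltW.
have rb : rad (c 1) = b by rewrite c1 rad_pol_ge0// ltW.
have rlo : rad (c t0) <= lo.
  have h00 : 0 <= (0 : R) <= 1 by rewrite lexx ler01.
  have h11 : 0 <= (1 : R) <= 1 by rewrite lexx ler01.
  have := hmin 0 h00; have := hmin 1 h11; rewrite ra rb.
  by case: hl => -[-> _].
have hcos : cos (al + sg * vt - al) = cos vt.
  rewrite addrC addKr; move/eqP: hsg; rewrite sqrf_eq1 => /orP[] /eqP ->; by rewrite ?mul1r// mulN1r cosN.
have [rz|rz] := eqVneq (rad (c t0)) 0.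
  right; exists 0; split=> //; first exact: (Reg0_ge0 h0).
  rewrite Phi0; have := rad_curve vM cc t01; rewrite rz ra rb sub0r subr0 normrN.
  by rewrite !gtr0_norm.
have rp : 0 < rad (c t0) by rewrite lt_def rz rad_ge0.
have cn t : 0 <= t <= 1 -> 0 < rad (c t) by move/hmin; exact: lt_le_trans.
have [rr|rr] := leP r0 (rad (c t0)).
  left; have m0 := Reg0_m_ge0 vM h0.
  have := @polar_lb R m vM c (m r0) r0 t0 a b al (al + sg * vt) vt (J r0) (psi m r0) cc cn c0 c1 a0 b0 m0.
  move=> /(_ _ _ _ t01 hvt hcos) h.
  apply: le_trans (h _ _ _).
  - rewrite /Psi -addrA lerD2l.
    have := ler_norm (J r0 a - J r0 (rad (c t0))); have := ler_norm (J r0 b - J r0 (rad (c t0))).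
    have := ler_norm (J r0 (rad (c t0)) - J r0 a); have := ler_norm (J r0 (rad (c t0)) - J r0 b).
    rewrite [`|J r0 (rad _) - J r0 a|]distrC [`|J r0 (rad _) - J r0 b|]distrC.
    by case: hl => -[-> ->]; hlra.
  - by move=> t ht; apply: le_trans rr (hmin t ht).
  - by move=> x; apply: (dJJ vM); exact: (Reg0_ge0 h0).
  - by move=> x x0 rx; rewrite (psi_eq vM).
right; exists (rad (c t0)); split; [exact: ltW|exact: ltW|].
have hr := Reg_lt vM hlo rp rlo.
have m0 := ltW (c_gt0 vM hr).
have := @polar_lb R m vM c _ (rad (c t0)) t0 a b al (al + sg * vt) vt (J (rad (c t0))) (psi m (rad (c t0))) cc cn c0 c1 a0 b0 m0.
move=> /(_ _ _ _ t01 hvt hcos) h.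
apply: le_trans (h _ _ _).
- rewrite (J_at_rho vM (or_intror hr)) !subr0 /Phi; apply: lerD; last exact: ler_norm.
  by rewrite lerD2l ler_norm.
- by move=> t ht; apply: hmin.
- by move=> x; apply: (dJJ vM); exact: ltW.
- by move=> x x0 rx; rewrite (psi_eq vM)//; right.
Qed.

Let clampC (y : R) : lo <= y -> continuous (fun r => J (clamp lo r) y) := JJ_cont_rho vM hlo.

Lemma Phi_evt r0 : 0 <= r0 -> r0 <= lo -> exists2 r, 0 <= r <= r0 & forall x, 0 <= x <= r0 -> Phi r <= Phi x.
Proof.
move=> r00 r0lo; pose F r := m r * vt + J (clamp lo r) a + J (clamp lo r) b.
have mc : continuous m := m_cont vM.
have c1 := clampC a_ge; have c2 := clampC b_ge.
have cF : continuous F by rewrite /F; cont.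
have FE x : 0 <= x <= r0 -> F x = Phi x by move=> hx; rewrite /F /Phi clampE//; lra.
have [r hr hmin] := evt_min r00 (fun x _ => cF x).
by exists r => // x hx; rewrite -!FE// hmin.
Qed.

Lemma Psi_evt : exists2 r, 0 <= r <= lo & forall x, 0 <= x <= lo -> Psi x <= Psi r.
Proof.
pose F r := - (m r * vt + (J (clamp lo r) hi - J (clamp lo r) lo)).
have mc : continuous m := m_cont vM.
have c1 := clampC lohi; have c2 := clampC (lexx lo).
have cF : continuous F by rewrite /F; cont.
have FE x : 0 <= x <= lo -> F x = - Psi x by move=> hx; rewrite /F /Psi clampE//; lra.
have [r hr hmin] := evt_min (ltW lo_gt0) (fun x _ => cF x).
by exists r => // x hx; rewrite -lerN2 -!FE// hmin.
Qed.

Lemma turned_arc rho : Reg rho -> rho <= lo -> Tau rho a + Tau rho b = vt ->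
  exists sa s, [/\ sa <= s, rho + sa ^+ 2 = a, rho + s ^+ 2 = b, GG m rho s - GG m rho sa = vt &
    TT m rho s - TT m rho sa = Phi rho].
Proof.
move=> hr rlo et; have ra := le_trans rlo a_ge; have rb := le_trans rlo b_ge.
have [a1 a2 a3 a4 a5] := arc_sqrt hr ra; have [b1 b2 b3 b4 b5] := arc_sqrt hr rb.
exists (- Num.sqrt (a - rho)), (Num.sqrt (b - rho)); split=> //.
- by apply: (@le_trans _ _ 0); rewrite ?sqrtr_ge0// oppr_le0 sqrtr_ge0.
- by rewrite a4 -/(Tau rho b) opprK addrC.
- by rewrite b3 a5 opprK /Phi -et; ring.
Qed.

Lemma direct_arc rho : Reg rho -> rho <= lo -> Tau rho hi - Tau rho lo = vt ->
  exists sa s, [/\ sa <= s, rho + sa ^+ 2 = a, rho + s ^+ 2 = b, GG m rho s - GG m rho sa = vt &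
    TT m rho s - TT m rho sa = Psi rho].
Proof.
move=> hr rlo et; have rhi := le_trans rlo lohi.
have [a1 a2 a3 a4 a5] := arc_sqrt hr rlo; have [b1 b2 b3 b4 b5] := arc_sqrt hr rhi.
have ss : Num.sqrt (lo - rho) <= Num.sqrt (hi - rho) by rewrite ler_wsqrtr// lerD2r.
case: hl => -[e1 e2].
  exists (Num.sqrt (lo - rho)), (Num.sqrt (hi - rho)); rewrite -e1 -e2; split=> //.
  by rewrite a3 b3 /Psi -et; ring.
exists (- Num.sqrt (hi - rho)), (- Num.sqrt (lo - rho)); rewrite -e1 -e2; split=> //.
- by rewrite lerN2.
- by rewrite a4 b4; lra.
- by rewrite a5 b5 /Psi -et; ring.
Qed.

(** [r0] maximises [Psi] and [r1] minimises [Phi] on [[0, r0]], so [curve_lb] bounds the distance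
    below by the smaller of [Phi r1] and [Psi r0]. The first-order conditions at that extremum say
    that its arc, turned or direct, sweeps exactly [vt], and the arc has the length of the bound. An
    extremum at radius 0 gives the first two cases. *)
Lemma arc_exists sg al : sg ^+ 2 = 1 ->
  [\/ vt = 0, dist m (pol a al) (pol b (al + sg * vt)) = a + b |
   exists rho sa s, [/\ Reg rho, rho <= lo & sa <= s] /\
    [/\ rho + sa ^+ 2 = a, rho + s ^+ 2 = b, GG m rho s - GG m rho sa = vt &
    dist m (pol a al) (pol b (al + sg * vt)) = TT m rho s - TT m rho sa]].
Proof.
move=> hsg; set d := dist _ _ _; have l0 := lo_gt0.
have a0 : 0 < a := lt_le_trans l0 a_ge; have b0 : 0 < b := lt_le_trans l0 b_ge.
have real rho (L : R) : Reg rho -> rho <= lo -> L <= d -> (exists sa s, [/\ sa <= s, rho + sa ^+ 2 = a, rho + s ^+ 2 = b,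
    GG m rho s - GG m rho sa = vt & TT m rho s - TT m rho sa = L]) ->
   exists rho sa s, [/\ Reg rho, rho <= lo & sa <= s] /\
    [/\ rho + sa ^+ 2 = a, rho + s ^+ 2 = b, GG m rho s - GG m rho sa = vt & d = TT m rho s - TT m rho sa].
  move=> hr rlo Ld [sa [s [h1 h2 h3 h4 h5]]]; exists rho, sa, s; split=> //; split=> //.
  apply/eqP; rewrite eq_le h5 Ld andbT -h5.
  by have := arc_dist vM al hr h1 hsg; rewrite h2 h3 h4.
have [r0 /andP[r00 r0lo] hPsi] := Psi_evt.
have [r1 /andP[r10 r1r0] hPhi] := Phi_evt r00 r0lo.
have h0 := Reg0_le vM hlo r00 r0lo.
have r1lo := le_trans r1r0 r0lo.
have h1 := Reg0_le vM hlo r10 r1lo.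
have lb : Num.min (Phi r1) (Psi r0) <= d.
  apply: (dist_ge vM) => c cc c0 c1; rewrite ge_min.
  have [->|[r [hr1 hr2 hr3]]] := curve_lb h0 r0lo hsg cc c0 c1; first by rewrite orbT.
  by rewrite (le_trans _ hr3)// hPhi// hr1.
have [hle|hlt] := leP (Phi r1) (Psi r0).
  rewrite min_l// in lb.
  have [e1|r1n] := eqVneq r1 0.
    rewrite e1 Phi0 in lb; apply: Or32; apply/eqP; rewrite eq_le lb andbT.
    by apply: le_trans (dist_through vM _ _) _; rewrite !rad_pol_ge0; [exact: lexx|exact: ltW|exact: ltW].
  have r1p : 0 < r1 by rewrite lt_def r1n.
  have hr1 := Reg_lt vM hlo r1p r1lo.
  have left1 : vt <= Tau r1 a + Tau r1 b.
    by apply: Phi_left => // r hr hr'; apply: hPhi; lra.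
  apply: Or33; have [r1r|r0r1] := ltP r1 r0.
    apply: (real r1 (Phi r1)) => //; apply: turned_arc => //; apply/eqP; rewrite eq_le left1 andbT.
    by apply: (@Phi_right r1 r0) => // r2 g1 g2; apply: hPhi; lra.
  (* As [Phi - Psi = 2 * JJ r0 lo] at [r0], the inequality [Phi r0 <= Psi r0] leaves only
     [r0 = lo]. *)
  have e01 : r1 = r0 by apply/eqP; rewrite eq_le r1r0.
  subst r1.
  have [r0l|lor0] := ltP r0 lo.
    exfalso; have : J r0 r0 < J r0 lo.
      apply: (incr_der r0l (fun t _ => der_cont (dJJ vM t (ltW r1p))) (fun t _ => dJJ vM t (ltW r1p))) => t ht.
      by apply: (psi_gt0 vM h0); lra.
    rewrite (J_at_rho vM h0) => jl; move: hle; rewrite /Phi /Psi.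
    by case: hl => -[<- <-]; hlra.
  have e0l : r0 = lo by apply/eqP; rewrite eq_le r0lo.
  apply: (real r0 (Phi r0)) => //; apply: turned_arc => //; apply/eqP; rewrite eq_le left1 andbT.
  (* The vertex is now the end of radius [lo], and turned and direct arcs coincide; the missing
     inequality comes from [Psi_left] with [x0] close to [lo]. *)
  have eT : Tau r0 a + Tau r0 b = Tau r0 hi.
    by case: hl => -[<- <-]; rewrite e0l Tau_rho ?addr0 ?add0r.
  rewrite eT; apply/ler_addgt0Pr => e egt.
  have [hieq|] := eqVneq hi lo.
    rewrite hieq -e0l Tau_rho; have /andP[g _] := hvt; lra.
  move=> hin; have lohi' : lo < hi by rewrite lt_neqAle eq_sym hin.
  have [x0 /andP[x1 x2] hx] := near_right (Tau_cont vM (or_intror hlo) (x := lo)) lohi' egt.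
  rewrite Tau_rho subr0 in hx.
  have := @Psi_left lo x0 hlo (lexx lo) (ltW x1) x1 (ltW x2).
  have hP r : 0 <= r -> r < lo -> Psi r <= Psi lo.
    by move=> g1 g2; have <- := f_equal Psi e0l; apply: hPsi; lra.
  move=> /(_ hP).
  have := ler_norm (Tau lo x0); move: hx; rewrite e0l; hlra.
rewrite min_r ?(ltW hlt)// in lb.
have r0l : r0 < lo.
  rewrite lt_neqAle r0lo andbT; apply/eqP => e0.
  have : Phi r1 <= Phi r0 by apply: hPhi; lra.
  apply/negP; rewrite -ltNge; apply: le_lt_trans hlt.
  rewrite /Phi /Psi; case: hl => -[<- <-]; rewrite e0 (J_at_rho vM (or_intror hlo)); hlra.
have right0 : vt <= Tau r0 hi - Tau r0 lo.
  by apply: Psi_right => // r2 g1 g2; apply: hPsi; lra.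
have [e0|r0n] := eqVneq r0 0.
  apply: Or31; move: right0; rewrite e0 !(Tau0 vM) subrr; have /andP[g _] := hvt; lra.
have r0p : 0 < r0 by rewrite lt_def r0n.
have hr0 := Reg_lt vM hlo r0p r0lo.
apply: Or33; apply: (real r0 (Psi r0)) => //; apply: direct_arc => //; apply/eqP; rewrite eq_le right0 andbT.
by apply: Psi_left => // r g1 g2; apply: hPsi; lra.
Qed.

(** The derivative [vt - Tau a - Tau b] of [Phi] is at most 0 all the way down to the origin, where
    [Phi 0 = a + b]. Since [Phi_diff] only gives one-sided estimates, [dini_le] replaces the mean
    value theorem. *)
Lemma Phi_le_sum rho : Reg rho -> rho <= lo ->
  (forall r, 0 < r -> r <= rho -> vt <= Tau r a + Tau r b) -> Phi rho <= a + b.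
Proof.
move=> hr rlo hT; have rho0 := Reg_gt0 hr.
have mc : continuous m := m_cont vM.
have m1c : continuous (m1 m) := dm1_cont vM.
have cN : continuous (fun x => - m1 m x) by cont.
have [x1 hx1 hmx] := evt_min (ltW rho0) (fun x _ => cN x).
pose M := Num.max (m1 m x1) 1.
have M0 : 0 < M by rewrite lt_max ltr01 orbT.
pose F r := m r * vt + J (clamp lo r) a + J (clamp lo r) b.
have c1 := clampC a_ge; have c2 := clampC b_ge.
have cF : continuous F by rewrite /F; cont.
have FE x : 0 <= x -> x <= rho -> F x = Phi x by move=> g1 g2; rewrite /F /Phi clampE//; lra.
have key r0 : 0 < r0 -> r0 <= rho -> F rho <= F r0.
  move=> r00 r0r; apply: (dini_le r0r (fun x _ => cF x)) => x e x0 xr e0.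
  have xp : 0 < x by lra.
  have hx := Reg_lt vM hr xp (ltW xr).
  have e1 : 0 < e / (2 * M) by rewrite divr_gt0// mulr_gt0.
  have [d d0 hd] := cont_dist (Tau_cont vM (or_intror hx) (x := x)) e1.
  exists d => // y xy yd yr.
  have := hd y; rewrite Tau_rho subr0 ger0_norm ?subr_ge0 ?(ltW xy)// => /(_ _)/(le_lt_trans (ler_norm _)) ht.
  have {}ht : Tau x y < e / (2 * M) by apply: ht; lra.
  have yp : 0 < y by lra.
  have hy := Reg_lt vM hr yp yr.
  have /andP[l _] := Phi_diff (or_intror hx) hy xy (le_trans yr rlo).
  have hTx := hT x xp (ltW xr).
  rewrite !FE; [|lra|lra|lra|lra].
  have cc : 0 < m y - m x by rewrite subr_gt0 (c12 vM (or_intror hx) xy).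
  have cM : m y - m x <= M * (y - x).
    have [z /andP[z1 z2] ->] := mvt xy (fun t _ => der_cont (dm vM t)) (fun t _ => dm vM t).
    rewrite ler_wpM2r ?subr_ge0 ?(ltW xy)// le_max; apply/orP; left.
    by rewrite -lerN2; apply: hmx; lra.
  have t0 : 0 <= Tau x y by apply: (Tau_ge0 vM (or_intror hx)); exact: ltW.
  have : (m y - m x) * (2 * Tau x y) <= e * (y - x).
    have -> : e * (y - x) = (M * (y - x)) * (2 * (e / (2 * M))) by field; rewrite gt_eqF.
    by apply: ler_pM => //; [exact: ltW|rewrite mulr_ge0|rewrite ler_pM2l// ltW].
  have : 0 <= (m y - m x) * (Tau x a + Tau x b - vt) by rewrite mulr_ge0 ?(ltW cc) ?subr_ge0.
  by move: l; hnra.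
rewrite -Phi0 -FE ?(ltW rho0)// -(FE 0) ?(ltW rho0)//.
apply/ler_addgt0Pr => e e0; have [r0 /andP[g1 g2]] := near_right (cF 0) rho0 e0.
rewrite ltr_norml => /andP[_ g3]; have := key r0 g1 (ltW g2); lra.
Qed.

End Ends.

End Exists.

(** * Rays and the critical set *)

Section InitVel.
Variable R : realType.
Notation pt := (R * R)%type.
Implicit Types (g : R -> pt) (w : pt) (e d x : R).

Lemma init_velP g w : init_vel g w <-> forall e : R, 0 < e -> exists2 d : R, 0 < d &
  forall x : R, 0 < x -> x < d -> `|((g x).1 - (g 0).1) / x - w.1| < e /\ `|((g x).2 - (g 0).2) / x - w.2| < e.
Proof.
split=> [/cvg_ballP hg e /hg|hg].
  move=> /nbhs_ballP[d /= d0 hd]; exists d => // x x0 xd.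
  have : ball (0 : R) d x by rewrite /ball /= sub0r normrN gtr0_norm.
  move/hd => /(_ x0) [] /=; rewrite /ball /= => h1 h2; split.
    by rewrite distrC [X in _ - X]mulrC; exact: h1.
  by rewrite distrC [X in _ - X]mulrC; exact: h2.
apply/cvg_ballP => e /hg[d d0 hd].
apply/nbhs_ballP; exists d => //= x; rewrite /ball /= sub0r normrN => xd x0.
rewrite gtr0_norm// in xd; have [h1 h2] := hd x x0 xd.
by split; rewrite /= /ball /= distrC [X in X - _]mulrC.
Qed.

End InitVel.

Section Rays.
Variables (R : realType) (m : R -> R).
Hypothesis vM : von_Mangoldt m.
Notation pt := (R * R)%type.
Implicit Types (s t x y r rho e th : R) (p q v w : pt) (g : R -> pt).
Local Notation J := (JJ m).
Local Notation Reg := (Reg m).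

(* A corner at the origin can be shortened, the metric being almost Euclidean there. *)
Lemma corner_origin vt sg al u0 : 0 <= vt -> vt < pi -> sg ^+ 2 = 1 -> 0 < u0 ->
  exists u : R, [/\ 0 < u, u <= u0 & dist m (pol u al) (pol u (al + sg * vt)) < 2 * u].
Proof.
move=> v0 vpi hsg u00.
have cv : -1 < cos vt.
  by rewrite -(@cospi R) ltr_cos// in_itv /= ?v0 ?pi_ge0 ?lexx ?(ltW vpi).
have hcos : cos (al + sg * vt) * cos al + sin (al + sg * vt) * sin al = cos vt.
  rewrite -cosB addrAC subrr add0r; move/eqP: hsg; rewrite sqrf_eq1 => /orP[] /eqP ->; by rewrite ?mul1r// mulN1r cosN.
have c1 := cos_le1 vt.
(* A margin for which the squared chord [2 * u ^+ 2 * (1 - cos vt)], enlarged by the factor [1 + e],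
   stays below [(2 * u) ^+ 2]. *)
pose e := (1 + cos vt) / 4; have e0 : 0 < e by rewrite divr_gt0//; lra.
have [d d0 hd] := cont_dist (gerr_cont vM (x := 0)) e0.
pose u := Num.min u0 (d / 2).
have u0' : 0 < u by rewrite lt_min u00 divr_gt0.
have ud : u <= d / 2 by rewrite ge_min lexx orbT.
exists u; split=> //; first by rewrite ge_min lexx.
pose p : pt := pol u al; pose q : pt := pol u (al + sg * vt).
pose x t := p.1 + t * (q.1 - p.1); pose y t := p.2 + t * (q.2 - p.2).
have dx t : is_derive t 1 x (q.1 - p.1) by rewrite /x; der; ring.
have dy t : is_derive t 1 y (q.2 - p.2) by rewrite /y; der; ring.
have [cc ec] := C1curve_pair dx dy (@cst_continuous _ _ _) (@cst_continuous _ _ _).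
pose c t : pt := (x t, y t).
have c0E : c 0 = p by rewrite /c /x /y !mul0r !addr0 -surjective_pairing.
have c1E : c 1 = q.
  have ee a b : a + (b - a) = b :> R by ring.
  by rewrite /c /x /y !mul1r !ee -surjective_pairing.
have {}cc : C1curve c := cc.
have {}ec t : derive1 c t = (q.1 - p.1, q.2 - p.2) := ec t.
have hle : dist m p q <= clength m c by rewrite -c0E -c1E; exact: (dist_le_clength vM cc).
apply: le_lt_trans hle _.
pose K2 := (1 + e) * (2 * u ^+ 2 * (1 - cos vt)).
have cs := cos2Dsin2 al; have cs' := cos2Dsin2 (al + sg * vt).
have K4 : K2 < (2 * u) ^+ 2.
  have -> : (2 * u) ^+ 2 = 4 * u ^+ 2 by ring.
  have -> : K2 = u ^+ 2 * (2 * (1 + e) * (1 - cos vt)) by rewrite /K2; ring.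
  rewrite mulrC ltr_pM2r ?exprn_gt0// /e; nra.
have K0 : 0 <= K2.
  rewrite /K2 !mulr_ge0 ?sqr_ge0//; lra.
apply: (@le_lt_trans _ _ (Num.sqrt K2)); last first.
  by rewrite -[ltRHS]ger0_norm ?mulr_ge0 ?(ltW u0')// -sqrtr_sqr ltr_sqrt// exprn_gt0// mulr_gt0.
have := @clength_le R m vM c (fun t => t * Num.sqrt K2) (fun=> Num.sqrt K2) cc.
rewrite mul1r mul0r subr0; apply.
- by move=> t _; cont.
- by move=> t _; der; ring.
move=> t ht; rewrite /speed ler_sqrt//.
rewrite (gmet_err m) ec.
have dv : dotp (q.1 - p.1, q.2 - p.2) (q.1 - p.1, q.2 - p.2) = 2 * u ^+ 2 * (1 - cos vt).
  rewrite /dotp /= -hcos.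
  transitivity (u ^+ 2 * ((cos (al + sg * vt) ^+ 2 + sin (al + sg * vt) ^+ 2) + (cos al ^+ 2 + sin al ^+ 2) - 2 * (cos (al + sg * vt) * cos al + sin (al + sg * vt) * sin al))).
    by ring.
  by rewrite cs cs'; ring.
have hr : rad (c t) <= u.
  rewrite -(ler_pXn2r (n := 2)) ?nnegrE ?rad_ge0 ?(ltW u0')// sqr_rad /=.
  have -> : x t ^+ 2 + y t ^+ 2 = u ^+ 2 * (cos al ^+ 2 + sin al ^+ 2) * (1 - t) ^+ 2 +
     u ^+ 2 * (cos (al + sg * vt) ^+ 2 + sin (al + sg * vt) ^+ 2) * t ^+ 2 +
     2 * t * (1 - t) * u ^+ 2 * (cos (al + sg * vt) * cos al + sin (al + sg * vt) * sin al).
    by rewrite /x /y /p /q /pol /=; ring.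
  rewrite cs cs' hcos !mulr1.
  have -> : u ^+ 2 * (1 - t) ^+ 2 + u ^+ 2 * t ^+ 2 + 2 * t * (1 - t) * u ^+ 2 * cos vt =
    u ^+ 2 * (1 - 2 * (t * (1 - t)) * (1 - cos vt)) by ring.
  rewrite ler_piMr ?sqr_ge0// gerBl !mulr_ge0//; lra.
have hg : gerr m (rad (c t)) <= e.
  have := hd (rad (c t)); rewrite {2}/gerr eqxx !subr0 ger0_norm ?rad_ge0// => h.
  by apply/ltW/(le_lt_trans (ler_norm _))/h; lra.
have cl := cross_le (c t) (q.1 - p.1, q.2 - p.2).
have eK : K2 = 2 * u ^+ 2 * (1 - cos vt) + e * (2 * u ^+ 2 * (1 - cos vt)) by rewrite /K2; ring.
rewrite dv in cl; rewrite dv eK lerD2l.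
apply: le_trans (_ : e * (crossp (c t) (q.1 - p.1, q.2 - p.2) / rad (c t)) ^+ 2 <= _).
  by rewrite ler_wpM2r ?sqr_ge0.
by rewrite ler_pM2l.
Qed.

Lemma through_not_min a b vt sg al : 0 < a -> 0 < b -> 0 <= vt -> vt < pi -> sg ^+ 2 = 1 ->
  dist m (pol a al) (pol b (al + sg * vt)) < a + b.
Proof.
move=> a0 b0 v0 vpi hsg.
have mn : 0 < Num.min a b by rewrite lt_min a0.
have [u [u0 um hu]] := corner_origin al v0 vpi hsg mn.
have ua : u <= a by apply: le_trans um _; rewrite ge_min lexx.
have ub : u <= b by apply: le_trans um _; rewrite ge_min lexx orbT.
have t1 := dist_triangle vM (pol a al) (pol u al) (pol b (al + sg * vt)).
have t2 := dist_triangle vM (pol u al) (pol u (al + sg * vt)) (pol b (al + sg * vt)).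
rewrite (dist_radial vM al (ltW a0) (ltW u0)) in t1.
rewrite (dist_radial vM (al + sg * vt) (ltW u0) (ltW b0)) in t2.
rewrite distrC ger0_norm ?subr_ge0// in t1; rewrite ger0_norm ?subr_ge0// in t2.
by hlra.
Qed.

Variable h : R -> R.
Hypothesis dh : forall x : R, 0 < x -> is_derive x 1 h (- (m x ^- 2)).

(** By [arc_exists] the distance is realised by some arc or by the path through the origin. The
    latter has a corner, the turning being less than [pi], and by [noncross] an arc with the same
    ends is the given one. *)
Lemma arc_min rho sa s sg al : Reg rho -> Reg (rho + sa ^+ 2) -> sa <= s -> sg ^+ 2 = 1 ->
  GG m rho s - GG m rho sa < pi ->
  dist m (pol (rho + sa ^+ 2) al) (pol (rho + s ^+ 2) (al + sg * (GG m rho s - GG m rho sa))) =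
  TT m rho s - TT m rho sa.
Proof.
move=> hr ha; rewrite le_eqVlt => /predU1P[-> hsg _|sas hsg vpi].
  by rewrite !subrr mulr0 addr0 (distxx vM).
set a := rho + sa ^+ 2 in ha *; set b := rho + s ^+ 2; set vt := GG m rho s - GG m rho sa in vpi *.
have v0 : 0 < vt by rewrite subr_gt0 (G_lt vM hr).
have hvt : 0 <= vt <= pi by rewrite !ltW.
have a0 : 0 < a := Reg_gt0 ha. have b0 : 0 < b := rr_gt0 hr s.
have [lo [hi [hlo hl lohi]]] : exists lo hi, [/\ Reg lo, (lo = a /\ hi = b) \/ (lo = b /\ hi = a) & lo <= hi].
  have [ab|/ltW ba] := leP a b; first by exists a, b; split=> //; left.
  by exists b, a; split=> //; [exact: (Reg_lt vM ha)|right].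
have [loa lob] : lo <= a /\ lo <= b by have := lohi; case: hl => -[-> ->].
have [e0|e0|[rho' [sa' [s' [[hr' _ sas'] [ea eb eG ->]]]]]] := @arc_exists R m vM a b vt lo hi hlo loa lob hl lohi hvt sg al hsg.
- by move: v0; rewrite e0 ltxx.
- by have := through_not_min al a0 b0 (ltW v0) vpi hsg; rewrite e0 ltxx.
have v0' : 0 < GG m rho' s' - GG m rho' sa' < pi by rewrite eG v0.
have [e1 e2 e3] := noncross vM dh hr' hr sas' (ltW sas) ea eG v0' eb.
by rewrite e1 e2 e3.
Qed.

Section ERay.
Variables rho sa sg al : R.
Hypotheses (hr : Reg rho) (ha : Reg (rho + sa ^+ 2)) (hsg : sg ^+ 2 = 1)
  (hpi : forall s, sa <= s -> GG m rho s - GG m rho sa < pi).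

Definition Ept s : pt := pol (rho + s ^+ 2) (al + sg * (GG m rho s - GG m rho sa)).

Lemma Ept_le s1 s2 : s1 <= s2 -> dist m (Ept s1) (Ept s2) <= TT m rho s2 - TT m rho s1.
Proof.
move=> h12; have := arc_dist vM (al + sg * (GG m rho s1 - GG m rho sa)) hr h12 hsg.
rewrite /Ept; have -> : al + sg * (GG m rho s1 - GG m rho sa) + sg * (GG m rho s2 - GG m rho s1) =
   al + sg * (GG m rho s2 - GG m rho sa) by ring.
by [].
Qed.

(** Only pieces starting at [sa] are known to minimize; two of them and the triangle inequality
    settle the piece in between. *)
Lemma Ept_dist s1 s2 : sa <= s1 -> s1 <= s2 -> dist m (Ept s1) (Ept s2) = TT m rho s2 - TT m rho s1.
Proof.
move=> s1a s12; apply/eqP; rewrite eq_le Ept_le//=.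
have s2a := le_trans s1a s12.
have e0 : Ept sa = pol (rho + sa ^+ 2) al by rewrite /Ept subrr mulr0 addr0.
have h2 := arc_min al hr ha s2a hsg (hpi s2a).
have h1 := arc_min al hr ha s1a hsg (hpi s1a).
have t := dist_triangle vM (Ept sa) (Ept s1) (Ept s2).
by move: t; rewrite e0 /Ept h1 h2; hlra.
Qed.

(** The arc has infinite length: [s * wE rho s <= m r] makes [TT m rho s - s ^+ 2] nondecreasing for
    [s >= 0]. *)
Lemma TT_onto t : 0 <= t -> exists2 s, sa <= s & TT m rho s = TT m rho sa + t.
Proof.
move=> t0; have dT0 := dT vM hr.
have grow s1 s2 : 0 <= s1 -> s1 <= s2 -> TT m rho s1 - s1 ^+ 2 <= TT m rho s2 - s2 ^+ 2.
  move=> s10 s12; apply: (ndecr_der (f := fun s => TT m rho s - s ^+ 2) (df := fun s => 2 * m (rho + s ^+ 2) / wE m rho s - 2 * s) s12) => s hs.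
  - by cont.
  - by have g := dT0 s; der; rewrite expr1; ring.
  have s0 : 0 <= s by lra.
  have w0 := wE_gt0 vM hr s; have eY := wE_sqr vM hr s; have mr := mrr_gt0 vM hr s.
  rewrite subr_ge0 ler_pdivlMr// -mulrA ler_pM2l//.
  rewrite -(ler_pXn2r (n := 2)) ?nnegrE ?mulr_ge0 ?(ltW w0) ?(ltW mr)// eY.
  by rewrite gerBl sqr_ge0.
pose S := Num.max sa (TT m rho sa + t + 1 + `|TT m rho sa| ).
pose z := Num.max S (Num.max 1 S).
have z1 : 1 <= z by rewrite !le_max lexx orbT.
have zS : S <= z by rewrite le_max lexx.
have zsa : sa <= z by apply: le_trans zS; rewrite le_max lexx.
have zt : TT m rho sa + t + 1 + `|TT m rho sa| <= z by apply: le_trans zS; rewrite le_max lexx orbT.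
have z0 : 0 <= z by lra.
have := grow 0 z (lexx 0) z0; rewrite T0 expr0n subr0 => gz.
have zz : z <= z ^+ 2 by rewrite expr2; nra.
have hv : TT m rho sa <= TT m rho sa + t <= TT m rho z.
  by rewrite lerDl t0 /=; have := normr_ge0 (TT m rho sa); lra.
have [s /andP[s1 _] e] := ivt zsa (fun x _ => der_cont (dT0 x)) hv.
by exists s.
Qed.

Lemma Eray_ex : exists g : R -> pt, [/\ ray m g, g 0 = pol (rho + sa ^+ 2) al,
  (forall s, sa <= s -> g (TT m rho s - TT m rho sa) = Ept s) &
  is_derive (0 : R) (1 : R) g
   (let d1 := sa * wE m rho sa / m (rho + sa ^+ 2) in
    let d2 := sg * (m rho / m (rho + sa ^+ 2) ^+ 2) in
    let r := rho + sa ^+ 2 in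
    (d1 * cos al - r * sin al * d2, d1 * sin al + r * cos al * d2))].
Proof.
have dT0 := dT vM hr; have [S [SK dS]] := inverse_ex dT0 (dT_gt0 vM hr).
pose st t := S (TT m rho sa + t); pose g t := Ept (st t).
have gE s : g (TT m rho s - TT m rho sa) = Ept s by rewrite /g /st addrC subrK SK.
have stP t : 0 <= t -> sa <= st t /\ TT m rho (st t) = TT m rho sa + t.
  by move=> /TT_onto[s sas es]; rewrite /st -es SK.
have gd s t : 0 <= s -> 0 <= t -> dist m (g s) (g t) = `|s - t|.
  move=> s0 t0; wlog st0 : s t s0 t0 / s <= t => [hw|].
    have [/hw hst|/ltW/hw hst] := leP s t; first exact: hst.
    by rewrite (dist_sym vM) distrC hst.
  have [a1 e1] := stP s s0; have [a2 e2] := stP t t0.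
  have le12 : st s <= st t.
    by rewrite leNgt; apply/negP => /(T_lt vM hr); rewrite e1 e2; lra.
  by rewrite /g Ept_dist// e1 e2 distrC ger0_norm ?subr_ge0//; ring.
have st00 : st 0 = sa by rewrite /st addr0 SK.
exists g; split.
- split=> [t t0|]; last exact: gd.
  by exists 1 => // s1 s2 h1 h2 _ _; exact: gd.
- by rewrite /g st00 /Ept subrr mulr0 addr0.
- by move=> s _; exact: gE.
have w0 := wE_gt0 vM hr sa; have mr := mrr_gt0 vM hr sa; have c0 := c_gt0 vM hr.
have dst : is_derive (0 : R) (1 : R) st (2 * m (rho + sa ^+ 2) / wE m rho sa)^-1.
  have h1 := dS sa; rewrite -[X in is_derive X]addr0 in h1.
  have h2 := der_comp (f := S) (g := fun t => TT m rho sa + t) h1 (der_add (der_cst (TT m rho sa) 0) (der_id 0)).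
  by apply: der_eq h2 _; rewrite add0r mulr1.
have dr : is_derive (0 : R) (1 : R) (fun t => rho + st t ^+ 2) (sa * wE m rho sa / m (rho + sa ^+ 2)).
  by der; rewrite st00; field; rewrite !gt_eqF.
have dth : is_derive (0 : R) (1 : R) (fun t => al + sg * (GG m rho (st t) - GG m rho sa)) (sg * (m rho / m (rho + sa ^+ 2) ^+ 2)).
  have h1 := dG vM hr sa; rewrite -{1}st00 in h1.
  have h2 := der_comp (f := GG m rho) (g := st) h1 dst.
  by der; field; rewrite !gt_eqF.
have := @der_pair R (fun t => (rho + st t ^+ 2) * cos (al + sg * (GG m rho (st t) - GG m rho sa)))
  (fun t => (rho + st t ^+ 2) * sin (al + sg * (GG m rho (st t) - GG m rho sa))) _ _ 0.
move=> hp.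
have al0 : al + sg * (GG m rho (st 0) - GG m rho sa) = al by rewrite st00 subrr mulr0 addr0.
pose D1 (t : R) : R := (sa * wE m rho sa / m (rho + sa ^+ 2)) * cos al - (rho + sa ^+ 2) * sin al * (sg * (m rho / m (rho + sa ^+ 2) ^+ 2)).
pose D2 (t : R) : R := (sa * wE m rho sa / m (rho + sa ^+ 2)) * sin al + (rho + sa ^+ 2) * cos al * (sg * (m rho / m (rho + sa ^+ 2) ^+ 2)).
apply: (hp D1 D2).
  by der; rewrite al0 st00 /D1; ring.
by der; rewrite al0 st00 /D2; ring.
Qed.

End ERay.

Lemma der_init_vel g w : is_derive (0 : R) (1 : R) g w -> init_vel g w.
Proof.
move=> [hd ew]; rewrite /init_vel.
have : (fun x => x^-1 *: (g (x *: 1 + 0) - g 0)) @ (0 : R)^' --> w.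
  by rewrite -ew; move: hd; rewrite /derivable.
have -> : (fun x : R => x^-1 *: (g (x *: 1 + 0) - g 0)) = (fun x => x^-1 *: (g x - g 0)).
  by apply/funext => x; rewrite -[_%:A]/(x * 1) mulr1 addr0.
move=> hc; apply: cvg_trans hc; apply: cvg_app.
move=> A [d /= d0 hA]; exists d => //= x xd x0; apply: hA => //.
by rewrite gt_eqF.
Qed.

Lemma acos_le_pihalf x : 0 <= x -> x <= 1 -> acos x <= pi / 2.
Proof.
move=> x0 x1; have hx : -1 <= x <= 1 by lra.
rewrite leNgt; apply/negP => lt.
have := @ltr_cos R (pi / 2) (acos x) _ _; rewrite acosK ?in_itv// cos_pihalf => hc.
have p0 := pi_gt0 R.
have a1 := acos_ge0 hx; have a2 := acos_lepi hx.
have : x < 0 by rewrite hc//=; apply/andP; split=> //; lra.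
lra.
Qed.

Lemma acos_gt_pihalf x : -1 <= x -> x < 0 -> pi / 2 < acos x.
Proof.
move=> x0 x1; have hx : -1 <= x <= 1 by lra.
rewrite ltNge; apply/negP => le.
have : 0 <= cos (acos x).
  apply: cos_ge0_pihalf; rewrite le andbT.
  by apply: le_trans (acos_ge0 hx); have := pi_gt0 R; lra.
by rewrite acosK ?in_itv//; lra.
Qed.

(* By symmetry it suffices to have rays tangent to the parallel in both directions. *)
Lemma tangent_Cm r th : Reg r -> (forall s, 0 <= s -> GG m r s < pi) -> Cm m (pol r th).
Proof.
move=> hr hpi v hv; have r0 := Reg_gt0 hr; have c0 := c_gt0 vM hr.
have ha : Reg (r + 0 ^+ 2) by rewrite expr0n addr0.
have hpi' s : 0 <= s -> GG m r s - GG m r 0 < pi by rewrite G0 subr0; exact: hpi.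
have qn : pol r th != origin R by exact: pol_neq0.
have rq : rad (pol r th) = r by rewrite rad_pol_ge0// ltW.
have rn : r != 0 by rewrite gt_eqF.
pose sg : R := if 0 <= crossp (pol r th) v then 1 else -1.
have hsg : sg ^+ 2 = 1 by rewrite /sg; case: ifP; rewrite ?sqrrN expr1n.
have sgv : 0 <= sg * crossp (pol r th) v.
  rewrite /sg; case: ifPn => [|]; rewrite ?mul1r//.
  by rewrite -ltNge mulN1r oppr_ge0 => /ltW.
have [g [gray g0 _ dg]] := Eray_ex th hr ha hsg hpi'.
rewrite /= expr0n addr0 !mul0r !add0r in g0 dg.
set w : pt := (_, _) in dg.
have cs := cos2Dsin2 th.
have cw : crossp (pol r th) w = r ^+ 2 * (sg / m r).
  rewrite /crossp /w /pol /=; transitivity (r ^+ 2 * (cos th ^+ 2 + sin th ^+ 2) * (sg * (m r / m r ^+ 2))); first by ring.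
  by rewrite cs mulr1; field; rewrite gt_eqF.
have dw : dotp (pol r th) w = 0 by rewrite /dotp /w /pol /=; ring.
exists g, w; split=> //; first exact: der_init_vel.
have ww : gmet m (pol r th) w w = 1.
  rewrite gmet_polar// rq dw cw mul0r expr0n add0r.
  have -> : m r ^+ 2 * (r ^+ 2 * (sg / m r) / r ^+ 2) ^+ 2 = sg ^+ 2 by field; rewrite rn gt_eqF.
  by [].
rewrite /angle ww hv !sqrtr1 mulr1 divr1.
have -> : gmet m (pol r th) v w = m r * (sg * crossp (pol r th) v / r ^+ 2).
  by rewrite /gmet (negbTE qn) rq dw cw; field; rewrite rn gt_eqF.
apply: acos_le_pihalf; first by rewrite mulr_ge0 ?(ltW c0)// divr_ge0// sqr_ge0.
rewrite -(ler_pXn2r (n := 2)) ?nnegrE ?ler01//; last by rewrite mulr_ge0 ?(ltW c0)// divr_ge0// sqr_ge0.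
rewrite expr1n -hv gmet_polar// rq.
have -> : (m r * (sg * crossp (pol r th) v / r ^+ 2)) ^+ 2 = sg ^+ 2 * (m r ^+ 2 * (crossp (pol r th) v / r ^+ 2) ^+ 2).
  by ring.
by rewrite hsg mul1r lerDr sqr_ge0.
Qed.

Lemma radial_ray th : ray m (fun t => pol t th).
Proof.
have hd s t : 0 <= s -> 0 <= t -> dist m (pol s th) (pol t th) = `|s - t|.
  by move=> s0 t0; rewrite (dist_radial vM)// distrC.
split=> [t t0|]; last exact: hd.
by exists 1 => // s1 s2 h1 h2 _ _; exact: hd.
Qed.

Lemma origin_Cm : Cm m (origin R).
Proof.
move=> v hv; rewrite /gmet eqxx in hv.
have hv' : v.1 ^+ 2 + v.2 ^+ 2 = 1 by rewrite -hv /dotp !expr2.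
have [th [e1 e2]] := circle_ex hv'.
have ev : v = (cos th, sin th) by rewrite [v]surjective_pairing e1 e2.
exists (fun t => pol t th), v; split; [exact: radial_ray|exact: pol0| |].
  apply: der_init_vel; rewrite ev.
  have := @der_pair R (fun t => t * cos th) (fun t => t * sin th) (fun=> cos th) (fun=> sin th) 0.
  by apply; der; ring.
rewrite /angle /gmet eqxx hv !sqrtr1 mulr1 divr1.
by apply: acos_le_pihalf.
Qed.

(* If [1/m^2] is not integrable, spiralling costs nothing and every ray is radial. *)
Lemma ray_radial g : ray m g -> 0 < rad (g 0) -> (forall M, exists2 r, 0 < r & h r < M) ->
  forall t, 0 <= t -> rad (g t) = rad (g 0) + t.
Proof.
move=> [_ hg] a0 hinf t t0; apply/eqP; rewrite eq_le; apply/andP; split.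
  have := rad_dist vM (g 0) (g t); rewrite hg// sub0r normrN (ger0_norm t0).
  by have := ler_norm (rad (g t) - rad (g 0)); hlra.
apply/ler_addgt0Pr => e e0; set a := rad (g 0) in a0 *.
have pi2 : 0 <= pi ^+ 2 / (2 * e) :> R by rewrite divr_ge0 ?sqr_ge0// mulr_ge0// ltW.
(* Beyond this radius, a spiral from radius [a] turning by at most [pi] exceeds the radial distance
   by at most [e]. *)
have [r r0 hr] := hinf (h a - pi ^+ 2 / (2 * e)).
have ar : a < r by apply: (h_inj_lt vM dh) => //; lra.
pose T := Num.max t (2 * a + r + 1).
have tT : t <= T by rewrite le_max lexx.
have rT : 2 * a + r + 1 <= T by rewrite le_max lexx orbT.
have T00 : 0 <= T by lra.
have rb : T - a <= rad (g T).
  have := dist_through vM (g 0) (g T); rewrite hg// sub0r normrN (ger0_norm T00) -/a; lra.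
have hb : h (rad (g T)) <= h r by apply: (h_le vM dh) => //; lra.
have [th0 e1] := pol_ex (g 0); have [th1 e2] := pol_ex (g T).
have [d [dpi cd sd]] := angle_rep th0 th1.
have e2' : g T = pol (rad (g T)) (th0 + d) by rewrite e2 rad_pol_ge0 ?rad_ge0// /pol cd sd.
have aT : a < rad (g T) by lra.
have := spiral_le vM dh th0 d a0 aT; rewrite -e2' -e1 hg// sub0r normrN (ger0_norm T00) => hs.
have dd : d ^+ 2 <= pi ^+ 2 by rewrite -real_normK ?num_real// lerXn2r// nnegrE ?pi_ge0.
have hh : pi ^+ 2 / (2 * e) <= h a - h (rad (g T)) by lra.
have hpos : 0 < h a - h (rad (g T)) by rewrite subr_gt0 (h_decr vM dh).
have : d ^+ 2 / (2 * (h a - h (rad (g T)))) <= e.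
  rewrite ler_pdivrMr ?mulr_gt0//; apply: le_trans dd _.
  by move: hh; rewrite ler_pdivrMr ?mulr_gt0//; lra.
have := rad_dist vM (g t) (g T); rewrite hg// (distrC t) (ger0_norm (_ : 0 <= T - t)) ?subr_ge0//.
have := ler_norm (rad (g T) - rad (g t)).
by move: hs; hlra.
Qed.

(** The test vector is the inward radial unit vector. If [h] were unbounded below, every ray from
    [q] would leave with [dr/dt = 1] and make an angle larger than [pi / 2] with it. *)
Lemma Cm_fin q : q != origin R -> Cm m q -> exists M, forall r, 0 < r -> M <= h r.
Proof.
move=> q0 hq; apply: contrapT => hn.
have hinf M : exists2 r, 0 < r & h r < M.
  apply: contrapT => hM; apply: hn; exists M => r r0; rewrite leNgt; apply/negP => hr.
  by apply: hM; exists r.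
have a0 : 0 < rad q by rewrite rad_gt0.
have an : rad q != 0 by rewrite gt_eqF.
pose v : pt := (- q.1 / rad q, - q.2 / rad q).
have hd : dotp q v = - rad q.
  rewrite /dotp /v /=; have -> : q.1 * (- q.1 / rad q) + q.2 * (- q.2 / rad q) = - (q.1 ^+ 2 + q.2 ^+ 2) / rad q by ring.
  by rewrite -sqr_rad; field.
have hc : crossp q v = 0 by rewrite /crossp /v /=; ring.
have hv : gmet m q v v = 1.
  by rewrite gmet_polar// hd hc mul0r expr0n mulr0 addr0 mulNr divff// sqrrN expr1n.
have [g [w [gray g0 hw]]] := hq v hv; apply/negP; rewrite -ltNge.
have hr := ray_radial gray; rewrite g0 in hr; have {}hr := hr a0 hinf.
(* [init_vel] is a one-sided limit of difference quotients, so the identity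
   [|g x|^2 = (rad q + x)^2] is expanded to first order by hand; [B] collects the constants of the
   error terms. *)
have qw : dotp q w = rad q.
  apply/eqP; rewrite -subr_eq0 -normr_le0; apply/ler_addgt0Pr => e e0; rewrite add0r.
  have /init_velP hw' := hw.
  pose B := 2 * `|q.1| + 2 * `|q.2| + 2 * (`|w.1| + 1) ^+ 2 + 2 * (`|w.2| + 1) ^+ 2 + 1.
  have B0 : 0 < B.
    have := normr_ge0 q.1; have := normr_ge0 q.2; have := sqr_ge0 (`|w.1| + 1); have := sqr_ge0 (`|w.2| + 1).
    by rewrite /B; lra.
  pose e1 := Num.min 1 (e / B).
  have e10 : 0 < e1 by rewrite lt_min ltr01 divr_gt0.
  have e11 : e1 <= 1 by rewrite ge_min lexx.
  have e1B : e1 * B <= e by rewrite -ler_pdivlMr// ge_min lexx orbT.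
  have [d d0 hd'] := hw' e1 e10.
  pose x := Num.min (d / 2) (e1 / 2).
  have x0 : 0 < x by rewrite lt_min !divr_gt0.
  have xd : x < d by apply: (@le_lt_trans _ _ (d / 2)); [rewrite ge_min lexx|lra].
  have xe : x <= e1 / 2 by rewrite ge_min lexx orbT.
  have [] := hd' x x0 xd; rewrite g0.
  set z1 := (_ / x); set z2 := (_ / x) => h1 h2.
  have id : x * (z1 ^+ 2 + z2 ^+ 2) + 2 * (q.1 * z1 + q.2 * z2) = 2 * rad q + x.
    have hx := hr x (ltW x0).
    have s1 := sqr_rad (g x); have s2 := sqr_rad q; rewrite hx in s1.
    have xn : x != 0 by rewrite gt_eqF.
    apply: (mulfI xn); rewrite /z1 /z2.
    transitivity ((g x).1 ^+ 2 + (g x).2 ^+ 2 - (q.1 ^+ 2 + q.2 ^+ 2)); first by field.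
    by rewrite -s1 -s2; ring.
  have n1 : `|z1| <= `|w.1| + 1.
    have := ler_normD (z1 - w.1) w.1; rewrite subrK; lra.
  have n2 : `|z2| <= `|w.2| + 1.
    have := ler_normD (z2 - w.2) w.2; rewrite subrK; lra.
  have q1 : z1 ^+ 2 <= (`|w.1| + 1) ^+ 2.
    by rewrite -real_normK ?num_real// lerXn2r ?nnegrE// addr_ge0.
  have q2 : z2 ^+ 2 <= (`|w.2| + 1) ^+ 2.
    by rewrite -real_normK ?num_real// lerXn2r ?nnegrE// addr_ge0.
  have p1 : `|q.1 * (z1 - w.1)| <= `|q.1| * e1 by rewrite normrM ler_wpM2l// ltW.
  have p2 : `|q.2 * (z2 - w.2)| <= `|q.2| * e1 by rewrite normrM ler_wpM2l// ltW.
  have -> : dotp q w - rad q = - (q.1 * (z1 - w.1)) - q.2 * (z2 - w.2) - x / 2 * (z1 ^+ 2 + z2 ^+ 2) + x / 2.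
    by rewrite /dotp; lra.
  have p3 : 0 <= x / 2 * (z1 ^+ 2 + z2 ^+ 2) by rewrite mulr_ge0 ?addr_ge0 ?sqr_ge0// divr_ge0// ltW.
  have p4 : x / 2 * (z1 ^+ 2 + z2 ^+ 2) <= e1 * ((`|w.1| + 1) ^+ 2 + (`|w.2| + 1) ^+ 2).
    apply: ler_pM; rewrite ?addr_ge0 ?sqr_ge0 ?divr_ge0 ?(ltW x0)//; first lra.
    exact: lerD.
  have b1 := ler_norm (q.1 * (z1 - w.1)); have b2 := ler_norm (q.2 * (z2 - w.2)).
  have b3 := ler_norm (- (q.1 * (z1 - w.1))); have b4 := ler_norm (- (q.2 * (z2 - w.2))).
  rewrite !normrN in b3 b4.
  have eB : e1 * B = 2 * (`|q.1| * e1) + 2 * (`|q.2| * e1) + 2 * (e1 * ((`|w.1| + 1) ^+ 2 + (`|w.2| + 1) ^+ 2)) + e1.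
    by rewrite /B; ring.
  rewrite eB in e1B.
  have u1 : 0 <= `|q.1| * e1 by rewrite mulr_ge0// ltW.
  have u2 : 0 <= `|q.2| * e1 by rewrite mulr_ge0// ltW.
  rewrite ler_norml; apply/andP; split; lra.
have vw : gmet m q v w = -1.
  by rewrite /gmet (negbTE q0) hd qw hc mul0r mulr0 mul0r addr0; field.
have ww : 1 <= gmet m q w w.
  by rewrite gmet_polar// qw divff// expr1n lerDl mulr_ge0 ?sqr_ge0.
rewrite /angle hv vw sqrtr1 mul1r mulN1r.
have sw : 1 <= Num.sqrt (gmet m q w w) by rewrite -[leLHS]sqrtr1 ler_sqrt// (le_trans ler01).
have sw0 : 0 < Num.sqrt (gmet m q w w) by exact: lt_le_trans sw.
apply: acos_gt_pihalf; last by rewrite oppr_lt0 invr_gt0.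
by rewrite lerN2 invf_le1.
Qed.

End Rays.

(** * Meridians through the origin and the integrability of [1/m^2] *)

Section NearOrigin.
Variables (R : realType) (m : R -> R).
Hypothesis vM : von_Mangoldt m.
Notation pt := (R * R)%type.
Implicit Types (s t x y r rho e th : R) (p q v w : pt) (g c : R -> pt).

Lemma gerr_bound : exists C d : R, [/\ 0 < C, 0 < d & forall r, 0 <= r -> r <= d -> - (C * r ^+ 2) <= gerr m r].
Proof.
have [C [d [C0 d0 Cd hd]]] := m_near0 vM.
exists (2 * C), d; split=> //; first by rewrite mulr_gt0.
move=> r r0 rd; rewrite /gerr; case: eqVneq => [->|rn]; first by rewrite expr0n mulr0 oppr0.
have rp : 0 < r by rewrite lt_def rn.
have [|_ _] := hd r _; first by rewrite r0.
rewrite ler_norml => /andP[h1 h2].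
have Cr : C * r ^+ 2 <= 1 / 2.
  by apply: le_trans Cd; rewrite ler_pM2l// lerXn2r// nnegrE (le_trans r0).
have h3 : 1 - C * r ^+ 2 <= m r / r.
  rewrite ler_pdivlMr//; have -> : (1 - C * r ^+ 2) * r = r - C * r ^+ 3 by ring.
  lra.
have : (1 - C * r ^+ 2) ^+ 2 <= (m r / r) ^+ 2.
  by rewrite lerXn2r ?nnegrE//; lra.
have := sqr_ge0 (C * r ^+ 2); lra.
Qed.

(* The function [x - C x y^2] calibrates the [x]-axis near the origin. *)
Lemma axis_calibration (C x y v w : R) : 0 < C -> C * (x ^+ 2 + y ^+ 2) <= 1 / 100 ->
  ((1 - C * y ^+ 2) * v - 2 * C * x * y * w) ^+ 2 <= v ^+ 2 + w ^+ 2 - C * (x * w - y * v) ^+ 2.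
Proof.
move=> C0 hxy; rewrite -subr_ge0.
pose a := C * x ^+ 2; pose b := C * y ^+ 2.
have a0 : 0 <= a by rewrite mulr_ge0 ?sqr_ge0 ?(ltW C0).
have b0 : 0 <= b by rewrite mulr_ge0 ?sqr_ge0 ?(ltW C0).
have ab : a + b <= 1 / 100 by rewrite /a /b -mulrDr.
(* Half of [w ^+ 2] completes the square with the mixed term; the remaining coefficients are
   nonnegative for [a + b <= 1 / 100]. *)
have -> : v ^+ 2 + w ^+ 2 - C * (x * w - y * v) ^+ 2 - ((1 - C * y ^+ 2) * v - 2 * C * x * y * w) ^+ 2 =
  (1 / 2) * (w + C * x * y * (6 - 4 * b) * v) ^+ 2 + w ^+ 2 * (1 / 2 - a - 4 * a * b) +
  b * v ^+ 2 * (1 - b - (1 / 2) * a * (6 - 4 * b) ^+ 2).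
  by rewrite /a /b; field.
have h1 : a * b <= 1 / 100 by nra.
have h2 : a * (6 - 4 * b) ^+ 2 <= 36 / 100.
  have : (6 - 4 * b) ^+ 2 <= 36 by nra.
  by have := sqr_ge0 (6 - 4 * b); nra.
have h3 : 0 <= 1 / 2 - a - 4 * a * b by move: (a) (b) a0 b0 ab h1 h2 => a' b' *; lra.
have h4 : 0 <= 1 - b - (1 / 2) * a * (6 - 4 * b) ^+ 2 by move: (a) (b) a0 b0 ab h1 h2 => a' b' *; lra.
apply: addr_ge0; first apply: addr_ge0.
- by apply: mulr_ge0; [lra|exact: sqr_ge0].
- by apply: mulr_ge0; [exact: sqr_ge0|].
- by apply: mulr_ge0 => //; apply: mulr_ge0; [|exact: sqr_ge0].
Qed.

(** A curve leaving the ball of radius [rr] is longer than [u + v], as both ends are within [rr / 2]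
    of the origin. Inside the ball the function of [axis_calibration], rotated by [th] and with the
    sign changed, increases from [- u] to [v]. *)
Lemma through_origin : exists2 d : R, 0 < d & forall u v th : R, 0 <= u -> u <= d -> 0 <= v -> v <= d ->
  dist m (pol u th) (pol v (th + pi)) = u + v.
Proof.
have [C [d [C0 d0 hd]]] := gerr_bound.
pose rr := Num.min d (Num.min 1 (1 / (100 * C))).
have rr0 : 0 < rr by rewrite !lt_min d0 ltr01 divr_gt0// mulr_gt0.
have rrd : rr <= d by rewrite ge_min lexx.
have rr1 : rr <= 1 by rewrite !ge_min lexx !orbT.
have rrC : C * rr ^+ 2 <= 1 / 100.
  have : rr <= 1 / (100 * C) by rewrite !ge_min lexx !orbT.
  rewrite ler_pdivlMr ?mulr_gt0// => hC; rewrite expr2; nra.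
exists (rr / 2) => [|u v th u0 ur v0 vr]; first by rewrite divr_gt0.
apply/eqP; rewrite eq_le; apply/andP; split.
  by apply: le_trans (dist_through vM _ _) _; rewrite !rad_pol_ge0.
apply: (dist_ge vM) => c cc c0 c1.
have ra : rad (c 0) = u by rewrite c0 rad_pol_ge0.
have rb : rad (c 1) = v by rewrite c1 rad_pol_ge0.
have [[t ht hr]|hsm] := pselect (exists2 t, 0 <= t <= 1 & rr < rad (c t)).
  have := rad_curve vM cc ht; rewrite ra rb.
  have := ler_norm (rad (c t) - u); have := ler_norm (rad (c t) - v); rewrite distrC.
  by hlra.
have {}hsm t : 0 <= t <= 1 -> rad (c t) <= rr.
  by move=> ht; rewrite leNgt; apply/negP => hr; apply: hsm; exists t.
have [d1 d2 k1 k2] := C1curve_coord cc.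
have cs := cos2Dsin2 th.
pose X t := (c t).1 * cos th + (c t).2 * sin th; pose Y t := - (c t).1 * sin th + (c t).2 * cos th.
pose V t := (derive1 c t).1 * cos th + (derive1 c t).2 * sin th.
pose W t := - (derive1 c t).1 * sin th + (derive1 c t).2 * cos th.
have dX t : is_derive t 1 X (V t) by have g1 := d1 t; have g2 := d2 t; rewrite /X /V; der; ring.
have dY t : is_derive t 1 Y (W t) by have g1 := d1 t; have g2 := d2 t; rewrite /Y /W; der; ring.
pose f t := - (X t - C * X t * Y t ^+ 2).
pose df t := - ((1 - C * Y t ^+ 2) * V t - 2 * C * X t * Y t * W t).
have dfE t : is_derive t 1 f (df t).
  by have g1 := dX t; have g2 := dY t; rewrite /f /df; der; ring.
have : f 1 - f 0 <= clength m c.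
  apply: (clength_ge vM (f := df) cc) => t ht; first exact: der_cont (dfE t).
  have ht' : 0 <= t <= 1 by lra.
  apply: le_trans (ler_norm _) _.
  rewrite -(ler_pXn2r (n := 2)) ?nnegrE ?speed_ge0// real_normK ?num_real//.
  rewrite /speed sqr_sqrtr ?gmet_ge0// /df sqrrN gmet_err.
  have hXY : X t ^+ 2 + Y t ^+ 2 = rad (c t) ^+ 2.
    rewrite sqr_rad /X /Y; transitivity (((c t).1 ^+ 2 + (c t).2 ^+ 2) * (cos th ^+ 2 + sin th ^+ 2)); first ring.
    by rewrite cs mulr1.
  have r0 := rad_ge0 (c t).
  have rsm := hsm t ht'.
  have r2 : rad (c t) ^+ 2 <= rr ^+ 2 by rewrite lerXn2r// nnegrE ?(ltW rr0).
  have hC : C * (X t ^+ 2 + Y t ^+ 2) <= 1 / 100.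
    by rewrite hXY; apply: le_trans rrC; rewrite ler_pM2l.
  apply: le_trans (axis_calibration (V t) (W t) C0 hC) _.
  have -> : dotp (derive1 c t) (derive1 c t) = V t ^+ 2 + W t ^+ 2.
    rewrite /V /W; transitivity (((derive1 c t).1 ^+ 2 + (derive1 c t).2 ^+ 2) * (cos th ^+ 2 + sin th ^+ 2)); last ring.
    by rewrite cs mulr1 /dotp !expr2.
  rewrite lerD2l.
  have -> : X t * W t - Y t * V t = crossp (c t) (derive1 c t).
    rewrite /X /Y /V /W /crossp; transitivity (((c t).1 * (derive1 c t).2 - (c t).2 * (derive1 c t).1) * (cos th ^+ 2 + sin th ^+ 2)); first ring.
    by rewrite cs mulr1.
  have [rz|rn] := eqVneq (rad (c t)) 0.
    rewrite rz invr0 mulr0 expr0n mulr0 oppr_le0 mulr_ge0 ?sqr_ge0 ?(ltW C0)//.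
  have := hd (rad (c t)) r0 (le_trans rsm rrd).
  have -> : - (C * crossp (c t) (derive1 c t) ^+ 2) = - (C * rad (c t) ^+ 2) * (crossp (c t) (derive1 c t) / rad (c t)) ^+ 2.
    by field.
  by move=> hg; rewrite ler_wpM2r ?sqr_ge0.
have e0 : f 0 = - u.
  rewrite /f /X /Y c0 /pol /=.
  have -> : u * cos th * cos th + u * sin th * sin th = u * (cos th ^+ 2 + sin th ^+ 2) by ring.
  have -> : - (u * cos th) * sin th + u * sin th * cos th = 0 by ring.
  by rewrite cs expr0n !mulr0 subr0 mulr1.
have e1 : f 1 = v.
  rewrite /f /X /Y c1 /pol /= cosDpi sinDpi.
  have -> : v * - cos th * cos th + v * - sin th * sin th = - v * (cos th ^+ 2 + sin th ^+ 2) by ring.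
  have -> : - (v * - cos th) * sin th + v * - sin th * cos th = 0 by ring.
  by rewrite cs expr0n !mulr0 subr0 mulr1 opprK.
by rewrite e0 e1 opprK addrC.
Qed.

Definition meridian (a th t : R) : pt := if t <= a then pol (a - t) th else pol (t - a) (th + pi).

Lemma rad_meridian a th t : rad (meridian a th t) = `|a - t|.
Proof.
by rewrite /meridian; case: leP => h; rewrite rad_pol// distrC.
Qed.

Lemma meridian_geodesic a th : 0 < a -> geodesic m (meridian a th).
Proof.
move=> a0 t t0; have [d d0 hd] := through_origin.
have out s1 s2 : a <= s1 -> a <= s2 -> dist m (pol (s1 - a) (th + pi)) (pol (s2 - a) (th + pi)) = `|s1 - s2|.
  by move=> h1 h2; rewrite (dist_radial vM) ?subr_ge0// distrC; congr (`|_|); ring.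
have inn s1 s2 : s1 <= a -> s2 <= a -> dist m (pol (a - s1) th) (pol (a - s2) th) = `|s1 - s2|.
  by move=> h1 h2; rewrite (dist_radial vM) ?subr_ge0//; congr (`|_|); ring.
case: (ltgtP t a) => ta.
- exists (a - t); first by rewrite subr_gt0.
  move=> s1 s2 _ _; rewrite !ltr_norml => /andP[_ h1] /andP[_ h2].
  by rewrite /meridian !ifT ?inn//; lra.
- exists (t - a); first by rewrite subr_gt0.
  move=> s1 s2 _ _; rewrite !ltr_norml => /andP[h1 _] /andP[h2 _].
  by rewrite /meridian !ifF ?out//; [lra|lra|apply/negbTE; rewrite -ltNge; lra|apply/negbTE; rewrite -ltNge; lra].
exists d => // s1 s2 _ _; rewrite ta !ltr_norml => /andP[h1 h1'] /andP[h2 h2'].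
rewrite /meridian; case: (leP s1 a) => g1; case: (leP s2 a) => g2.
- by rewrite inn.
- by rewrite hd; [rewrite ltr0_norm; lra|lra|lra|lra|lra].
- by rewrite (dist_sym vM) hd; [rewrite gtr0_norm; lra|lra|lra|lra|lra].
- by rewrite out// ltW.
Qed.

Lemma pole_meridian a th b : 0 < a -> pole m (pol a th) -> 0 <= b -> dist m (pol a th) (pol b (th + pi)) = a + b.
Proof.
move=> a0 hp; rewrite le_eqVlt => /predU1P[<-|b0].
  by rewrite pol0 (dist_sym vM) (dist_origin vM) rad_pol_ge0 ?ltW// addr0.
have [_ hg] : ray m (meridian a th).
  apply: hp; first exact: meridian_geodesic.
  by rewrite /meridian (ltW a0) subr0.
have ab : 0 <= a + b by rewrite addr_ge0// ltW.
have := hg 0 (a + b) (lexx 0) ab; rewrite /meridian (ltW a0) subr0 sub0r normrN (ger0_norm ab).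
by rewrite ifF; [have -> : a + b - a = b by ring|apply/negbTE; rewrite -ltNge; lra].
Qed.

Variable h : R -> R.
Hypothesis dh : forall x : R, 0 < x -> is_derive x 1 h (- (m x ^- 2)).

(** The meridian through the origin would be a ray from [q], which [ray_radial] sends outwards,
    whereas it is at the origin after time [rad q]. *)
Lemma pole_fin q : q != origin R -> pole m q -> exists M, forall r, 0 < r -> M <= h r.
Proof.
move=> q0 hq; apply: contrapT => hn.
have hinf M : exists2 r, 0 < r & h r < M.
  apply: contrapT => hM; apply: hn; exists M => r r0; rewrite leNgt; apply/negP => hr.
  by apply: hM; exists r.
have a0 : 0 < rad q by rewrite rad_gt0.
have [th eq] := pol_ex q.
have m0 : meridian (rad q) th 0 = q by rewrite /meridian (ltW a0) subr0.
have hray : ray m (meridian (rad q) th) by apply: hq => //; exact: meridian_geodesic.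
have := ray_radial vM dh hray; rewrite m0 => /(_ a0 hinf (rad q) (ltW a0)).
rewrite rad_meridian subrr normr0; lra.
Qed.

(* If [1/m^2] is integrable then [m] is eventually nondecreasing: otherwise it would be
   eventually decreasing, hence bounded. *)
Lemma fin_Reg : (exists M, forall r, 0 < r -> M <= h r) -> exists rho, Reg m rho.
Proof.
move=> [M hM].
have dm0 := dm vM; have dm10 := dm1 vM.
(* Monotone curvature: a negative value of [Gm] at [r1] makes [m] convex from there on, a
   nonnegative one makes [m] concave before. *)
have mono r1 : 0 < r1 -> (forall x, r1 < x -> 0 <= m2 m x) \/ (forall x, 0 < x -> x <= r1 -> m2 m x <= 0).
  move=> r10; have [_ hG] := vM; have [G0|G0] := leP 0 (Gm m r1).
    right => x x0 xr; have := hG x r1 x0 xr; rewrite !(Gm_E m) in G0 *.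
    move=> le; have := le_trans G0 le; rewrite mulNr oppr_ge0 pmulr_lle0// invr_gt0 (m_gt0 vM)//.
  left => x rx; have := hG r1 x r10 (ltW rx) => le; have := le_lt_trans le G0.
  by rewrite (Gm_E m) mulNr oppr_lt0 pmulr_lgt0 ?invr_gt0 ?(m_gt0 vM)//; [exact: ltW|lra].
have [r1 r10 hr1] : exists2 r1, 0 < r1 & forall x, r1 <= x -> 0 <= m1 m x.
  have [[r0 r00 hr0]|hno] := pselect (exists2 r0, 0 < r0 & forall x, r0 < x -> 0 <= m2 m x).
    have [[x1 x1r hx1]|hneg] := pselect (exists2 x1, r0 <= x1 & 0 <= m1 m x1).
      exists x1 => [|x xx]; first lra.
      apply: le_trans hx1 _; apply: (ndecr_der xx (fun t _ => der_cont (dm10 t)) (fun t _ => dm10 t)) => t ht.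
      by apply: hr0; lra.
    have hneg' x : r0 <= x -> m1 m x < 0.
      by move=> rx; rewrite ltNge; apply/negP => hx; apply: hneg; exists x.
    have mle x : r0 <= x -> m x <= m r0.
      move=> rx; rewrite -lerN2.
      have dmN t : is_derive t 1 (fun t => - m t) (- m1 m t) by have g := dm0 t; der.
      apply: (ndecr_der (f := fun t => - m t) rx (fun t _ => der_cont (dmN t)) (fun t _ => dmN t)) => t ht.
      by rewrite oppr_ge0; apply/ltW/hneg'; lra.
    have mr := m_gt0 vM r00.
    pose q := m r0 ^- 2; have q0 : 0 < q by rewrite invr_gt0 exprn_gt0.
    pose x := r0 + (`|h r0 - M| + 1) / q.
    have xr : r0 <= x by rewrite lerDl divr_ge0 ?addr_ge0// ltW.
    (* [m <= m r0] makes [h] fall at least at the rate [q], so at [x] it would have passed below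
       [M]. *)
    exfalso; have : - h r0 - q * r0 <= - h x - q * x.
      apply: (ndecr_der (f := fun t => - h t - q * t) (df := fun t => m t ^- 2 - q) xr) => t ht.
      + have t0 : 0 < t by lra. have g := der_cont (dh t0); by cont.
      + have t0 : 0 < t by lra. have g := dh t0; by der; ring.
      + have t0 : 0 < t by lra.
        rewrite subr_ge0 /q lef_pV2 ?posrE ?exprn_gt0 ?(m_gt0 vM)//.
        by rewrite lerXn2r ?nnegrE ?(ltW (m_gt0 vM _))// mle//; lra.
    have hx : M <= h x by apply: hM; lra.
    have e : q * x = q * r0 + (`|h r0 - M| + 1) by rewrite /x mulrDr; congr (_ + _); field; rewrite gt_eqF.
    by have := ler_norm (h r0 - M); lra.
  have conc x : 0 < x -> m2 m x <= 0.
    move=> x0; have [g|g] := mono x x0; last by apply: g.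
    by exfalso; apply: hno; exists x.
  exists 1 => // x x1; rewrite leNgt; apply/negP => hx.
  have x0 : 0 < x by lra.
  have mx := m_gt0 vM x0.
  pose e := - m1 m x; have e0 : 0 < e by rewrite oppr_gt0.
  pose z := x + (m x + 1) / e.
  have xz : x <= z by rewrite lerDl divr_ge0// ?(ltW e0)//; lra.
  have z0 : 0 < z by lra.
  have dec y : x <= y -> m1 m y <= - e.
    move=> xy; rewrite /e opprK -lerN2.
    have dmN t : is_derive t 1 (fun t => - m1 m t) (- m2 m t) by have g := dm10 t; der.
    apply: (ndecr_der (f := fun t => - m1 m t) xy (fun t _ => der_cont (dmN t)) (fun t _ => dmN t)) => t ht.
    by rewrite oppr_ge0; apply: conc; lra.
  have : - m x - e * x <= - m z - e * z.
    have dmN t : is_derive t 1 (fun t => - m t - e * t) (- m1 m t - e) by have g := dm0 t; der; ring.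
    apply: (ndecr_der (f := fun t => - m t - e * t) xz (fun t _ => der_cont (dmN t)) (fun t _ => dmN t)) => t ht.
    by have := dec t; lra.
  have -> : e * z = e * x + (m x + 1) by rewrite /z mulrDr; congr (_ + _); field; rewrite gt_eqF.
  by have := m_gt0 vM z0; lra.
have [d d0 hd] := m_small vM dh.
have mc : continuous m := m_cont vM.
pose dd := Num.min d r1; have dd0 : 0 < dd by rewrite lt_min d0.
have ddr : dd <= r1 by rewrite ge_min lexx orbT.
have ddd : dd <= d by rewrite ge_min lexx.
have [x1 hx1 hmin] := evt_min ddr (fun x _ => mc x).
have mu0 : 0 < m x1 by apply: (m_gt0 vM); lra.
(* [m rho <= 2 * rho] is then below the minimum [m x1] over [[dd, r1]]; before [d] and after [r1]
   monotonicity of [m] is available. *)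
pose rho := Num.min (dd / 2) (m x1 / 4).
have rho0 : 0 < rho by rewrite lt_min !divr_gt0.
have rd : rho <= dd / 2 by rewrite ge_min lexx.
have rm : rho <= m x1 / 4 by rewrite ge_min lexx orbT.
exists rho; split=> // [x x0 xr|x rx].
  have xd : x <= d by lra.
  by have [_ g _] := hd x x0 xd; lra.
have incr x' y' : 0 < x' -> x' < y' -> y' <= d -> m x' < m y'.
  move=> x0 xy yd; apply: (incr_der xy (fun t _ => der_cont (dm0 t)) (fun t _ => dm0 t)) => t ht.
  have t0 : 0 < t by lra.
  have td : t <= d by lra.
  by have [_ g _] := hd t t0 td; lra.
have [xd|dx] := leP x d; first exact: incr.
have rhod : rho <= d by lra.
have [/andP[_ g] _ _] := hd rho rho0 rhod.
suff : m x1 <= m x by lra.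
have [xr1|r1x] := leP x r1; first by apply: hmin; lra.
apply: (@le_trans _ _ (m r1)); first by apply: hmin; lra.
apply: (ndecr_der (ltW r1x) (fun t _ => der_cont (dm0 t)) (fun t _ => dm0 t)) => t ht.
by apply: hr1; lra.
Qed.

End NearOrigin.

(** * A necessary condition for poles *)

Section PoleCondition.
Variables (R : realType) (m : R -> R).
Hypothesis vM : von_Mangoldt m.
Notation pt := (R * R)%type.
Implicit Types (s t x y r rho e th a b : R).
Variables (h : R -> R) (k0 : R).
Hypothesis dh : forall x : R, 0 < x -> is_derive x 1 h (- (m x ^- 2)).
Local Notation k := (kk m h).
Hypothesis k0_le : forall x : R, 0 < x -> k0 <= k x.
Hypothesis k0_near : forall e : R, 0 < e -> exists2 d : R, 0 < d & forall x, 0 < x -> x <= d -> k x < k0 + e.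
Local Notation Tau := (Tau m).
Local Notation Reg := (Reg m).

Lemma Tau_lt_pi rho y : Reg rho -> rho <= y -> 0 < h rho + h y + 2 * k0 -> Tau rho y < pi.
Proof.
move=> hr ry hp; have s0 := sqrtr_ge0 (y - rho).
have := turn_lt vM dh k0_le hr s0; rewrite G0 subr0 expr0n addr0; apply=> t ht.
have y0 : 0 < y by have := Reg_gt0 hr; lra.
have : h y <= h (rho + t ^+ 2).
  apply: (h_le vM dh); first exact: (rr_gt0 hr t).
  have [e1 _ _ _ _] := arc_sqrt vM hr ry; rewrite -[leRHS]e1 lerD2l.
  by rewrite lerXn2r ?nnegrE ?sqrtr_ge0//; lra.
lra.
Qed.

Lemma Tau_slope r1 r2 a : Reg r1 -> Reg r2 -> r1 < r2 -> r2 <= a ->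
  - Num.sqrt (a - r1) * wE m r1 (- Num.sqrt (a - r1)) / m r1 <
  - Num.sqrt (a - r2) * wE m r2 (- Num.sqrt (a - r2)) / m r2.
Proof.
move=> h1 h2 r12 r2a; have r1a : r1 <= a by lra.
have c1 := c_gt0 vM h1; have c2 := c_gt0 vM h2.
have cc : m r1 < m r2 by exact: (Reg0_lt vM (or_intror h1)).
have a0 : 0 < m a by apply: (m_gt0 vM); have := Reg_gt0 h2; lra.
rewrite !wEN !mulNr ltrN2.
have sq r : Reg r -> r <= a -> (Num.sqrt (a - r) * wE m r (Num.sqrt (a - r)) / m r) ^+ 2 = m a ^+ 2 / m r ^+ 2 - 1.
  move=> hr ra; have cr := c_gt0 vM hr; have [e _ _ _ _] := arc_sqrt vM hr ra.
  by rewrite expr_div_n (wE_sqr vM hr) e; field; rewrite gt_eqF.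
have ps r : Reg r -> 0 <= Num.sqrt (a - r) * wE m r (Num.sqrt (a - r)) / m r.
  by move=> hr; rewrite divr_ge0 ?mulr_ge0 ?sqrtr_ge0 ?(ltW (wE_gt0 vM hr _)) ?(ltW (c_gt0 vM hr)).
rewrite -(ltr_pXn2r (n := 2)) ?nnegrE ?ps// !sq// ltrD2r ltr_pM2l ?exprn_gt0//.
by rewrite ltf_pV2 ?posrE ?exprn_gt0// ltrXn2r ?nnegrE ?(ltW c1) ?(ltW c2).
Qed.

(* Inward arcs from radius [a] do not cross before the angle [pi]; hence if one of them
   reaches radius [b] at angle [pi], those passing closer to the origin do not reach it earlier. *)
Lemma turn_mono r1 r2 a b : Reg r1 -> Reg r2 -> r1 < r2 -> r2 <= a -> r2 <= b ->
  Tau r1 a < pi -> Tau r2 a < pi -> Tau r2 a + Tau r2 b = pi -> pi <= Tau r1 a + Tau r1 b.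
Proof.
move=> h1 h2 r12 r2a r2b t1 t2 e2.
have r1a : r1 <= a by lra. have r1b : r1 <= b by lra.
have [a1 a2 _ a4 _] := arc_sqrt vM h1 r1a; have [b1 b2 _ b4 _] := arc_sqrt vM h2 r2a.
have [c1 _ _ _ _] := arc_sqrt vM h2 r2b.
have sl := Tau_slope h1 h2 r12 r2a.
pose sa1 := - Num.sqrt (a - r1); pose sa2 := - Num.sqrt (a - r2); pose s2 := Num.sqrt (b - r2).
have s20 : 0 <= s2 by exact: sqrtr_ge0.
have sa10 : sa1 <= 0 by rewrite oppr_le0 sqrtr_ge0.
have sa20 : sa2 <= 0 by rewrite oppr_le0 sqrtr_ge0.
have sa2s2 : sa2 <= s2 by lra.
have eG2 : GG m r2 s2 - GG m r2 sa2 = pi by rewrite b4 opprK addrC.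
have ea : r2 + sa2 ^+ 2 = r1 + sa1 ^+ 2 by rewrite b2 a2.
pose S := Num.sqrt (Num.max a b + 1 - r1).
have S0 : 0 <= S by exact: sqrtr_ge0.
have rS : r1 + S ^+ 2 = Num.max a b + 1.
  rewrite sqr_sqrtr; first by ring.
  by have : a <= Num.max a b; [rewrite le_max lexx|lra].
have sa1S : sa1 < S.
  rewrite lt_neqAle; apply/andP; split; last lra.
  apply/eqP => e; have S00 : S = 0 by lra.
  move: rS; rewrite S00 expr0n addr0; have : a <= Num.max a b by rewrite le_max lexx.
  lra.
have xS : pi <= GG m r1 S - GG m r1 sa1.
  rewrite leNgt; apply/negP => xpi.
  have x0 : 0 < GG m r1 S - GG m r1 sa1 by rewrite subr_gt0 (G_lt vM h1).
  have hv : GG m r2 sa2 <= GG m r2 sa2 + (GG m r1 S - GG m r1 sa1) <= GG m r2 s2 by lra.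
  have [s0 /andP[s01 s02] es0] := ivt sa2s2 (fun x _ => der_cont (dG vM h2 x)) hv.
  have eT : GG m r2 s0 - GG m r2 sa2 = GG m r1 S - GG m r1 sa1 by rewrite es0; ring.
  have hT : 0 < GG m r2 s0 - GG m r2 sa2 <= pi by rewrite eT x0 ltW.
  have := noncross_lt vM dh h2 h1 s01 (ltW sa1S) ea eT hT sl.
  rewrite eT (lt_eqF xpi) /= => /(h_inj_lt vM dh (rr_gt0 h2 _) (rr_gt0 h1 _)).
  rewrite rS => lt; have : r2 + s0 ^+ 2 <= Num.max a b.
    have [s00|s00] := leP 0 s0.
      apply: (@le_trans _ _ b); last by rewrite le_max lexx orbT.
      by rewrite -[leRHS]c1 lerD2l lerXn2r// nnegrE.
    apply: (@le_trans _ _ a); last by rewrite le_max lexx.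
    rewrite -[leRHS]b2 lerD2l -[s0 ^+ 2]sqrrN -[(- Num.sqrt _) ^+ 2]sqrrN opprK.
    by rewrite lerXn2r ?nnegrE ?sqrtr_ge0//; [lra|rewrite lerNl; exact: s01].
  lra.
have hv : GG m r1 sa1 <= GG m r1 sa1 + pi <= GG m r1 S by have := pi_ge0 R; lra.
have [s1 /andP[s11 _] es1] := ivt (ltW sa1S) (fun x _ => der_cont (dG vM h1 x)) hv.
have eT : GG m r2 s2 - GG m r2 sa2 = GG m r1 s1 - GG m r1 sa1 by rewrite eG2 es1; ring.
have hT : 0 < GG m r2 s2 - GG m r2 sa2 <= pi by rewrite eG2 pi_gt0 lexx.
have := noncross_lt vM dh h2 h1 sa2s2 s11 ea eT hT sl.
rewrite eG2 eqxx /= => hle.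
have rb : r1 + s1 ^+ 2 <= b.
  rewrite leNgt; apply/negP => lt; move: hle; rewrite c1 leNgt => /negP; apply.
  by apply: (h_decr vM dh) => //; have := Reg_gt0 h2; lra.
have s10 : 0 <= s1.
  rewrite leNgt; apply/negP => s1n; have := G_lt vM h1 s1n; rewrite G0 es1 a4; lra.
have : GG m r1 s1 <= Tau r1 b.
  apply: (G_le vM h1); rewrite -[leLHS]ger0_norm// -sqrtr_sqr; apply: ler_wsqrtr; lra.
by rewrite es1 a4; lra.
Qed.

(** If the arc turned by more than [pi], it would meet the opposite meridian at some radius [b'],
    after a length at most [a + b'] by [turn_mono] and [Phi_le_sum]. It meets the meridian at a
    nonzero angle, and cutting this corner contradicts the minimality of the meridian up to
    [b' + 1]. *)
Lemma Tau_pole r0 a b th : Reg r0 -> 0 < a -> pole m (pol a th) -> r0 <= a -> r0 <= b ->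
  0 < h r0 + h (Num.max a b) + 2 * k0 -> Tau r0 a + Tau r0 b <= pi.
Proof.
move=> hr0 a0 hpole r0a r0b hp; rewrite leNgt; apply/negP => hlt.
have r00 := Reg_gt0 hr0; have b0 : 0 < b by lra.
have ma : a <= Num.max a b by rewrite le_max lexx.
have ltpi r : 0 < r -> r <= r0 -> Tau r a < pi.
  move=> rp rr0; apply: Tau_lt_pi; [exact: (Reg_lt vM hr0)|lra|].
  have := h_le vM dh rp rr0; have := h_le vM dh a0 ma; lra.
have [a1 a2 a3 a4 a5] := arc_sqrt vM hr0 r0a; have [b1 _ _ _ _] := arc_sqrt vM hr0 r0b.
pose sa := - Num.sqrt (a - r0).
have sas : sa <= Num.sqrt (b - r0) by apply: (@le_trans _ _ 0); rewrite ?sqrtr_ge0// oppr_le0 sqrtr_ge0.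
have hv : GG m r0 sa <= GG m r0 sa + pi <= GG m r0 (Num.sqrt (b - r0)).
  by have := pi_ge0 R; rewrite a4 -/(Tau r0 b); lra.
have [s /andP[sas' sb] es] := ivt sas (fun x _ => der_cont (dG vM hr0 x)) hv.
have s0 : 0 <= s.
  rewrite leNgt; apply/negP => sn; have := G_lt vM hr0 sn; rewrite G0 es a4.
  have := ltpi r0 r00 (lexx r0); lra.
pose b' := r0 + s ^+ 2.
have r0b' : r0 <= b' by rewrite lerDl sqr_ge0.
have b'b : b' <= b by rewrite -[leRHS]b1 lerD2l lerXn2r// nnegrE sqrtr_ge0.
have sE : Num.sqrt (b' - r0) = s by rewrite /b' addrC addKr sqrtr_sqr ger0_norm.
have Tb' : Tau r0 b' = GG m r0 s by rewrite /Tau sE.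
have tot : Tau r0 a + Tau r0 b' = pi by rewrite Tb' es a4; ring.
have hT r : 0 < r -> r <= r0 -> pi <= Tau r a + Tau r b'.
  move=> rp; rewrite le_eqVlt => /predU1P[->|rr0]; first by rewrite tot.
  have hr := Reg_lt vM hr0 rp (ltW rr0).
  by apply: (turn_mono hr hr0) => //; apply: ltpi => //; exact: ltW.
have hPhi := Phi_le_sum vM hr0 r0a r0b' hr0 (lexx r0) hT.
have [_ _ b3 _ _] := arc_sqrt vM hr0 r0b'; rewrite sE in b3.
have LE : TT m r0 s - TT m r0 sa = Phi m a b' pi r0.
  by rewrite b3 a5 /Phi -tot; ring.
have sas'' : sa < s.
  rewrite lt_neqAle sas' andbT; apply/eqP => e; move: es; rewrite -e.
  by have := pi_gt0 R; lra.
have h11 : (1 : R) ^+ 2 = 1 by rewrite expr1n.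
have [C C0 hC] := arc_spread vM th hr0 sas'' h11.
have dE : dist m (pol a th) (pol (b' + 1) (th + pi)) = a + (b' + 1).
  by apply: (pole_meridian vM) => //; lra.
have c0 := c_gt0 vM hr0.
have b'0 : 0 < b' by lra. have bb : b' < b' + 1 by lra.
pose H := h b' - h (b' + 1). have H0 : 0 < H by rewrite subr_gt0 (h_decr vM dh).
pose K := C + 1 / (2 * H). have K0 : 0 < K by rewrite ltr_wpDl// divr_gt0// mulr_gt0.
(* Stopping short by the angle [d] saves [m r0 * d], and all second-order costs amount to
   [K * d ^+ 2]; this [d] is the optimum. *)
pose d := m r0 / (2 * K). have d0 : 0 < d by rewrite divr_gt0// mulr_gt0.
have := hC (- d); rewrite a2 -/b' es.
have -> : th + 1 * (GG m r0 sa + pi - GG m r0 sa) + - d = th + pi - d by ring.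
rewrite LE => t1.
have := spiral_le vM dh (th + pi - d) d b'0 bb; rewrite subrK => t2.
have := dist_triangle vM (pol a th) (pol b' (th + pi - d)) (pol (b' + 1) (th + pi)).
rewrite dE => t3.
have : 0 <= - (m r0 * d) + K * d ^+ 2.
  rewrite sqrrN in t1.
  have e3 : K * d ^+ 2 = C * d ^+ 2 + d ^+ 2 / (2 * H) by rewrite /K; field; rewrite gt_eqF.
  by rewrite e3; move: t1 t2 t3 hPhi; rewrite -/H; hlra.
have -> : - (m r0 * d) + K * d ^+ 2 = - (m r0 * d / 2) by rewrite /d; field; rewrite gt_eqF.
by rewrite oppr_ge0 leNgt divr_gt0// mulr_gt0.
Qed.

Lemma xcos_le_sin x : 0 <= x -> x <= pi -> x * cos x <= sin x.
Proof.
move=> x0 xpi; have dS (y : R) : is_derive y (1 : R) (fun y : R => sin y - y * cos y) (y * sin y).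
  by der; ring.
have : sin 0 - 0 * cos 0 <= sin x - x * cos x.
  apply: (ndecr_der (f := fun y : R => sin y - y * cos y) x0 (fun t _ => der_cont (dS t)) (fun t _ => dS t)) => t ht.
  by rewrite mulr_ge0 ?sin_ge0_pi//; lra.
by rewrite sin0 mul0r subr0 subr_ge0.
Qed.

Lemma Tau_lower rho x y : Reg rho -> rho < x -> x <= y -> m rho * (h x - h y) <= Tau rho y - Tau rho x.
Proof.
move=> hr rx xy; have c0 := c_gt0 vM hr; have r0 := Reg_gt0 hr.
have : Tau rho x + m rho * h x <= Tau rho y + m rho * h y.
  apply: (ndecr_der (f := fun t => Tau rho t + m rho * h t)
    (df := fun t => m rho / (m t ^+ 2 * psi m rho t) + m rho * - (m t ^- 2)) xy) => t ht.
  - have t0 : 0 < t by lra.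
    have g1 := @Tau_cont _ _ vM rho (or_intror hr); have g2 := der_cont (dh t0); by cont.
  - have t0 : 0 < t by lra. have rt : rho < t by lra.
    by have g1 := Tau_der vM (or_intror hr) rt; have g2 := dh t0; der; ring.
  have t0 : 0 < t by lra. have rt : rho < t by lra.
  have p0 := psi_gt0 vM (or_intror hr) rt; have p1 := psi_le1 m rho t; have mt := m_gt0 vM t0.
  have -> : m rho / (m t ^+ 2 * psi m rho t) + m rho * - (m t ^- 2) =
    m rho * (1 - psi m rho t) / (m t ^+ 2 * psi m rho t) by field; rewrite !gt_eqF.
  apply: divr_ge0; apply: mulr_ge0; [exact: ltW|by rewrite subr_ge0|exact: sqr_ge0|exact: ltW].
rewrite mulrBr; lra.
Qed.

(** Up to radius [r] one has [k <= k r], hence [(u + k r)'' + (u + k r) >= 0]. Then [sturm_cot]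
    bounds the tangent of the missing angle [f = pi / 2 - Tau] by [m rho * (h r + k r) / psi], and
    [f <= tan f]. *)
Lemma vertex_turn rho r : Reg rho -> rho < r -> 0 <= h r + k r ->
  pi / 2 - m rho * (h r + k r) / psi m rho r <= Tau rho r.
Proof.
move=> hr rr Q0; have c0 := c_gt0 vM hr; have rho0 := Reg_gt0 hr.
have r0 : 0 < r by lra.
have p0 := psi_gt0 vM (or_intror hr) rr.
set Q := h r + k r in Q0 *.
have cQ : 0 <= m rho * Q / psi m rho r by rewrite divr_ge0 ?mulr_ge0 ?(ltW c0) ?(ltW p0).
have [tp|/ltW tp] := leP (pi / 2) (Tau rho r); first lra.
have t0 : 0 <= Tau rho r by apply: (Tau_ge0 vM (or_intror hr)); exact: ltW.
have s0 := sqrtr_ge0 (r - rho).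
have [sx [U [V [e0 e1 H]]]] := arc_u vM dh hr s0.
rewrite G0 subr0 -/(Tau rho r) in e1 H.
have [rE _ _ _ _] := arc_sqrt vM hr (ltW rr).
have hTT : 0 <= Tau rho r <= Tau rho r by rewrite lexx t0.
have h00 : 0 <= (0 : R) <= Tau rho r by rewrite lexx t0.
have V0 : V 0 = 0 by have [_ _ -> _ _] := H _ h00; rewrite e0 mul0r oppr0 mul0r.
have UT : U (Tau rho r) = h r by have [_ -> _ _ _] := H _ hTT; rewrite e1 rE.
have VT : V (Tau rho r) = - (psi m rho r / m rho).
  have [_ _ -> _ _] := H _ hTT; rewrite e1 rE; have := psi_rr vM hr s0; rewrite rE => ->.
  by field; rewrite !gt_eqF// (m_gt0 vM).
have : V 0 <= (U (Tau rho r) + k r) * sin (Tau rho r) + V (Tau rho r) * cos (Tau rho r).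
  apply: (@sturm_cot R (fun x => U x + k r) V (fun x => - (U x + k (rho + sx x ^+ 2)))) => [|x hx|x hx|x hx].
  - by rewrite t0.
  - by have [_ _ _ g _] := H x hx; der; rewrite addr0.
  - by have [] := H x hx.
  - have hx' : 0 <= x <= Tau rho r by lra.
    have [/andP[g1 g2] _ _ _ _] := H x hx'.
    have : k (rho + sx x ^+ 2) <= k r.
      apply: (kk_ndecr vM dh); first exact: (rr_gt0 hr).
      by rewrite -[leRHS]rE lerD2l lerXn2r// nnegrE.
    lra.
rewrite V0 UT VT -/Q mulNr subr_ge0 => hle.
pose f := pi / 2 - Tau rho r; have f0 : 0 <= f by rewrite subr_ge0.
have tE : Tau rho r = pi / 2 - f by rewrite /f; ring.
have pp := pi_gt0 R.
have fpi : f <= pi / 2 by rewrite /f; lra.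
rewrite tE in hle.
have eS : sin (pi / 2 - f) = cos f by rewrite sinB sin_pihalf cos_pihalf mul1r mul0r subr0.
have eC : cos (pi / 2 - f) = sin f by rewrite cosB sin_pihalf cos_pihalf mul0r mul1r add0r.
rewrite eS eC in hle.
have hx := xcos_le_sin f0; have {}hx : f * cos f <= sin f by apply: hx; lra.
suff : f <= m rho * Q / psi m rho r by rewrite /f; lra.
rewrite ler_pdivlMr//.
have [fE|fn] := eqVneq f (pi / 2).
  exfalso; move: hle; rewrite fE cos_pihalf sin_pihalf mulr0 mulr1 leNgt divr_gt0//.
have cf : 0 < cos f by apply: cos_gt0_pihalf; apply/andP; split; [lra|rewrite lt_neqAle fn fpi].
rewrite -(ler_pM2r cf).
have : psi m rho r * (f * cos f) <= psi m rho r * sin f by rewrite ler_pM2l.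
have : psi m rho r * sin f <= m rho * (Q * cos f).
  by rewrite -ler_pdivrMl// mulrA [_^-1 * _]mulrC.
by hnra.
Qed.

(** For vertex radius [rho] near 0, [vertex_turn] up to [rN] and [Tau_lower] beyond bound the total
    turning below by [pi - m rho * (h a + h b + 2 * k rN)] up to [o(m rho)], while [Tau_pole] bounds
    it above by [pi]. Division by [m rho] gives the condition up to an error, as [k rN] is close to
    [k0]. *)
Lemma pole_cond a th : 0 < a -> pole m (pol a th) -> forall b, 0 < b -> 0 <= h a + h b + 2 * k0.
Proof.
move=> a0 hpole b b0.
have qn : pol a th != origin R by exact: pol_neq0.
have [rR hR] := fin_Reg vM dh (pole_fin vM dh qn hpole).
have rR0 := Reg_gt0 hR.
have [d1 d10 hd1] := h_unbounded vM dh (Num.max (- h (Num.max a b) - 2 * k0) (- k0)).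
apply/ler_addgt0Pr => e e0; have e2 : 0 < e / 4 by rewrite divr_gt0.
have [d2 d20 hd2] := k0_near e2.
pose rN := Num.min (Num.min rR d1) (Num.min d2 (Num.min a b)).
have rN0 : 0 < rN by rewrite !lt_min rR0 d10 d20 a0.
have rNR : rN <= rR by rewrite !ge_min lexx.
have rNd1 : rN <= d1 by rewrite !ge_min lexx !orbT.
have rNd2 : rN <= d2 by rewrite !ge_min lexx !orbT.
have rNa : rN <= a by rewrite !ge_min lexx !orbT.
have rNb : rN <= b by rewrite !ge_min lexx !orbT.
have hN := Reg_lt vM hR rN0 rNR.
have hr r : 0 < r -> r <= rN -> 0 < h r + h (Num.max a b) + 2 * k0 /\ - k0 < h r.
  move=> r0 rr; have := hd1 r r0 (le_trans rr rNd1); rewrite gt_max => /andP[]; lra.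
have kN := hd2 rN rN0 rNd2; have kN' := k0_le rN0.
have [_ hN0] := hr rN rN0 (lexx rN).
have mN := c_gt0 vM hN.
set Q := h rN + k rN; have Q0 : 0 <= Q by rewrite /Q; lra.
pose f r := 2 * Q / Num.sqrt (1 - (m r / m rN) ^+ 2).
have mc : continuous m := m_cont vM.
have cf : continuous_at 0 f.
  by rewrite /f; cont; rewrite (m_at0 vM) mul0r expr0n subr0 sqrtr1 oner_eq0.
have [rho /andP[rho0 rhoN]] := near_right cf rN0 e2.
rewrite {2}/f (m_at0 vM) mul0r expr0n subr0 sqrtr1 divr1 ltr_norml => /andP[_ hf].
have hrho := Reg_lt vM hN rho0 (ltW rhoN).
have [hp _] := hr rho rho0 (ltW rhoN).
have rhoa : rho <= a by lra. have rhob : rho <= b by lra.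
have T1 := Tau_pole hrho a0 hpole rhoa rhob hp.
have T2 := vertex_turn hrho rhoN Q0.
have T3 := Tau_lower hrho rhoN rNa; have T4 := Tau_lower hrho rhoN rNb.
have c0 := c_gt0 vM hrho.
have pE : psi m rho rN = Num.sqrt (1 - (m rho / m rN) ^+ 2).
  by rewrite /psi; have -> : Num.max rN rho = rN by apply/max_idPl/ltW.
have p0 := psi_gt0 vM (or_intror hrho) rhoN.
have : m rho * (2 * h rN - h a - h b) <= m rho * f rho.
  have -> : m rho * f rho = 2 * (m rho * Q / psi m rho rN) by rewrite /f pE; ring.
  by move: T1 T2 T3 T4; rewrite -/Q; hlra.
rewrite ler_pM2l// => T5; move: T5 hf; rewrite /Q; lra.
Qed.

(** The extra [- kap] on the last stretch of length [e], integrated against [sin (pi - x)], improves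
    the Sturm bound at [pi] by [kap * (1 - cos e)]. *)
Lemma sturm_gain (D D1 D2 : R -> R) (kap e : R) : 0 <= e -> e <= pi ->
  (forall x, 0 <= x <= pi -> is_derive x 1 D (D1 x)) ->
  (forall x, 0 <= x <= pi -> is_derive x 1 D1 (D2 x)) ->
  (forall x, 0 < x < pi -> D2 x + D x <= 0) ->
  (forall x, pi - e < x < pi -> D2 x + D x <= - kap) ->
  D1 0 = 0 -> D pi <= - D 0 - kap * (1 - cos e).
Proof.
move=> e0 epi h0 h1 h2 h3 D10; have pp := pi_gt0 R.
pose K x := D1 x * sin (pi - x) + D x * cos (pi - x).
have dK x : 0 <= x <= pi -> is_derive x 1 K ((D2 x + D x) * sin (pi - x)).
  by move=> hx; have g0 := h0 x hx; have g1 := h1 x hx; rewrite /K; der; ring.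
have pe : 0 <= pi - e by lra.
have k1 : - K 0 <= - K (pi - e).
  apply: (ndecr_der (f := fun x => - K x) (df := fun x => - ((D2 x + D x) * sin (pi - x))) pe) => x hx.
  - have hx' : 0 <= x <= pi by lra. have g := der_cont (dK x hx'); by cont.
  - have hx' : 0 <= x <= pi by lra. have g := dK x hx'; by der.
  - rewrite oppr_ge0 mulr_le0_ge0// ?h2 ?sin_ge0_pi//; lra.
have pe' : pi - e <= pi by lra.
have k2 : - K (pi - e) - kap * cos (pi - (pi - e)) <= - K pi - kap * cos (pi - pi).
  apply: (ndecr_der (f := fun x => - K x - kap * cos (pi - x)) (df := fun x => - ((D2 x + D x) * sin (pi - x)) - kap * sin (pi - x)) pe') => x hx.
  - have hx' : 0 <= x <= pi by lra. have g := der_cont (dK x hx'); by cont.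
  - have hx' : 0 <= x <= pi by lra. have g := dK x hx'; by der; ring.
  - have s0 : 0 <= sin (pi - x) by rewrite sin_ge0_pi//; lra.
    by have := h3 x hx; nra.
have E0 : K 0 = - D 0 by rewrite /K subr0 D10 mul0r add0r cospi mulrN1.
have Epi : K pi = D pi by rewrite /K subrr sin0 cos0 mulr0 add0r mulr1.
have ee : pi - (pi - e) = e by ring.
move: k1 k2; rewrite E0 Epi subrr cos0 ee; lra.
Qed.

(** Along an arc with Clairaut constant [c], [u'^2 = c^-2 - m^-2], so the quantity is [c^-2] minus
    the energy [u'^2 + (u + k0)^2], conserved if [k = k0]. Its derivative in the radius is
    [- 2 * m^-2 * (k - k0)]. *)
Lemma energy_mono r b : 0 < r -> r <= b ->
  m b ^- 2 - (h b + k0) ^+ 2 <= m r ^- 2 - (h r + k0) ^+ 2.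
Proof.
move=> r0 rb; rewrite -lerN2.
apply: (ndecr_der (f := fun x => - (m x ^- 2 - (h x + k0) ^+ 2)) (df := fun x => 2 * (m x ^- 2) * (k x - k0)) rb) => x hx.
- have x0 : 0 < x by lra. have mc : continuous m := m_cont vM.
  have g := der_cont (dh x0); by cont; rewrite gt_eqF// exprn_gt0// (m_gt0 vM).
- have x0 : 0 < x by lra. have g := dh x0; have g' := dm vM x; have mx := m_gt0 vM x0.
  der; first by rewrite expf_neq0// gt_eqF.
  by rewrite /kk; field; rewrite gt_eqF.
- have x0 : 0 < x by lra. have := k0_le x0 => kx.
  by rewrite !mulr_ge0 ?subr_ge0 ?invr_ge0 ?sqr_ge0.
Qed.

Lemma energy_gain r r1 r2 b : 0 < r -> r <= r1 -> r1 <= r2 -> r2 <= b ->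
  m b ^- 2 - (h b + k0) ^+ 2 + 2 * (k r1 - k0) * (h r1 - h r2) <= m r ^- 2 - (h r + k0) ^+ 2.
Proof.
move=> r0 rr1 r12 r2b; apply: le_trans (energy_mono r0 rr1).
have r10 : 0 < r1 by lra. have r20 : 0 < r2 by lra.
have := energy_mono r20 r2b.
suff : - (m r1 ^- 2 - (h r1 + k0) ^+ 2) + 2 * (k r1 - k0) * h r1 <= - (m r2 ^- 2 - (h r2 + k0) ^+ 2) + 2 * (k r1 - k0) * h r2.
  rewrite mulrBr; lra.
apply: (ndecr_der (f := fun x => - (m x ^- 2 - (h x + k0) ^+ 2) + 2 * (k r1 - k0) * h x) (df := fun x => 2 * (m x ^- 2) * (k x - k r1)) r12) => x hx.
- have x0 : 0 < x by lra. have mc : continuous m := m_cont vM.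
  have g := der_cont (dh x0); by cont; rewrite gt_eqF// exprn_gt0// (m_gt0 vM).
- have x0 : 0 < x by lra. have g := dh x0; have g' := dm vM x; have mx := m_gt0 vM x0.
  have kE : k x = m1 m x / m x - h x by [].
  der; first by rewrite expf_neq0// gt_eqF.
  by rewrite kE; field; rewrite gt_eqF.
- have xr1 : r1 <= x by lra. have := kk_ndecr vM dh r10 xr1 => kx.
  by rewrite !mulr_ge0 ?subr_ge0 ?invr_ge0 ?sqr_ge0.
Qed.

Lemma Reg_of_eta r : 0 < r -> 0 < h r + k0 -> (forall b, r < b -> (m b ^- 2 < m r ^- 2)) -> Reg r.
Proof.
move=> r0 er hb; have mr := m_gt0 vM r0; split=> // [x x0 xr|b rb].
  have mx := m_gt0 vM x0.
  have : 0 < m1 m x / m x by have := k0_le x0; have := h_le vM dh x0 xr; rewrite /kk; lra.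
  by rewrite pmulr_lgt0// invr_gt0.
have mb : 0 < m b by apply: (m_gt0 vM); lra.
by have := hb b rb; rewrite ltf_pV2 ?posrE ?exprn_gt0// ltr_pXn2r ?nnegrE ?(ltW mr) ?(ltW mb).
Qed.

Definition good r := Reg r /\ forall s, 0 <= s -> GG m r s < pi.

(** From [h b < h r] and the positive sum, [(h b + k0)^2 < (h r + k0)^2], which [energy_mono] turns
    into [m r < m b]; the turning is then bounded by [turn_lt]. *)
Lemma good_strict r : 0 < r -> (forall b, r <= b -> 0 < h r + h b + 2 * k0) -> good r.
Proof.
move=> r0 hb; have er : 0 < h r + k0 by have := hb r (lexx r); lra.
have hr : Reg r.
  apply: Reg_of_eta => // b rb; have := energy_mono r0 (ltW rb).
  have := hb b (ltW rb); have := h_decr vM dh r0 rb; nra.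
split=> // s s0; have := turn_lt vM dh k0_le hr s0; rewrite G0 subr0; apply=> t ht.
rewrite expr0n addr0; apply: hb; by rewrite lerDl sqr_ge0.
Qed.

(* The pole condition at [a] extends strictly beyond [a]: either the curvature is constant
   and there is no obstruction, or the monotonicity of [k] gains a definite amount. *)
Lemma good_beyond a : 0 < a -> (forall b, 0 < b -> 0 <= h a + h b + 2 * k0) ->
  exists2 a', a < a' & forall r, 0 < r -> r <= a' -> good r.
Proof.
move=> a0 hNC.
(* The condition at [b + 1] makes it strict at [b], as [h] decreases strictly. *)
have strict b : 0 < b -> 0 < h a + h b + 2 * k0.
  move=> b0; have b1 : 0 < b + 1 by lra. have bb : b < b + 1 by lra.
  have := hNC _ b1; have := h_decr vM dh b0 bb; lra.
have goodle r : 0 < r -> r <= a -> good r.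
  move=> r0 ra; apply: good_strict => // b rb; have b0 : 0 < b by lra.
  have := strict b b0; have := h_le vM dh r0 ra; lra.
have ea : 0 < h a + k0 by have := strict a a0; lra.
have [[r1' r10' kr1']|kcst] := pselect (exists2 r1, 0 < r1 & k0 < k r1); last first.
  have kE x : 0 < x -> k x = k0.
    move=> x0; apply/eqP; rewrite eq_le k0_le// andbT leNgt; apply/negP => hx.
    by apply: kcst; exists x.
  (* With [k] constant, [h + k0 = m1 / m]. If this became negative, [m] would stay bounded and [h]
     would fall without bound, against the condition at [a]. So every radius is good, and [a + 1]
     below is an arbitrary choice. *)
  have eta x : 0 < x -> 0 < h x + k0.
    move=> x0; rewrite ltNge; apply/negP => ex.
    pose y := x + 1; have y0 : 0 < y by rewrite /y; lra.
    have ey : h y + k0 < 0.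
      have xy : x < y by rewrite /y; lra. have := h_decr vM dh x0 xy; lra.
    have my := m_gt0 vM y0.
    have mle z : y <= z -> m z <= m y.
      move=> yz; rewrite -lerN2.
      have dmN t : is_derive t 1 (fun t => - m t) (- m1 m t) by have g := dm vM t; der.
      apply: (ndecr_der (f := fun t => - m t) yz (fun t _ => der_cont (dmN t)) (fun t _ => dmN t)) => t ht.
      have t0 : 0 < t by lra. have yt : y <= t by lra. have mt := m_gt0 vM t0.
      have : m1 m t / m t <= 0 by have := kE t t0; have := h_le vM dh y0 yt; rewrite /kk; lra.
      by rewrite pmulr_lle0 ?invr_gt0// oppr_ge0.
    pose q := m y ^- 2; have q0 : 0 < q by rewrite invr_gt0 exprn_gt0.
    pose z := y + (`|h y + h a + 2 * k0| + 1) / q.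
    have yz : y <= z by rewrite lerDl divr_ge0 ?addr_ge0// ltW.
    have z0 : 0 < z by lra.
    have : - h y - q * y <= - h z - q * z.
      apply: (ndecr_der (f := fun t => - h t - q * t) (df := fun t => m t ^- 2 - q) yz) => t ht.
      + have t0 : 0 < t by lra. have g := der_cont (dh t0); by cont.
      + have t0 : 0 < t by lra. have g := dh t0; by der; ring.
      + have t0 : 0 < t by lra.
        rewrite subr_ge0 /q lef_pV2 ?posrE ?exprn_gt0 ?(m_gt0 vM)//.
        by rewrite lerXn2r ?nnegrE ?(ltW (m_gt0 vM _))// mle//; lra.
    have e : q * z = q * y + (`|h y + h a + 2 * k0| + 1) by rewrite /z mulrDr; congr (_ + _); field; rewrite gt_eqF.
    have := strict z z0; have := ler_norm (h y + h a + 2 * k0); lra.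
  exists (a + 1) => [|r r0 _]; first lra.
  apply: good_strict => // b rb; have b0 : 0 < b by lra.
  have := eta r r0; have := eta b b0; lra.
pose r1 := Num.max r1' (a + 1); pose r2 := r1 + 1.
have r1a : a + 1 <= r1 by rewrite le_max lexx orbT.
have r10 : 0 < r1 by lra.
have kr1 : k0 < k r1 by apply: lt_le_trans kr1' _; apply: (kk_ndecr vM dh) => //; rewrite le_max lexx.
have r20 : 0 < r2 by rewrite /r2; lra.
have r12 : r1 < r2 by rewrite /r2; lra.
pose kap := k r1 - k0; have kap0 : 0 < kap by rewrite subr_gt0.
pose g1 := h a + h r1 + 2 * k0; have g10 : 0 < g1 by exact: strict.
pose g2 := h a + h r2 + 2 * k0; have g20 : 0 < g2 by exact: strict.
have hd12 : 0 < h r1 - h r2 by rewrite subr_gt0 (h_decr vM dh).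
(* [e] is so small that an arc turned by more than [pi - e] has passed the radius [r1], beyond which
   [k - k0 >= kap]. *)
have [e [e0 ehalf ce]] : exists e : R, [/\ 0 < e, e < pi / 2 & (1 - cos e) * (h a + k0) < g1 / 2].
  have pp := pi_gt0 R; have p2 : 0 < pi / 2 :> R by lra.
  have cc : continuous_at (0 : R) (fun e : R => (1 - cos e) * (h a + k0)) by cont.
  have gh : 0 < g1 / 2 by rewrite divr_gt0.
  have [e /andP[e0 ep]] := near_right cc p2 gh.
  rewrite cos0 subrr mul0r subr0 => /(le_lt_trans (ler_norm _)) he.
  by exists e.
have ce1 : cos e < 1.
  have pp := pi_gt0 R.
  have i1 : e \in `[0, pi] by rewrite in_itv /=; apply/andP; split; [exact: ltW|clear ce; lra].
  have i2 : (0 : R) \in `[0, pi] by rewrite in_itv /= lexx ltW.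
  by have := ltr_cos i2 i1; rewrite cos0 => ->.
(* Allowed drop of [h] from [a] to [a']. In order, the entries preserve [h r + k0 > 0], the strict
   condition at [r2], half of the margin at [r1], and keep the loss below the gains of [sturm_gain]
   and of [energy_gain]. *)
pose bd := Num.min (Num.min (h a + k0) g2) (Num.min (g1 / 2) (Num.min (kap * (1 - cos e)) (2 * kap * (h r1 - h r2) / (2 * (h a + k0))))).
have bd0 : 0 < bd.
  rewrite !lt_min ea g20 divr_gt0//= mulr_gt0 ?subr_gt0//= divr_gt0// !mulr_gt0//.
have ch : continuous_at a h by exact: der_cont (dh a0).
have a1 : a < a + 1 by lra.
have [a' /andP[aa' a'1] hbd] := near_right ch a1 bd0.
have {}hbd : h a - h a' < bd by move: hbd; rewrite distrC => /(le_lt_trans (ler_norm _)).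
exists a' => // r r0 ra'.
have [ra|ar] := leP r a; first exact: goodle.
have hra : h r < h a by apply: (h_decr vM dh).
have hr' : h a - h r < bd by have := h_le vM dh r0 ra'; lra.
move: hr'; rewrite !lt_min => /andP[/andP[b1 b2] /andP[b3 /andP[b4 b5]]].
have er : 0 < h r + k0 by lra.
have rr1 : r <= r1 by lra.
have sq : (h a + k0) ^+ 2 - (h r + k0) ^+ 2 < 2 * kap * (h r1 - h r2).
  have -> : (h a + k0) ^+ 2 - (h r + k0) ^+ 2 = (h a - h r) * ((h a + k0) + (h r + k0)) by ring.
  move: b5; rewrite ltr_pdivlMr ?mulr_gt0// => b5; apply: le_lt_trans b5.
  by rewrite ler_wpM2l ?subr_ge0 ?(ltW hra)//; lra.
have hR : Reg r.
  apply: Reg_of_eta => // b rb; have b0 : 0 < b by lra.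
  have hb := h_decr vM dh r0 rb; have sb := strict b b0.
  (* Radii up to [r2] are handled by the strict condition, those beyond by the energy gained between
     [r1] and [r2]. *)
  have [br2|r2b] := leP b r2.
    have := energy_mono r0 (ltW rb); have := h_le vM dh b0 br2.
    rewrite /g2 in b2; nra.
  have := energy_gain r0 rr1 (ltW r12) (ltW r2b); rewrite -/kap.
  have [eb|eb] := leP 0 (h b + k0).
    have : (h b + k0) ^+ 2 <= (h r + k0) ^+ 2 by rewrite lerXn2r ?nnegrE//; lra.
    have : 0 < 2 * kap * (h r1 - h r2) by rewrite !mulr_gt0.
    lra.
  have : (h b + k0) ^+ 2 < (h a + k0) ^+ 2 by rewrite -sqrrN ltrXn2r ?nnegrE//; lra.
  lra.
split=> // s s0; rewrite ltNge; apply/negP => hpi.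
have hv : GG m r 0 <= pi <= GG m r s by rewrite G0 pi_ge0.
have [z /andP[z0 zs] ez] := ivt s0 (fun x _ => der_cont (dG vM hR x)) hv.
have [sx [U [V [e1 e2 H]]]] := arc_u vM dh hR z0.
rewrite G0 subr0 ez in e2 H.
have hpp : 0 <= (pi : R) <= pi by rewrite pi_ge0 lexx.
have h00 : 0 <= (0 : R) <= pi by rewrite lexx pi_ge0.
have V0 : V 0 = 0 by have [_ _ -> _ _] := H _ h00; rewrite e1 mul0r oppr0 mul0r.
have U0 : U 0 = h r by have [_ -> _ _ _] := H _ h00; rewrite e1 expr0n addr0.
have dD x : 0 <= x <= pi -> is_derive x 1 (fun x => U x + k0) (V x).
  by move=> hx; have [_ _ _ g _] := H x hx; der; rewrite addr0.
have dD1 x : 0 <= x <= pi -> is_derive x 1 V (- (U x + k (r + sx x ^+ 2))).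
  by move=> hx; have [] := H x hx.
have hD2 x : 0 < x < pi -> - (U x + k (r + sx x ^+ 2)) + (U x + k0) <= 0.
  by move=> hx; have := k0_le (rr_gt0 hR (sx x)); lra.
have low x : 0 <= x -> x <= pi -> U x + k0 <= (h r + k0) * cos x.
  move=> x0 xpi; have hx : 0 <= x <= pi by rewrite x0.
  have := @sturm_le R (fun x => U x + k0) V (fun x => - (U x + k (r + sx x ^+ 2))) x hx.
  rewrite U0 V0 mul0r addr0; apply=> y hy; [apply: dD|apply: dD1|apply: hD2]; lra.
have gain : U pi + k0 <= - (h r + k0) - kap * (1 - cos e).
  rewrite -U0; apply: (@sturm_gain (fun x => U x + k0) V (fun x => - (U x + k (r + sx x ^+ 2))) kap e) => //.
  - exact: ltW.
  - by have := pi_gt0 R; lra.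
  - move=> x hx; have x0 : 0 <= x by have := pi_gt0 R; lra.
    have xpi : x <= pi by lra.
    have hx' : 0 <= x <= pi by rewrite x0.
    have l := low x x0 xpi.
    have cx : cos x <= - cos e.
      have -> : - cos e = cos (pi - e) by rewrite cosB cospi sinpi mulN1r mul0r addr0.
      have pp := pi_gt0 R.
      have i1 : x \in `[0, pi] by rewrite in_itv /= x0.
      have i2 : pi - e \in `[0, pi] by rewrite in_itv /=; apply/andP; split; hlra.
      by have := ltr_cos i2 i1; have /andP[g _] := hx; rewrite g => /ltW.
    have : U x + k0 < h r1 + k0.
      apply: le_lt_trans l _; apply: (@le_lt_trans _ _ ((h r + k0) * - cos e)); first by rewrite ler_pM2l.
      have : (h r + k0) * (1 - cos e) <= (h a + k0) * (1 - cos e) by rewrite ler_wpM2r ?subr_ge0 ?(ltW ce1)//; lra.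
      rewrite /g1 in ce b3; lra.
    rewrite ltrD2r; have [_ -> _ _ _] := H x hx'.
    move=> /(h_inj_lt vM dh (rr_gt0 hR _) r10)/ltW/(kk_ndecr vM dh r10).
    rewrite /kap; lra.
have := strict (r + sx pi ^+ 2) (rr_gt0 hR _).
have [_ <- _ _ _] := H pi hpp.
lra.
Qed.

End PoleCondition.

(** * Unique continuation of minimizers *)

Section NoBranch.
Variables (R : realType) (m : R -> R).
Hypothesis vM : von_Mangoldt m.
Notation pt := (R * R)%type.
Implicit Types (s t x y : R) (p q : pt).

Lemma trig_lip x y : `|cos x - cos y| <= `|x - y| /\ `|sin x - sin y| <= `|x - y|.
Proof.
wlog xy : x y / x < y => [hw|].
  case: (ltgtP x y) => [/hw//|/hw|->]; last by rewrite !subrr.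
  by rewrite [`|cos x - _|]distrC [`|sin x - _|]distrC [`|x - _|]distrC.
have dc (t : R) : is_derive t (1 : R) (fun t : R => cos t) (- sin t) by der; ring.
have ds (t : R) : is_derive t (1 : R) (fun t : R => sin t) (cos t) by der; ring.
have [z1 _ e1] := mvt xy (fun t _ => der_cont (dc t)) (fun t _ => dc t).
have [z2 _ e2] := mvt xy (fun t _ => der_cont (ds t)) (fun t _ => ds t).
have b1 : `|- sin z1| <= 1 by rewrite normrN ler_norml sin_geN1 sin_le1.
have b2 : `|cos z2| <= 1 by rewrite ler_norml cos_geN1 cos_le1.
rewrite [`|cos x - _|]distrC [`|sin x - _|]distrC [`|x - _|]distrC e1 e2 !normrM.
by split; rewrite ler_piMl.
Qed.

(** Between two directions at angle [vt] on the circle of radius [a], a curve either leaves the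
    annulus of half-width [a / 2], which costs at least [a / 2], or is calibrated by a multiple of
    [theta] and costs at least [m x0 * vt]. *)
Lemma dist_eq0 p q : dist m p q = 0 -> p = q.
Proof.
move=> d0; have rpq : rad q = rad p.
  by have := rad_dist vM p q; rewrite d0 normr_le0 subr_eq0 => /eqP.
have [rz|rn] := eqVneq (rad p) 0.
  have : rad q = 0 by rewrite rpq.
  by move/eqP; rewrite rad_eq0 => /eqP ->; move/eqP: rz; rewrite rad_eq0 => /eqP ->.
have r0 : 0 < rad p by rewrite lt_def rn rad_ge0.
set a := rad p in rpq r0.
have [th0 e0] := pol_ex p; have [th1 e1] := pol_ex q; rewrite rpq in e1; rewrite -/a in e0.
have [vt /andP[v0 vpi] ec] := cos_pi_ex (th1 - th0).
have [vt0|vtn] := eqVneq vt 0.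
  have c1 : cos (th1 - th0) = 1 by rewrite ec vt0 cos0.
  have s1 : sin (th1 - th0) = 0.
    by apply/eqP; rewrite -sqrf_eq0 sin2cos2 c1 expr1n subrr.
  have c01 : cos th1 = cos th0 by rewrite -(subrK th0 th1) cosD c1 s1 mul1r mul0r subr0.
  have s01 : sin th1 = sin th0 by rewrite -(subrK th0 th1) sinD c1 s1 mul1r mul0r add0r.
  by rewrite e0 e1 /pol c01 s01.
have vtp : 0 < vt by rewrite lt_def vtn.
exfalso; have mc : continuous m := m_cont vM.
have hab : a / 2 <= a * 2 by lra.
have [x0 hx0 hmin] := evt_min hab (fun x _ => mc x).
have k0 : 0 < m x0 by apply: (m_gt0 vM); lra.
pose l := Num.min (a / 2) (m x0 * vt).
have l0 : 0 < l by rewrite lt_min divr_gt0 ?mulr_gt0.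
suff : l <= dist m p q by rewrite d0; lra.
apply: (dist_ge vM) => c cc c0 c1.
have [[t ht hr]|hsm] := pselect (exists2 t, 0 <= t <= 1 & a / 2 < `|rad (c t) - a|).
  have := rad_curve vM cc ht; rewrite c0 -/a; have := normr_ge0 (rad (c 1) - rad (c t)).
  have : l <= a / 2 by rewrite ge_min lexx.
  by hlra.
have {}hsm t : 0 <= t <= 1 -> a / 2 <= rad (c t) <= a * 2.
  move=> ht; have : `|rad (c t) - a| <= a / 2 by rewrite leNgt; apply/negP => hr; apply: hsm; exists t.
  rewrite ler_norml; lra.
have rp t : 0 <= t <= 1 -> 0 < rad (c t) by move/hsm; lra.
have cn t : 0 <= t <= 1 -> c t != origin R by move=> /rp; rewrite rad_gt0.
have [th [dr [dth hl]]] := polar_lift m cc cn.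
have {}hl : is_lift m c th dr dth := hl.
have [S [dS ->]] := clength_primitive vM cc.
have h00 : 0 <= (0 : R) <= 1 by rewrite lexx ler01.
have h11 : 0 <= (1 : R) <= 1 by rewrite lexx ler01.
have hth : vt <= `|th 1 - th 0|.
  apply: angle_le; first by rewrite v0.
  have [f0 _ _ _] := hl _ h00; have [f1 _ _ _] := hl _ h11.
  rewrite c0 -/a {1}e0 in f0; rewrite c1 rpq {1}e1 in f1.
  have [_ ec0 es0] := pol_angle r0 r0 f0; have [_ ec1 es1] := pol_angle r0 r0 f1.
  by rewrite -ec !cosB ec0 es0 ec1 es1.
have key ep : ep ^+ 2 = 1 -> ep * m x0 * (th 1 - th 0) <= S 1 - S 0.
  move=> hep; have := @calib_seg R m vM c th dr dth S (fun=> 0) (fun=> 0) (ep * m x0) 0 1 hl (lexx 0) ler01 (lexx 1).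
  rewrite subrr addr0; apply=> // t ht; split; first exact: der_cst.
  have mr := m_gt0 vM (rp t ht).
  rewrite expr0n addr0 expr_div_n exprMn hep mul1r ler_pdivrMr ?exprn_gt0// mul1r.
  by rewrite lerXn2r ?nnegrE ?(ltW k0) ?(ltW mr)//; apply: hmin; exact: hsm.
have lm : l <= m x0 * `|th 1 - th 0|.
  by apply: (@le_trans _ _ (m x0 * vt)); [rewrite ge_min lexx orbT|rewrite ler_pM2l].
apply: le_trans lm _; have [h|h] := leP 0 (th 1 - th 0).
  by have := key 1; rewrite expr1n mul1r ger0_norm//; apply.
by have := key (-1); rewrite sqrrN expr1n mulN1r ltr0_norm// mulrN -mulNr; apply.
Qed.

Definition minimizing (g : R -> pt) (a b : R) := forall s1 s2, a <= s1 <= b -> a <= s2 <= b ->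
  dist m (g s1) (g s2) = `|s1 - s2|.

Section Strip.
Variables (c r0 d : R).
Hypotheses (d0 : 0 < d) (dr0 : d < r0) (hm : forall x, r0 - d <= x <= r0 + d -> `|c| < m x).

(** The annulus contains no vertex for the signed Clairaut constant [c], so the radius is a
    coordinate along its arcs. The clamp extends everything continuously to the line; [J], [G] and
    [T] below are the radial calibration, the angle and the time as functions of the radius. *)
Let cl x := Num.max (r0 - d) (Num.min x (r0 + d)).
Let M x := m (cl x).
Let ps x := Num.sqrt (1 - (c / M x) ^+ 2).

Let cl_in x : r0 - d <= cl x <= r0 + d.
Proof.
have dd := d0; rewrite /cl le_max lexx /= ge_max ge_min lexx orbT andbT; lra.
Qed.

Let clE x : r0 - d <= x <= r0 + d -> cl x = x.
Proof. by move=> /andP[h1 h2]; rewrite /cl min_l// max_r. Qed.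

Let M_gt x : `|c| < M x. Proof. exact: hm (cl_in x). Qed.

Let M_gt0 x : 0 < M x. Proof. exact: le_lt_trans (normr_ge0 c) (M_gt x). Qed.

Let q_lt1 x : (c / M x) ^+ 2 < 1.
Proof.
rewrite -real_normK ?num_real// expr_lt1// normrM normfV (gtr0_norm (M_gt0 x)).
by rewrite ltr_pdivrMr// mul1r.
Qed.

Let ps_gt0 x : 0 < ps x. Proof. by rewrite sqrtr_gt0 subr_gt0. Qed.
Let ps_le1 x : ps x <= 1. Proof. by rewrite -[leRHS]sqrtr1 ler_sqrt// gerBl sqr_ge0. Qed.
Let ps_sqr x : ps x ^+ 2 = 1 - (c / M x) ^+ 2. Proof. by rewrite sqr_sqrtr// subr_ge0 ltW. Qed.

Let cl_cont : continuous cl.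
Proof.
move=> x; rewrite /cl; have -> : (fun x => Num.max (r0 - d) (Num.min x (r0 + d))) =
   (fun x => Num.max (r0 - d) (- Num.max (- x) (- (r0 + d)))).
  by apply/funext => y; rewrite oppr_max !opprK.
by cont.
Qed.

Let M_cont : continuous M.
Proof. by move=> x; have mc : continuous m := m_cont vM; apply: (@cont_comp R m cl); [exact: mc|exact: cl_cont]. Qed.

Let ps_cont : continuous ps.
Proof. by have h := M_cont; rewrite /ps; cont; rewrite gt_eqF. Qed.

Let J := prim ps.
Let G := prim (fun x => c / (M x ^+ 2 * ps x)).
Let T := prim (fun x => (ps x)^-1).

Let gc : continuous (fun x => c / (M x ^+ 2 * ps x)).
Proof.
have h := M_cont; have h' := ps_cont => x; cont.
by rewrite mulf_neq0 ?expf_neq0// gt_eqF.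
Qed.

Let tc : continuous (fun x => (ps x)^-1).
Proof. by have h' := ps_cont => x; cont; rewrite gt_eqF. Qed.

Let dJ x : is_derive x 1 J (ps x). Proof. exact: dprim. Qed.
Let dG x : is_derive x 1 G (c / (M x ^+ 2 * ps x)). Proof. exact: (dprim x gc). Qed.
Let dT x : is_derive x 1 T (ps x)^-1. Proof. exact: (dprim x tc). Qed.

Let TJG x y : T x - T y = J x - J y + c * (G x - G y).
Proof.
pose D t := T t - J t - c * G t.
have hD (t : R) : is_derive t (1 : R) D 0.
  have h1 := dJ t; have h2 := dG t; have h3 := dT t; rewrite /D; der.
  have e := ps_sqr t; have M0 := M_gt0 t; have p0 := ps_gt0 t.
  transitivity ((1 - (c / M t) ^+ 2 - ps t ^+ 2) / ps t); first by field; rewrite !gt_eqF.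
  by rewrite e subrr mul0r.
have cD a b : D a = D b.
  have [ab|/ltW ba] := leP a b; first by apply: (cst_der ab (fun t _ => der_cont (hD t))) => t _; exact: hD.
  by apply/esym/(cst_der ba (fun t _ => der_cont (hD t))) => t _; exact: hD.
by have := cD x y; rewrite /D; lra.
Qed.

Let T_lt x y : x < y -> T x < T y.
Proof.
move=> xy; apply: (incr_der xy (fun t _ => der_cont (dT t)) (fun t _ => dT t)) => t _.
by rewrite invr_gt0.
Qed.

(* In the coordinates [f = c theta + sg J(r)] and [w = theta - sg G(r)] the metric reads
   [df^2 + (m^2 - c^2) dw^2]; constant multiples of [f] and [w] serve as calibrations. *)
Let lower (C : R -> pt) (th dr dth S : R -> R) sg lam : sg ^+ 2 = 1 -> is_lift m C th dr dth ->
  (forall t, is_derive t 1 S (speed m C t)) -> 0 < lam ->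
  (forall x, r0 - d <= x <= r0 + d -> lam <= (M x * ps x) ^+ 2) ->
  (forall t, 0 <= t <= 1 -> r0 - d <= rad (C t) <= r0 + d) ->
  (c * (th 1 - th 0) + sg * (J (rad (C 1)) - J (rad (C 0)))) ^+ 2 +
  lam * (th 1 - th 0 - sg * (G (rad (C 1)) - G (rad (C 0)))) ^+ 2 <= (S 1 - S 0) ^+ 2.
Proof.
move=> hsg hl dS lam0 hlam hr; set D := th 1 - th 0.
set Df := c * D + _; set Dw := D - _.
have rp t : 0 <= t <= 1 -> 0 < rad (C t) by move/hr; have := dr0; lra.
have key al be : al ^+ 2 + be ^+ 2 / lam <= 1 -> al * Df + be * Dw <= S 1 - S 0.
  move=> hab; have := @calib_seg R m vM C th dr dth S (fun x => sg * (al * J x - be * G x))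
    (fun x => sg * (al * ps x - be * (c / (M x ^+ 2 * ps x)))) (al * c + be) 0 1 hl (lexx 0) ler01 (lexx 1).
  have -> : (al * c + be) * (th 1 - th 0) + (sg * (al * J (rad (C 1)) - be * G (rad (C 1))) -
     sg * (al * J (rad (C 0)) - be * G (rad (C 0)))) = al * Df + be * Dw by rewrite /Df /Dw /D; ring.
  apply; [exact: rp|move=> t ht; split].
    by have h1 := dJ (rad (C t)); have h2 := dG (rad (C t)); der; ring.
  have hx := hr t ht; set x := rad (C t) in hx *.
  have Mx : m x = M x by rewrite /M clE.
  have e := ps_sqr x; have M0 := M_gt0 x; have p0 := ps_gt0 x; have hl' := hlam x hx.
  rewrite Mx; apply: le_trans hab.
  have -> : ((al * c + be) / M x) ^+ 2 + (sg * (al * ps x - be * (c / (M x ^+ 2 * ps x)))) ^+ 2 =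
    al ^+ 2 * ((c / M x) ^+ 2 + sg ^+ 2 * ps x ^+ 2) + be ^+ 2 * (ps x ^+ 2 + sg ^+ 2 * (c / M x) ^+ 2) / (M x * ps x) ^+ 2
    + 2 * al * be * c / M x ^+ 2 * (1 - sg ^+ 2).
    by field; rewrite !gt_eqF.
  have e1 : (c / M x) ^+ 2 + ps x ^+ 2 = 1 by rewrite e addrC subrK.
  have e2 : ps x ^+ 2 + (c / M x) ^+ 2 = 1 by rewrite addrC.
  rewrite hsg subrr mulr0 addr0 !mul1r e1 e2 !mulr1 lerD2l.
  rewrite ler_wpM2l ?sqr_ge0// lef_pV2// posrE ?exprn_gt0 ?mulr_gt0//.
have NN : 0 <= Df ^+ 2 + lam * Dw ^+ 2 by rewrite addr_ge0 ?sqr_ge0// mulr_ge0 ?sqr_ge0// ltW.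
pose N := Num.sqrt (Df ^+ 2 + lam * Dw ^+ 2).
have N2 : N ^+ 2 = Df ^+ 2 + lam * Dw ^+ 2 by rewrite sqr_sqrtr.
have S0 : 0 <= S 1 - S 0.
  have := key 0 0; rewrite !mul0r addr0 expr0n mul0r addr0; apply; exact: ler01.
rewrite -N2 lerXn2r ?nnegrE ?sqrtr_ge0//.
have [->//|Nn] := eqVneq N 0.
have := key (Df / N) (lam * Dw / N).
have -> : (Df / N) ^+ 2 + (lam * Dw / N) ^+ 2 / lam = (Df ^+ 2 + lam * Dw ^+ 2) / N ^+ 2 by field; rewrite Nn gt_eqF.
have -> : Df / N * Df + lam * Dw / N * Dw = (Df ^+ 2 + lam * Dw ^+ 2) / N by field.
rewrite -N2 divff ?expf_neq0// lexx => /(_ isT).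
by have -> : N ^+ 2 / N = N by field.
Qed.

(** The competitor is the arc from [ry] to [rz] with an additional angle [dw] spread linearly in the
    radius: it costs [c * dw] to first order, and [Lam] controls the second order. The parameter
    [sg * r] increases in both directions of travel. *)
Let upper sg ry rz th dw Lam : sg ^+ 2 = 1 -> r0 - d <= ry <= r0 + d -> r0 - d <= rz <= r0 + d ->
  0 < sg * (rz - ry) -> (forall x, r0 - d <= x <= r0 + d -> M x ^+ 2 <= Lam) ->
  dist m (pol ry th) (pol rz (th + sg * (G rz - G ry) + dw)) <=
  sg * (T rz - T ry) + c * dw + Lam * dw ^+ 2 / (2 * (sg * (rz - ry))).
Proof.
move=> hsg hy hz; set Dl := sg * (rz - ry) => Dl0 hLam.
have sgK x : sg * (sg * x) = x by rewrite mulrA -expr2 hsg mul1r.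
pose ka := dw / Dl; pose a := sg * ry; pose b := sg * rz.
have abD : b - a = Dl by rewrite /b /a /Dl mulrBr.
have ab : a <= b by rewrite -subr_ge0 abD ltW.
have c2L : c ^+ 2 <= Lam.
  apply: le_trans (hLam r0 _); last by have := d0; lra.
  by rewrite -[c ^+ 2]real_normK ?num_real// lerXn2r ?nnegrE ?normr_ge0 ?(ltW (M_gt0 r0))// ltW.
pose r_ t := sg * t; pose th_ t := th + sg * (G (sg * t) - G ry) + dw * ((t - a) / Dl).
pose F t := sg * T (sg * t) + c * ka * t + Lam * ka ^+ 2 / 2 * t.
have e1 : pol (r_ a) (th_ a) = pol ry th.
  by rewrite /r_ /th_ /a sgK; congr pol; rewrite !subrr mul0r !mulr0 !addr0.
have e2 : pol (r_ b) (th_ b) = pol rz (th + sg * (G rz - G ry) + dw).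
  by rewrite /r_ /th_ abD divff ?gt_eqF// mulr1 /b sgK.
have e3 : F b - F a = sg * (T rz - T ry) + c * dw + Lam * dw ^+ 2 / (2 * Dl).
  rewrite /F {1}/b {1}/a !sgK.
  have -> : sg * T rz + c * ka * b + Lam * ka ^+ 2 / 2 * b - (sg * T ry + c * ka * a + Lam * ka ^+ 2 / 2 * a) =
   sg * (T rz - T ry) + c * (ka * (b - a)) + Lam / 2 * (ka * (ka * (b - a))) by ring.
  have -> : ka * (b - a) = dw by rewrite abD /ka; field; rewrite gt_eqF.
  by congr (_ + _); rewrite /ka; field; rewrite gt_eqF.
rewrite -e1 -e2 -e3.
have Mc := M_cont; have pc := ps_cont.
have strip t : a < t < b -> r0 - d <= sg * t <= r0 + d.
  have : sg = 1 \/ sg = -1 by move/eqP: hsg; rewrite sqrf_eq1 => /orP[] /eqP; [left|right].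
  rewrite /a /b => -[] ->; rewrite ?mul1r ?mulN1r; move: hy hz => /andP[h1 h2] /andP[h3 h4] /andP[h5 h6]; lra.
have dsg (t : R) : is_derive t (1 : R) (fun t : R => sg * t) sg by der; ring.
have dGs t : is_derive t 1 (fun t => G (sg * t)) (c / (M (sg * t) ^+ 2 * ps (sg * t)) * sg).
  exact: (der_comp (f := G) (g := fun t => sg * t) (dG _) (dsg t)).
have dTs t : is_derive t 1 (fun t => T (sg * t)) ((ps (sg * t))^-1 * sg).
  exact: (der_comp (f := T) (g := fun t => sg * t) (dT _) (dsg t)).
have dth t : is_derive t 1 th_ (c / (M (sg * t) ^+ 2 * ps (sg * t)) + ka).
  have g := dGs t; rewrite /th_; der.
  transitivity (sg ^+ 2 * (c / (M (sg * t) ^+ 2 * ps (sg * t))) + ka); first by rewrite /ka; ring.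
  by rewrite hsg mul1r.
have dF t : is_derive t 1 F ((ps (sg * t))^-1 + c * ka + Lam * ka ^+ 2 / 2).
  have g := dTs t; rewrite /F; der.
  transitivity (sg ^+ 2 * (ps (sg * t))^-1 + c * ka + Lam * ka ^+ 2 / 2); first by ring.
  by rewrite hsg mul1r.
apply: (dist_polar_le vM (r := r_) (th := th_) (F := F) ab dsg dth _ _ _ _ (fun t _ => dF t)).
- by move=> t; exact: cont_cst.
- move=> t; have csg : continuous (fun t : R => sg * t) by cont.
  have c1 := cont_comp (f := M) (g := fun t => sg * t) (@M_cont (sg * t)) (csg t).
  have c2 := cont_comp (f := ps) (g := fun t => sg * t) (@ps_cont (sg * t)) (csg t).
  by cont; rewrite mulf_neq0 ?expf_neq0// gt_eqF.
- by move=> t /strip; rewrite /r_; have := dr0; lra.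
- by move=> t _; exact: der_cont (dF t).
- move=> t /strip hs; have p0 := ps_gt0 (sg * t); have p1 := ps_le1 (sg * t).
  have : 1 <= (ps (sg * t))^-1 by rewrite invf_ge1.
  have : 0 <= (1 + c * ka) ^+ 2 by exact: sqr_ge0.
  have : c ^+ 2 * ka ^+ 2 <= Lam * ka ^+ 2 by rewrite ler_wpM2r ?sqr_ge0.
  move: (ps (sg * t))^-1 => i; nra.
move=> t /strip hs; have p0 := ps_gt0 (sg * t); have p1 := ps_le1 (sg * t).
have M0 := M_gt0 (sg * t); have e := ps_sqr (sg * t); have hL := hLam _ hs.
have -> : m (r_ t) = M (sg * t) by rewrite /M clE.
rewrite hsg; move: (M (sg * t)) (ps (sg * t)) p0 p1 M0 e hL => Mx px p0 p1 M0 e hL.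
have -> : 1 + Mx ^+ 2 * (c / (Mx ^+ 2 * px) + ka) ^+ 2 =
  (px ^+ 2 + (c / Mx) ^+ 2) / px ^+ 2 + 2 * c * ka / px + Mx ^+ 2 * ka ^+ 2 by field; rewrite !gt_eqF.
have e' : px ^+ 2 + (c / Mx) ^+ 2 = 1 by rewrite e subrK.
rewrite e'.
have -> : (px^-1 + c * ka + Lam * ka ^+ 2 / 2) ^+ 2 =
  1 / px ^+ 2 + 2 * c * ka / px + Lam * ka ^+ 2 / px + (c * ka + Lam * ka ^+ 2 / 2) ^+ 2 by field; rewrite gt_eqF.
apply: ler_wpDr; first exact: sqr_ge0.
rewrite lerD2l; apply: (@le_trans _ _ (Lam * ka ^+ 2)); first by rewrite ler_wpM2r ?sqr_ge0.
rewrite ler_pdivlMr// ler_piMr// mulr_ge0 ?sqr_ge0//.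
exact: le_trans (sqr_ge0 _) hL.
Qed.

Let small_eq (x y : R) (K : R) : (forall e : R, 0 < e -> `|x - y| <= K * e) -> x = y.
Proof.
move=> hxy; apply/eqP; rewrite -subr_eq0 -normr_le0 leNgt; apply/negP => x0.
have K0 : 0 < `|K| + 1 by rewrite ltr_wpDl.
have := hxy (`|x - y| / 2 / (`|K| + 1)); rewrite !divr_gt0// => /(_ isT).
have : K * (`|x - y| / 2 / (`|K| + 1)) <= (`|K| + 1) * (`|x - y| / 2 / (`|K| + 1)).
  by rewrite ler_wpM2r ?divr_ge0 ?(ltW K0)// (le_trans (ler_norm K))// lerDl.
have -> : (`|K| + 1) * (`|x - y| / 2 / (`|K| + 1)) = `|x - y| / 2 by field; rewrite gt_eqF.
move: (K * _) => X; lra.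
Qed.

(** Let [w] be the angular deviation of [z] from the arc, and [Df] the increment of the coordinate
    [f] of [lower] from the point at [r0] to [z]. Then [lower] gives [Df^2 + lam * w^2 <= u^2],
    whereas the detour from [ry] gives [u <= Df + K * w^2] with [K] independent of [u]. For small
    [u] this forces [w = 0], which is how even a tangential corner is excluded. *)
Lemma strip_ahead sg ry ay : sg ^+ 2 = 1 -> r0 - d <= ry <= r0 + d -> 0 < sg * (r0 - ry) ->
  exists2 u0 : R, 0 < u0 & forall u z, 0 < u -> u <= u0 ->
    dist m (pol r0 (ay + sg * (G r0 - G ry))) z = u ->
    dist m (pol ry ay) z = sg * (T r0 - T ry) + u ->
    sg * (T (rad z) - T r0) = u /\ z = pol (rad z) (ay + sg * (G (rad z) - G ry)).
Proof.
move=> hsg hy; set L := sg * (r0 - ry) => L0.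
have dd := d0; have ddr := dr0.
have hab : r0 - d <= r0 + d by lra.
have cMp : continuous (fun x => (M x * ps x) ^+ 2) by have hM := M_cont; have hp := ps_cont; cont.
have [xl hxl] := evt_min hab (fun x _ => cMp x); set lam := (M xl * ps xl) ^+ 2 => hlam.
have lam0 : 0 < lam by rewrite exprn_gt0// mulr_gt0.
have cM : continuous (fun x => - M x ^+ 2) by have hM := M_cont; cont.
have [xL hxL] := evt_min hab (fun x _ => cM x); set Lam := M xL ^+ 2 => hLam'.
have {}hLam' x : r0 - d <= x <= r0 + d -> M x ^+ 2 <= Lam by move=> /hLam'; rewrite lerN2.
have Lam0 : 0 < Lam by rewrite exprn_gt0.
pose K := Lam / L; have K0 : 0 < K by exact: divr_gt0.
(* [d / 2] keeps almost shortest curves in the annulus, [L / 4] keeps [rz] at distance at least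
   [L / 2] from [ry], and the last entry is [4 * u * K <= lam]. *)
pose u0 := Num.min (d / 2) (Num.min (L / 4) (lam / (4 * K))).
have u00 : 0 < u0 by rewrite !lt_min !divr_gt0// mulr_gt0.
exists u0 => // u z up; rewrite !le_min => /and3P[ud uL uK] hu hvu.
set a0 := ay + _ in hu; set rz := rad z; set A := ay + sg * (G rz - G ry).
have {}uK : 4 * u * K <= lam.
  have K4 : 0 < 4 * K by exact: mulr_gt0.
  have -> : 4 * u * K = u * (4 * K) by ring.
  by rewrite -ler_pdivlMr.
(* The infimum in [dist] is approached by a curve with error [ep], so the deviation is only bounded
   by [eta]; the estimates end with [lam * w ^+ 2 <= 6 * u * ep], whence the choice of [ep]. *)
have key eta : 0 < eta -> exists w : R, [/\ `|w| <= eta, `|sg * (T rz - T r0) - u| <= (2 + `|c|) * eta & z = pol rz (A + w)].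
  move=> eta0; pose ep := Num.min u (Num.min eta (eta ^+ 2 * lam / (6 * u))).
  have ep0 : 0 < ep by rewrite !lt_min up eta0 divr_gt0 ?mulr_gt0 ?exprn_gt0.
  have : ep <= ep by [].
  rewrite {2}/ep !le_min => /and3P[epu epe epk].
  have {}epk : 6 * u * ep <= eta ^+ 2 * lam.
    by rewrite mulrC -ler_pdivlMr ?mulr_gt0.
  have [C [CC C0 C1 hC]] := dist_approx vM (pol r0 a0) z ep0; rewrite hu in hC.
  have r0p : 0 < r0 by lra.
  have rad0 : rad (C 0) = r0 by rewrite C0 rad_pol_ge0// ltW.
  have rC t : 0 <= t <= 1 -> r0 - d <= rad (C t) <= r0 + d.
    move=> ht; have := rad_curve vM CC ht; rewrite rad0.
    have := normr_ge0 (rad (C 1) - rad (C t)) => h1 h2.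
    have : `|rad (C t) - r0| <= d by hlra.
    rewrite ler_norml; lra.
  have Cn t : 0 <= t <= 1 -> C t != origin R by move=> /rC ht; rewrite -rad_gt0; lra.
  have [th [dr [dth hl]]] := polar_lift m CC Cn.
  have {}hl : is_lift m C th dr dth := hl.
  have [S [dS eS]] := clength_primitive vM CC.
  have h00 : 0 <= (0 : R) <= 1 by rewrite lexx ler01.
  have h11 : 0 <= (1 : R) <= 1 by rewrite lexx ler01.
  have hrz := rC _ h11; rewrite C1 -/rz in hrz.
  have := lower hsg hl dS lam0 hlam rC; rewrite C1 rad0 -/rz -eS.
  set D := th 1 - th 0; set Df := c * D + _; set w := D - _ => hlow.
  have CL0 := clength_ge0 vM CC.
  have {hlow hC CL0}low : Df ^+ 2 + lam * w ^+ 2 <= (u + ep) ^+ 2.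
    by apply: le_trans hlow _; rewrite lerXn2r ?nnegrE//; hlra.
  have ez : z = pol rz (A + w).
    have [f0 _ _ _] := hl _ h00; have [f1 _ _ _] := hl _ h11.
    rewrite C1 -/rz in f1; rewrite rad0 C0 in f0.
    have [_ ec es] := pol_angle r0p r0p f0.
    have -> : A + w = a0 + D by rewrite /A /w /a0; ring.
    have et : th 1 = th 0 + D by rewrite /D; ring.
    by rewrite f1 et /pol (cosD (th 0)) (cosD a0) (sinD (th 0)) (sinD a0) ec es.
  have Dlow : L / 2 <= sg * (rz - ry).
    have hx : `|rz - r0| <= L / 2.
      have := rad_dist vM (pol r0 a0) z; rewrite hu rad_pol_ge0 ?(ltW r0p)// -/rz; lra.
    have : `|sg * (rz - r0)| <= L / 2.
      by rewrite normrM (_ : `|sg| = 1) ?mul1r//; apply/eqP; rewrite -sqr_norm_eq1 hsg.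
    rewrite ler_norml => /andP[h1 _].
    have -> : sg * (rz - ry) = L + sg * (rz - r0) by rewrite /L; ring.
    by lra.
  have Dp : 0 < sg * (rz - ry) by apply: lt_le_trans Dlow; rewrite divr_gt0.
  have := @upper sg ry rz ay w Lam hsg hy hrz Dp hLam'; rewrite -/A -ez hvu => hup.
  have eT : sg * (T rz - T r0) + c * w = Df.
    by rewrite TJG /Df /w; ring.
  have {hup}up2 : u <= Df + K * w ^+ 2.
    have : Lam * w ^+ 2 / (2 * (sg * (rz - ry))) <= K * w ^+ 2.
      have -> : K * w ^+ 2 = Lam * w ^+ 2 / L by rewrite /K mulrAC.
      apply: ler_wpM2l; first by apply: mulr_ge0; [exact: ltW|exact: sqr_ge0].
      have p2 : 0 < 2 * (sg * (rz - ry)) by apply: mulr_gt0.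
      by rewrite lef_pV2 ?posrE// mulrC -ler_pdivrMr.
    move: hup eT; rewrite -/T; have -> : sg * (T rz - T ry) = sg * (T r0 - T ry) + sg * (T rz - T r0) by ring.
    move: (Lam * _ / _) (sg * (T r0 - T ry)) (sg * (T rz - T r0)) (c * w) (K * w ^+ 2) => x1 x2 x3 x4 x5; lra.
  have W0 : 0 <= w ^+ 2 by exact: sqr_ge0.
  have KW : K * w ^+ 2 <= u.
    have h1 : lam * w ^+ 2 <= 4 * u ^+ 2.
      apply: le_trans (_ : (u + ep) ^+ 2 <= _); first by move: low; have := sqr_ge0 Df; lra.
      nra.
    rewrite -(ler_pM2l lam0); apply: (@le_trans _ _ (K * (4 * u ^+ 2))).
      by rewrite mulrCA ler_pM2l.
    have -> : K * (4 * u ^+ 2) = 4 * u * K * u by ring.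
    by rewrite ler_pM2r.
  have w2 : lam * w ^+ 2 <= 6 * u * ep.
    have hDf : (u - K * w ^+ 2) ^+ 2 <= Df ^+ 2 by rewrite lerXn2r ?nnegrE; lra.
    have h2 : 4 * u * K * w ^+ 2 <= lam * w ^+ 2 by rewrite ler_wpM2r.
    have h3 : ep ^+ 2 <= u * ep by rewrite expr2 ler_wpM2r// ltW.
    have h4 : 0 <= (K * w ^+ 2) ^+ 2 by exact: sqr_ge0.
    have e4 : (u - K * w ^+ 2) ^+ 2 = u ^+ 2 - (4 * u * K * w ^+ 2) / 2 + (K * w ^+ 2) ^+ 2 by field.
    have e5 : (u + ep) ^+ 2 = u ^+ 2 + 2 * (u * ep) + ep ^+ 2 by ring.
    rewrite e4 in hDf; rewrite e5 in low; move: h2 h3 h4 hDf low.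
    have -> : 6 * u * ep = 6 * (u * ep) by ring.
    move: (lam * w ^+ 2) (4 * u * K * w ^+ 2) (u * ep) (ep ^+ 2) ((K * w ^+ 2) ^+ 2) (Df ^+ 2) (u ^+ 2) => x1 x2 x3 x4 x5 x6 x7; lra.
  have wE : `|w| <= eta.
    rewrite -(ler_pXn2r (n := 2)) ?nnegrE ?(ltW eta0)// real_normK ?num_real//.
    by rewrite -(ler_pM2l lam0) mulrC [lam * _]mulrC mulrC; apply: le_trans w2 _; rewrite mulrC in epk *; lra.
  have KW2 : K * w ^+ 2 <= 2 * ep.
    rewrite -(ler_pM2l lam0) mulrCA; apply: (@le_trans _ _ (K * (6 * u * ep))); first by rewrite ler_pM2l.
    have -> : K * (6 * u * ep) = (4 * u * K) * ep * (3 / 2) by field.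
    have h1 : 4 * u * K * ep <= lam * ep by rewrite ler_pM2r.
    have h2 : 0 <= lam * ep by rewrite mulr_ge0 ?ltW.
    rewrite [leRHS](_ : _ = 2 * (lam * ep)); last by ring.
    by move: (4 * u * K * ep) (lam * ep) h1 h2 => x1 x2; lra.
  have Dfup : Df <= u + ep.
    rewrite leNgt; apply/negP => hh.
    have : (u + ep) ^+ 2 < Df ^+ 2 by rewrite ltrXn2r ?nnegrE//; lra.
    have : 0 <= lam * w ^+ 2 by rewrite mulr_ge0// ltW.
    by move: low; lra.
  exists w; split=> //.
  have -> : sg * (T rz - T r0) - u = (Df - u) - c * w by rewrite -eT; ring.
  apply: le_trans (ler_normB _ _) _; rewrite normrM mulrDl lerD//.
    rewrite ler_norml; apply/andP; split; lra.
  by rewrite ler_wpM2l.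
split.
  apply: (@small_eq _ _ (2 + `|c|)) => e e0.
  by have [w [_ h _]] := key e e0.
have rz0 : 0 <= rz by exact: rad_ge0.
rewrite [LHS]surjective_pairing /pol; congr pair.
  apply: (@small_eq _ _ rz) => e e0; have [w [hw _ ->]] := key e e0.
  rewrite /= -mulrBr normrM ger0_norm// ler_wpM2l//.
  by apply: le_trans (trig_lip _ _).1 _; rewrite addrC addKr.
apply: (@small_eq _ _ rz) => e e0; have [w [hw _ ->]] := key e e0.
rewrite /= -mulrBr normrM ger0_norm// ler_wpM2l//.
by apply: le_trans (trig_lip _ _).2 _; rewrite addrC addKr.
Qed.

(** The differential equations of [r] and [th] are integrated through [T] and [G], which brings the
    curve into the form of [strip_ahead], with the point at time [t1 - eta] as starting point
    [ry]. *)
Lemma nobranch_strip sg t1 eta (r th : R -> R) g : sg ^+ 2 = 1 -> 0 < eta -> r t1 = r0 ->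
  (forall t, t1 - eta <= t <= t1 + eta -> [/\ r0 - d <= r t <= r0 + d,
     is_derive t 1 r (sg * Num.sqrt (1 - (c / m (r t)) ^+ 2)) & is_derive t 1 th (c / m (r t) ^+ 2)]) ->
  minimizing g (t1 - eta) (t1 + eta) -> g (t1 - eta) = pol (r (t1 - eta)) (th (t1 - eta)) ->
  g t1 = pol (r t1) (th t1) ->
  exists2 e : R, 0 < e & forall t, t1 <= t <= t1 + e -> g t = pol (r t) (th t).
Proof.
move=> hsg eta0 r1 hrt hg gy g1.
have sg1 : sg = 1 \/ sg = -1 by move/eqP: hsg; rewrite sqrf_eq1 => /orP[] /eqP; [left|right].
have dTr t : t1 - eta <= t <= t1 + eta -> is_derive t 1 (fun t => sg * T (r t) - t) 0.
  move=> /hrt[hs dr _]; have h1 := dT (r t); der.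
  have p0 := ps_gt0 (r t).
  have -> : Num.sqrt (1 - (c / m (r t)) ^+ 2) = ps (r t) by rewrite /ps /M clE.
  transitivity (sg ^+ 2 - 1); first by field; rewrite gt_eqF.
  by rewrite hsg subrr.
have dGr t : t1 - eta <= t <= t1 + eta -> is_derive t 1 (fun t => sg * G (r t) - th t) 0.
  move=> /hrt[hs dr dt]; have h1 := dG (r t); der.
  have p0 := ps_gt0 (r t); have M0 := M_gt0 (r t).
  have -> : m (r t) = M (r t) by rewrite /M clE.
  have -> : Num.sqrt (1 - (c / M (r t)) ^+ 2) = ps (r t) by [].
  transitivity (sg ^+ 2 * (c / M (r t) ^+ 2) - c / M (r t) ^+ 2); first by field; rewrite !gt_eqF.
  by rewrite hsg mul1r subrr.
have cst (f : R -> R) : (forall t, t1 - eta <= t <= t1 + eta -> is_derive t 1 f 0) ->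
    forall x y, t1 - eta <= x -> x <= y -> y <= t1 + eta -> f x = f y.
  move=> df x y h1 h2 h3; apply: (cst_der h2) => t /andP[h4 h5].
    by apply: (der_cont (df t _)); lra.
  by apply: df; lra.
have eT x y : t1 - eta <= x -> x <= y -> y <= t1 + eta -> sg * (T (r y) - T (r x)) = y - x.
  by move=> h1 h2 h3; have := cst _ dTr x y h1 h2 h3; rewrite mulrBr; lra.
have eG x y : t1 - eta <= x -> x <= y -> y <= t1 + eta -> sg * (G (r y) - G (r x)) = th y - th x.
  by move=> h1 h2 h3; have := cst _ dGr x y h1 h2 h3; rewrite mulrBr; lra.
set y := t1 - eta in gy *.
have h1 : y <= y by []. 
have h2 : y <= t1 by rewrite /y; lra.
have h3 : t1 <= t1 + eta by lra.
have T_inj a b : T a = T b -> a = b.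
  by move=> e; case: (ltgtP a b) => // /T_lt; rewrite e ltxx.
have T_sg a b : 0 < sg * (T a - T b) -> 0 < sg * (a - b).
  case: sg1 => ->; rewrite ?mul1r ?mulN1r ?opprB !subr_gt0 => hT.
    by rewrite ltNge; apply/negP; rewrite le_eqVlt => /predU1P[e|/T_lt]; [move: hT; rewrite e ltxx|move/lt_trans => /(_ _ hT); rewrite ltxx].
  by rewrite ltNge; apply/negP; rewrite le_eqVlt => /predU1P[e|/T_lt]; [move: hT; rewrite e ltxx|move/lt_trans => /(_ _ hT); rewrite ltxx].
have hT1 := eT y t1 h1 h2 h3; have hG1 := eG y t1 h1 h2 h3; rewrite r1 in hT1 hG1.
have L0 : 0 < sg * (r0 - r y) by apply: T_sg; rewrite hT1 /y; lra.
have hy : r0 - d <= r y <= r0 + d by have [] := hrt y _ => //; rewrite /y; lra.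
have [u0 u00 hu] := @strip_ahead sg (r y) (th y) hsg hy L0.
rewrite hG1 hT1 (_ : th y + (th t1 - th y) = th t1) in hu; last by ring.
exists (Num.min u0 eta); first by rewrite lt_min u00.
move=> t; case: (ltgtP t1 t) => [tt /= ht|//|<-//].
have [hu1 hu2] : t - t1 <= u0 /\ t - t1 <= eta.
  by move: ht; rewrite -lerBlDl le_min => /andP[].
have up : 0 < t - t1 by lra.
have [] := hu (t - t1) (g t) up hu1.
- by rewrite -r1 -g1 hg ?ltr0_norm ?opprB//; lra.
- rewrite -gy hg ?ltr0_norm ?opprB//; rewrite /y; lra.
have h4 : t <= t1 + eta by lra.
have e1 := eT t1 t h2 (ltW tt) h4; rewrite r1 in e1.
move=> e2 e3; have er : rad (g t) = r t.
  apply: T_inj; have : sg * (sg * (T (rad (g t)) - T r0)) = sg * (sg * (T (r t) - T r0)) by rewrite e1 e2.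
  by rewrite !mulrA -expr2 hsg !mul1r; lra.
rewrite e3 er; congr pol.
have -> : sg * (G (r t) - G (r y)) = th t - th y by apply: eG => //; lra.
by ring.
Qed.

End Strip.

Lemma nobranch c sg t1 eta (r th : R -> R) g : sg ^+ 2 = 1 -> 0 < eta ->
  (forall t, t1 - eta <= t <= t1 + eta -> [/\ 0 < r t, `|c| < m (r t),
     is_derive t 1 r (sg * Num.sqrt (1 - (c / m (r t)) ^+ 2)) & is_derive t 1 th (c / m (r t) ^+ 2)]) ->
  minimizing g (t1 - eta) (t1 + eta) ->
  (forall t, t1 - eta <= t <= t1 -> g t = pol (r t) (th t)) ->
  exists2 e : R, 0 < e & forall t, t1 <= t <= t1 + e -> g t = pol (r t) (th t).
Proof.
move=> hsg eta0 hrt hg he; set r0 := r t1.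
have h1 : t1 - eta <= t1 <= t1 + eta by lra.
have [r00 cm dr1 _] := hrt _ h1.
have cm0 : 0 < m r0 - `|c| by rewrite subr_gt0.
have [d1 d10 hd1] := cont_dist (@m_cont R m vM r0) cm0.
pose d := Num.min (d1 / 2) (r0 / 2).
have d0 : 0 < d by rewrite lt_min !divr_gt0.
have : d <= d by []. 
rewrite {2}/d le_min => /andP[dd1 ddr].
have dr0 : d < r0 by lra.
have hm x : r0 - d <= x <= r0 + d -> `|c| < m x.
  move=> hx; have : `|m x - m r0| < m r0 - `|c|.
    by apply: hd1; rewrite ltr_norml; lra.
  by rewrite ltr_norml; lra.
have [e1 e10 he1] := cont_dist (der_cont dr1) d0.
pose e := Num.min (e1 / 2) eta.
have e0 : 0 < e by rewrite lt_min divr_gt0.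
have : e <= e by []. 
rewrite {2}/e le_min => /andP[ee1 ee].
apply: (@nobranch_strip c r0 d d0 dr0 hm sg t1 e r th g hsg e0 erefl).
- move=> t ht; have ht' : t1 - eta <= t <= t1 + eta by lra.
  have [_ _ h2 h3] := hrt t ht'; split=> //.
  have : `|r t - r0| < d by apply: he1; rewrite ltr_norml; lra.
  by rewrite ltr_norml; lra.
- by move=> s1 s2 hs1 hs2; apply: hg; lra.
- by apply: he; lra.
- by apply: he; lra.
Qed.
End NoBranch.

(** * Complete arcs and unique continuation at a vertex *)

Section Tracks.
Variables (R : realType) (m : R -> R).
Hypothesis vM : von_Mangoldt m.
Notation pt := (R * R)%type.
Implicit Types (s t x y r rho e th al sg : R) (p q z : pt) (g E : R -> pt).
Local Notation Reg := (Reg m).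

Lemma polN r th : pol (- r) th = pol r (th + pi).
Proof. by rewrite /pol cosD sinD cospi sinpi !mulr0 subr0 addr0 !mulrN1 !mulrN !mulNr. Qed.

Lemma pol_pi r th sg : sg ^+ 2 = 1 -> pol r (th + sg * pi) = pol r (th + pi).
Proof.
move/eqP; rewrite sqrf_eq1 => /orP[]/eqP ->; rewrite ?mul1r// mulN1r.
by rewrite /pol cosD sinD cosN sinN (cosD th) (sinD th) cospi sinpi oppr0 !mulr0.
Qed.

Lemma signP sg : sg ^+ 2 = 1 -> sg = 1 \/ sg = -1.
Proof. by move/eqP; rewrite sqrf_eq1 => /orP[] /eqP; [left|right]. Qed.

Lemma dist_axis th x y : dist m (pol x th) (pol y th) <= `|x - y|.
Proof.
wlog xy : x y / x <= y => [hw|].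
  by case: (leP x y) => [/hw//|/ltW/hw]; rewrite (dist_sym vM) [`|x - y|]distrC.
have [x0|x0] := leP 0 x.
  by rewrite (dist_radial vM _ x0 (le_trans x0 xy)) distrC.
have [y0|y0] := leP y 0.
  have e w : pol w th = pol (- w) (th + pi) by rewrite -polN opprK.
  by rewrite !e (dist_radial vM) ?oppr_ge0 ?(ltW x0)// opprK addrC.
apply: le_trans (dist_through vM _ _) _; rewrite !rad_pol ltr0_norm// gtr0_norm// distrC ger0_norm ?subr_ge0//.
by rewrite addrC.
Qed.

Lemma polar_from al z : exists sg vt : R, [/\ sg ^+ 2 = 1, 0 <= vt <= pi & z = pol (rad z) (al + sg * vt)].
Proof.
have [be ez] := pol_ex z; have [d [d1 d2 d3]] := angle_rep al be.
exists (if 0 <= d then 1 else -1), `|d|; split; first by case: ifP; rewrite ?sqrrN expr1n.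
  by rewrite normr_ge0.
have -> : (if 0 <= d then 1 else -1) * `|d| = d.
  by case: leP => h; [rewrite mul1r ger0_norm|rewrite mulN1r ltr0_norm// opprK].
by rewrite {1}ez /pol d2 d3.
Qed.

Lemma arc_to a al z : Reg a -> 0 < rad z -> exists sg vt : R,
  [/\ sg ^+ 2 = 1, 0 <= vt <= pi, z = pol (rad z) (al + sg * vt) &
  [\/ vt = 0, dist m (pol a al) z = a + rad z |
   exists rho sa s, [/\ Reg rho & sa <= s] /\
    [/\ rho + sa ^+ 2 = a, rho + s ^+ 2 = rad z, GG m rho s - GG m rho sa = vt &
    dist m (pol a al) z = TT m rho s - TT m rho sa]]].
Proof.
move=> ha z0; have [sg [vt [hsg hvt ez]]] := polar_from al z.
exists sg, vt; split=> //.
have h : exists lo hi, [/\ Reg lo, lo <= a, lo <= rad z, (lo = a /\ hi = rad z) \/ (lo = rad z /\ hi = a) & lo <= hi].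
  have [h|h] := leP a (rad z); first by exists a, (rad z); split=> //; left.
  by exists (rad z), a; split; rewrite ?(ltW h)//; [exact: (Reg_lt vM ha z0 (ltW h))|right].
have [lo [hi [h1 h2 h3 h4 h5]]] := h.
have := arc_exists vM h1 h2 h3 h4 h5 hvt al hsg; rewrite -ez.
move=> [->|->|[rho [sa [s [[k1 k2 k3] [k4 k5 k6 k7]]]]]].
- by constructor 1.
- by constructor 2.
by constructor 3; exists rho, sa, s.
Qed.

(** The complete arc in arc length: [t0] is the time of the vertex, [al] its direction and [sg] the
    sense of rotation. *)
Definition arc_track E := exists rho sg al t0, [/\ Reg rho, sg ^+ 2 = 1 &
  forall s, E (t0 + TT m rho s) = pol (rho + s ^+ 2) (al + sg * GG m rho s)].

Definition axis_track E := exists t0 th, forall t, E t = pol (t - t0) th.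

Definition track E := arc_track E \/ axis_track E.

Lemma TT_surj rho x : Reg rho -> exists s, TT m rho s = x.
Proof.
move=> hr; have [x0|x0] := leP 0 x.
  by have [s _ e] := TT_onto vM 0 hr x0; exists s; rewrite e (T0 m rho) add0r.
have x1 : 0 <= - x by rewrite oppr_ge0 ltW.
have [s _ e] := TT_onto vM 0 hr x1; exists (- s).
by rewrite (TN vM hr) e (T0 m rho) add0r opprK.
Qed.

Lemma arc_track_ex rho sg al t0 : Reg rho -> sg ^+ 2 = 1 ->
  exists2 E, track E & forall s, E (t0 + TT m rho s) = pol (rho + s ^+ 2) (al + sg * GG m rho s).
Proof.
move=> hr hsg; have [S [hS _]] := inverse_ex (dT vM hr) (dT_gt0 vM hr).
pose E t := pol (rho + S (t - t0) ^+ 2) (al + sg * GG m rho (S (t - t0))).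
have hE s : E (t0 + TT m rho s) = pol (rho + s ^+ 2) (al + sg * GG m rho s).
  by rewrite /E [t0 + _]addrC addrK hS.
by exists E => //; left; exists rho, sg, al, t0.
Qed.

Lemma track_rev E x : track E -> track (fun t => E (x - t)).
Proof.
case=> [[rho [sg [al [t0 [hr hsg hE]]]]]|[t0 [th hE]]]; [left|right].
  exists rho, (- sg), al, (x - t0); split=> //; first by rewrite sqrrN.
  move=> s; have -> : x - (x - t0 + TT m rho s) = t0 + TT m rho (- s) by rewrite (TN vM hr); ring.
  by rewrite hE sqrrN (GN vM hr) mulrN mulNr.
exists (x - t0), (th + pi) => t; rewrite hE -polN; congr pol; ring.
Qed.

Lemma track_lip E t1 t2 : track E -> dist m (E t1) (E t2) <= `|t1 - t2|.
Proof.
move=> tE; wlog t12 : t1 t2 / t1 <= t2 => [hw|].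
  by case: (leP t1 t2) => [/hw//|/ltW/hw]; rewrite (dist_sym vM) [`|t1 - t2|]distrC.
case: tE => [[rho [sg [al [t0 [hr hsg hE]]]]]|[t0 [th hE]]]; last first.
  by rewrite !hE; apply: le_trans (dist_axis _ _ _) _; rewrite opprB addrA subrK.
have [s1 e1] := TT_surj (t1 - t0) hr; have [s2 e2] := TT_surj (t2 - t0) hr.
have s12 : s1 <= s2.
  rewrite leNgt; apply/negP => /(T_lt vM hr); rewrite e1 e2; lra.
have -> : t1 = t0 + TT m rho s1 by rewrite e1; ring.
have -> : t2 = t0 + TT m rho s2 by rewrite e2; ring.
rewrite !hE; have := arc_dist vM (al + sg * GG m rho s1) hr s12 hsg.
have -> : al + sg * GG m rho s1 + sg * (GG m rho s2 - GG m rho s1) = al + sg * GG m rho s2 by ring.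
move=> h; apply: (le_trans h); rewrite distrC ger0_norm; first by rewrite opprD addrACA subrr add0r.
by rewrite subr_ge0 lerD2l (T_le vM hr).
Qed.

(** For first variations: a quantity minimal at [d = 0] and known up to a quadratic error has no
    linear term. *)
Lemma lin_quad (k C : R) : (forall d : R, 0 <= k * d + C * d ^+ 2) -> k = 0.
Proof.
move=> hd; apply/eqP; apply: contraT => kn.
have C0 : 0 < `|C| + 1 by rewrite ltr_wpDl.
have := hd (- k / (2 * (`|C| + 1))).
have hC : C <= `|C| + 1 by apply: le_trans (ler_norm C) _; rewrite lerDl.
have k2 : 0 < k ^+ 2 by rewrite exprn_even_gt0.
have -> : k * (- k / (2 * (`|C| + 1))) + C * (- k / (2 * (`|C| + 1))) ^+ 2 =
   (k ^+ 2 / (4 * (`|C| + 1) ^+ 2)) * (C - 2 * (`|C| + 1)) by field; rewrite gt_eqF.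
have : 0 < k ^+ 2 / (4 * (`|C| + 1) ^+ 2) by rewrite divr_gt0// mulr_gt0// exprn_gt0.
move: (k ^+ 2 / _) hC C0; move: `|C| => c hC C0 q q0; nra.
Qed.

Variable h : R -> R.
Hypothesis dh : forall x : R, 0 < x -> is_derive x 1 h (- (m x ^- 2)).

(** A radial segment has no first-order variation under rotation of one end. *)
Lemma spiral_sym a b al : 0 < a -> 0 < b -> a != b -> exists C : R, forall d : R,
  dist m (pol a (al + d)) (pol b al) <= `|b - a| + C * d ^+ 2.
Proof.
move=> a0 b0 ab; case: (ltgtP a b) => [lt|lt|e]; last by rewrite e eqxx in ab.
- exists (2 * (h a - h b))^-1 => d; have := spiral_le vM dh (al + d) (- d) a0 lt.
  by rewrite addrK sqrrN gtr0_norm ?subr_gt0// [_ ^+ 2 / _]mulrC.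
exists (2 * (h b - h a))^-1 => d; rewrite (dist_sym vM).
by have := spiral_le vM dh al d b0 lt; rewrite ltr0_norm ?subr_lt0// opprB [_ ^+ 2 / _]mulrC.
Qed.

(** The strip argument breaks down where [dr/dt = 0]. Instead [arc_to] describes a shortest path
    from the vertex to [g t], and the vertex is rotated by [d]: the linear terms of both sides must
    cancel, so this path has the Clairaut constant and the sense of the incoming arc. Starting at
    the radius [rho], it then starts at its own vertex and continues that arc. *)
Lemma vertex_nobranch rho sg al t1 eta E g : Reg rho -> sg ^+ 2 = 1 -> 0 < eta ->
  (forall s, E (t1 + TT m rho s) = pol (rho + s ^+ 2) (al + sg * GG m rho s)) ->
  minimizing m g (t1 - eta) (t1 + eta) ->
  (forall t, t1 - eta <= t <= t1 -> g t = E t) ->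
  exists2 e : R, 0 < e & forall t, t1 <= t <= t1 + e -> g t = E t.
Proof.
move=> hr hsg eta0 hE hg he; have rho0 := Reg_gt0 hr; have c0 := c_gt0 vM hr.
have g1 : g t1 = pol rho al.
  rewrite he; last by lra.
  by have := hE 0; rewrite (T0 m rho) (G0 m rho) expr0n mulr0 !addr0.
have [sa ea] := TT_surj (- eta) hr.
have sa0 : sa < 0.
  rewrite ltNge; apply/negP => /(T_le vM hr); rewrite ea (T0 m rho); lra.
have gy : g (t1 - eta) = pol (rho + sa ^+ 2) (al + sg * GG m rho sa).
  by rewrite he; [rewrite -hE ea|lra].
have [C1 _ hC1] := arc_spread vM (al + sg * GG m rho sa) hr sa0 hsg.
have {}hC1 (d : R) : dist m (g (t1 - eta)) (pol rho (al + d)) <= eta + sg * m rho * d + C1 * d ^+ 2.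
  have := hC1 d; rewrite gy ea (T0 m rho) (G0 m rho) expr0n addr0 !sub0r opprK.
  by have -> : al + sg * GG m rho sa + sg * - GG m rho sa + d = al + d by ring.
exists (Num.min eta (rho / 2)); first by rewrite lt_min eta0 divr_gt0.
move=> t; rewrite le_eqVlt => /andP[/predU1P[<- _|tt ht]]; first by rewrite he//; lra.
have [ht1 ht2] : t - t1 <= eta /\ t - t1 <= rho / 2.
  by move: ht; rewrite -lerBlDl le_min => /andP[].
set u := t - t1 in ht1 ht2; have u0 : 0 < u by rewrite subr_gt0.
set z := g t.
have du : dist m (pol rho al) z = u.
  by rewrite -g1 hg ?ltr0_norm ?subr_lt0// ?opprB//; rewrite /u in ht1; lra.
have dv : dist m (g (t1 - eta)) z = eta + u.
  rewrite hg ?ltr0_norm; rewrite /u in ht1 *; lra.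
have rz : `|rad z - rho| <= u by have := rad_dist vM (pol rho al) z; rewrite du rad_pol_ge0 ?(ltW rho0).
have z0 : 0 < rad z by move: rz; rewrite ler_norml; lra.
have lq (k C : R) : (forall d : R, dist m (pol rho (al + d)) z <= u + k * d + C * d ^+ 2) -> k = - (sg * m rho).
  move=> hk; apply/eqP; rewrite -subr_eq0 opprK; apply/eqP.
  apply: (@lin_quad _ (C + C1)) => d; have := dist_triangle vM (g (t1 - eta)) (pol rho (al + d)) z.
  rewrite dv; have := hk d; have := hC1 d.
  have -> : (k + sg * m rho) * d + (C + C1) * d ^+ 2 = (k * d + C * d ^+ 2) + (sg * m rho * d + C1 * d ^+ 2) by ring.
  move: (k * d) (C * d ^+ 2) (sg * m rho * d) (C1 * d ^+ 2) => x1 x2 x3 x4; hlra.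
have [sg' [vt [hsg' hvt ez [vt0|dsum|[rho' [sa' [s' [[hr' ss'] [e1 e2 e3 e4]]]]]]]]] := arc_to al hr z0.
- exfalso; have ez0 : z = pol (rad z) al by rewrite {1}ez vt0 mulr0 addr0.
  have rn : rho != rad z.
    by apply/eqP => er; move: du; rewrite ez0 -er (distxx vM) => /eqP; rewrite lt_eqF.
  have [C hC] := spiral_sym al rho0 z0 rn.
  have : (0 : R) = - (sg * m rho).
    apply: (lq 0 C) => d; rewrite mul0r addr0 {1}ez0; apply: le_trans (hC d) _.
    by rewrite lerD2r.
  move/eqP; rewrite eq_sym oppr_eq0 mulf_eq0 [m rho == 0]gt_eqF// orbF => /eqP sg0.
  by move/eqP: hsg; rewrite sg0 expr0n eq_sym oner_eq0.
- by exfalso; move: dsum; rewrite du; lra.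
have ss : sa' < s'.
  by rewrite lt_neqAle ss' andbT; apply/eqP => es; move: e4; rewrite du es subrr => /eqP; rewrite gt_eqF.
have kk : - (sg' * m rho') = - (sg * m rho).
  have ss2 : - s' < - sa' by rewrite ltrN2.
  have hsg2 : (- sg') ^+ 2 = 1 by rewrite sqrrN.
  have [C2 _ hC2] := arc_spread vM (al + sg' * vt) hr' ss2 hsg2.
  have rot (d : R) : dist m (pol rho (al + d)) z <= u - sg' * m rho' * d + C2 * d ^+ 2.
    rewrite (dist_sym vM); have := hC2 d; rewrite !sqrrN e1 e2 -ez !(GN vM hr') !(TN vM hr') !opprK mulNr.
    have -> : al + sg' * vt + - (sg' * (- GG m rho' sa' + GG m rho' s')) + d = al + d by rewrite -e3; ring.
    have -> : - TT m rho' sa' + TT m rho' s' = u by rewrite -du e4 addrC.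
    by rewrite !mulNr.
  by apply: (lq _ C2) => d; rewrite mulNr; exact: rot.
have {}kk : sg' * m rho' = sg * m rho by apply: oppr_inj.
have c0' := c_gt0 vM hr'.
have mm : m rho' = m rho.
  apply/eqP; rewrite -(@eqrXn2 _ 2) ?(ltW c0) ?(ltW c0')//; apply/eqP.
  by rewrite -[LHS]mul1r -hsg' -exprMn kk exprMn hsg mul1r.
have er := Reg_inj hr' hr mm; have es : sg' = sg.
  by apply: (mulIf (_ : m rho != 0)); [rewrite gt_eqF|rewrite -kk mm].
rewrite er in e1 e2 e3 e4.
have sa0' : sa' = 0.
  by apply/eqP; rewrite -sqrf_eq0; apply/eqP; apply: (addrI rho); rewrite addr0.
rewrite sa0' (T0 m rho) (G0 m rho) !subr0 in e3 e4.
rewrite ez es -e3 -e2 -hE -e4 du; congr E; rewrite /u; ring.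
Qed.

End Tracks.

(** * Existence of poles *)

Section Poles.
Variables (R : realType) (m : R -> R).
Hypothesis vM : von_Mangoldt m.
Notation pt := (R * R)%type.
Implicit Types (s t x y r rho e th al sg : R) (p q z : pt) (g E : R -> pt).
Local Notation Reg := (Reg m).
Variable h : R -> R.
Hypothesis dh : forall x : R, 0 < x -> is_derive x 1 h (- (m x ^- 2)).

Lemma nonvertex_nobranch rho sg al t0 s1 eta E g : Reg rho -> sg ^+ 2 = 1 -> 0 < eta -> s1 != 0 ->
  (forall s, E (t0 + TT m rho s) = pol (rho + s ^+ 2) (al + sg * GG m rho s)) ->
  let t1 := t0 + TT m rho s1 in
  minimizing m g (t1 - eta) (t1 + eta) ->
  (forall t, t1 - eta <= t <= t1 -> g t = E t) ->
  exists2 e : R, 0 < e & forall t, t1 <= t <= t1 + e -> g t = E t.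
Proof.
move=> hr hsg eta0 s1n hE t1 hg he.
have [S [hS dS]] := inverse_ex (dT vM hr) (dT_gt0 vM hr).
have c0 := c_gt0 vM hr.
have ES t : E t = pol (rho + S (t - t0) ^+ 2) (al + sg * GG m rho (S (t - t0))).
  have [s es] := TT_surj vM (t - t0) hr.
  by rewrite -es hS -hE es; congr E; ring.
have s1p : 0 < `|s1| by rewrite normr_gt0.
have cS : continuous_at (TT m rho s1) S by exact: der_cont (dS s1).
have [d d0 hd] := cont_dist cS s1p.
pose e := Num.min (d / 2) eta.
have e0 : 0 < e by rewrite lt_min divr_gt0.
have : e <= e by [].
rewrite {2}/e le_min => /andP[ed ee].
pose sig : R := if 0 < s1 then 1 else -1.
have hsig : sig ^+ 2 = 1 by rewrite /sig; case: ifP; rewrite ?sqrrN expr1n.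
have sgS t : t1 - e <= t <= t1 + e -> 0 < sig * S (t - t0).
  move=> ht; have : `|S (t - t0) - S (TT m rho s1)| < `|s1|.
    by apply: hd; rewrite /t1 in ht; rewrite ltr_norml; lra.
  rewrite hS /sig; case: ifPn => [s0|]; first by rewrite mul1r (gtr0_norm s0) ltr_norml; lra.
  rewrite -leNgt le_eqVlt (negbTE s1n) => /= s0.
  by rewrite mulN1r (ltr0_norm s0) ltr_norml; lra.
have dSt t : is_derive t 1 (fun t => S (t - t0)) (2 * m (rho + S (t - t0) ^+ 2) / wE m rho (S (t - t0)))^-1.
  have [s es] := TT_surj vM (t - t0) hr.
  have h1 := dS s; rewrite es in h1.
  have h2 : is_derive t (1 : R) (fun t : R => t - t0) 1 by der; ring.
  have := der_comp (f := S) (g := fun t : R => t - t0) h1 h2; rewrite -es hS mulr1; exact.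
have [e' e'0 he'] : exists2 e' : R, 0 < e' & forall t, t1 <= t <= t1 + e' ->
    g t = pol (rho + S (t - t0) ^+ 2) (al + sg * GG m rho (S (t - t0))).
  apply: (nobranch vM (c := sg * m rho) (sg := sig) (eta := e) (r := fun t => rho + S (t - t0) ^+ 2)
    (th := fun t => al + sg * GG m rho (S (t - t0))) hsig e0).
  - move=> t ht; have := sgS t ht; have h1 := dSt t; move: h1; set s := S (t - t0) => h1 s0.
    have sn : s != 0 by apply: contraTneq s0 => ->; rewrite mulr0 ltxx.
    have M0 := mrr_gt0 vM hr s; have w0 := wE_gt0 vM hr s.
    have cm := c_lt hr sn.
    have nsg : `|sg| = 1 by apply/eqP; rewrite -sqr_norm_eq1 hsg.
    split; first exact: rr_gt0 hr s.
    + by rewrite normrM nsg mul1r gtr0_norm.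
    + have -> : Num.sqrt (1 - (sg * m rho / m (rho + s ^+ 2)) ^+ 2) = sig * s * wE m rho s / m (rho + s ^+ 2).
        have p0 : 0 <= sig * s * wE m rho s / m (rho + s ^+ 2).
          by rewrite divr_ge0 ?(ltW M0)// mulr_ge0 ?ltW.
        rewrite -[RHS]ger0_norm// -sqrtr_sqr; congr Num.sqrt.
        have -> : (sig * s * wE m rho s / m (rho + s ^+ 2)) ^+ 2 = sig ^+ 2 * (s * wE m rho s) ^+ 2 / m (rho + s ^+ 2) ^+ 2.
          by field; rewrite gt_eqF.
        rewrite hsig mul1r (wE_sqr vM hr).
        have -> : (sg * m rho / m (rho + s ^+ 2)) ^+ 2 = sg ^+ 2 * m rho ^+ 2 / m (rho + s ^+ 2) ^+ 2.
          by field; rewrite gt_eqF.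
        by rewrite hsg; field; rewrite gt_eqF.
      der; rewrite -/s.
      transitivity (sig ^+ 2 * (s * wE m rho s / m (rho + s ^+ 2))); last by ring.
      by rewrite hsig; field; rewrite !gt_eqF.
    have h2 := dG vM hr s.
    have h3 := der_comp (f := GG m rho) (g := fun t => S (t - t0)) h2 h1.
    der; rewrite -/s.
    by field; rewrite !gt_eqF.
  - by move=> x y hx hy; apply: hg; lra.
  - by move=> t ht; rewrite -ES; apply: he; lra.
by exists e' => // t ht; rewrite ES he'.
Qed.

(** Off the origin this is [nobranch] with Clairaut constant 0. At the origin any direction but the
    opposite one makes a corner, excluded by [through_not_min]. *)
Lemma axis_nobranch t0 th t1 eta E g : 0 < eta -> (forall t, E t = pol (t - t0) th) ->
  minimizing m g (t1 - eta) (t1 + eta) ->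
  (forall t, t1 - eta <= t <= t1 -> g t = E t) ->
  exists2 e : R, 0 < e & forall t, t1 <= t <= t1 + e -> g t = E t.
Proof.
move=> eta0 hE hg he.
have dsub (a : R) (t : R) : is_derive t (1 : R) (fun t : R => t - a) 1 by der; ring.
have dsub' (a : R) (t : R) : is_derive t (1 : R) (fun t : R => a - t) (-1) by der; ring.
case: (ltgtP t1 t0) => [lt|lt|et].
- pose e := Num.min ((t0 - t1) / 2) eta.
  have e0 : 0 < e by rewrite lt_min eta0 andbT divr_gt0// subr_gt0.
  have : e <= e by [].
  rewrite {2}/e le_min => /andP[ed ee].
  have [e' e'0 he'] : exists2 e' : R, 0 < e' & forall t, t1 <= t <= t1 + e' -> g t = pol (t0 - t) (th + pi).
    apply: (nobranch vM (c := 0) (sg := -1) (eta := e) (r := fun t => t0 - t) (th := fun=> th + pi)).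
    + by rewrite sqrrN expr1n.
    + exact: e0.
    + move=> t ht; have tp : 0 < t0 - t by lra.
      split=> //; first by rewrite normr0; exact (m_gt0 vM tp).
        by rewrite mul0r expr0n subr0 sqrtr1 mulr1; exact: dsub'.
      by rewrite mul0r; exact: der_cst.
    + by move=> x y hx hy; apply: hg; lra.
    by move=> t ht; rewrite -polN opprB -hE; apply: he; lra.
  by exists e' => // t ht; rewrite hE he'// -polN opprB.
- pose e := Num.min ((t1 - t0) / 2) eta.
  have e0 : 0 < e by rewrite lt_min eta0 andbT divr_gt0// subr_gt0.
  have : e <= e by [].
  rewrite {2}/e le_min => /andP[ed ee].
  have [e' e'0 he'] : exists2 e' : R, 0 < e' & forall t, t1 <= t <= t1 + e' -> g t = pol (t - t0) th.
    apply: (nobranch vM (c := 0) (sg := 1) (eta := e) (r := fun t => t - t0) (th := fun=> th)).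
    + by rewrite expr1n.
    + exact: e0.
    + move=> t ht; have tp : 0 < t - t0 by lra.
      split=> //; first by rewrite normr0; exact (m_gt0 vM tp).
        by rewrite mul0r expr0n subr0 sqrtr1 mulr1; exact: dsub.
      by rewrite mul0r; exact: der_cst.
    + by move=> x y hx hy; apply: hg; lra.
    by move=> t ht; rewrite -hE; apply: he; lra.
  by exists e' => // t ht; rewrite hE he'.
exists eta => // t; rewrite le_eqVlt => /andP[/predU1P[<- _|tt ht]]; first by rewrite he//; lra.
set u := t - t1; have u0 : 0 < u by rewrite subr_gt0.
have gy : g (t1 - u) = pol u (th + pi).
  rewrite he; last by rewrite /u; lra.
  by rewrite hE -polN; congr pol; rewrite -et /u; ring.
have g1 : g t1 = origin R.
  by rewrite he ?hE ?et ?subrr ?pol0//; lra.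
have d1 : rad (g t) = u.
  by rewrite -(dist_origin vM) -g1 hg ?ltr0_norm ?subr_lt0// ?opprB//; lra.
have d2 : dist m (g (t1 - u)) (g t) = u + u.
  by rewrite hg ?ltr0_norm; rewrite /u; lra.
have [sg [vt [hsg /andP[v0 vpi] ez]]] := polar_from (th + pi) (g t).
rewrite d1 in ez.
have [vlt|vge] := ltP vt pi.
  by have := through_not_min vM (th + pi) u0 u0 v0 vlt hsg; rewrite -ez -gy d2 ltxx.
have vE : vt = pi by apply/eqP; rewrite eq_le vpi.
by rewrite ez vE pol_pi// -!polN opprK hE -et.
Qed.

Lemma track_nobranch E t1 eta g : track m E -> 0 < eta ->
  minimizing m g (t1 - eta) (t1 + eta) ->
  (forall t, t1 - eta <= t <= t1 -> g t = E t) ->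
  exists2 e : R, 0 < e & forall t, t1 <= t <= t1 + e -> g t = E t.
Proof.
case=> [[rho [sg [al [t0 [hr hsg hE]]]]]|[t0 [th hE]]] eta0 hg he; last exact: axis_nobranch hE hg he.
have [s es] := TT_surj vM (t1 - t0) hr.
have et : t1 = t0 + TT m rho s by rewrite es; ring.
have [s0|sn] := eqVneq s 0.
  apply: (vertex_nobranch vM dh hr hsg eta0 _ hg he) => x.
  by rewrite et s0 (T0 m rho) addr0 hE.
by rewrite et in hg he *; exact: (nonvertex_nobranch hr hsg eta0 sn hE hg he).
Qed.

(** The set of times up to which [g] follows [E] is closed, both curves being 1-Lipschitz near its
    supremum, and [track_nobranch] extends it beyond. *)
Lemma track_forward E g a a1 b : track m E -> a < a1 -> a1 <= b ->
  (forall t, a < t -> t <= b -> exists2 eta : R, 0 < eta & minimizing m g (t - eta) (t + eta)) ->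
  (forall t, a <= t <= a1 -> g t = E t) -> forall t, a <= t <= b -> g t = E t.
Proof.
move=> tE aa ab hloc he.
pose B := [set x | a1 <= x <= b /\ forall t, a <= t <= x -> g t = E t].
have B1 : B a1 by split=> //; rewrite lexx.
have supB : has_sup B by split; [exists a1|exists b => x [/andP[]]].
set s := sup B.
have s1 : a1 <= s by apply: ub_le_sup => //; case: supB.
have sb : s <= b by apply: ge_sup; [exists a1|move=> x [/andP[]]].
have hlt t : a <= t -> t < s -> g t = E t.
  move=> at_ ts; have st : 0 < s - t by rewrite subr_gt0.
  have [x [_ hx] hx2] := sup_adherent st supB.
  by apply: hx; rewrite at_ /=; rewrite -/s in hx2; lra.
have as_ : a < s by lra.
have [eta eta0 hg] := hloc s as_ sb.
have gs : g s = E s.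
  apply: (dist_eq0 vM); apply/eqP; rewrite eq_le (dist_ge0 vM) andbT leNgt; apply/negP => D0.
  pose u := Num.min (dist m (g s) (E s) / 4) (Num.min eta (s - a)).
  have u0 : 0 < u by rewrite !lt_min eta0 subr_gt0 as_ divr_gt0.
  have : u <= u by [].
  rewrite {2}/u !le_min => /and3P[u1 u2 u3].
  have es : g (s - u) = E (s - u) by apply: hlt; lra.
  have h1 : dist m (g s) (g (s - u)) = u.
    have i1 : s - eta <= s <= s + eta by clear - u0 u2; lra.
    have i2 : s - eta <= s - u <= s + eta by clear - u0 u2; lra.
    by rewrite hg// (_ : s - (s - u) = u) ?gtr0_norm//; ring.
  have h2 : dist m (E (s - u)) (E s) <= u.
    by apply: le_trans (track_lip vM _ _ tE) _; rewrite ltr0_norm; lra.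
  have := dist_triangle vM (g s) (g (s - u)) (E s); rewrite h1 es.
  by hlra.
have hle t : a <= t <= s -> g t = E t.
  by move=> /andP[h1]; rewrite le_eqVlt => /predU1P[->//|]; exact: hlt.
have [sb'|bs] := ltP s b; last by move=> t ht; apply: hle; lra.
pose et := Num.min eta (s - a).
have et0 : 0 < et by rewrite lt_min eta0 subr_gt0.
have : et <= et by [].
rewrite {2}/et le_min => /andP[et1 et2].
have hg' : minimizing m g (s - et) (s + et) by move=> x y hx hy; apply: hg; lra.
have he' t : s - et <= t <= s -> g t = E t by move=> ht; apply: hle; lra.
have [e e0 hs] := track_nobranch tE et0 hg' he'.
pose x := Num.min (s + e) b.
have sx : s < x by rewrite lt_min sb' andbT; lra.
have xb : x <= b by rewrite ge_min lexx orbT.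
have xe : x <= s + e by rewrite ge_min lexx.
have : B x.
  split; first by rewrite xb andbT; lra.
  move=> t ht; have [ts|ts] := leP t s; first by apply: hle; lra.
  by apply: hs; lra.
by move=> /(ub_le_sup (proj2 supB)); rewrite -/s leNgt sx.
Qed.

(** A geodesic [g] from [p] minimizes up to some time [t1]; let [E] be the minimizing track from [p]
    through [g t1]. The path [k], equal to [g] before [t1] and to [E] after, minimizes as well.
    Unique continuation run backwards from beyond [t1] gives [g = E] on [[0, t1]], and run forwards
    it gives equality everywhere. *)
Lemma pole_of_tracks p : (forall x : pt, x != p -> exists E, [/\ track m E, E 0 = p, E (dist m p x) = x &
  forall t, 0 <= t -> dist m p (E t) = t]) -> pole m p.
Proof.
move=> hp g gg g0; have [e e0 he] := gg 0 (lexx 0).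
pose t1 := e / 2; have t10 : 0 < t1 by exact: divr_gt0.
have te : t1 < e by rewrite /t1; lra.
have gmin s1 s2 : 0 <= s1 <= t1 -> 0 <= s2 <= t1 -> dist m (g s1) (g s2) = `|s1 - s2|.
  by move=> /andP[a1 a2] /andP[b1 b2]; apply: he; rewrite ?subr0 ?ger0_norm//; lra.
have d1 : dist m p (g t1) = t1 by rewrite -g0 gmin ?ltr0_norm; lra.
have xp : g t1 != p.
  by apply: contraTneq t10 => ex; rewrite -d1 ex (distxx vM) ltxx.
have [E [tE E0 E1 hE]] := hp _ xp; rewrite d1 in E1.
have Elip s1 s2 : 0 <= s1 -> 0 <= s2 -> dist m (E s1) (E s2) = `|s1 - s2|.
  wlog s12 : s1 s2 / s1 <= s2 => [hw h1 h2|h1 h2].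
    by case: (leP s1 s2) => [/hw|/ltW/hw]; [apply|rewrite (dist_sym vM) [`|s1 - s2|]distrC; apply].
  apply/eqP; rewrite eq_le (track_lip vM)//=.
  have := dist_triangle vM p (E s1) (E s2); rewrite !hE// => h3.
  by rewrite distrC ger0_norm ?subr_ge0//; hlra.
pose k t := if t <= t1 then g t else E t.
have kmin s1 s2 : 0 <= s1 -> 0 <= s2 -> dist m (k s1) (k s2) = `|s1 - s2|.
  wlog s12 : s1 s2 / s1 <= s2 => [hw h1 h2|h1 h2].
    by case: (leP s1 s2) => [/hw|/ltW/hw]; [apply|rewrite (dist_sym vM) [`|s1 - s2|]distrC; apply].
  rewrite /k; case: (leP s1 t1) => k1; case: (leP s2 t1) => k2.
  - by apply: gmin; lra.
  - apply/eqP; rewrite distrC ger0_norm ?subr_ge0// eq_le; apply/andP; split.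
      apply: le_trans (dist_triangle vM _ (g t1) _) _.
      rewrite gmin ?lexx ?(ltW t10) ?h1// -[in X in _ + X]E1 Elip ?(ltW t10)//.
      by rewrite distrC ger0_norm ?subr_ge0// ltr0_norm ?subr_lt0//; hlra.
    have := dist_triangle vM p (g s1) (E s2); rewrite hE//.
    have -> : dist m p (g s1) = s1.
      by rewrite -g0 gmin ?lexx ?(ltW t10) ?h1// sub0r normrN ger0_norm.
    by hlra.
  - by have := le_lt_trans k2 k1; rewrite ltNge s12.
  exact: Elip.
(* Time is reversed about [t1]: for [x] in [[0, t1]] the reversed path is [E], and it is followed
   down to the time [t > 0], so that the neighbourhoods used stay in nonnegative times. *)
have back t : 0 < t -> t <= t1 -> g t = E t.
  move=> t0 tt; pose b := 2 * t1 - t.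
  have hb : forall x, 0 <= x <= b -> k (2 * t1 - x) = E (2 * t1 - x).
    apply: (@track_forward (fun x => E (2 * t1 - x)) (fun x => k (2 * t1 - x)) 0 t1 b (track_rev vM _ tE) t10).
    - by rewrite /b; lra.
    - move=> x x0 xb; exists (Num.min (b - x + t) t1).
        by rewrite lt_min t10 andbT; rewrite /b in xb *; lra.
      have : Num.min (b - x + t) t1 <= b - x + t by rewrite ge_min lexx.
      set et := Num.min _ _ => het s1 s2 hs1 hs2.
      rewrite kmin; [|rewrite /b in het; lra|rewrite /b in het; lra].
      by rewrite distrC; congr `|_|; ring.
    move=> x hx; rewrite /k; case: leP => // hh.
    have -> : 2 * t1 - x = t1 by lra.
    by rewrite E1.
  have hbb : 0 <= b <= b by rewrite /b; lra.
  have := hb b hbb; rewrite /k (_ : 2 * t1 - b = t) ?tt// /b; ring.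
have {}back t : 0 <= t <= t1 -> g t = E t.
  by rewrite le_eqVlt => /andP[/predU1P[<- _|t0 tt]]; [rewrite g0 E0|exact: back].
have gE t : 0 <= t -> g t = E t.
  move=> t0; have [tt|tt] := leP t t1; first by apply: back; rewrite t0.
  apply: (@track_forward E g 0 t1 t tE t10 (ltW tt)) => //; last by rewrite t0 lexx.
  move=> x x0 xt; have [d d0 hd] := gg x (ltW x0).
  pose et := Num.min (d / 2) x.
  have et0 : 0 < et by rewrite lt_min x0 divr_gt0.
  have : et <= et by [].
  rewrite {2}/et le_min => /andP[et1 et2].
  exists et => // s1 s2 hs1 hs2; apply: hd; rewrite ?ltr_norml; lra.
split=> // s t s0 t0; rewrite !gE//; exact: Elip.
Qed.

Lemma origin_pole : pole m (origin R).
Proof.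
apply: pole_of_tracks => x xn; have [th ex] := pol_ex x.
exists (fun t => pol (t - 0) th); split.
- by right; exists 0, th.
- by rewrite subrr pol0.
- by rewrite (dist_origin vM) subr0.
by move=> t t0; rewrite (dist_origin vM) subr0 rad_pol_ge0.
Qed.

(** With [h >= M], a small radius [a] has [h a > - M - 2 * k0], hence [h a + h b + 2 * k0 > 0] for
    all [b]. No arc from this radius turns by [pi], so all of them minimize forever; a point is
    joined to the pole by an arc, or by a radial track if the angle between them is 0 or [pi]. *)
Lemma pole_ex : (exists M, forall r, 0 < r -> M <= h r) -> exists2 q : pt, q != origin R & pole m q.
Proof.
move=> fin; have [rho0 hr0] := fin_Reg vM dh fin; case: fin => M hM.
have [k0 [k0_le _]] := k0_ex vM dh.
have [d d0 hd] := h_unbounded vM dh (- M - 2 * k0).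
have r00 := Reg_gt0 hr0.
pose a := Num.min d rho0.
have a0 : 0 < a by rewrite lt_min d0.
have ad : a <= d by rewrite ge_min lexx.
have ar : a <= rho0 by rewrite ge_min lexx orbT.
have ha : Reg a := Reg_lt vM hr0 a0 ar.
have hab b : 0 < b -> 0 < h a + h b + 2 * k0.
  by move=> b0; have := hM b b0; have := hd a a0 ad; lra.
have turn rho sa s : Reg rho -> rho + sa ^+ 2 = a -> sa <= s -> GG m rho s - GG m rho sa < pi.
  move=> hr ea ss; apply: (turn_lt vM dh k0_le hr ss) => t _.
  by rewrite ea; apply: hab; exact: (rr_gt0 hr t).
pose al : R := 0.
(* The angle to the opposite point is [pi], which no arc sweeps; of the three cases of [arc_to] only
   the path through the origin remains. *)
have sum b : 0 < b -> dist m (pol a al) (pol b (al + pi)) = a + b.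
  move=> b0; have z0 : 0 < rad (pol b (al + pi)) by rewrite rad_pol_ge0// ltW.
  have [sg [vt [hsg hvt ez]]] := arc_to vM al ha z0; rewrite rad_pol_ge0 ?(ltW b0)// in ez *.
  have [_ ec _] := pol_angle b0 b0 ez.
  have vE : vt = pi.
    move/andP: hvt => [v0 vpi]; apply/eqP; rewrite eq_le vpi leNgt/=; apply/negP => vlt.
    have : cos pi < cos vt :> R by rewrite ltr_cos ?in_itv/= ?v0 ?vpi ?pi_ge0 ?lexx.
    have -> : cos vt = cos (pi : R).
      move: ec; rewrite /al !add0r => ->; case: (signP hsg) => ->; rewrite ?mul1r// mulN1r cosN//.
    by rewrite ltxx.
  case=> [vt0|//|[rho [sa [s [[hr ss] [e1 e2 e3 e4]]]]]].
    by have := pi_gt0 R; rewrite -vE vt0 ltxx.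
  by have := turn rho sa s hr e1 ss; rewrite e3 vE ltxx.
have through : exists E, [/\ track m E, E 0 = pol a al, forall b, 0 <= b -> E (a + b) = pol b (al + pi),
    forall b, 0 <= b <= a -> E (a - b) = pol b al & forall t, 0 <= t -> dist m (pol a al) (E t) = t].
  exists (fun t => pol (t - a) (al + pi)); split.
  - by right; exists a, (al + pi).
  - by rewrite sub0r -polN opprK.
  - by move=> b b0; rewrite [a + b]addrC addrK.
  - by move=> b b0; rewrite -polN; congr pol; ring.
  move=> t t0; have [ta|at_] := leP t a.
    rewrite -polN opprB (dist_radial vM) ?(ltW a0) ?subr_ge0//.
    by rewrite ler0_norm; lra.
  by rewrite sum ?subr_gt0// addrC subrK.
exists (pol a al); first exact: pol_neq0.
apply: pole_of_tracks => x xn.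
have [Et [tEt Et0 Et1 Et2 Et3]] := through.
have := rad_ge0 x; rewrite le_eqVlt => /predU1P[/esym r0|r0].
  move/eqP: r0; rewrite rad_eq0 => /eqP ->.
  exists Et; split=> //; rewrite (dist_sym vM) (dist_origin vM) rad_pol_ge0 ?(ltW a0)//.
  by have := Et1 0 (lexx 0); rewrite addr0 !pol0.
have [sg [vt [hsg hvt ez [vt0|dsum|[rho [sa [s [[hr ss] [e1 e2 e3 e4]]]]]]]]] := arc_to vM al ha r0.
- rewrite vt0 mulr0 addr0 in ez.
  have [bl|bl] := leP (rad x) a.
    exists Et; split=> //; rewrite {1 2}ez (dist_radial vM) ?(ltW a0) ?rad_ge0// ler0_norm ?subr_le0// opprB.
    by rewrite Et2// rad_ge0.
  exists (fun t => pol (t - - a) al); split.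
  + by right; exists (- a), al.
  + by rewrite opprK add0r.
  + by rewrite {1 2}ez (dist_radial vM) ?(ltW a0) ?rad_ge0// ger0_norm ?subr_ge0 ?(ltW bl)// opprK subrK.
  by move=> t t0; rewrite opprK (dist_radial vM) ?addr_ge0 ?(ltW a0)// addrK ger0_norm.
- have [vlt|vge] := ltP vt pi.
    by move/andP: hvt => [v0 _]; have := through_not_min vM al a0 r0 v0 vlt hsg; rewrite -ez dsum ltxx.
  have vE : vt = pi by apply/eqP; rewrite eq_le vge andbT; case/andP: hvt.
  exists Et; split=> //; rewrite dsum Et1 ?(ltW r0)//.
  by rewrite {2}ez vE pol_pi.
have [E tE hE] := arc_track_ex vM (al - sg * GG m rho sa) (- TT m rho sa) hr hsg.
have E' s' : E (TT m rho s' - TT m rho sa) = pol (rho + s' ^+ 2) (al + sg * (GG m rho s' - GG m rho sa)).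
  by rewrite addrC hE; congr pol; ring.
exists E; split=> //.
- by have := E' sa; rewrite !subrr mulr0 addr0 e1.
- by rewrite e4 E' e2 e3 -ez.
move=> t t0; have [s' ss' es'] := TT_onto vM sa hr t0.
have -> : t = TT m rho s' - TT m rho sa by rewrite es'; ring.
rewrite E' -e1; apply: (arc_min vM dh) => //; first by rewrite e1.
exact: turn.
Qed.

End Poles.

Section Radius.
Variables (R : realType) (m : R -> R).
Hypothesis vM : von_Mangoldt m.
Notation pt := (R * R)%type.
Implicit Types (r a b th : R) (q : pt).

Lemma pole_le_Rp q : pole m q -> ((rad q)%:E <= Rp m)%E.
Proof. by move=> hq; apply: ereal_sup_ubound; exists q => //; rewrite (dist_origin vM). Qed.

Lemma segment_component (A : set pt) r th : 0 <= r -> (forall x : R, 0 <= x <= r -> A (pol x th)) ->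
  connected_component A (origin R) (pol r th).
Proof.
move=> r0 hA; pose f (x : R) : pt := pol x th.
have cf : continuous f.
  move=> x; apply: differentiable_continuous; apply/derivable1_diffP.
  have hx (y : R) : is_derive y (1 : R) (fun t : R => t * cos th) (cos th) by der; ring.
  have hy (y : R) : is_derive y (1 : R) (fun t : R => t * sin th) (sin th) by der; ring.
  by have [] := der_pair (dx := fun=> cos th) (dy := fun=> sin th) (hx x) (hy x).
apply: (@connected_component_max _ A (f @` `[0, r])).
- by exists 0; [rewrite /= in_itv/= lexx r0|rewrite /f pol0].
- by move=> _ [x /= hx <-]; apply: hA; move: hx; rewrite in_itv.
- apply: connected_continuous_connected; first exact: segment_connected.
  exact: continuous_subspaceT.
by exists r => //=; rewrite in_itv/= r0 lexx.
Qed.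

Lemma good_Cm a r th : (forall x : R, 0 < x -> x <= a -> good m x) -> 0 <= r -> r <= a -> Cm m (pol r th).
Proof.
move=> ha; have [h dh] := h_ex vM; rewrite le_eqVlt => /predU1P[<- _|r0 ra].
  by rewrite pol0; exact: origin_Cm.
by have [hr ht] := ha r r0 ra; apply: tangent_Cm dh _ _ hr ht.
Qed.

(** The condition of [pole_cond] is closed, so radii of poles that approach or exceed [a] suffice:
    [h] is monotone, and continuous at [a]. *)
Lemma good_beyond_poles a : 0 < a ->
  (forall y : R, y < a -> exists2 q, pole m q & y < rad q) ->
  exists2 a' : R, a < a' & forall r, 0 < r -> r <= a' -> good m r.
Proof.
move=> a0 hy; have [h dh] := h_ex vM; have [k0 [k0_le k0_near]] := k0_ex vM dh.
apply: (good_beyond vM dh k0_le a0) => b b0; rewrite leNgt; apply/negP => neg.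
have e0 : 0 < - (h a + h b + 2 * k0) by rewrite oppr_gt0.
have [y /andP[y0 ya] hya] := near_left (der_cont (dh a a0)) a0 e0.
have [q hq yq] := hy y ya; have [th eq_] := pol_ex q; rewrite eq_ in hq.
have q0 : 0 < rad q by exact: lt_trans yq.
have := pole_cond vM dh k0_le k0_near q0 hq b0.
have := h_le vM dh y0 (ltW yq); have := ler_norm (h y - h a).
by move: hya; move: (h y) (h a) (h b) (h (rad q)) `|_| neg => x1 x2 x3 x4 x5 x6; lra.
Qed.

Lemma pole_good a th : 0 < a -> pole m (pol a th) -> good m a.
Proof.
move=> a0 ha; have [|a' aa hg] := good_beyond_poles a0; last by apply: hg => //; exact: ltW.
by move=> y ya; exists (pol a th) => //; rewrite rad_pol_ge0// ltW.
Qed.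
End Radius.

Unset Implicit Arguments. Unset Strict Implicit.

Theorem theorem1p5 (R : realType) (m : R -> R) :
  von_Mangoldt m ->
  ((0 < Rp m)%E -> (Rp m < +oo)%E ->
     poles m `<` connected_component (Cm m) (origin R)) /\
  (Rp m = 0%E <-> Cm m = [set origin R]).
Proof.
move=> vM; have [h dh] := h_ex vM; split.
  move=> P0 Pinf.
  have Pfin : Rp m \is a fin_num by rewrite fin_numE gt_eqF ?(lt_trans _ P0)// lt_eqF.
  pose a := fine (Rp m); have eP : Rp m = a%:E by rewrite fineK.
  have a0 : 0 < a by rewrite -lte_fin -eP.
  have [|a' aa hg] := good_beyond_poles vM a0.
    move=> y ya; have : (y%:E < Rp m)%E by rewrite eP lte_fin.
    move=> /ereal_sup_gt[_ [q hq <-]]; rewrite lte_fin (dist_origin vM) => yq.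
    by exists q.
  have ball r th : 0 <= r -> r <= a' -> connected_component (Cm m) (origin R) (pol r th).
    move=> r0 ra; apply: segment_component => // x /andP[x0 xr].
    exact (good_Cm vM hg x0 (le_trans xr ra)).
  split.
    move=> q hq; have [th ->] := pol_ex q; apply: ball; first exact: rad_ge0.
    by have := pole_le_Rp vM hq; rewrite eP lee_fin => /le_trans; apply; exact: ltW.
  (* The inclusion is proper because the point at radius [a' > Rp] lies in the component and is too
     far out to be a pole. *)
  move=> hsub; have a'0 : 0 <= a' by rewrite ltW// (lt_trans a0).
  have /(pole_le_Rp vM) : pole m (pol a' 0) by apply: hsub; exact: ball.
  by rewrite eP lee_fin rad_pol_ge0// leNgt aa.
split.
  move=> P0; apply/seteqP; split=> [q hq|_ ->]; last exact: origin_Cm.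
  apply: contrapT => /eqP qn; have [q' qn' hq'] := pole_ex vM dh (Cm_fin vM dh qn hq).
  by have := pole_le_Rp vM hq'; rewrite P0 lee_fin leNgt rad_gt0 qn'.
move=> CE; apply/eqP; rewrite eq_le; apply/andP; split; last first.
  have := pole_le_Rp vM (origin_pole vM dh).
  by rewrite (_ : rad (origin R) = 0)//; apply/eqP; rewrite rad_eq0.
apply: ge_ereal_sup => _ [q hq <-]; rewrite lee_fin (dist_origin vM) leNgt.
apply/negP => q0; have [th eq_] := pol_ex q; rewrite eq_ in hq.
have [hr ht] := pole_good vM q0 hq.
have : Cm m (pol (rad q) th) by exact: tangent_Cm dh _ _ hr ht.
by rewrite CE => /eqP; rewrite (negbTE (pol_neq0 th q0)).
Qed.
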